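(* For each $q,p\in\mathbb{N}$, $\vec r\in\mathbb{N}^p_{\mathrm{ord}}$, $\vec a\in\mathbb{R}_+^p$, $\sigma\in\{0,1\}$, $T>0$, $x_0\in\mathbb{R}$ and $\delta\in(0,\tfrac12)$, there exist Schwartz class solutions $u:\mathbb{R}\times[0,T)\to\mathbb{R}$ of the Boussinesq equation $u_{tt}=u_{xx}+(u^2)_{xx}+u_{xxxx}$ on $\mathbb{R}\times[0,T)$ such that: (i) for each $q_1,q_2\in\mathbb{N}$ with $q_1+2q_2\le q$, $\sup_{(x,t)\in\mathbb{R}\times[0,T)}\big|\partial_x^{q_1}\partial_t^{q_2}u(x,t)\big|<\infty$ and $\partial_x^{q_1}\partial_t^{q_2}u$ can be continuously extended to $\mathbb{R}\times[0,T]$; (ii) for each $q_1,q_2\in\mathbb{N}$ with $q_1+2q_2=q+1$, $$(-1)^{\lceil q_1/2\rceil}\,\partial_x^{q_1}\partial_t^{q_2}u(x_0,t)\asymp\frac{\mathrm{LOG}\big(\tfrac1{T-t};\vec r,\vec a,\sigma\big)}{(T-t)^{\delta}}\quad\text{as }t\to T,$$ and $$\big|\partial_x^{q_1}\partial_t^{q_2}u(x,t)\big|\le C\,\frac{1+|x|}{|x-x_0|},\qquad x\in\mathbb{R}\setminus\{x_0\},\ t\in[0,T),$$ for some constant $C>0$.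
   Context: $\mathbb{N}=\{0,1,2,\dots\}$, $\mathbb{N}_{>0}=\{1,2,\dots\}$, $\mathbb{R}_+=[0,+\infty)$, and $\mathbb{N}^p_{\mathrm{ord}}=\{(r_1,\dots,r_p)\in(\mathbb{N}_{>0})^p: r_1<r_2<\dots<r_p\}$. For $r\in\mathbb{N}_{>0}$, $\log_r$ denotes the $r$-th iterate of the logarithm. Define $\mathrm{LOG}(s;\vec r,\vec a,\sigma)=(-1)^\sigma\prod_{j=1}^p(\log_{r_j}s)^{a_j}$, with $\mathrm{LOG}\equiv(-1)^\sigma$ if $p=0$. For real functions $f,g$ defined for $t<T$ close to $T$, $f(t)\asymp g(t)$ as $t\to T$ means there exist $T_0\in(0,T)$ and $c_1,c_2>0$ with $c_1 g(t)\le f(t)\le c_2 g(t)$ for all $t\in[T_0,T)$. For $T\in(0,\infty]$, $u$ is a Schwartz class solution of the Boussinesq equation on $\mathbb{R}\times[0,T)$ if $u$ is a smooth real-valued solution of $u_{tt}=u_{xx}+(u^2)_{xx}+u_{xxxx}$ on $\mathbb{R}\times[0,T)$ and for each integer $N\ge1$ and each $\tau\in[0,T)$, $\sup_{x\in\mathbb{R},t\in[0,\tau]}\sum_{i=0}^N(1+|x|)^N|\partial_x^i u(x,t)|<\infty$. *)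

(* Defs.v *)
From Stdlib Require Import Reals.
From Coquelicot Require Import Coquelicot.
Open Scope R_scope.

Definition iter_log (r : nat) (s : R) : R := Nat.iter r ln s.

Fixpoint prod_upto (p : nat) (f : nat -> R) : R :=
  match p with
  | O => 1
  | S k => prod_upto k f * f k
  end.

Definition LOG (s : R) (p : nat) (r : nat -> nat) (a : nat -> R) (sigma : nat) : R :=
  (-1) ^ sigma * prod_upto p (fun j => Rpower (iter_log (r j) s) (a j)).

Definition asymp_at (T : R) (f g : R -> R) : Prop :=
  exists T0 c1 c2, 0 < T0 < T /\ 0 < c1 /\ 0 < c2 /\
    forall t, T0 <= t < T -> c1 * g t <= f t <= c2 * g t.

Definition cont_within (S : R -> Prop) (f : R -> R -> R) : Prop :=
  forall x t, S t -> forall eps, 0 < eps -> exists del, 0 < del /\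
    forall y s, S s -> Rabs (y - x) < del -> Rabs (s - t) < del ->
      Rabs (f y s - f x t) < eps.

Definition deriv_within (S : R -> Prop) (g : R -> R) (t l : R) : Prop :=
  forall eps, 0 < eps -> exists del, 0 < del /\
    forall s, S s -> s <> t -> Rabs (s - t) < del ->
      Rabs ((g s - g t) / (s - t) - l) < eps.

Definition Ico0 (T : R) (t : R) : Prop := 0 <= t < T.
Definition Icc0 (T : R) (t : R) : Prop := 0 <= t <= T.

(* D i j is the partial derivative d_x^i d_t^j u on R x [0,T), all of them
   existing and jointly continuous: this is smoothness of u on R x [0,T)
   (t-derivatives one-sided at t = 0). *)
Definition IsPartials (T : R) (u : R -> R -> R) (D : nat -> nat -> R -> R -> R) : Prop :=
  (forall x t, Ico0 T t -> D 0%nat 0%nat x t = u x t) /\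
  (forall i j x t, Ico0 T t ->
     derivable_pt_lim (fun y => D i j y t) x (D (S i) j x t)) /\
  (forall i j x t, Ico0 T t ->
     deriv_within (Ico0 T) (fun s => D i j x s) t (D i (S j) x t)) /\
  (forall i j, cont_within (Ico0 T) (D i j)).

Definition SchwartzBoussinesq (T : R) (u : R -> R -> R) (D : nat -> nat -> R -> R -> R) : Prop :=
  IsPartials T u D /\
  (forall x t, Ico0 T t ->
     D 0%nat 2%nat x t = D 2%nat 0%nat x t + Derive_n (fun y => (u y t) ^ 2) 2 x
                         + D 4%nat 0%nat x t) /\
  (forall (N : nat) (tau : R), (1 <= N)%nat -> 0 <= tau < T ->
     exists M, forall x t, 0 <= t <= tau ->
       sum_f_R0 (fun i => (1 + Rabs x) ^ N * Rabs (D i 0%nat x t)) N <= M).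

(* Main.v *)
Require Import Defs.
From Stdlib Require Import Reals Lra Lia Psatz ClassicalEpsilon Ranalysis5.
From Coquelicot Require Import Coquelicot.
Open Scope R_scope.

(* With s = T - t and x measured from x0, write the solution as a Hartley integral
   u(x,s) = int f(k,s) cas(k x) dk, where cas = cos + sin. The equation becomes the boundary value problem
   f_ss = (k^4 - k^2) f - k^2 (f * f), f(k,0) = phi(k), where * is the convolution belonging to the kernel cas.
   The elliptic sign of the linear part makes small data solvable by Picard iteration in the norm weighted by
   (1+|k|)^-(1+theta+q) (exp(-|k|s) + exp(-|k|(S-s))): for 0 < s < S everything decays rapidly in k, so u is
   smooth for t < T, while all singular behaviour at t = T comes from the algebraic decay of phi at s = 0.
   The nonlinear correction gains two powers of k, so the derivatives of order q+1 are, up to bounded terms,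
   those of the linear flow, which behaves like int k^(q+1) phi(k) exp(-k^2 s) dk at x = x0. The datum is
   phi(k) = c k^(q+1) sum_j c_j exp(-t_j^2 k^2) with t_j = (4^j X0)^(-1/2) and c_j = g(t_j^-2) t_j^(2q+3);
   the Gaussian moments then give int k^(2q+2) (phi(k)/k^(q+1)) exp(-k^2 s) dk ~ sum_j g(4^j X0) min(1, 1/(4^j X0 s)),
   which is comparable to g(1/s) because g grows along powers of 4 by a factor strictly between 1 and 2.
   Away from x0 one integration by parts in k gives the bound 1/|x - x0|. *)

(** As an evolution in [t] the equation is ill-posed: its modes behave like [exp (k^2 t)] and
    [exp (- k^2 t)], so no Cauchy problem at [t = 0] can be iterated. Hence the singular profile is
    prescribed at [s = 0], and an artificial second condition is imposed at [s = SS]. A Dirichlet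
    condition there could be resonant: [k^4 - k^2] is negative for [0 < |k| < 1], and on a long
    interval the sine solutions may vanish at both ends. Mixing in the value at [1/2], where these
    solutions are bounded below, makes the problem solvable with uniform constants for every length.
    The kernel [cas] keeps all integrals real, at the price of a four-term product. The weight
    decays like [exp (- |k| s)], not at the true rate [exp (- k^2 s)], because only a subadditive
    exponent survives convolution. The iteration carries just one derivative in [k]; the others are
    recovered afterwards. The surplus exponent is [th = 1/2 - d] with [delta < d < 1/2]: [d] above
    [delta] makes room for the logarithms, [d] below [1/2] makes the lacunary series of Gaussians
    converge. *)

(* Replaces an equality in a Coquelicot carrier by one in R, which [ring] requires. *)
Ltac Rring := match goal with |- ?a = ?b => change (@eq R a b) end; ring.

(* th is the surplus decay exponent of the datum, qn the number q of bounded derivatives, SS the length of the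
   reversed time interval; SS exceeds T so that t = 0 is interior. *)
Class params := Params {
  th : R; th_gt0 : 0 < th; th_le1 : th <= 1;
  qn : nat;
  SS : R; SS_ge1 : 1 <= SS }.

(** * Integrals over the line of dominated functions *)

Section Integral.
Context {P : params}.

(** [th > 0] makes this weight integrable, and [th <= 1] keeps its exponent at most 2, so that
    changing the point costs at most a square, as in [om_comp]. *)
Definition om (k : R) : R := Rpower (1 + Rabs k) (- (1 + th)).

Lemma abs1_ge1 k : 1 <= 1 + Rabs k.
Proof. generalize (Rabs_pos k); lra. Qed.

Lemma om_gt0 k : 0 < om k.
Proof. apply exp_pos. Qed.

Lemma om_inv k : om k = / Rpower (1 + Rabs k) (1 + th).
Proof. unfold om; now rewrite Rpower_Ropp. Qed.

Lemma om_comp c k l : 1 <= c -> 1 + Rabs k <= c * (1 + Rabs l) -> om l <= c ^ 2 * om k.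
Proof.
intros Hc H; rewrite !om_inv.
assert (Hk := abs1_ge1 k); assert (Hl := abs1_ge1 l); assert (H0 := th_gt0); assert (H1 := th_le1).
assert (A : Rpower (1 + Rabs k) (1 + th) <= c ^ 2 * Rpower (1 + Rabs l) (1 + th)).
{ apply Rle_trans with (Rpower (c * (1 + Rabs l)) (1 + th)).
  - apply Rle_Rpower_l; lra.
  - rewrite <- Rpower_mult_distr by lra.
    apply Rmult_le_compat_r; [left; apply exp_pos|].
    rewrite <- Rpower_pow by lra. apply Rle_Rpower; simpl; lra. }
assert (p1 : 0 < Rpower (1 + Rabs k) (1 + th)) by apply exp_pos.
assert (p2 : 0 < Rpower (1 + Rabs l) (1 + th)) by apply exp_pos.
apply Rmult_le_reg_l with (Rpower (1 + Rabs l) (1 + th)); [easy|].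
rewrite Rinv_r by lra.
apply Rmult_le_reg_r with (Rpower (1 + Rabs k) (1 + th)); [easy|].
replace (_ * (c ^ 2 * / _) * _) with (c ^ 2 * Rpower (1 + Rabs l) (1 + th)) by (field; lra).
lra.
Qed.

Lemma om_le1 k : om k <= 1.
Proof.
rewrite om_inv.
assert (1 <= Rpower (1 + Rabs k) (1 + th)).
{ apply Rle_trans with (Rpower (1 + Rabs k) 0).
  - rewrite Rpower_O; [lra|generalize (abs1_ge1 k); lra].
  - apply Rle_Rpower; [apply abs1_ge1|pose proof th_gt0; lra]. }
apply Rle_trans with (/ 1); [apply Rinv_le_contravar; lra|lra].
Qed.

Lemma om_ge k : / (1 + Rabs k) ^ 2 <= om k.
Proof.
rewrite om_inv. apply Rinv_le_contravar; [apply exp_pos|].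
assert (Hk := abs1_ge1 k).
rewrite <- Rpower_pow by lra. apply Rle_Rpower; [lra|generalize th_le1; simpl; lra].
Qed.

Lemma om_opp k : om (- k) = om k.
Proof. unfold om; now rewrite Rabs_Ropp. Qed.

Lemma is_derive_Rpower_pos a x : 0 < x ->
  is_derive (fun y => Rpower y a) x (a * Rpower x (a - 1)).
Proof. intros H; apply is_derive_Reals, derivable_pt_lim_power, H. Qed.

Lemma om_cont k : continuous om k.
Proof.
unfold om.
apply (continuous_comp (fun k => 1 + Rabs k) (fun y => Rpower y (- (1 + th)))).
- apply (continuous_plus (fun _ => 1) Rabs); [apply continuous_const|apply continuous_Rabs].
- apply (ex_derive_continuous (fun y => Rpower y (- (1 + th)))). eexists; apply is_derive_Rpower_pos.
  generalize (abs1_ge1 k); lra.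
Qed.

(** Integrability in quantitative form: continuity and a majorant whose tail is known in closed
    form. All limits under the integral sign are taken inside this class. *)
Definition dom (C : R) (f : R -> R) : Prop :=
  (forall k, continuous f k) /\ (forall k, Rabs (f k) <= C * om k).

Lemma dom_ge0 C f : dom C f -> 0 <= C.
Proof.
intros [_ H]. specialize (H 0). generalize (Rabs_pos (f 0)) (om_gt0 0); intros.
destruct (Rle_lt_dec 0 C); [easy|]. nra.
Qed.

Lemma dom_weaken C C' f : C <= C' -> dom C f -> dom C' f.
Proof.
intros H [Hc Hb]; split; [easy|]; intros k.
apply Rle_trans with (1 := Hb k). apply Rmult_le_compat_r; [left; apply om_gt0|easy].
Qed.

Lemma ex_RInt_cont (f : R -> R) a b : (forall k, continuous f k) -> ex_RInt f a b.
Proof. intros H; apply (ex_RInt_continuous (V := R_CompleteNormedModule)); intros; apply H. Qed.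

Lemma RInt_scalR (f : R -> R) a b c : (forall k, continuous f k) ->
  RInt (fun x => c * f x) a b = c * RInt f a b.
Proof. intros H; apply (RInt_scal (V := R_CompleteNormedModule)); now apply ex_RInt_cont. Qed.

Lemma RInt_plusR (f g : R -> R) a b : (forall k, continuous f k) -> (forall k, continuous g k) ->
  RInt (fun x => f x + g x) a b = RInt f a b + RInt g a b.
Proof. intros H H'; apply (RInt_plus (V := R_CompleteNormedModule)); now apply ex_RInt_cont. Qed.

Lemma RInt_minusR (f g : R -> R) a b : (forall k, continuous f k) -> (forall k, continuous g k) ->
  RInt (fun x => f x - g x) a b = RInt f a b - RInt g a b.
Proof. intros H H'; apply (RInt_minus (V := R_CompleteNormedModule)); now apply ex_RInt_cont. Qed.

Lemma RInt_ChaslesR (f : R -> R) a b c : (forall k, continuous f k) ->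
  RInt f a b + RInt f b c = RInt f a c.
Proof. intros H; apply (RInt_Chasles (V := R_CompleteNormedModule)); now apply ex_RInt_cont. Qed.

(** The integral of [om] over the half-line from [r] to infinity. *)
Definition tail (r : R) : R := / th * Rpower (1 + r) (- th).

Lemma tail_ge0 r : 0 <= tail r.
Proof.
unfold tail. apply Rmult_le_pos; left; [apply Rinv_0_lt_compat, th_gt0|apply exp_pos].
Qed.

Lemma tail_small eps : 0 < eps -> exists r, 0 < r /\ tail r < eps.
Proof.
intros He. assert (H0 := th_gt0).
assert (H1 : 0 < / (th * eps)) by (apply Rinv_0_lt_compat, Rmult_lt_0_compat; lra).
exists (Rpower (/ (th * eps)) (/ th)). split; [apply exp_pos|].
set (r := Rpower _ _). assert (Hr : 0 < r) by apply exp_pos.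
assert (A : Rpower r th = / (th * eps)).
{ unfold r. rewrite Rpower_mult, Rinv_l, Rpower_1; lra. }
assert (B : Rpower r th < Rpower (1 + r) th) by (apply Rlt_Rpower_l; lra).
unfold tail. rewrite Rpower_Ropp.
rewrite A in B.
assert (C : / Rpower (1 + r) th < th * eps).
{ rewrite <- (Rinv_inv (th * eps)). apply Rinv_lt_contravar; [|easy].
  apply Rmult_lt_0_compat; [easy|apply exp_pos]. }
apply Rmult_lt_reg_l with th; [easy|].
rewrite <- Rmult_assoc, Rinv_r; lra.
Qed.

Lemma RInt_om_pos a b : 0 <= a <= b -> RInt om a b <= tail a.
Proof.
intros [Ha Hab]. assert (H0 := th_gt0).
assert (E : is_RInt om a b (minus (- / th * Rpower (1 + b) (- th)) (- / th * Rpower (1 + a) (- th)))).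
{ apply (is_RInt_derive (fun k => - / th * Rpower (1 + k) (- th)) om).
  - intros x; rewrite Rmin_left, Rmax_right by easy; intros Hx.
    unfold om. rewrite Rabs_right by lra.
    replace (Rpower (1 + x) (- (1 + th))) with (- / th * (1 * (- th * Rpower (1 + x) (- th - 1)))).
    2:{ replace (- th - 1) with (- (1 + th)) by ring. field; lra. }
    apply is_derive_scal.
    apply (is_derive_comp (fun y => Rpower y (- th)) (fun x => 1 + x)).
    + apply is_derive_Rpower_pos; lra.
    + auto_derive; [easy|ring].
  - intros; apply om_cont. }
rewrite (is_RInt_unique _ _ _ _ E). unfold tail, minus, plus, opp; simpl.
assert (0 < / th * Rpower (1 + b) (- th)).
{ apply Rmult_lt_0_compat; [now apply Rinv_0_lt_compat|apply exp_pos]. }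
lra.
Qed.

Lemma RInt_flip (f : R -> R) a b : (forall k, continuous f k) ->
  RInt (fun k => f (- k)) a b = RInt f (- b) (- a).
Proof.
intros Hf.
assert (E := RInt_comp_lin (V := R_CompleteNormedModule) f (-1) 0 a b).
rewrite <- (opp_RInt_swap (V := R_CompleteNormedModule) f) by now apply ex_RInt_cont.
replace (- a) with (-1 * a + 0) by ring. replace (- b) with (-1 * b + 0) by ring.
rewrite <- E by now apply ex_RInt_cont.
rewrite <- (RInt_opp (V := R_CompleteNormedModule)).
- apply RInt_ext; intros x _. unfold opp, scal; simpl; unfold mult; simpl.
  replace (-1 * x + 0) with (- x) by ring. ring.
- apply ex_RInt_cont. intros k.
  apply (continuous_mult (fun _ => -1)); [apply continuous_const|].
  apply (continuous_comp (fun y => -1 * y + 0) f); [|apply Hf].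
  apply (continuous_plus (fun y => -1 * y)); [|apply continuous_const].
  apply (continuous_mult (fun _ => -1)); [apply continuous_const|apply continuous_id].
Qed.

Lemma tail_pos0 C f r a b : dom C f -> 0 <= r <= a -> a <= b ->
  Rabs (RInt f a b) <= C * tail r.
Proof.
intros Hf [Hr Ha] Hab. assert (HC := dom_ge0 _ _ Hf). destruct Hf as [Hc Hb].
apply Rle_trans with (1 := abs_RInt_le f a b Hab (ex_RInt_cont f a b Hc)).
apply Rle_trans with (RInt (fun k => C * om k) r b).
- rewrite <- (RInt_Chasles (V := R_CompleteNormedModule) (fun k => C * om k) r a b).
  + assert (0 <= RInt (fun k => C * om k) r a).
    { apply RInt_ge_0; [easy| |].
      - apply ex_RInt_cont; intros; apply (continuous_mult (fun _ => C)); [apply continuous_const|apply om_cont].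
      - intros; apply Rmult_le_pos; [easy|left; apply om_gt0]. }
    assert (RInt (fun t => Rabs (f t)) a b <= RInt (fun k => C * om k) a b).
    { apply RInt_le; [easy| | |intros; apply Hb].
      - apply ex_RInt_cont; intros; apply (continuous_comp f Rabs); [apply Hc|apply continuous_Rabs].
      - apply ex_RInt_cont; intros; apply (continuous_mult (fun _ => C)); [apply continuous_const|apply om_cont]. }
    unfold plus; simpl; lra.
  + apply ex_RInt_cont; intros; apply (continuous_mult (fun _ => C)); [apply continuous_const|apply om_cont].
  + apply ex_RInt_cont; intros; apply (continuous_mult (fun _ => C)); [apply continuous_const|apply om_cont].
- rewrite RInt_scalR by apply om_cont.
  apply Rmult_le_compat_l; [easy|]. apply RInt_om_pos; lra.
Qed.

Lemma dom_flip C f : dom C f -> dom C (fun k => f (- k)).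
Proof.
intros [Hc Hb]; split; intros k.
- apply (continuous_comp (fun y => - y) f); [|apply Hc].
  apply (continuous_opp (fun y : R => y)), continuous_id.
- rewrite <- (om_opp k). apply Hb.
Qed.

Lemma tail_pos C f r a b : dom C f -> 0 <= r <= a -> r <= b -> Rabs (RInt f a b) <= C * tail r.
Proof.
intros Hf Ha Hb. destruct (Rle_lt_dec a b).
- now apply tail_pos0.
- rewrite <- (opp_RInt_swap (V := R_CompleteNormedModule)) by apply ex_RInt_cont, Hf.
  unfold opp; simpl. rewrite Rabs_Ropp. apply tail_pos0; [easy| |]; lra.
Qed.

Lemma tail_neg C f r a b : dom C f -> 0 <= r <= - a -> r <= - b -> Rabs (RInt f a b) <= C * tail r.
Proof.
intros Hf Ha Hb.
replace (RInt f a b) with (RInt (fun k => f (- k)) (- b) (- a)).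
- now apply tail_pos; [apply dom_flip| lra|].
- rewrite RInt_flip by apply Hf. now rewrite !Ropp_involutive.
Qed.

Lemma RInt_diff C f r a b a' b' : dom C f -> 0 <= r ->
  a <= - r -> a' <= - r -> r <= b -> r <= b' ->
  Rabs (RInt f a b - RInt f a' b') <= 2 * C * tail r.
Proof.
intros Hf Hr Ha Ha' Hb Hb'.
assert (Hex : forall u v, ex_RInt f u v) by (intros; apply ex_RInt_cont, Hf).
assert (E : RInt f a b = RInt f a a' + (RInt f a' b' + RInt f b' b)).
{ rewrite <- (RInt_Chasles (V := R_CompleteNormedModule) f a a' b) by easy.
  rewrite <- (RInt_Chasles (V := R_CompleteNormedModule) f a' b' b) by easy. reflexivity. }
rewrite E.
replace (_ - _) with (RInt f a a' + RInt f b' b) by ring.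
apply Rle_trans with (1 := Rabs_triang _ _).
assert (A1 := tail_neg C f r a a' Hf ltac:(lra) ltac:(lra)).
assert (A2 := tail_pos C f r b' b Hf ltac:(lra) ltac:(lra)). lra.
Qed.

(* The symmetric limit is only used for [dom]inated f, where it is the absolutely convergent integral. *)
Definition intR (f : R -> R) : R := real (Lim_seq (fun n => RInt f (- INR n) (INR n))).

(** The one quantitative fact about [intR] from which the others follow. The truncations are Cauchy
    by [RInt_diff], and the limit inherits that bound. The interval need not be symmetric, which is
    what translations require. *)
Lemma intR_key C f r a b : dom C f -> 0 <= r -> a <= - r -> r <= b ->
  Rabs (RInt f a b - intR f) <= 2 * C * tail r.
Proof.
intros Hf Hr Ha Hb.
assert (HC := dom_ge0 _ _ Hf).
set (u := fun n => RInt f (- INR n) (INR n)).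
assert (Hcv : ex_finite_lim_seq u).
{ apply ex_lim_seq_cauchy_corr. intros eps.
  destruct (tail_small (eps / (2 * C + 1))) as [r' [Hr' Ht]].
  { apply Rdiv_lt_0_compat; [apply eps|lra]. }
  assert (Ht2 : 2 * C * tail r' < eps).
  { apply (Rmult_lt_compat_r (2 * C + 1)) in Ht; [|lra].
    unfold Rdiv in Ht. rewrite Rmult_assoc, Rinv_l in Ht by lra.
    generalize (tail_ge0 r'); nra. }
  destruct (archimed_cor1 (/ r')) as [N [HN HN0]]; [now apply Rinv_0_lt_compat|].
  assert (HN' : r' < INR N).
  { rewrite <- (Rinv_inv r'), <- (Rinv_inv (INR N)). apply Rinv_lt_contravar; [|easy].
    apply Rmult_lt_0_compat; apply Rinv_0_lt_compat; [now apply lt_0_INR|easy]. }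
  exists N. intros n m Hn Hm. apply le_INR in Hn, Hm.
  apply Rle_lt_trans with (2 := Ht2). apply RInt_diff; lra || easy. }
assert (Hl : is_lim_seq u (intR f)).
{ destruct Hcv as [l Hl]. unfold intR. fold u. rewrite (is_lim_seq_unique _ _ Hl). exact Hl. }
assert (Hl2 : is_lim_seq (fun n => Rabs (RInt f a b - u n)) (Rabs (RInt f a b - intR f))).
{ apply (is_lim_seq_abs (fun n => RInt f a b - u n) (RInt f a b - intR f)). apply is_lim_seq_minus'; [apply is_lim_seq_const|easy]. }
apply (is_lim_seq_le_loc (fun n => Rabs (RInt f a b - u n)) (fun _ => 2 * C * tail r)
  (Rabs (RInt f a b - intR f)) (2 * C * tail r)); [|easy|apply is_lim_seq_const].
destruct (INR_unbounded r) as [N HN].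
exists N. intros n Hn. apply le_INR in Hn. apply RInt_diff; lra || easy.
Qed.

Lemma Rabs_small_eq x y : (forall eps, 0 < eps -> Rabs (x - y) <= eps) -> x = y.
Proof.
intros H. apply Rminus_diag_uniq. apply NNPP; intros H1.
assert (H2 := Rabs_pos_lt _ H1). specialize (H (Rabs (x - y) / 2) ltac:(lra)). lra.
Qed.

Lemma tail_small_mul C eps : 0 <= C -> 0 < eps -> exists r, 0 < r /\ C * tail r < eps.
Proof.
intros HC He. destruct (tail_small (eps / (C + 1))) as [r [Hr Ht]].
{ apply Rdiv_lt_0_compat; lra. }
exists r; split; [easy|].
apply (Rmult_lt_compat_r (C + 1)) in Ht; [|lra].
unfold Rdiv in Ht. rewrite Rmult_assoc, Rinv_l in Ht by lra.
generalize (tail_ge0 r); nra.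
Qed.

(** The intervals on the two sides may differ, as they do after a change of variable. *)
Lemma intR_eq C C' f g : dom C f -> dom C' g ->
  (forall r, 0 < r -> exists a b a' b', a <= - r /\ r <= b /\ a' <= - r /\ r <= b' /\
     RInt f a b = RInt g a' b') -> intR f = intR g.
Proof.
intros Hf Hg H. apply Rabs_small_eq; intros eps He.
assert (HC := dom_ge0 _ _ Hf). assert (HC' := dom_ge0 _ _ Hg).
destruct (tail_small_mul (2 * C + 2 * C') eps) as [r [Hr Ht]]; [lra|easy|].
destruct (H r Hr) as [a0 [b0 [a1 [b1 [H1 [H2 [H3 [H4 E]]]]]]]].
assert (K1 := intR_key C f r a0 b0 Hf ltac:(lra) H1 H2).
assert (K2 := intR_key C' g r a1 b1 Hg ltac:(lra) H3 H4).
rewrite E in K1. rewrite Rabs_minus_sym in K1.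
replace (intR f - intR g) with ((intR f - RInt g a1 b1) + (RInt g a1 b1 - intR g)) by ring.
apply Rle_trans with (1 := Rabs_triang _ _). lra.
Qed.

(** Dominated convergence with locally uniform convergence: a radius is chosen for which both tails
    are small by [intR_key], and on the remaining compact interval the integrands are uniformly
    close. *)
Lemma intR_lim {T : Type} (F : (T -> Prop) -> Prop) {FF : Filter F} C (u : T -> R -> R) f :
  F (fun t => dom C (u t)) -> dom C f ->
  (forall r eps, 0 < r -> 0 < eps -> F (fun t => forall l, Rabs l <= r -> Rabs (u t l - f l) <= eps)) ->
  filterlim (fun t => intR (u t)) F (locally (intR f)).
Proof.
intros Hu Hf H. apply filterlim_locally. intros eps.
assert (HC := dom_ge0 _ _ Hf).
destruct (tail_small_mul (4 * C) (eps / 2)) as [r [Hr Ht]]; [lra|apply is_pos_div_2|].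
assert (He : 0 < eps / (4 * r + 1)) by (apply Rdiv_lt_0_compat; [apply eps|lra]).
generalize (filter_and _ _ Hu (H r _ Hr He)). apply filter_imp. intros t [Ht1 Ht2].
change (Rabs (intR (u t) - intR f) < eps).
assert (K1 := intR_key C (u t) r (- r) r Ht1 ltac:(lra) ltac:(lra) ltac:(lra)).
assert (K2 := intR_key C f r (- r) r Hf ltac:(lra) ltac:(lra) ltac:(lra)).
assert (K3 : Rabs (RInt (u t) (- r) r - RInt f (- r) r) <= (r - - r) * (eps / (4 * r + 1))).
{ rewrite <- RInt_minusR by (apply Ht1 || apply Hf).
  apply abs_RInt_le_const; [lra| |].
  - apply (ex_RInt_minus (V := R_CompleteNormedModule)); apply ex_RInt_cont; apply Ht1 || apply Hf.
  - intros l Hl. apply Ht2. apply Rabs_le; lra. }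
assert (K4 : (r - - r) * (eps / (4 * r + 1)) < eps / 2).
{ apply Rmult_lt_reg_r with (4 * r + 1); [lra|].
  replace ((r - - r) * (eps / (4 * r + 1)) * (4 * r + 1)) with (2 * r * eps) by (field; lra).
  generalize (cond_pos eps); nra. }
apply Rabs_le_between in K1, K2, K3. apply Rabs_lt_between'. lra.
Qed.

(** Compactness of [[a, b]] makes continuity in the parameter uniform in [l]. Choice turns the
    pointwise neighbourhoods into the gauge that [compactness_value_1d] takes. *)
Lemma tube {U : UniformSpace} (F : R -> U -> R) a b (p0 : U) eps : 0 < eps ->
  (forall l, a <= l <= b -> continuous (fun q => F (fst q) (snd q)) (l, p0)) ->
  locally p0 (fun p => forall l, a <= l <= b -> Rabs (F l p - F l p0) <= eps).
Proof.
intros He Hc.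
assert (H : forall l, exists d : posreal, a <= l <= b ->
   forall l' p', Rabs (l' - l) < d -> ball p0 d p' -> Rabs (F l' p' - F l p0) < eps / 2).
{ intros l. destruct (classic (a <= l <= b)) as [Hl|Hl].
  - specialize (Hc l Hl). apply filterlim_locally with (eps := mkposreal _ (is_pos_div_2 (mkposreal eps He))) in Hc.
    destruct Hc as [d Hd]. exists d. intros _ l' p' H1 H2.
    apply (Hd (l', p')). split; [exact H1|exact H2].
  - exists (mkposreal 1 Rlt_0_1). tauto. }
set (delta := fun l => proj1_sig (constructive_indefinite_description _ (H l))).
assert (Hd : forall l, a <= l <= b -> forall l' p', Rabs (l' - l) < delta l -> ball p0 (delta l) p' ->
  Rabs (F l' p' - F l p0) < eps / 2).
{ intros l. exact (proj2_sig (constructive_indefinite_description _ (H l))). }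
clearbody delta.
destruct (compactness_value_1d a b delta) as [d Hcd].
exists d. intros p Hp l Hl.
apply Rnot_lt_le. intros Hlt. apply (Hcd l Hl). intros [t [Ht [H1 H2]]].
specialize (Hd t Ht).
assert (A1 := Hd l p H1 (ball_le _ _ _ H2 _ Hp)).
assert (A2 := Hd l p0 H1 (ball_center _ _)).
apply Rabs_lt_between in A1, A2.
assert (Rabs (F l p - F l p0) < eps) by (apply Rabs_lt_between; lra). lra.
Qed.

Lemma intR_continuous {U : UniformSpace} C (F : R -> U -> R) (p0 : U) :
  (forall l, continuous (fun q => F (fst q) (snd q)) (l, p0)) ->
  locally p0 (fun p => dom C (fun l => F l p)) ->
  continuous (fun p => intR (fun l => F l p)) p0.
Proof.
intros Hc Hd.
apply (intR_lim (locally p0) C (fun p l => F l p) (fun l => F l p0)); [easy|apply (locally_singleton _ _ Hd)|].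
intros r eps Hr He.
generalize (tube F (- r) r p0 eps He (fun l _ => Hc l)). apply filter_imp.
intros p Hp l Hl. apply Hp. apply Rabs_le_between; easy.
Qed.

Lemma dom_plus C D f g : dom C f -> dom D g -> dom (C + D) (fun k => f k + g k).
Proof.
intros [Hf Bf] [Hg Bg]; split; intros k.
- apply (continuous_plus f g); [apply Hf|apply Hg].
- apply Rle_trans with (1 := Rabs_triang _ _). specialize (Bf k); specialize (Bg k); lra.
Qed.

Lemma dom_scal C a f : dom C f -> dom (Rabs a * C) (fun k => a * f k).
Proof.
intros [Hf Bf]; split; intros k.
- apply (continuous_mult (fun _ => a) f); [apply continuous_const|apply Hf].
- rewrite Rabs_mult, Rmult_assoc. apply Rmult_le_compat_l; [apply Rabs_pos|apply Bf].
Qed.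

Lemma dom_mult C f b : dom C f -> (forall k, continuous b k) -> (forall k, Rabs (b k) <= 1) ->
  dom C (fun k => f k * b k).
Proof.
intros Hf Hb B; split; intros k.
- apply (continuous_mult f b); [apply Hf|apply Hb].
- rewrite Rabs_mult. apply Rle_trans with (Rabs (f k) * 1).
  + apply Rmult_le_compat_l; [apply Rabs_pos|apply B].
  + rewrite Rmult_1_r; apply Hf.
Qed.

Lemma intR_unique C f x : dom C f ->
  (forall eps, 0 < eps -> exists R0, forall r, R0 <= r -> Rabs (RInt f (- r) r - x) <= eps) -> intR f = x.
Proof.
intros Hf H. apply Rabs_small_eq; intros eps He.
assert (HC := dom_ge0 _ _ Hf).
destruct (tail_small_mul (2 * C) (eps / 2)) as [r [Hr Ht]]; [lra|lra|].
destruct (H (eps / 2) ltac:(lra)) as [R0 HR].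
set (r1 := Rmax r R0). assert (Hr1 : r <= r1) by apply Rmax_l.
specialize (HR r1 (Rmax_r _ _)).
assert (K1 := intR_key C f r (- r1) r1 Hf ltac:(lra) ltac:(lra) ltac:(lra)).
rewrite Rabs_minus_sym in K1.
replace (intR f - x) with ((intR f - RInt f (- r1) r1) + (RInt f (- r1) r1 - x)) by ring.
apply Rle_trans with (1 := Rabs_triang _ _). lra.
Qed.

Lemma intR_plus C D f g : dom C f -> dom D g -> intR (fun k => f k + g k) = intR f + intR g.
Proof.
intros Hf Hg. apply (intR_unique (C + D)); [now apply dom_plus|].
intros eps He. assert (HC := dom_ge0 _ _ Hf). assert (HD := dom_ge0 _ _ Hg).
destruct (tail_small_mul (2 * C + 2 * D) eps) as [r [Hr Ht]]; [lra|lra|].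
exists r. intros r1 Hr1.
assert (K1 := intR_key C f r (- r1) r1 Hf ltac:(lra) ltac:(lra) ltac:(lra)).
assert (K2 := intR_key D g r (- r1) r1 Hg ltac:(lra) ltac:(lra) ltac:(lra)).
rewrite RInt_plusR by (apply Hf || apply Hg).
apply Rabs_le_between in K1, K2. apply Rabs_le_between. lra.
Qed.

Lemma intR_scal C a f : dom C f -> intR (fun k => a * f k) = a * intR f.
Proof.
intros Hf. apply (intR_unique (Rabs a * C)); [now apply dom_scal|].
intros eps He. assert (HC := dom_ge0 _ _ Hf).
destruct (tail_small_mul (Rabs a * (2 * C)) eps) as [r [Hr Ht]]; [|lra|].
{ apply Rmult_le_pos; [apply Rabs_pos|lra]. }
exists r. intros r1 Hr1.
assert (K1 := intR_key C f r (- r1) r1 Hf ltac:(lra) ltac:(lra) ltac:(lra)).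
rewrite RInt_scalR by apply Hf.
rewrite <- Rmult_minus_distr_l, Rabs_mult.
apply Rle_trans with (Rabs a * (2 * C * tail r)); [|lra].
apply Rmult_le_compat_l; [apply Rabs_pos|easy].
Qed.

Lemma intR_le C D f g : dom C f -> dom D g -> (forall k, f k <= g k) -> intR f <= intR g.
Proof.
intros Hf Hg H. apply Rnot_lt_le. intros Hlt.
assert (HC := dom_ge0 _ _ Hf). assert (HD := dom_ge0 _ _ Hg).
destruct (tail_small_mul (2 * C + 2 * D) (intR f - intR g)) as [r [Hr Ht]]; [lra|lra|].
assert (K1 := intR_key C f r (- r) r Hf ltac:(lra) ltac:(lra) ltac:(lra)).
assert (K2 := intR_key D g r (- r) r Hg ltac:(lra) ltac:(lra) ltac:(lra)).
assert (RInt f (- r) r <= RInt g (- r) r).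
{ apply RInt_le; [lra| | |intros; apply H]; apply ex_RInt_cont; apply Hf || apply Hg. }
apply Rabs_le_between in K1, K2. lra.
Qed.

Lemma dom_om : dom 1 om.
Proof. split; intros k; [apply om_cont|]. rewrite Rabs_right; generalize (om_gt0 k); lra. Qed.

Lemma intR_ext f g : (forall k, f k = g k) -> intR f = intR g.
Proof.
intros H. unfold intR. f_equal. apply Lim_seq_ext. intros n. apply RInt_ext. intros; apply H.
Qed.

Lemma intR_bound C f : dom C f -> Rabs (intR f) <= C * intR om.
Proof.
intros Hf. rewrite <- (intR_scal 1) by apply dom_om.
assert (D1 := dom_scal _ C _ dom_om).
apply Rabs_le_between. split.
- assert (E : - intR (fun k => C * om k) = intR (fun k => (-1) * (C * om k))).
  { rewrite (intR_scal _ (-1) _ D1). ring. }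
  rewrite E. apply (intR_le _ _ _ _ (dom_scal _ (-1) _ D1) Hf).
  intros k. destruct Hf as [_ Hb]. specialize (Hb k). apply Rabs_le_between in Hb. lra.
- apply (intR_le _ _ _ _ Hf D1). intros k. destruct Hf as [_ Hb]. specialize (Hb k).
  apply Rabs_le_between in Hb. lra.
Qed.

Lemma intR_om_ge0 : 0 <= intR om.
Proof.
assert (H := intR_bound _ _ dom_om). generalize (Rabs_pos (intR om)); lra.
Qed.

Lemma intR_flip C f : dom C f -> intR (fun k => f (- k)) = intR f.
Proof.
intros Hf. apply (intR_eq C C); [now apply dom_flip|easy|].
intros r Hr. exists (- r), r, (- r), r. repeat split; try lra.
rewrite RInt_flip by apply Hf. now rewrite Ropp_involutive.
Qed.

Lemma om_shift a l : om (l + a) <= (1 + Rabs a) ^ 2 * om l.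
Proof.
apply om_comp; [apply abs1_ge1|].
assert (Rabs l <= Rabs (l + a) + Rabs a).
{ replace l with ((l + a) - a) at 1 by ring. unfold Rminus. rewrite <- (Rabs_Ropp a). apply Rabs_triang. }
generalize (Rabs_pos a) (Rabs_pos (l + a)); nra.
Qed.

Lemma dom_shift C f a : dom C f -> dom (C * (1 + Rabs a) ^ 2) (fun k => f (k + a)).
Proof.
intros Hf; assert (HC := dom_ge0 _ _ Hf); split; intros k.
- apply (continuous_comp (fun y => y + a) f); [|apply Hf].
  apply (continuous_plus (fun y : R => y)); [apply continuous_id|apply continuous_const].
- apply Rle_trans with (1 := proj2 Hf _). rewrite Rmult_assoc. apply Rmult_le_compat_l; [easy|apply om_shift].
Qed.

Lemma intR_shift C f a : dom C f -> intR (fun k => f (k + a)) = intR f.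
Proof.
intros Hf. apply (intR_eq _ _ _ _ (dom_shift _ _ a Hf) Hf).
intros r Hr. assert (Ha := Rabs_pos a).
exists (- (r + Rabs a)), (r + Rabs a), (- (r + Rabs a) + a), (r + Rabs a + a).
assert (- Rabs a <= a <= Rabs a) by (apply Rabs_le_between; lra).
repeat split; try lra.
replace (- (r + Rabs a) + a) with (1 * (- (r + Rabs a)) + a) by ring.
replace (r + Rabs a + a) with (1 * (r + Rabs a) + a) by ring.
rewrite <- (RInt_comp_lin (V := R_CompleteNormedModule) f 1 a) by apply ex_RInt_cont, Hf.
apply RInt_ext; intros x _. unfold scal; simpl; unfold mult; simpl. rewrite !Rmult_1_l. reflexivity.
Qed.

(* The boundary terms vanish because [om] tends to 0 at infinity. *)
Lemma intR_derive C D f df : dom C f -> dom D df -> (forall k, is_derive f k (df k)) -> intR df = 0.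
Proof.
intros Hf Hd H. apply (intR_unique D); [easy|]. intros eps He.
assert (HC := dom_ge0 _ _ Hf).
exists (Rmax 1 ((2 * C) / eps)). intros r Hr.
assert (H1 : 1 <= r) by (apply Rle_trans with (2 := Hr), Rmax_l).
assert (H2 : 2 * C / eps <= r) by (apply Rle_trans with (2 := Hr), Rmax_r).
assert (E : RInt df (- r) r = f r - f (- r)).
{ apply is_RInt_unique. apply (is_RInt_derive f df); intros; [apply H|apply Hd]. }
rewrite E.
assert (O : om r <= / r).
{ rewrite om_inv. apply Rinv_le_contravar; [lra|].
  rewrite Rabs_right by lra. apply Rle_trans with (Rpower (1 + r) 1); [rewrite Rpower_1; lra|].
  apply Rle_Rpower; generalize th_gt0; lra. }
assert (B1 := proj2 Hf r). assert (B2 := proj2 Hf (- r)). rewrite om_opp in B2.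
assert (C * om r <= eps / 2).
{ apply Rle_trans with (C * / r); [now apply Rmult_le_compat_l|].
  apply Rmult_le_reg_r with r; [lra|]. rewrite Rmult_assoc, Rinv_l by lra.
  apply (Rmult_le_compat_r eps) in H2; [|lra].
  unfold Rdiv in H2. rewrite Rmult_assoc, Rinv_l in H2 by lra. lra. }
apply Rabs_le_between in B1, B2. apply Rabs_le_between. lra.
Qed.

End Integral.

(** * Differentiation under the integral, exchange of integrals, convolution *)

Section Convolution.
Context {P : params}.

Definition cont2 (f : R -> R -> R) : Prop :=
  forall k s, continuous (fun p : R * R => f (fst p) (snd p)) (k, s).

Lemma cont2_comp {U : UniformSpace} f (a b : U -> R) u : cont2 f ->
  continuous a u -> continuous b u -> continuous (fun v => f (a v) (b v)) u.
Proof. intros Hf Ha Hb. apply (continuous_comp_2 a b f); [easy|easy|apply Hf]. Qed.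

Lemma cont2_1 f s k : cont2 f -> continuous (fun k => f k s) k.
Proof. intros H; apply (cont2_comp f); [easy|apply continuous_id|apply continuous_const]. Qed.

Lemma cont2_2 f k s : cont2 f -> continuous (fun s => f k s) s.
Proof. intros H; apply (cont2_comp f); [easy|apply continuous_const|apply continuous_id]. Qed.

Lemma is_derive_quot (f : R -> R) x l :
  filterlim (fun h => (f (x + h) - f x) / h) (locally' 0) (locally l) <-> is_derive f x l.
Proof.
rewrite is_derive_Reals. split.
- intros H eps He. apply filterlim_locally with (eps := mkposreal eps He) in H.
  destruct H as [d Hd]. exists d. intros h Hh0 Hh. apply Hd; [|easy].
  change (Rabs (h - 0) < d). now rewrite Rminus_0_r.
- intros H. apply filterlim_locally. intros eps. destruct (H eps (cond_pos eps)) as [d Hd].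
  exists d. intros h Hh Hh0. apply Hd; [easy|]. change (Rabs (h - 0) < d) in Hh. now rewrite Rminus_0_r in Hh.
Qed.

Lemma MVT_le (f df : R -> R) x h : (forall t, Rabs (t - x) <= Rabs h -> is_derive f t (df t)) ->
  exists c, Rabs (c - x) <= Rabs h /\ f (x + h) - f x = df c * h.
Proof.
intros H.
assert (Hin : forall t, Rmin x (x + h) <= t <= Rmax x (x + h) -> Rabs (t - x) <= Rabs h).
{ intros t. unfold Rmin, Rmax, Rabs. destruct (Rle_dec x (x + h)); destruct (Rcase_abs (t - x)); destruct (Rcase_abs h); lra. }
destruct (MVT_gen f x (x + h) df) as [c [Hc E]].
- intros t Ht; apply H, Hin; lra.
- intros t Ht. apply derivable_continuous_pt. exists (df t). apply is_derive_Reals, H, Hin, Ht.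
- exists c. split; [now apply Hin|]. rewrite E. ring.
Qed.

(** The mean value theorem turns difference quotients into values of [dF] at intermediate points.
    This gives both the domination by [D] and, with [tube], uniform convergence on compact sets. *)
Lemma intR_is_derive C D (F dF : R -> R -> R) p0 :
  (forall l, continuous (fun q => dF (fst q) (snd q)) (l, p0)) ->
  locally p0 (fun p => dom C (fun l => F l p)) ->
  locally p0 (fun p => dom D (fun l => dF l p)) ->
  locally p0 (fun p => forall l, is_derive (fun p => F l p) p (dF l p)) ->
  is_derive (fun p => intR (fun l => F l p)) p0 (intR (fun l => dF l p0)).
Proof.
intros Hc Hd Hd' H.
assert (D0 := locally_singleton _ _ Hd). assert (D1 := locally_singleton _ _ Hd').
apply is_derive_quot.
assert (Hloc : locally' 0 (fun h => dom D (fun l => (F l (p0 + h) - F l p0) / h))).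
{ destruct (filter_and _ _ Hd (filter_and _ _ Hd' H)) as [d Hdd].
  exists d. intros h Hh Hh0. change (Rabs (h - 0) < d) in Hh. rewrite Rminus_0_r in Hh.
  assert (Hb : forall t, Rabs (t - p0) <= Rabs h -> ball p0 d t).
  { intros t Ht. change (Rabs (t - p0) < d). lra. }
  split.
  - intros k. destruct (Hdd (p0 + h)) as [[K _] _].
    { apply Hb. right; f_equal; ring. }
    apply (continuous_mult (fun l => F l (p0 + h) - F l p0) (fun _ => / h)); [|apply continuous_const].
    apply (continuous_minus (fun l => F l (p0 + h)) (fun l => F l p0)); [apply K|apply D0].
  - intros k. destruct (MVT_le (F k) (dF k) p0 h) as [c [Hc1 Hc2]].
    { intros t Ht. apply (Hdd t (Hb t Ht)). }
    rewrite Hc2. replace (dF k c * h / h) with (dF k c) by (field; easy).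
    destruct (Hdd c (Hb c Hc1)) as [_ [[_ K] _]]. apply K. }
refine (filterlim_ext_loc (fun h => intR (fun l => (F l (p0 + h) - F l p0) / h)) _ _ _).
- destruct (filter_and _ _ Hd H) as [d Hdd].
  exists d. intros h Hh Hh0. change (Rabs (h - 0) < d) in Hh. rewrite Rminus_0_r in Hh.
  destruct (Hdd (p0 + h)) as [K _].
  { assert (Hb : forall t : R, Rabs (t - p0) <= Rabs h -> ball p0 d t).
    { intros t Ht. change (Rabs (t - p0) < d). lra. }
    apply Hb. right; f_equal; ring. }
  transitivity (intR (fun l => / h * (F l (p0 + h) + (-1) * F l p0))).
  { apply intR_ext; intros l; field; easy. }
  assert (D2 := dom_scal _ (-1) _ D0).
  rewrite (intR_scal _ _ _ (dom_plus _ _ _ _ K D2)), (intR_plus _ _ _ _ K D2), (intR_scal _ _ _ D0).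
  field; easy.
- apply (intR_lim (locally' 0) D (fun h l => (F l (p0 + h) - F l p0) / h)); [easy|easy|].
  intros r eps Hr He.
  destruct (filter_and _ _ H (tube dF (- r) r p0 eps He (fun l _ => Hc l))) as [d Hdd].
  exists d. intros h Hh Hh0 l Hl. change (Rabs (h - 0) < d) in Hh. rewrite Rminus_0_r in Hh.
  assert (Hb : forall t, Rabs (t - p0) <= Rabs h -> ball p0 d t).
  { intros t Ht. change (Rabs (t - p0) < d). lra. }
  destruct (MVT_le (F l) (dF l) p0 h) as [c [Hc1 Hc2]].
  { intros t Ht. apply (Hdd t (Hb t Ht)). }
  rewrite Hc2. replace (dF l c * h / h) with (dF l c) by (field; easy).
  apply (Hdd c (Hb c Hc1)). now apply Rabs_le_between.
Qed.

Lemma RInt_continuous_param {U : UniformSpace} (F : R -> U -> R) a b (p0 : U) :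
  (forall l, continuous (fun q => F (fst q) (snd q)) (l, p0)) ->
  (forall p l, continuous (fun l => F l p) l) ->
  continuous (fun p => RInt (fun l => F l p) a b) p0.
Proof.
intros Hc Hc1. apply filterlim_locally. intros eps.
assert (He : 0 < eps / (Rabs (b - a) + 1)).
{ apply Rdiv_lt_0_compat; [apply eps|generalize (Rabs_pos (b - a)); lra]. }
assert (He2 : Rabs (b - a) * (eps / (Rabs (b - a) + 1)) < eps).
{ assert (H := Rabs_pos (b - a)). apply Rmult_lt_reg_r with (Rabs (b - a) + 1); [lra|].
  replace (Rabs (b - a) * (eps / (Rabs (b - a) + 1)) * (Rabs (b - a) + 1)) with (Rabs (b - a) * eps) by (field; lra).
  generalize (cond_pos eps); nra. }
set (e := eps / (Rabs (b - a) + 1)) in *. clearbody e.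
generalize (tube F (Rmin a b) (Rmax a b) p0 _ He (fun l _ => Hc l)). apply filter_imp.
intros p Hp. change (Rabs (RInt (fun l => F l p) a b - RInt (fun l => F l p0) a b) < eps).
rewrite <- RInt_minusR by apply Hc1.
apply Rle_lt_trans with (2 := He2).
assert (Hex : forall a b, ex_RInt (fun l => F l p - F l p0) a b).
{ intros; apply ex_RInt_cont. intros k. apply (continuous_minus (fun l => F l p) (fun l => F l p0)); apply Hc1. }
destruct (Rle_lt_dec a b) as [Hab|Hab].
- rewrite Rmin_left, Rmax_right in Hp by easy. rewrite (Rabs_right (b - a)) by lra.
  apply abs_RInt_le_const; [easy|apply Hex|exact Hp].
- rewrite Rmin_right, Rmax_left in Hp by lra.
  rewrite <- (opp_RInt_swap (V := R_CompleteNormedModule)) by apply Hex. unfold opp; simpl.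
  rewrite Rabs_Ropp, (Rabs_left (b - a)) by lra. replace (- (b - a)) with (a - b) by ring.
  apply abs_RInt_le_const; [lra|apply Hex|exact Hp].
Qed.

(** Both sides vanish at [b = a] and have the same derivative in the upper endpoint, so the exchange
    of integrals reduces to differentiation under [intR]. *)
Lemma intR_RInt C (F : R -> R -> R) a b : cont2 F -> (forall k l, Rabs (F k l) <= C * om l) ->
  intR (fun l => RInt (fun k => F k l) a b) = RInt (fun k => intR (fun l => F k l)) a b.
Proof.
intros Hc Hb.
assert (HD : forall k, dom C (fun l => F k l)).
{ intros k; split; intros l; [now apply (cont2_2 F)|apply Hb]. }
assert (HC := dom_ge0 _ _ (HD 0)).
assert (D1 : forall c, dom (Rabs (c - a) * C) (fun l => RInt (fun k => F k l) a c)).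
{ intros c; split; intros l.
  - apply (RInt_continuous_param F).
    + intros k. apply (cont2_comp F); [easy|apply continuous_fst|apply continuous_snd].
    + intros l' k. now apply cont2_1.
  - rewrite Rmult_assoc.
    destruct (Rle_lt_dec a c) as [Hac|Hac].
    + rewrite (Rabs_right (c - a)) by lra. apply abs_RInt_le_const; [easy| |intros; apply Hb].
      apply ex_RInt_cont; intros; now apply cont2_1.
    + rewrite (Rabs_left (c - a)) by lra. replace (- (c - a)) with (a - c) by ring.
      rewrite <- (opp_RInt_swap (V := R_CompleteNormedModule)).
      * unfold opp; simpl. rewrite Rabs_Ropp. apply abs_RInt_le_const; [lra| |intros; apply Hb].
        apply ex_RInt_cont; intros; now apply cont2_1.
      * apply ex_RInt_cont; intros; now apply cont2_1. }
assert (E : is_RInt (fun k => intR (fun l => F k l)) a b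
  (minus (intR (fun l => RInt (fun k => F k l) a b)) (intR (fun l => RInt (fun k => F k l) a a)))).
{ apply (is_RInt_derive (fun c => intR (fun l => RInt (fun k => F k l) a c))).
  - intros c _. apply (intR_is_derive ((Rabs (c - a) + 1) * C) C (fun l c => RInt (fun k => F k l) a c) (fun l c => F c l)).
    + intros l. apply (cont2_comp F); [easy|apply continuous_snd|apply continuous_fst].
    + exists (mkposreal 1 Rlt_0_1). intros y Hy. apply dom_weaken with (2 := D1 y).
      apply Rmult_le_compat_r; [easy|]. change (Rabs (y - c) < 1) in Hy.
      replace (y - a) with ((y - c) + (c - a)) by ring. generalize (Rabs_triang (y - c) (c - a)); lra.
    + apply filter_forall, HD.
    + apply filter_forall. intros y l. apply (is_derive_RInt (fun k => F k l) _ a).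
      * apply filter_forall. intros z. apply (RInt_correct (V := R_CompleteNormedModule)).
        apply ex_RInt_cont; intros; now apply cont2_1.
      * now apply cont2_1.
  - intros k _. apply (intR_continuous C (fun l k => F k l)).
    + intros l. apply (cont2_comp F); [easy|apply continuous_snd|apply continuous_fst].
    + apply filter_forall, HD. }
rewrite (is_RInt_unique _ _ _ _ E). unfold minus, plus, opp; simpl.
rewrite (intR_ext (fun l => RInt (fun k => F k l) a a) (fun l => 0 * om l)).
- rewrite (intR_scal 1) by apply dom_om. ring.
- intros l. rewrite RInt_point. unfold zero; simpl; ring.
Qed.

(** The finite case [intR_RInt] is pushed to [r] tending to infinity by [intR_lim]. The bound with
    [E], uniform in [r], is the domination; the bound with [B] makes the truncated inner integrals
    converge locally uniformly in [l]. *)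
Lemma intR_Fubini C D E (F : R -> R -> R) : cont2 F ->
  (forall k l, Rabs (F k l) <= C * om l) ->
  dom D (fun k => intR (fun l => F k l)) ->
  (forall r l, 0 <= r -> Rabs (RInt (fun k => F k l) (- r) r) <= E * om l) ->
  (forall r, exists B, forall k l, Rabs l <= r -> Rabs (F k l) <= B * om k) ->
  dom E (fun l => intR (fun k => F k l)) ->
  intR (fun k => intR (fun l => F k l)) = intR (fun l => intR (fun k => F k l)).
Proof.
intros Hc Hb HD HE HB HE2. apply (intR_unique D); [easy|]. intros eps He.
assert (L : filterlim (fun r => intR (fun l => RInt (fun k => F k l) (- r) r)) (Rbar_locally p_infty)
   (locally (intR (fun l => intR (fun k => F k l))))).
{ apply (intR_lim (Rbar_locally p_infty) E (fun r l => RInt (fun k => F k l) (- r) r)); [|easy|].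
  - exists 0. intros r Hr; split; intros l; [|apply HE; lra].
    apply (RInt_continuous_param F).
    + intros k. apply (cont2_comp F); [easy|apply continuous_fst|apply continuous_snd].
    + intros l' k. now apply cont2_1.
  - intros r e Hr0 He0. destruct (HB r) as [B HB'].
    assert (HdB : forall l, Rabs l <= r -> dom B (fun k => F k l)).
    { intros l Hl; split; intros k; [now apply cont2_1|now apply HB']. }
    assert (HB0 : 0 <= B) by (apply dom_ge0 with (f := fun k => F k 0), HdB; rewrite Rabs_R0; lra).
    destruct (tail_small_mul (2 * B) e) as [r1 [Hr1 Ht]]; [lra|easy|].
    exists r1. intros x Hx l Hl.
    assert (K := intR_key B _ r1 (- x) x (HdB l Hl) ltac:(lra) ltac:(lra) ltac:(lra)). lra. }
apply filterlim_locally with (eps := mkposreal eps He) in L. destruct L as [M HM].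
exists (M + 1). intros r Hr. specialize (HM r ltac:(lra)).
change (Rabs (intR (fun l => RInt (fun k => F k l) (- r) r) - intR (fun l => intR (fun k => F k l))) < eps) in HM.
rewrite (intR_RInt C) in HM by easy. lra.
Qed.

Definition conv (f g : R -> R) (k : R) : R := intR (fun l => f l * g (k - l)).

Lemma cont_flip (f : R -> R) a : (forall k, continuous f k) -> forall l, continuous (fun l => f (a - l)) l.
Proof.
intros H l. apply (continuous_comp (fun l => a - l) f); [|apply H].
apply (continuous_minus (fun _ => a) (fun l : R => l)); [apply continuous_const|apply continuous_id].
Qed.

Lemma dom_bnd C f k : dom C f -> Rabs (f k) <= C.
Proof.
intros Hf. assert (HC := dom_ge0 _ _ Hf). apply Rle_trans with (1 := proj2 Hf k).
rewrite <- (Rmult_1_r C) at 2. apply Rmult_le_compat_l; [easy|apply om_le1].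
Qed.

Lemma dom_mult_gen C B f b : dom C f -> (forall k, continuous b k) -> (forall k, Rabs (b k) <= B) ->
  dom (C * B) (fun k => f k * b k).
Proof.
intros Hf Hb HB; split; intros k.
- apply (continuous_mult f b); [apply Hf|apply Hb].
- rewrite Rabs_mult, (Rmult_comm C), Rmult_assoc, (Rmult_comm B).
  apply Rmult_le_compat; try apply Rabs_pos; [apply Hf|apply HB].
Qed.

Lemma conv_dom_integrand C D f g k : dom C f -> dom D g -> dom (C * D) (fun l => f l * g (k - l)).
Proof.
intros Hf Hg. apply (dom_mult_gen C D f (fun l => g (k - l))); [easy| |].
- apply cont_flip, Hg.
- intros l; apply (dom_bnd _ _ _ Hg).
Qed.

Lemma intR_om_flip a : intR (fun l => om (a - l)) = intR om.
Proof.
rewrite <- (intR_flip 1 om dom_om).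
rewrite <- (intR_shift 1 _ (- a) (dom_flip _ _ dom_om)).
apply intR_ext; intros l; f_equal; ring.
Qed.

(** All convolution estimates have this shape: if the product of two envelopes is at most [A] times
    [om l + om (k - l)], then [A], which may depend on [k], carries the decay, and each of the two
    weights has integral [intR om]. *)
Lemma conv_bound A C D f g k (U synth : R -> R) : dom C f -> dom D g ->
  (forall l, Rabs (f l) <= U l) -> (forall l, Rabs (g l) <= synth l) ->
  (forall l, U l * synth (k - l) <= A * (om l + om (k - l))) ->
  Rabs (conv f g k) <= 2 * intR om * A.
Proof.
intros Hf Hg HU HV H.
assert (Do : dom ((1 + Rabs k) ^ 2) (fun l => om (k - l))).
{ split; intros l; [apply cont_flip; apply om_cont|].
  rewrite <- om_opp, Rabs_right by (left; apply om_gt0).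
    replace (- (k - l)) with (l + - k) by ring. rewrite <- (Rabs_Ropp k). apply om_shift. }
assert (Ds := dom_scal _ A _ (dom_plus _ _ _ _ dom_om Do)).
assert (Df := conv_dom_integrand _ _ _ _ k Hf Hg).
assert (B : forall l, Rabs (f l * g (k - l)) <= A * (om l + om (k - l))).
{ intros l. rewrite Rabs_mult. apply Rle_trans with (2 := H l).
  apply Rmult_le_compat; [apply Rabs_pos|apply Rabs_pos|apply HU|apply HV]. }
assert (E : intR (fun l => A * (om l + om (k - l))) = 2 * intR om * A).
{ rewrite (intR_scal _ _ _ (dom_plus _ _ _ _ dom_om Do)), (intR_plus _ _ _ _ dom_om Do), intR_om_flip. ring. }
rewrite <- E. unfold conv. apply Rabs_le_between. split.
- replace (- intR (fun l => A * (om l + om (k - l)))) with (intR (fun l => (-1) * (A * (om l + om (k - l))))).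
  2:{ rewrite (intR_scal _ _ _ Ds). ring. }
  apply (intR_le _ _ _ _ (dom_scal _ (-1) _ Ds) Df). intros l. specialize (B l). apply Rabs_le_between in B. lra.
- apply (intR_le _ _ _ _ Df Ds). intros l. specialize (B l). apply Rabs_le_between in B. lra.
Qed.

(** One of the two frequencies is at least about half of [k]; its weight is traded for that of [k],
    the other one is kept for integration. *)
Lemma om_mult k l : om l * om (k - l) <= 4 * om k * (om l + om (k - l)).
Proof.
assert (P1 := om_gt0 l). assert (P2 := om_gt0 (k - l)). assert (P3 := om_gt0 k).
assert (T : Rabs k <= Rabs l + Rabs (k - l)).
{ replace k with (l + (k - l)) at 1 by ring. apply Rabs_triang. }
destruct (Rle_lt_dec (1 + Rabs k) (2 * (1 + Rabs l))) as [H|H].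
- assert (K := om_comp 2 k l ltac:(lra) H). nra.
- assert (K := om_comp 2 k (k - l) ltac:(lra) ltac:(lra)). nra.
Qed.

Lemma conv_om_bound C D f g k : dom C f -> dom D g -> Rabs (conv f g k) <= 8 * intR om * C * D * om k.
Proof.
intros Hf Hg.
assert (HC := dom_ge0 _ _ Hf). assert (HD := dom_ge0 _ _ Hg).
assert (K := conv_bound (4 * C * D * om k) C D f g k (fun l => C * om l) (fun l => D * om l) Hf Hg (proj2 Hf) (proj2 Hg)).
apply Rle_trans with (1 := K ltac:(intros l; assert (H := om_mult k l); cbv beta;
  replace (C * om l * (D * om (k - l))) with (C * D * (om l * om (k - l))) by ring;
  replace (4 * C * D * om k * (om l + om (k - l))) with (C * D * (4 * om k * (om l + om (k - l)))) by ring;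
  apply Rmult_le_compat_l; [now apply Rmult_le_pos|easy])).
right; ring.
Qed.

Definition dom2 (C : R) (f : R -> R -> R) : Prop :=
  cont2 f /\ forall k s, Rabs (f k s) <= C * om k.

Lemma dom2_1 C f s : dom2 C f -> dom C (fun k => f k s).
Proof. intros [Hc Hb]; split; intros k; [now apply cont2_1|apply Hb]. Qed.

Definition conv2 (f g : R -> R -> R) (k s : R) : R := conv (fun l => f l s) (fun l => g l s) k.

Lemma conv2_cont C D f g : dom2 C f -> dom2 D g -> cont2 (conv2 f g).
Proof.
intros Hf Hg k s. unfold conv2, conv.
apply (intR_continuous (C * D) (fun l p => f l (snd p) * g (fst p - l) (snd p)) (k, s)).
- intros l. apply (continuous_mult (fun q : R * (R * R) => f (fst q) (snd (snd q)))
     (fun q : R * (R * R) => g (fst (snd q) - fst q) (snd (snd q)))).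
  + apply (cont2_comp f (fun q : R * (R * R) => fst q) (fun q => snd (snd q))); [apply Hf|apply continuous_fst|].
    apply (continuous_comp (fun q : R * (R * R) => snd q) (fun p : R * R => snd p)); apply continuous_snd.
  + apply (cont2_comp g (fun q : R * (R * R) => fst (snd q) - fst q) (fun q => snd (snd q))); [apply Hg| |].
    * apply (continuous_minus (fun q : R * (R * R) => fst (snd q)) (fun q => fst q)); [|apply continuous_fst].
      apply (continuous_comp (fun q : R * (R * R) => snd q) (fun p : R * R => fst p)); [apply continuous_snd|apply continuous_fst].
    * apply (continuous_comp (fun q : R * (R * R) => snd q) (fun p : R * R => snd p)); apply continuous_snd.
- apply filter_forall. intros [k' s']; simpl.
  apply (conv_dom_integrand C D (fun l => f l s') (fun l => g l s')); now apply dom2_1.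
Qed.

Lemma conv2_dom2 C D f g : dom2 C f -> dom2 D g -> dom2 (8 * intR om * C * D) (conv2 f g).
Proof.
intros Hf Hg; split; [now apply (conv2_cont C D)|].
intros k s. apply conv_om_bound; now apply dom2_1.
Qed.

(** The derivative falls on the second factor alone, and the first need not be differentiable. The
    gain of derivatives in the bootstrapping rests on this asymmetry. *)
Lemma conv_derive C D D' f g dg k : dom C f -> dom D g -> dom D' dg -> (forall k, is_derive g k (dg k)) ->
  is_derive (conv f g) k (conv f dg k).
Proof.
intros Hf Hg Hdg H. unfold conv.
apply (intR_is_derive (C * D) (C * D') (fun l k => f l * g (k - l)) (fun l k => f l * dg (k - l)) k).
- intros l. apply (continuous_mult (fun q : R * R => f (fst q)) (fun q => dg (snd q - fst q))).
  + apply (continuous_comp (fun q : R * R => fst q) f); [apply continuous_fst|apply Hf].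
  + apply (continuous_comp (fun q : R * R => snd q - fst q) dg); [|apply Hdg].
    apply (continuous_minus (fun q : R * R => snd q) (fun q => fst q)); [apply continuous_snd|apply continuous_fst].
- apply filter_forall; intros p; now apply conv_dom_integrand.
- apply filter_forall; intros p; now apply conv_dom_integrand.
- apply filter_forall; intros p l.
  apply (is_derive_scal (fun k => g (k - l)) p (f l)).
  replace (dg (p - l)) with (scal 1 (dg (p - l))) by apply (scal_one (K := R_Ring)).
  apply (is_derive_comp g (fun k => k - l)); [apply H|auto_derive; [easy|ring]].
Qed.

Lemma RInt_bound C f a b : dom C f -> Rabs (RInt f a b) <= 2 * (C * tail 0).
Proof.
intros Hf.
assert (H : forall x, Rabs (RInt f 0 x) <= C * tail 0).
{ intros x. destruct (Rle_lt_dec 0 x).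
  - apply tail_pos; lra || easy.
  - apply tail_neg; lra || easy. }
rewrite <- (RInt_ChaslesR f a 0 b) by apply Hf.
apply Rle_trans with (1 := Rabs_triang _ _). assert (H1 := H b). assert (H2 := H a).
rewrite <- (opp_RInt_swap (V := R_CompleteNormedModule)) by apply ex_RInt_cont, Hf.
unfold opp; simpl. rewrite Rabs_Ropp. lra.
Qed.

(** Exchange of the integrals followed by the shift [k -> k + l]. With [b] a cosine or a sine, the
    addition formulas then separate the variables, which is the convolution theorem. *)
Lemma intR_cv C D f g b : dom C f -> dom D g -> (forall k, continuous b k) -> (forall k, Rabs (b k) <= 1) ->
  intR (fun k => conv f g k * b k) = intR (fun l => f l * intR (fun k => g k * b (k + l))).
Proof.
intros Hf Hg Hb Bb.
assert (HC := dom_ge0 _ _ Hf). assert (HD := dom_ge0 _ _ Hg).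
set (F := fun k l => f l * g (k - l) * b k).
assert (Hb' : forall l k, continuous (fun k => b (k + l)) k).
{ intros l k. apply (continuous_comp (fun k => k + l) b); [|apply Hb].
  apply (continuous_plus (fun k : R => k) (fun _ => l)); [apply continuous_id|apply continuous_const]. }
assert (Dg : forall l, dom D (fun k => g k * b (k + l))).
{ intros l. apply dom_mult; [easy|apply Hb'|intros; apply Bb]. }
assert (E1 : forall l, intR (fun k => g (k - l) * b k) = intR (fun k => g k * b (k + l))).
{ intros l. rewrite <- (intR_shift D (fun k => g k * b (k + l)) (- l)) by easy. apply intR_ext. intros k.
  replace (k + - l + l) with k by ring. reflexivity. }
assert (Ds : forall l, dom (D * (1 + Rabs (- l)) ^ 2) (fun k => g (k - l) * b k)).
{ intros l. apply (dom_mult _ (fun k => g (k - l))); [|easy|easy]. apply (dom_shift D g (- l) Hg). }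
assert (E2 : forall l, intR (fun k => F k l) = f l * intR (fun k => g k * b (k + l))).
{ intros l. rewrite <- E1. rewrite <- (intR_scal _ (f l) _ (Ds l)). apply intR_ext; intros k; unfold F; ring. }
assert (E3 : forall k, intR (fun l => F k l) = conv f g k * b k).
{ intros k. unfold conv. rewrite Rmult_comm, <- (intR_scal _ (b k) _ (conv_dom_integrand _ _ _ _ k Hf Hg)).
  apply intR_ext; intros l; unfold F; ring. }
transitivity (intR (fun k => intR (fun l => F k l))).
{ apply intR_ext; intros k; now rewrite E3. }
transitivity (intR (fun l => intR (fun k => F k l))).
2:{ apply intR_ext; intros l; now rewrite E2. }
assert (Hcg : cont2 (fun k l => g (k - l))).
{ intros k l. apply (continuous_comp (fun q : R * R => fst q - snd q) g); [|apply Hg].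
  apply (continuous_minus (fun q : R * R => fst q) (fun q => snd q)); [apply continuous_fst|apply continuous_snd]. }
assert (Dcv : dom (8 * intR om * C * D) (conv f g)).
{ split; intros k; [|now apply conv_om_bound].
  apply (cont2_1 (conv2 (fun l _ => f l) (fun l _ => g l)) 0). apply (conv2_cont C D).
  - split; [|intros; apply Hf]. intros l s. apply (continuous_comp (fun q : R * R => fst q) f); [apply continuous_fst|apply Hf].
  - split; [|intros; apply Hg]. intros l s. apply (continuous_comp (fun q : R * R => fst q) g); [apply continuous_fst|apply Hg]. }
(* The third constant has two summands because [intR_Fubini] asks for one number that bounds the
   truncated inner integrals, through [RInt_bound], as well as the full ones, through
   [intR_bound]. *)
apply (intR_Fubini (C * D) (8 * intR om * C * D) (2 * (D * tail 0) * C + C * (D * intR om))).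
- intros k l. unfold F.
  apply (continuous_mult (fun q : R * R => f (snd q) * g (fst q - snd q)) (fun q => b (fst q))).
  + apply (continuous_mult (fun q : R * R => f (snd q)) (fun q => g (fst q - snd q))); [|apply Hcg].
    apply (continuous_comp (fun q : R * R => snd q) f); [apply continuous_snd|apply Hf].
  + apply (continuous_comp (fun q : R * R => fst q) b); [apply continuous_fst|apply Hb].
- intros k l. unfold F. rewrite !Rabs_mult.
  assert (A1 := proj2 Hf l). assert (A2 := dom_bnd _ _ (k - l) Hg). assert (A3 := Bb k).
  generalize (Rabs_pos (f l)) (Rabs_pos (g (k - l))) (Rabs_pos (b k)) (om_gt0 l); intros.
  apply Rle_trans with (C * om l * D * 1); [|right; ring].
  apply Rmult_le_compat; try easy; [apply Rmult_le_pos; easy|]. apply Rmult_le_compat; easy.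
- destruct (dom_mult _ _ b Dcv Hb Bb) as [H1 H2]. split.
  + intros k. apply continuous_ext with (2 := H1 k). intros x; now rewrite E3.
  + intros k. rewrite E3. apply H2.
- intros r l Hr. unfold F.
  assert (G0 : forall k, continuous (fun k => g (k - l) * b k) k) by apply Ds.
  transitivity (Rabs (f l * RInt (fun k => g (k - l) * b k) (- r) r)).
  { right; f_equal. rewrite <- RInt_scalR by easy. apply RInt_ext; intros k _. apply Rmult_assoc. }
  replace (RInt (fun k => g (k - l) * b k) (- r) r) with (RInt (fun k => g k * b (k + l)) (- r - l) (r - l)).
  2:{ replace (- r - l) with (1 * - r + - l) by ring. replace (r - l) with (1 * r + - l) by ring.
      rewrite <- (RInt_comp_lin (V := R_CompleteNormedModule) (fun k => g k * b (k + l)) 1 (- l)) by apply ex_RInt_cont, Dg.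
      apply RInt_ext; intros k _. unfold scal; simpl; unfold mult; simpl.
      replace (1 * k + - l + l) with k by ring. replace (1 * k + - l) with (k - l) by ring. apply Rmult_1_l. }
  rewrite Rabs_mult. assert (K := RInt_bound _ _ (- r - l) (r - l) (Dg l)). assert (A1 := proj2 Hf l).
  assert (0 <= tail 0) by apply tail_ge0. assert (0 <= intR om) by apply intR_om_ge0. assert (0 < om l) by apply om_gt0.
  apply Rle_trans with (C * om l * (2 * (D * tail 0))).
  + apply Rmult_le_compat; try apply Rabs_pos; easy.
  + assert (0 <= C * (D * intR om) * om l) by (repeat apply Rmult_le_pos; lra). lra.
- intros r. exists (C * (D * (1 + Rabs r) ^ 2)). intros k l Hl. unfold F. rewrite !Rabs_mult.
  assert (A1 := dom_bnd _ _ l Hf).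
  assert (A2 : Rabs (g (k - l)) <= D * (1 + Rabs r) ^ 2 * om k).
  { apply Rle_trans with (1 := proj2 Hg _). rewrite Rmult_assoc. apply Rmult_le_compat_l; [easy|].
    apply Rle_trans with (1 := om_shift (- l) k). apply Rmult_le_compat_r; [left; apply om_gt0|].
    rewrite Rabs_Ropp. apply pow_incr. generalize (Rabs_pos l) (Rle_abs r); lra. }
  apply Rle_trans with (C * (D * (1 + Rabs r) ^ 2 * om k) * 1); [|right; ring].
  apply Rmult_le_compat; try apply Rabs_pos; [apply Rmult_le_pos; apply Rabs_pos| |apply Bb].
  apply Rmult_le_compat; try apply Rabs_pos; easy.
- assert (0 <= tail 0) by apply tail_ge0. assert (0 <= intR om) by apply intR_om_ge0.
  assert (Hr1 : dom (C * (D * intR om)) (fun l => f l * intR (fun k => g k * b (k + l)))).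
  { apply dom_mult_gen; [easy| |].
    - intros l. apply (intR_continuous D (fun k l => g k * b (k + l))).
      + intros k. apply (continuous_mult (fun q : R * R => g (fst q)) (fun q => b (fst q + snd q))).
        * apply (continuous_comp (fun q : R * R => fst q) g); [apply continuous_fst|apply Hg].
        * apply (continuous_comp (fun q : R * R => fst q + snd q) b); [|apply Hb].
          apply (continuous_plus (fun q : R * R => fst q) (fun q => snd q)); [apply continuous_fst|apply continuous_snd].
      + apply filter_forall; intros; apply Dg.
    - intros l. apply intR_bound, Dg. }
  apply dom_weaken with (C * (D * intR om)).
  + assert (0 <= 2 * (D * tail 0) * C) by (apply Rmult_le_pos; [apply Rmult_le_pos; [lra|apply Rmult_le_pos; lra]|lra]). lra.
  + split; intros l.
    * apply continuous_ext with (2 := proj1 Hr1 l). intros x; now rewrite E2.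
    * rewrite E2. apply Hr1.
Qed.

End Convolution.

Lemma nondecr_of_derive (f df : R -> R) a b : a <= b ->
  (forall t, a <= t <= b -> is_derive f t (df t)) -> (forall t, a <= t <= b -> 0 <= df t) -> f a <= f b.
Proof.
intros Hab H H0.
destruct (MVT_gen f a b df) as [c [Hc E]].
- intros t Ht; apply H. rewrite Rmin_left, Rmax_right in Ht by easy; lra.
- intros t Ht. rewrite Rmin_left, Rmax_right in Ht by easy.
  apply derivable_continuous_pt. exists (df t). now apply is_derive_Reals, H.
- rewrite Rmin_left, Rmax_right in Hc by easy. specialize (H0 c Hc). nra.
Qed.

Lemma const_of_derive (f : R -> R) a : (forall t, is_derive f t 0) -> f a = f 0.
Proof.
intros H. destruct (MVT_gen f 0 a (fun _ => 0)) as [c [_ E]].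
- intros; apply H.
- intros. apply derivable_continuous_pt. exists 0. apply is_derive_Reals, H.
- lra.
Qed.

(** For an abstract function [auto_derive] leaves a term [Derive (fun t => f t) x]; this replaces it
    by the known derivative. *)
Ltac use_der H :=
  match type of H with is_derive ?f ?x ?l =>
    let E := fresh in
    assert (E : Derive (fun t => f t) x = l) by exact (is_derive_unique f x l H);
    rewrite E; clear E
  end.

(** * The linear boundary value problem in s *)

Section Hyperbolic.

(* cosh (sqrt z s) and sinh (sqrt z s) / sqrt z, continued to z <= 0. *)
Definition CH (z s : R) : R :=
  if Rlt_dec 0 z then cosh (sqrt z * s)
  else if Rlt_dec z 0 then cos (sqrt (- z) * s) else 1.

Definition SH (z s : R) : R :=
  if Rlt_dec 0 z then sinh (sqrt z * s) / sqrt z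
  else if Rlt_dec z 0 then sin (sqrt (- z) * s) / sqrt (- z) else s.

Lemma CH_derive z s : is_derive (CH z) s (z * SH z s).
Proof.
unfold CH, SH. destruct (Rlt_dec 0 z) as [H|H]; [|destruct (Rlt_dec z 0) as [H'|H']].
- assert (H0 := sqrt_lt_R0 z H). unfold cosh, sinh. auto_derive; [easy|].
  rewrite <- (sqrt_sqrt z) at 5 by lra. field; lra.
- assert (H0 := sqrt_lt_R0 (- z) ltac:(lra)). auto_derive; [easy|].
  replace z with (- (sqrt (- z) * sqrt (- z))) at 3 by (rewrite sqrt_sqrt; lra). field; lra.
- auto_derive; [easy|]. replace z with 0 by lra. ring.
Qed.

Lemma SH_derive z s : is_derive (SH z) s (CH z s).
Proof.
unfold CH, SH. destruct (Rlt_dec 0 z) as [H|H]; [|destruct (Rlt_dec z 0) as [H'|H']].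
- assert (H0 := sqrt_lt_R0 z H). unfold cosh, sinh. auto_derive; [easy|]. field; lra.
- assert (H0 := sqrt_lt_R0 (- z) ltac:(lra)). auto_derive; [easy|]. field; lra.
- auto_derive; [easy|]. ring.
Qed.

Lemma CH_0 z : CH z 0 = 1.
Proof.
unfold CH. destruct (Rlt_dec 0 z); [|destruct (Rlt_dec z 0); [|easy]]; rewrite Rmult_0_r.
- apply cosh_0.
- apply cos_0.
Qed.

Lemma SH_0 z : SH z 0 = 0.
Proof.
unfold SH. destruct (Rlt_dec 0 z); [|destruct (Rlt_dec z 0); [|easy]]; rewrite Rmult_0_r.
- rewrite sinh_0; unfold Rdiv; ring.
- rewrite sin_0; unfold Rdiv; ring.
Qed.

Lemma CH_SH z s : CH z s * CH z s - z * (SH z s * SH z s) = 1.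
Proof.
rewrite (const_of_derive (fun s => CH z s * CH z s - z * (SH z s * SH z s)) s).
- rewrite CH_0, SH_0; ring.
- intros t. assert (H1 := CH_derive z t). assert (H2 := SH_derive z t).
  auto_derive.
  + repeat split; eexists; eassumption.
  + use_der H1; use_der H2. ring.
Qed.

Lemma CH_cont z s : continuous (CH z) s.
Proof. apply (ex_derive_continuous (CH z)); eexists; apply CH_derive. Qed.

Lemma SH_cont z s : continuous (SH z) s.
Proof. apply (ex_derive_continuous (SH z)); eexists; apply SH_derive. Qed.

Lemma cosh_le_exp x : 0 <= x -> cosh x <= exp x.
Proof. intros H. unfold cosh. assert (exp (- x) <= exp x) by (destruct H; [left; apply exp_increasing; lra|subst; right; f_equal; ring]). lra. Qed.

Lemma exp_le_mono x y : x <= y -> exp x <= exp y.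
Proof. intros [H|H]; [left; now apply exp_increasing|subst; right; easy]. Qed.

(** The threshold 16 bounds [zz k] for [|k| <= 2], the range later treated as low frequency; there
    [sqrt z <= 4]. *)
Lemma CH_low z s T : z <= 16 -> 0 <= s <= T -> Rabs (CH z s) <= exp (4 * T).
Proof.
intros Hz Hs. assert (E : 1 <= exp (4 * T)) by (rewrite <- exp_0 at 1; apply exp_le_mono; lra).
unfold CH. destruct (Rlt_dec 0 z) as [H|H]; [|destruct (Rlt_dec z 0) as [H'|H']].
- assert (Hq : sqrt z <= 4).
  { replace 4 with (sqrt (4 * 4)) by (apply sqrt_square; lra). apply sqrt_le_1; lra. }
  assert (Hp := sqrt_pos z).
  assert (0 <= sqrt z * s) by (apply Rmult_le_pos; lra).
  rewrite Rabs_right by (unfold cosh; generalize (exp_pos (sqrt z * s)) (exp_pos (- (sqrt z * s))); lra).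
  apply Rle_trans with (1 := cosh_le_exp _ H0). apply exp_le_mono. nra.
- apply Rle_trans with (2 := E). apply Rabs_le_between. apply COS_bound.
- rewrite Rabs_R1; lra.
Qed.

Lemma SH_low z s T : z <= 16 -> 0 <= s <= T -> Rabs (SH z s) <= T * exp (4 * T).
Proof.
intros Hz Hs.
destruct (MVT_gen (SH z) 0 s (CH z)) as [c [Hc E]].
- intros; apply SH_derive.
- intros. apply derivable_continuous_pt. exists (CH z x). apply is_derive_Reals, SH_derive.
- rewrite Rmin_left, Rmax_right in Hc by lra. rewrite SH_0, !Rminus_0_r in E. rewrite E, Rabs_mult, Rmult_comm.
  apply Rmult_le_compat; try apply Rabs_pos; [rewrite Rabs_right; lra|apply CH_low; lra].
Qed.

Lemma sin_half x : 0 < x <= 1 -> x / 2 <= sin x.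
Proof.
intros Hx. destruct (SIN x ltac:(lra)) as [H _].
{ generalize PI2_1; unfold PI2; lra. }
apply Rle_trans with (2 := H). unfold sin_lb, sin_approx, sum_f_R0, sin_term; simpl.
assert (0 <= x ^ 5) by (apply pow_le; lra).
assert (x ^ 3 <= x) by (simpl; nra).
assert (x ^ 7 <= x ^ 5).
{ replace (x ^ 7) with (x ^ 5 * (x * x)) by ring. rewrite <- (Rmult_1_r (x ^ 5)) at 2. apply Rmult_le_compat_l; nra. }
simpl in *. nra.
Qed.

(** At [s = 1/2] and [z >= -1/4] the argument of the sine is at most [1/4], well before its first
    zero, while for [z > 0] the hyperbolic sine exceeds its argument. This uniform lower bound is
    the reason for an interior point in the boundary condition. *)
Lemma SH_half z : - (1/4) <= z -> 1 / 4 <= SH z (1 / 2).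
Proof.
intros Hz. unfold SH. destruct (Rlt_dec 0 z) as [H|H]; [|destruct (Rlt_dec z 0) as [H'|H']].
- assert (H0 := sqrt_lt_R0 z H).
  apply Rmult_le_reg_r with (sqrt z); [easy|]. unfold Rdiv at 2. rewrite Rmult_assoc, Rinv_l, Rmult_1_r by lra.
  set (x := sqrt z * (1 / 2)).
  assert (Hx : 0 <= x) by (unfold x; lra).
  replace (1 / 4 * sqrt z) with (x / 2) by (unfold x; field).
  assert (E : 0 <= sinh x - x).
  { replace 0 with (sinh 0 - 0) by (rewrite sinh_0; ring).
    apply (nondecr_of_derive (fun x => sinh x - x) (fun x => cosh x - 1)); [easy| |].
    - intros t _. unfold sinh, cosh. auto_derive; [easy|field].
    - intros t _. unfold cosh. assert (P := exp_pos t).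
      assert (exp t * exp (- t) = 1) by (rewrite <- exp_plus; replace (t + - t) with 0 by ring; apply exp_0).
      assert (0 <= (exp t - 1) * (exp t - 1)) by (generalize (Rle_0_sqr (exp t - 1)); unfold Rsqr; lra).
      assert (0 < exp (- t)) by apply exp_pos. nra. }
  lra.
- assert (H0 := sqrt_lt_R0 (- z) ltac:(lra)).
  assert (Hq : sqrt (- z) <= 1 / 2).
  { replace (1 / 2) with (sqrt ((1 / 2) * (1 / 2))) by (apply sqrt_square; lra). apply sqrt_le_1; lra. }
  assert (K := sin_half (sqrt (- z) * (1 / 2)) ltac:(lra)).
  apply Rmult_le_reg_r with (sqrt (- z)); [easy|]. unfold Rdiv at 2. rewrite Rmult_assoc, Rinv_l, Rmult_1_r by lra. lra.
- lra.
Qed.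

Lemma SH_ge z s : 0 <= s -> - s <= SH z s.
Proof.
intros Hs. unfold SH. destruct (Rlt_dec 0 z) as [H|H]; [|destruct (Rlt_dec z 0) as [H'|H']].
- assert (H0 := sqrt_lt_R0 z H).
  assert (0 <= sinh (sqrt z * s)).
  { unfold sinh. assert (exp (- (sqrt z * s)) <= exp (sqrt z * s)) by (apply exp_le_mono; nra). lra. }
  assert (0 <= sinh (sqrt z * s) / sqrt z) by (apply Rmult_le_pos; [easy|left; now apply Rinv_0_lt_compat]). lra.
- assert (H0 := sqrt_lt_R0 (- z) ltac:(lra)).
  apply Rmult_le_reg_r with (sqrt (- z)); [easy|]. unfold Rdiv. rewrite Rmult_assoc, Rinv_l, Rmult_1_r by lra.
  set (x := sqrt (- z) * s). assert (Hx : 0 <= x) by (unfold x; nra).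
  replace (- s * sqrt (- z)) with (- x) by (unfold x; ring).
  enough (0 <= sin x + x) by lra.
  replace 0 with (sin 0 + 0) by (rewrite sin_0; ring).
  apply (nondecr_of_derive (fun x => sin x + x) (fun x => cos x + 1)); [easy| |].
  + intros t _. auto_derive; [easy|ring].
  + intros t _. generalize (COS_bound t); lra.
- lra.
Qed.

End Hyperbolic.

Section BVP.
Context {P : params}.

(** [SH z SS] can be as low as [- SS], whereas [SH z (1/2)] is at least [1/4]. With this coefficient
    the sum [den z] is at least [SS], hence at least 1. *)
Definition bc_coef : R := 8 * SS.
Definition den (z : R) : R := SH z SS + bc_coef * SH z (1 / 2).

Lemma den_ge1 z : - (1/4) <= z -> 1 <= den z.
Proof.
intros Hz. assert (HS := SS_ge1). unfold den, bc_coef.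
assert (H1 := SH_half z Hz). assert (H2 : - SS <= SH z SS) by (apply SH_ge; lra). nra.
Qed.

Definition IC (z : R) (h : R -> R) (s : R) : R := RInt (fun t => CH z t * h t) 0 s.
Definition IS (z : R) (h : R -> R) (s : R) : R := RInt (fun t => SH z t * h t) 0 s.
(** Variation of constants: the particular solution with zero value and slope at 0. The kernel
    [SH z (s - t)] is expanded by the addition formula, so that [s] appears only outside the
    integrals and as their endpoint. *)
Definition duhamel z h s : R := SH z s * IC z h s - CH z s * IS z h s.
Definition dduhamel z h s : R := CH z s * IC z h s - z * SH z s * IS z h s.
(** The initial slope of the solution, found by solving the second boundary condition, which is
    affine in it with coefficient [den z]. *)
Definition shoot z phi h : R := - (phi * (CH z SS + bc_coef * CH z (1 / 2)) + duhamel z h SS + bc_coef * duhamel z h (1 / 2)) / den z.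

(* [sol z phi h] is the solution of y'' = z y + h, y(0) = phi, y(SS) + bc_coef y(1/2) = 0. The second
   condition does not involve z and is uniquely solvable for all z >= -1/4, the range of k^4 - k^2. *)
Definition sol z phi h s : R := phi * CH z s + shoot z phi h * SH z s + duhamel z h s.
Definition dsol z phi h s : R := phi * (z * SH z s) + shoot z phi h * CH z s + dduhamel z h s.

Lemma IC_derive z h s : (forall t, continuous h t) -> is_derive (IC z h) s (CH z s * h s).
Proof.
intros Hh. assert (Hc : forall t, continuous (fun t => CH z t * h t) t).
{ intros t; apply (continuous_mult (CH z) h); [apply CH_cont|apply Hh]. }
apply (is_derive_RInt (fun t => CH z t * h t) _ 0); [|apply Hc].
apply filter_forall; intros t. apply (RInt_correct (V := R_CompleteNormedModule)), ex_RInt_cont, Hc.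
Qed.

Lemma IS_derive z h s : (forall t, continuous h t) -> is_derive (IS z h) s (SH z s * h s).
Proof.
intros Hh. assert (Hc : forall t, continuous (fun t => SH z t * h t) t).
{ intros t; apply (continuous_mult (SH z) h); [apply SH_cont|apply Hh]. }
apply (is_derive_RInt (fun t => SH z t * h t) _ 0); [|apply Hc].
apply filter_forall; intros t. apply (RInt_correct (V := R_CompleteNormedModule)), ex_RInt_cont, Hc.
Qed.

Lemma sol_derive z phi h s : (forall t, continuous h t) -> is_derive (sol z phi h) s (dsol z phi h s).
Proof.
intros Hh. assert (H1 := CH_derive z s). assert (H2 := SH_derive z s).
assert (H3 := IC_derive z h s Hh). assert (H4 := IS_derive z h s Hh).
unfold sol, duhamel. auto_derive.
- repeat split; eexists; eassumption.
- use_der H1; use_der H2; use_der H3; use_der H4.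
  unfold dsol, dduhamel. ring.
Qed.

Lemma dsol_derive z phi h s : (forall t, continuous h t) ->
  is_derive (dsol z phi h) s (z * sol z phi h s + h s).
Proof.
intros Hh. assert (H1 := CH_derive z s). assert (H2 := SH_derive z s).
assert (H3 := IC_derive z h s Hh). assert (H4 := IS_derive z h s Hh).
unfold dsol, dduhamel. auto_derive.
- repeat split; eexists; eassumption.
- use_der H1; use_der H2; use_der H3; use_der H4.
  transitivity (z * sol z phi h s + h s * (CH z s * CH z s - z * (SH z s * SH z s))).
  + unfold sol, duhamel; ring.
  + rewrite CH_SH; ring.
Qed.

Lemma duhamel_0 z h : duhamel z h 0 = 0.
Proof. unfold duhamel, IC, IS. rewrite !RInt_point, SH_0. unfold zero; simpl. ring. Qed.

Lemma sol_0 z phi h : sol z phi h 0 = phi.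
Proof. unfold sol. rewrite duhamel_0, CH_0, SH_0. ring. Qed.

Lemma sol_bc z phi h : - (1/4) <= z -> sol z phi h SS + bc_coef * sol z phi h (1 / 2) = 0.
Proof.
intros Hz. assert (Hd := den_ge1 z Hz). unfold sol.
assert (E : shoot z phi h * den z = - (phi * (CH z SS + bc_coef * CH z (1 / 2)) + duhamel z h SS + bc_coef * duhamel z h (1 / 2))).
{ unfold shoot. field. lra. }
unfold den in E. lra.
Qed.

Definition is_sol z phi (h y dy : R -> R) : Prop :=
  (forall s, is_derive y s (dy s)) /\ (forall s, is_derive dy s (z * y s + h s)) /\
  y 0 = phi /\ y SS + bc_coef * y (1 / 2) = 0.

Lemma sol_is_sol z phi h : - (1/4) <= z -> (forall t, continuous h t) ->
  is_sol z phi h (sol z phi h) (dsol z phi h).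
Proof.
intros Hz Hh; split; [|split; [|split]]; intros.
- now apply sol_derive.
- now apply dsol_derive.
- apply sol_0.
- now apply sol_bc.
Qed.

Lemma is_sol_lin z a b phi psi h g y dy v dv :
  is_sol z phi h y dy -> is_sol z psi g v dv ->
  is_sol z (a * phi + b * psi) (fun s => a * h s + b * g s) (fun s => a * y s + b * v s) (fun s => a * dy s + b * dv s).
Proof.
intros [H1 [H2 [H3 H4]]] [H5 [H6 [H7 H8]]].
assert (L : forall (f g : R -> R) s df dg, is_derive f s df -> is_derive g s dg ->
   is_derive (fun s => a * f s + b * g s) s (a * df + b * dg)).
{ intros. apply (is_derive_plus (fun s => a * f s) (fun s => b * g0 s)); now apply is_derive_scal. }
split; [|split; [|split]]; intros.
- now apply L.
- replace (z * (a * y s + b * v s) + (a * h s + b * g s)) with (a * (z * y s + h s) + b * (z * v s + g s)) by ring. now apply L.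
- now rewrite H3, H7.
- replace (_ + _) with (a * (y SS + bc_coef * y (1 / 2)) + b * (v SS + bc_coef * v (1 / 2))) by ring. rewrite H4, H8. ring.
Qed.

(** The difference [w] of two solutions solves the homogeneous equation with [w 0 = 0]. Its
    Wronskians with [CH] and [SH] are constant, so [w] is a multiple of [SH z], and the second
    condition multiplies that factor by [den z], which is not zero. *)
Lemma is_sol_unique z phi h y dy v dv : - (1/4) <= z ->
  is_sol z phi h y dy -> is_sol z phi h v dv -> forall s, y s = v s /\ dy s = dv s.
Proof.
intros Hz Hy Hv.
destruct (is_sol_lin z 1 (-1) _ _ _ _ _ _ _ _ Hy Hv) as [H1 [H2 [H3 H4]]].
set (w := fun s => 1 * y s + -1 * v s) in *. set (dw := fun s => 1 * dy s + -1 * dv s) in *.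
assert (W0 : w 0 = 0) by (unfold w; lra).
assert (A : forall s, w s * CH z s - dw s * SH z s = 0).
{ intros s. rewrite (const_of_derive (fun s => w s * CH z s - dw s * SH z s) s).
  - rewrite W0, SH_0. ring.
  - intros t. assert (E1 := CH_derive z t). assert (E2 := SH_derive z t).
    assert (E3 := H1 t). assert (E4 := H2 t).
    auto_derive.
    + repeat split; eexists; eassumption.
    + use_der E1; use_der E2; use_der E3; use_der E4.
      unfold w, dw. ring. }
assert (B : forall s, dw s * CH z s - z * w s * SH z s = dw 0).
{ intros s. rewrite (const_of_derive (fun s => dw s * CH z s - z * w s * SH z s) s).
  - rewrite SH_0, CH_0. ring.
  - intros t. assert (E1 := CH_derive z t). assert (E2 := SH_derive z t).
    assert (E3 := H1 t). assert (E4 := H2 t).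
    auto_derive.
    + repeat split; eexists; eassumption.
    + use_der E1; use_der E2; use_der E3; use_der E4.
      unfold w, dw. ring. }
assert (W : forall s, w s = dw 0 * SH z s).
{ intros s. rewrite <- (Rmult_1_r (w s)), <- (CH_SH z s), <- (B s).
  transitivity ((w s * CH z s - dw s * SH z s) * CH z s + (dw s * CH z s - z * w s * SH z s) * SH z s); [ring|].
  rewrite (A s). ring. }
assert (D : forall s, dw s = dw 0 * CH z s).
{ intros s. rewrite <- (Rmult_1_r (dw s)), <- (CH_SH z s), <- (B s).
  transitivity ((w s * CH z s - dw s * SH z s) * (z * SH z s) + (dw s * CH z s - z * w s * SH z s) * CH z s); [ring|].
  rewrite (A s). ring. }
assert (Z : dw 0 = 0).
{ assert (K := den_ge1 z Hz). change (w SS + bc_coef * w (1 / 2) = 0) in H4. rewrite !W in H4.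
  assert (E : dw 0 * den z = 0) by (unfold den; lra).
  apply Rmult_integral in E. lra. }
intros s. specialize (W s); specialize (D s). rewrite Z in W, D. unfold w, dw in W, D. lra.
Qed.

(* A supersolution of the linear problem at high frequency that is submultiplicative under convolution. *)
Definition Yw (k s : R) : R := exp (- (Rabs k * s)) + exp (- (Rabs k * (SS - s))).

Lemma Yw_gt0 k s : 0 < Yw k s.
Proof. unfold Yw. generalize (exp_pos (- (Rabs k * s))) (exp_pos (- (Rabs k * (SS - s)))); lra. Qed.

Lemma Yw_le2 k s : 0 <= s <= SS -> Yw k s <= 2.
Proof.
intros Hs. unfold Yw. assert (Hk := Rabs_pos k).
assert (exp (- (Rabs k * s)) <= exp 0) by (apply exp_le_mono; nra).
assert (exp (- (Rabs k * (SS - s))) <= exp 0) by (apply exp_le_mono; nra).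
rewrite exp_0 in *. lra.
Qed.

Lemma Yw_ge k s : 0 <= s <= SS -> exp (- (Rabs k * SS)) <= Yw k s.
Proof.
intros Hs. unfold Yw. assert (Hk := Rabs_pos k).
assert (exp (- (Rabs k * SS)) <= exp (- (Rabs k * s))) by (apply exp_le_mono; nra).
generalize (exp_pos (- (Rabs k * (SS - s)))); lra.
Qed.

Lemma Yw_shift k s s' : Yw k s' <= exp (Rabs k * Rabs (s - s')) * Yw k s.
Proof.
unfold Yw. rewrite Rmult_plus_distr_l, <- !exp_plus. assert (Hk := Rabs_pos k).
assert (s - s' <= Rabs (s - s')) by apply Rle_abs.
assert (s' - s <= Rabs (s - s')) by (rewrite Rabs_minus_sym; apply Rle_abs).
apply Rplus_le_compat; apply exp_le_mono; nra.
Qed.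

(** With [m] the smaller of [s] and [SS - s], the triangle inequality bounds each of the four
    products by [exp (- |k| m)], which is one of the two terms of [Yw k s]. *)
Lemma Yw_mult k l s : 0 <= s <= SS -> Yw l s * Yw (k - l) s <= 4 * Yw k s.
Proof.
intros Hs. unfold Yw.
assert (T : Rabs k <= Rabs l + Rabs (k - l)).
{ replace k with (l + (k - l)) at 1 by ring. apply Rabs_triang. }
assert (H1 := Rabs_pos l). assert (H2 := Rabs_pos (k - l)).
rewrite Rmult_plus_distr_r, !Rmult_plus_distr_l, <- !exp_plus.
assert (P1 := exp_pos (- (Rabs k * s))). assert (P2 := exp_pos (- (Rabs k * (SS - s)))).
set (m := Rmin s (SS - s)).
assert (Hm : 0 <= m /\ m <= s /\ m <= SS - s).
{ unfold m. split; [apply Rmin_glb; lra|split; [apply Rmin_l|apply Rmin_r]]. }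
assert (E : exp (- (Rabs k * m)) <= exp (- (Rabs k * s)) + exp (- (Rabs k * (SS - s)))).
{ unfold m, Rmin. destruct (Rle_dec s (SS - s)); lra. }
assert (L : forall a b, m <= a -> m <= b -> exp (- (Rabs l * a) + - (Rabs (k - l) * b)) <= exp (- (Rabs k * m))).
{ intros a b Ha Hb. apply exp_le_mono.
  assert (Rabs k * m <= (Rabs l + Rabs (k - l)) * m) by (apply Rmult_le_compat_r; lra).
  assert (Rabs l * m <= Rabs l * a) by (apply Rmult_le_compat_l; lra).
  assert (Rabs (k - l) * m <= Rabs (k - l) * b) by (apply Rmult_le_compat_l; lra). lra. }
assert (L1 := L s s (proj1 (proj2 Hm)) (proj1 (proj2 Hm))). assert (L2 := L s (SS - s) (proj1 (proj2 Hm)) (proj2 (proj2 Hm))).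
assert (L3 := L (SS - s) s (proj2 (proj2 Hm)) (proj1 (proj2 Hm))). assert (L4 := L (SS - s) (SS - s) (proj2 (proj2 Hm)) (proj2 (proj2 Hm))). lra.
Qed.

Definition dYw (k s : R) : R := - Rabs k * exp (- (Rabs k * s)) + Rabs k * exp (- (Rabs k * (SS - s))).

Lemma Yw_derive k s : is_derive (Yw k) s (dYw k s).
Proof. unfold Yw, dYw. auto_derive; [easy|unfold Rminus; ring]. Qed.

Lemma dYw_derive k s : is_derive (dYw k) s (k ^ 2 * Yw k s).
Proof. unfold Yw, dYw. auto_derive; [easy|]. rewrite <- (pow2_abs k). unfold Rminus; ring. Qed.

(* v/CH is unimodal because its derivative has the sign of the Wronskian v' CH - z v SH, which is nonincreasing. *)
Lemma max_principle z (v dv d2v : R -> R) : 0 < z ->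
  (forall s, is_derive v s (dv s)) -> (forall s, is_derive dv s (d2v s)) ->
  (forall s, 0 <= s <= SS -> d2v s <= z * v s) -> 0 <= v 0 -> 0 <= v SS ->
  forall s, 0 <= s <= SS -> 0 <= v s.
Proof.
intros Hz H1 H2 H3 H0 HS s Hs.
assert (CP : forall t, 0 < CH z t).
{ intros t. unfold CH. destruct (Rlt_dec 0 z); [|lra]. unfold cosh.
  generalize (exp_pos (sqrt z * t)) (exp_pos (- (sqrt z * t))); lra. }
set (W := fun t => dv t * CH z t - z * v t * SH z t).
assert (DW : forall t, is_derive W t ((d2v t - z * v t) * CH z t)).
{ intros t. assert (E1 := CH_derive z t). assert (E2 := SH_derive z t).
  assert (E3 := H1 t). assert (E4 := H2 t). unfold W. auto_derive.
  - repeat split; eexists; eassumption.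
  - use_der E1; use_der E2; use_der E3; use_der E4.
    ring. }
assert (Wmono : forall a b, 0 <= a -> a <= b -> b <= SS -> W b <= W a).
{ intros a b Ha Hab Hb.
  enough (- W a <= - W b) by lra.
  apply (nondecr_of_derive (fun t => - W t) (fun t => - ((d2v t - z * v t) * CH z t)) a b Hab).
  - intros t _. apply (is_derive_opp W), DW.
  - intros t Ht. specialize (CP t). specialize (H3 t ltac:(lra)). nra. }
assert (DQ : forall t, is_derive (fun t => v t / CH z t) t (W t / (CH z t * CH z t))).
{ intros t. assert (E1 := CH_derive z t). assert (E3 := H1 t). assert (C := CP t). auto_derive.
  - repeat split; try (eexists; eassumption); lra.
  - use_der E1; use_der E3. unfold W. field. lra. }
assert (I : forall t, 0 < / (CH z t * CH z t)) by (intros t; apply Rinv_0_lt_compat, Rmult_lt_0_compat; apply CP).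
assert (Q : 0 <= v s / CH z s).
{ destruct (Rle_lt_dec 0 (W s)) as [Hw|Hw].
  - apply Rle_trans with (v 0 / CH z 0); [rewrite CH_0; lra|].
    apply (nondecr_of_derive (fun t => v t / CH z t) (fun t => W t / (CH z t * CH z t))); [lra|intros; apply DQ|].
    intros t Ht. assert (M := Wmono t s ltac:(lra) ltac:(lra) ltac:(lra)). specialize (I t). unfold Rdiv. nra.
  - apply Rle_trans with (v SS / CH z SS).
    + apply Rmult_le_pos; [easy|left; apply Rinv_0_lt_compat, CP].
    + enough (- (v s / CH z s) <= - (v SS / CH z SS)) by lra.
      apply (nondecr_of_derive (fun t => - (v t / CH z t)) (fun t => - (W t / (CH z t * CH z t)))); [lra| |].
      * intros t _. apply (is_derive_opp (fun t => v t / CH z t)), DQ.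
      * intros t Ht. assert (M := Wmono s t ltac:(lra) ltac:(lra) ltac:(lra)). specialize (I t). unfold Rdiv. nra. }
specialize (CP s). apply (Rmult_le_compat_r (CH z s)) in Q; [|lra].
unfold Rdiv in Q. rewrite Rmult_assoc, Rinv_l in Q; lra.
Qed.

End BVP.

(** * Bounds for the boundary value problem, uniform in the frequency *)

Section Bounds.
Context {P : params}.

Definition zz (k : R) : R := k ^ 4 - k ^ 2.

Lemma zz_ge k : - (1/4) <= zz k.
Proof. unfold zz. assert (0 <= (k ^ 2 - 1/2) ^ 2) by apply pow2_ge_0. nra. Qed.

Lemma sqr_of_abs k a : 0 <= a -> a <= Rabs k -> a ^ 2 <= k ^ 2.
Proof. intros Ha H. rewrite <- (pow2_abs k). apply pow_incr; lra. Qed.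

Lemma zz_high k : 2 <= Rabs k -> 3 * k ^ 2 <= zz k /\ (1 + k ^ 4) / 2 <= zz k /\ 12 <= zz k.
Proof.
intros H. assert (H1 := sqr_of_abs k 2 ltac:(lra) H). unfold zz.
replace (k ^ 4) with (k ^ 2 * k ^ 2) by ring. set (m := k ^ 2) in *. repeat split; nra.
Qed.

Lemma zz_abs k : Rabs (zz k) <= 1 + k ^ 4.
Proof.
unfold zz. replace (k ^ 4) with (k ^ 2 * k ^ 2) by ring. assert (0 <= k ^ 2) by apply pow2_ge_0.
set (m := k ^ 2) in *. apply Rabs_le_between. nra.
Qed.

Lemma sqrt_zz k : 2 <= Rabs k -> Rabs k <= sqrt (zz k).
Proof.
intros H. destruct (zz_high k H) as [H1 _]. rewrite <- (sqrt_Rsqr (Rabs k)) by apply Rabs_pos.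
rewrite <- Rsqr_abs. apply sqrt_le_1_alt. unfold Rsqr. assert (0 <= k ^ 2) by apply pow2_ge_0. nra.
Qed.

Lemma SH_pos z s : 0 < z -> 0 <= s -> 0 <= SH z s.
Proof.
intros Hz Hs. unfold SH. destruct (Rlt_dec 0 z); [|lra]. assert (H0 := sqrt_lt_R0 z Hz).
apply Rmult_le_pos; [|left; now apply Rinv_0_lt_compat].
unfold sinh. assert (exp (- (sqrt z * s)) <= exp (sqrt z * s)) by (apply exp_le_mono; nra). lra.
Qed.

Lemma SH_lt0 z s : 0 < z -> 0 < s -> 0 < SH z s.
Proof.
intros Hz Hs. unfold SH. destruct (Rlt_dec 0 z); [|lra]. assert (H0 := sqrt_lt_R0 z Hz).
apply Rmult_lt_0_compat; [|now apply Rinv_0_lt_compat].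
unfold sinh. assert (exp (- (sqrt z * s)) < exp (sqrt z * s)) by (apply exp_increasing; nra). lra.
Qed.

Lemma SH_ratio_exp z s : 0 < z -> 0 <= s <= SS -> SH z s <= SH z SS * exp (- (sqrt z * (SS - s))).
Proof.
intros Hz Hs. unfold SH. destruct (Rlt_dec 0 z); [|lra]. assert (H0 := sqrt_lt_R0 z Hz).
set (mu := sqrt z) in *. unfold sinh, Rdiv.
apply Rle_trans with ((exp (mu * SS) - exp (- (mu * SS))) * exp (- (mu * (SS - s))) * (/ 2 * / mu)); [|right; ring].
apply Rle_trans with ((exp (mu * s) - exp (- (mu * s))) * (/ 2 * / mu)); [right; ring|].
apply Rmult_le_compat_r.
{ apply Rmult_le_pos; [lra|left; now apply Rinv_0_lt_compat]. }
rewrite Rmult_minus_distr_r, <- !exp_plus.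
replace (mu * SS + - (mu * (SS - s))) with (mu * s) by ring.
assert (exp (- (mu * SS) + - (mu * (SS - s))) <= exp (- (mu * s))) by (apply exp_le_mono; nra). lra.
Qed.

Lemma exp_Yw k s : 2 <= Rabs k -> 0 <= s <= SS -> exp (- (sqrt (zz k) * (SS - s))) <= Yw k s.
Proof.
intros Hk Hs. assert (H := sqrt_zz k Hk). unfold Yw.
assert (exp (- (sqrt (zz k) * (SS - s))) <= exp (- (Rabs k * (SS - s)))).
{ apply exp_le_mono. assert (Rabs k * (SS - s) <= sqrt (zz k) * (SS - s)) by (apply Rmult_le_compat_r; lra). lra. }
generalize (exp_pos (- (Rabs k * s))); lra.
Qed.

(** Subtracting a multiple of [SH z] gives [yD] with zero value at [SS]. Since the second derivative
    of [Yw] is [k^2 Yw], at most half of [z Yw], the other half absorbs the source, and the maximum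
    principle yields [|yD| <= a Yw]. The mixed condition then bounds [y SS] through [yD (1/2)]: the
    ratio of the two values of [SH] is nonnegative and so only helps. The multiple of [SH z] decays
    away from [SS] at rate [sqrt z >= |k|]. *)
Lemma sol_bound_high k phi h H : 2 <= Rabs k -> (forall t, continuous h t) -> 0 <= H ->
  (forall s, 0 <= s <= SS -> Rabs (h s) <= H * Yw k s) ->
  forall s, 0 <= s <= SS ->
  Rabs (sol (zz k) phi h s) <= 4 * (1 + 2 * bc_coef) * (Rabs phi + H / (1 + k ^ 4)) * Yw k s.
Proof.
intros Hk Hc HH Hh s Hs. assert (HS := SS_ge1).
destruct (zz_high k Hk) as [Z1 [Z2 Z3]]. set (z := zz k) in *.
assert (Hz : - (1/4) <= z) by lra.
destruct (sol_is_sol z phi h Hz Hc) as [D1 [D2 [B0 BS]]].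
set (y := sol z phi h) in *. set (dy := dsol z phi h) in *.
set (b := y SS / SH z SS).
assert (SP : 0 < SH z SS) by (apply SH_lt0; lra).
set (yD := fun s => y s - b * SH z s).
set (a := Rabs phi + 2 * H / z).
assert (Ha : 0 <= 2 * H / z) by (apply Rmult_le_pos; [lra|left; apply Rinv_0_lt_compat; lra]).
assert (Ha2 : 2 * H / z * z = 2 * H) by (field; lra).
assert (Hphi := Rabs_pos phi).
assert (HaP : 0 <= a) by (unfold a; lra).
assert (Hq : k ^ 2 <= z / 2) by (assert (0 <= k ^ 2) by apply pow2_ge_0; lra).
assert (yD0 : yD 0 = phi) by (unfold yD; rewrite SH_0, B0; ring).
assert (yDS : yD SS = 0) by (unfold yD, b; field; lra).
assert (Y0 : 1 <= Yw k 0).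
{ unfold Yw. rewrite Rmult_0_r, Ropp_0, exp_0. generalize (exp_pos (- (Rabs k * (SS - 0)))); lra. }
assert (YP : forall s, 0 < Yw k s) by (intros; apply Yw_gt0).
assert (KK : forall e, Rabs e = 1 -> forall s, 0 <= s <= SS -> 0 <= a * Yw k s + e * yD s).
{ intros e He. assert (He' : e = 1 \/ e = -1) by (unfold Rabs in He; destruct (Rcase_abs e); lra).
  apply (max_principle z (fun s => a * Yw k s + e * yD s)
    (fun s => a * dYw k s + e * (dy s - b * CH z s))
    (fun s => a * (k ^ 2 * Yw k s) + e * ((z * y s + h s) - b * (z * SH z s)))); [lra| | | | |].
  - intros t. apply (is_derive_plus (fun s => a * Yw k s) (fun s => e * yD s)); apply is_derive_scal; [apply Yw_derive|].
    apply (is_derive_minus y (fun s => b * SH z s)); [apply D1|apply is_derive_scal, SH_derive].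
  - intros t. apply (is_derive_plus (fun s => a * dYw k s) (fun s => e * (dy s - b * CH z s))); apply is_derive_scal; [apply dYw_derive|].
    apply (is_derive_minus dy (fun s => b * CH z s)); [apply D2|apply is_derive_scal, CH_derive].
  - intros t Ht. specialize (Hh t Ht). specialize (YP t).
    assert (E : e * h t <= H * Yw k t).
    { apply Rle_trans with (2 := Hh). apply Rle_trans with (1 := Rle_abs _). rewrite Rabs_mult, He; lra. }
    assert (F : H * Yw k t <= a * (z / 2) * Yw k t).
    { apply Rmult_le_compat_r; [lra|]. unfold a. nra. }
    assert (G : a * Yw k t * k ^ 2 <= a * Yw k t * (z / 2)).
    { apply Rmult_le_compat_l; [apply Rmult_le_pos; lra|easy]. }
    unfold yD. lra.
  - cbv beta. rewrite yD0. assert (Rabs phi <= a * Yw k 0).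
    { apply Rle_trans with a; [unfold a; lra|]. nra. }
    assert (- Rabs phi <= phi <= Rabs phi) by (apply Rabs_le_between; lra).
    destruct He' as [-> | ->]; lra.
  - cbv beta. rewrite yDS. specialize (YP SS). assert (0 <= a * Yw k SS) by (apply Rmult_le_pos; lra). lra. }
assert (BD : forall s, 0 <= s <= SS -> Rabs (yD s) <= a * Yw k s).
{ intros t Ht. apply Rabs_le_between.
  assert (A1 := KK 1 ltac:(apply Rabs_R1) t Ht). assert (A2 := KK (-1) ltac:(rewrite Rabs_left; lra) t Ht). lra. }
assert (M0 : 0 < bc_coef) by (unfold bc_coef; lra).
assert (SHh : 0 <= SH z (1 / 2)) by (apply SH_pos; lra).
assert (ES : y SS * (1 + bc_coef * (SH z (1 / 2) / SH z SS)) = - (bc_coef * yD (1 / 2))).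
{ unfold yD, b. replace (y SS * _) with (y SS + bc_coef * (y SS / SH z SS * SH z (1/2))) by (field; lra). lra. }
assert (R1 : 0 <= bc_coef * (SH z (1 / 2) / SH z SS)).
{ apply Rmult_le_pos; [lra|]. apply Rmult_le_pos; [easy|left; now apply Rinv_0_lt_compat]. }
assert (YS : Rabs (y SS) <= bc_coef * (2 * a)).
{ assert (A1 := BD (1/2) ltac:(lra)). assert (A2 : Yw k (1/2) <= 2) by (apply Yw_le2; lra).
  assert (A3 : Rabs (y SS) * (1 + bc_coef * (SH z (1 / 2) / SH z SS)) = bc_coef * Rabs (yD (1 / 2))).
  { rewrite <- (Rabs_right (1 + bc_coef * (SH z (1 / 2) / SH z SS))) by lra. rewrite <- Rabs_mult, ES, Rabs_Ropp, Rabs_mult, (Rabs_right bc_coef) by lra. easy. }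
  apply Rle_trans with (bc_coef * Rabs (yD (1 / 2))).
  - rewrite <- A3. rewrite <- (Rmult_1_r (Rabs (y SS))) at 1. apply Rmult_le_compat_l; [apply Rabs_pos|lra].
  - apply Rmult_le_compat_l; [lra|]. nra. }
assert (Yb : Rabs (b * SH z s) <= bc_coef * (2 * a) * Yw k s).
{ unfold b. replace (y SS / SH z SS * SH z s) with (y SS * (SH z s / SH z SS)) by (field; lra).
  rewrite Rabs_mult. apply Rmult_le_compat; try apply Rabs_pos; [easy|].
  assert (0 <= SH z s) by (apply SH_pos; lra).
  rewrite Rabs_right by (apply Rle_ge, Rmult_le_pos; [easy|left; now apply Rinv_0_lt_compat]).
  apply Rmult_le_reg_r with (SH z SS); [easy|]. unfold Rdiv. rewrite Rmult_assoc, Rinv_l, Rmult_1_r by lra.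
  assert (z0 : 0 < z) by lra. apply Rle_trans with (1 := SH_ratio_exp z s z0 Hs).
  rewrite Rmult_comm. apply Rmult_le_compat_r; [lra|]. now apply exp_Yw. }
assert (Ea : a <= 4 * (Rabs phi + H / (1 + k ^ 4))).
{ unfold a. assert (K4 : 0 <= k ^ 4) by (replace (k ^ 4) with ((k ^ 2) ^ 2) by ring; apply pow2_ge_0).
  assert (2 * H / z <= 4 * (H / (1 + k ^ 4))).
  { replace (4 * (H / (1 + k ^ 4))) with (2 * H * / ((1 + k ^ 4) / 2)) by (field; lra).
    apply Rmult_le_compat_l; [lra|]. apply Rinv_le_contravar; lra. }
  lra. }
replace (y s) with (yD s + b * SH z s) by (unfold yD; ring).
apply Rle_trans with (1 := Rabs_triang _ _). specialize (BD s Hs).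
apply Rle_trans with ((1 + 2 * bc_coef) * a * Yw k s); [lra|].
apply Rmult_le_compat_r; [left; apply YP|].
replace (4 * (1 + 2 * bc_coef) * (Rabs phi + H / (1 + k ^ 4))) with ((1 + 2 * bc_coef) * (4 * (Rabs phi + H / (1 + k ^ 4)))) by ring.
apply Rmult_le_compat_l; lra.
Qed.

Lemma pow4_ge0 k : 0 <= k ^ 4.
Proof. replace (k ^ 4) with ((k ^ 2) ^ 2) by ring; apply pow2_ge_0. Qed.

(** For [|k| <= 2] the explicit formula is bounded crudely. The weight [Yw] is then at least
    [exp (- 2 SS)], and the factor 17 bounds [1 + k^4], so the required form costs only
    constants. *)
Lemma sol_bound_low : exists C, 0 <= C /\ forall k phi h H, Rabs k <= 2 -> (forall t, continuous h t) -> 0 <= H ->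
  (forall s, 0 <= s <= SS -> Rabs (h s) <= H * Yw k s) ->
  forall s, 0 <= s <= SS ->
  Rabs (sol (zz k) phi h s) <= C * (Rabs phi + H / (1 + k ^ 4)) * Yw k s.
Proof.
assert (HS := SS_ge1).
set (K := exp (4 * SS)). set (p := 4 * (SS * K) * (SS * K)).
assert (KP : 0 < K) by apply exp_pos.
assert (SK : 0 < SS * K) by (apply Rmult_lt_0_compat; lra).
assert (pP : 0 <= p) by (unfold p; apply Rmult_le_pos; lra).
assert (M0 : 0 < bc_coef) by (unfold bc_coef; lra).
set (Q := (K + p) * (1 + (1 + bc_coef) * (SS * K))).
assert (X0 : 0 <= (1 + bc_coef) * (SS * K)) by (apply Rmult_le_pos; lra).
assert (Q0 : 0 <= Q) by (unfold Q; apply Rmult_le_pos; lra).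
assert (E2 := exp_pos (2 * SS)).
exists (17 * Q * exp (2 * SS)). split; [apply Rmult_le_pos; lra|].
intros k phi h H Hk Hc HH Hh.
assert (k4 : k ^ 4 <= 16).
{ replace (k ^ 4) with ((k ^ 2) ^ 2) by ring. replace 16 with (4 ^ 2) by ring. apply pow_incr. split; [apply pow2_ge_0|].
  rewrite <- (pow2_abs k). replace 4 with (2 ^ 2) by ring. apply pow_incr. split; [apply Rabs_pos|easy]. }
assert (k40 := pow4_ge0 k).
assert (Hz : zz k <= 16) by (unfold zz; assert (0 <= k ^ 2) by apply pow2_ge_0; lra).
assert (Hz' := zz_ge k). set (z := zz k) in *.
assert (BC : forall s, 0 <= s <= SS -> Rabs (CH z s) <= K) by (intros; now apply CH_low).
assert (BSH : forall s, 0 <= s <= SS -> Rabs (SH z s) <= SS * K) by (intros; now apply SH_low).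
assert (Hh2 : forall s, 0 <= s <= SS -> Rabs (h s) <= 2 * H).
{ intros t Ht. apply Rle_trans with (1 := Hh t Ht). assert (A := Yw_le2 k t Ht). nra. }
assert (GI : forall (g : R -> R) B s, (forall t, continuous g t) -> 0 <= B -> (forall t, 0 <= t <= SS -> Rabs (g t) <= B) ->
   0 <= s <= SS -> Rabs (RInt (fun t => g t * h t) 0 s) <= SS * (B * (2 * H))).
{ intros g B t Hg HB0 HB Ht.
  apply Rle_trans with ((t - 0) * (B * (2 * H))).
  - apply abs_RInt_le_const; [lra| |].
    + apply ex_RInt_cont; intros; apply (continuous_mult g h); [apply Hg|apply Hc].
    + intros x Hx. rewrite Rabs_mult. apply Rmult_le_compat; try apply Rabs_pos; [apply HB; lra|apply Hh2; lra].
  - apply Rmult_le_compat_r; [|lra]. apply Rmult_le_pos; lra. }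
assert (BP : forall s, 0 <= s <= SS -> Rabs (duhamel z h s) <= p * H).
{ intros t Ht. unfold duhamel.
  assert (A1 := GI (CH z) K t (CH_cont z) ltac:(lra) BC Ht).
  assert (SK0 : 0 <= SS * K) by lra. assert (A2 := GI (SH z) (SS * K) t (SH_cont z) SK0 BSH Ht).
  unfold Rminus. apply Rle_trans with (1 := Rabs_triang _ _). rewrite Rabs_Ropp, !Rabs_mult.
  apply Rle_trans with (SS * K * (SS * (K * (2 * H))) + K * (SS * (SS * K * (2 * H)))); [|unfold p; right; ring].
  apply Rplus_le_compat; apply Rmult_le_compat; try apply Rabs_pos; auto. }
intros s Hs.
assert (IS : 0 <= SS <= SS) by lra. assert (Ih : 0 <= 1 / 2 <= SS) by lra.
assert (BA : Rabs (shoot z phi h) <= (1 + bc_coef) * (K * Rabs phi + p * H)).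
{ unfold shoot, Rdiv. rewrite Rabs_mult, Rabs_Ropp. assert (D := den_ge1 z Hz').
  rewrite Rabs_inv, (Rabs_right (den z)) by lra.
  apply Rle_trans with (Rabs (phi * (CH z SS + bc_coef * CH z (1 / 2)) + duhamel z h SS + bc_coef * duhamel z h (1 / 2)) * 1).
  - apply Rmult_le_compat_l; [apply Rabs_pos|]. apply Rle_trans with (/ 1); [apply Rinv_le_contravar; lra|lra].
  - rewrite Rmult_1_r.
    apply Rle_trans with (1 := Rabs_triang _ _).
    apply Rle_trans with ((Rabs (phi * (CH z SS + bc_coef * CH z (1 / 2))) + Rabs (duhamel z h SS)) + Rabs (bc_coef * duhamel z h (1 / 2))).
    { apply Rplus_le_compat_r, Rabs_triang. }
    rewrite !Rabs_mult, (Rabs_right bc_coef) by lra.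
    assert (A1 := BP SS IS). assert (A2 := BP (1/2) Ih).
    assert (A3 : Rabs (CH z SS + bc_coef * CH z (1 / 2)) <= (1 + bc_coef) * K).
    { apply Rle_trans with (1 := Rabs_triang _ _). rewrite Rabs_mult, (Rabs_right bc_coef) by lra.
      assert (A4 := BC SS IS). assert (A5 := BC (1/2) Ih). nra. }
    assert (A4 : Rabs phi * Rabs (CH z SS + bc_coef * CH z (1 / 2)) <= Rabs phi * ((1 + bc_coef) * K)).
    { apply Rmult_le_compat_l; [apply Rabs_pos|easy]. }
    assert (A5 : bc_coef * Rabs (duhamel z h (1 / 2)) <= bc_coef * (p * H)) by (apply Rmult_le_compat_l; lra).
    lra. }
assert (T : Rabs (sol z phi h s) <= Q * (Rabs phi + H)).
{ unfold sol. apply Rle_trans with (1 := Rabs_triang _ _).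
  apply Rle_trans with ((Rabs (phi * CH z s) + Rabs (shoot z phi h * SH z s)) + Rabs (duhamel z h s)).
  { apply Rplus_le_compat_r, Rabs_triang. }
  rewrite !Rabs_mult.
  assert (A1 : Rabs phi * Rabs (CH z s) <= Rabs phi * K) by (apply Rmult_le_compat_l; [apply Rabs_pos|auto]).
  assert (A2 : Rabs (shoot z phi h) * Rabs (SH z s) <= (1 + bc_coef) * (K * Rabs phi + p * H) * (SS * K)).
  { apply Rmult_le_compat; try apply Rabs_pos; auto. }
  assert (A3 := BP s Hs).
  assert (Hp := Rabs_pos phi).
  apply Rle_trans with (Rabs phi * K + (1 + bc_coef) * (K * Rabs phi + p * H) * (SS * K) + p * H); [lra|].
  unfold Q.
  assert (0 <= (p * Rabs phi + K * H) * (1 + (1 + bc_coef) * (SS * K))).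
  { apply Rmult_le_pos; [|lra]. assert (0 <= p * Rabs phi) by now apply Rmult_le_pos.
    assert (0 <= K * H) by (apply Rmult_le_pos; lra). lra. }
  lra. }
apply Rle_trans with (1 := T).
assert (Y1 : 1 <= exp (2 * SS) * Yw k s).
{ assert (A := Yw_ge k s Hs). assert (A2 : exp (- (2 * SS)) <= exp (- (Rabs k * SS))) by (apply exp_le_mono; nra).
  replace 1 with (exp (2 * SS) * exp (- (2 * SS))).
  - apply Rmult_le_compat_l; lra.
  - rewrite <- exp_plus. replace (2 * SS + - (2 * SS)) with 0 by ring. apply exp_0. }
assert (E1 : Rabs phi + H <= 17 * (Rabs phi + H / (1 + k ^ 4))).
{ assert (H / 17 <= H / (1 + k ^ 4)) by (apply Rmult_le_compat_l; [lra|apply Rinv_le_contravar; lra]).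
  generalize (Rabs_pos phi); lra. }
assert (E0 : 0 <= Rabs phi + H / (1 + k ^ 4)).
{ assert (0 <= H / (1 + k ^ 4)) by (apply Rmult_le_pos; [lra|left; apply Rinv_0_lt_compat; lra]). generalize (Rabs_pos phi); lra. }
replace (17 * Q * exp (2 * SS) * (Rabs phi + H / (1 + k ^ 4)) * Yw k s) with
  (Q * (17 * (Rabs phi + H / (1 + k ^ 4)) * (exp (2 * SS) * Yw k s))) by ring.
apply Rmult_le_compat_l; [easy|].
apply Rle_trans with (1 := E1). rewrite <- (Rmult_1_r (17 * _)) at 1. apply Rmult_le_compat_l; lra.
Qed.

Lemma sol_bound : exists C, 0 < C /\ forall k phi h H, (forall t, continuous h t) -> 0 <= H ->
  (forall s, 0 <= s <= SS -> Rabs (h s) <= H * Yw k s) ->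
  forall s, 0 <= s <= SS ->
  Rabs (sol (zz k) phi h s) <= C * (Rabs phi + H / (1 + k ^ 4)) * Yw k s.
Proof.
destruct sol_bound_low as [C [HC Hl]]. assert (HS := SS_ge1).
assert (M0 : 0 < bc_coef) by (unfold bc_coef; lra).
exists (C + 4 * (1 + 2 * bc_coef)). split; [lra|]. intros k phi h H Hc HH Hh s Hs.
assert (0 <= (Rabs phi + H / (1 + k ^ 4)) * Yw k s).
{ apply Rmult_le_pos; [|left; apply Yw_gt0]. assert (k4 := pow4_ge0 k).
  assert (0 <= H / (1 + k ^ 4)) by (apply Rmult_le_pos; [lra|left; apply Rinv_0_lt_compat; lra]). generalize (Rabs_pos phi); lra. }
destruct (Rle_lt_dec (Rabs k) 2) as [Hk|Hk].
- apply Rle_trans with (1 := Hl k phi h H Hk Hc HH Hh s Hs). rewrite !(Rmult_assoc _ (Rabs phi + _)).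
  apply Rmult_le_compat_r; lra.
- apply Rle_trans with (1 := sol_bound_high k phi h H ltac:(lra) Hc HH Hh s Hs). rewrite !(Rmult_assoc _ (Rabs phi + _)).
  apply Rmult_le_compat_r; lra.
Qed.

(** Interpolation: the slope is controlled by the values of [y] at two points at distance [d] and by
    the second derivative between them. With [d] of order [/ (1 + k^2)] both contributions are of
    order [1 + k^2], and since [|k| d <= SS] the weight [Yw] varies by a bounded factor over that
    distance. *)
Lemma dsol_bound : exists C, 0 < C /\ forall k phi h H, (forall t, continuous h t) -> 0 <= H ->
  (forall s, 0 <= s <= SS -> Rabs (h s) <= H * Yw k s) ->
  forall s, 0 <= s <= SS ->
  Rabs (dsol (zz k) phi h s) <= C * (1 + k ^ 2) * (Rabs phi + H / (1 + k ^ 4)) * Yw k s.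
Proof.
destruct sol_bound as [C [HC Hb]]. assert (HS := SS_ge1). assert (EP := exp_pos SS).
exists (exp SS * (4 * C + SS * (C + 1))). split.
{ apply Rmult_lt_0_compat; [easy|]. assert (0 < SS * (C + 1)) by (apply Rmult_lt_0_compat; lra). lra. }
intros k phi h H Hc HH Hh s Hs.
specialize (Hb k phi h H Hc HH Hh).
assert (k2 : 0 <= k ^ 2) by apply pow2_ge_0. assert (k4 := pow4_ge0 k).
set (a := Rabs phi + H / (1 + k ^ 4)) in *.
assert (Hd : 0 <= H / (1 + k ^ 4)) by (apply Rmult_le_pos; [lra|left; apply Rinv_0_lt_compat; lra]).
assert (Ha : 0 <= a) by (unfold a; generalize (Rabs_pos phi); lra).
assert (HHa : H <= (1 + k ^ 4) * a).
{ replace H with ((1 + k ^ 4) * (H / (1 + k ^ 4))) at 1 by (field; lra). apply Rmult_le_compat_l; [lra|].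
  unfold a. generalize (Rabs_pos phi); lra. }
destruct (sol_is_sol (zz k) phi h (zz_ge k) Hc) as [D1 [D2 _]].
set (y := sol (zz k) phi h) in *. set (dy := dsol (zz k) phi h) in *.
set (d := SS / (2 * (1 + k ^ 2))).
assert (Hd0 : 0 < d) by (apply Rdiv_lt_0_compat; lra).
assert (Hd1 : d <= SS / 2).
{ unfold d, Rdiv. apply Rmult_le_compat_l; [lra|]. apply Rinv_le_contravar; lra. }
assert (Hdk : Rabs k * d <= SS).
{ unfold d. assert (Rabs k <= 1 + k ^ 2) by (rewrite <- (pow2_abs k); generalize (Rabs_pos k); intros; nra).
  apply Rmult_le_reg_r with (2 * (1 + k ^ 2)); [lra|].
  replace (Rabs k * (SS / (2 * (1 + k ^ 2))) * (2 * (1 + k ^ 2))) with (Rabs k * SS) by (field; lra).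
  assert (0 <= SS * (1 + k ^ 2 - Rabs k)) by (apply Rmult_le_pos; lra).
  assert (0 <= SS * (1 + k ^ 2)) by (apply Rmult_le_pos; lra). lra. }
assert (YY : forall t, Rabs (s - t) <= d -> Yw k t <= exp SS * Yw k s).
{ intros t Ht. apply Rle_trans with (1 := Yw_shift k s t). apply Rmult_le_compat_r; [left; apply Yw_gt0|].
  apply exp_le_mono. apply Rle_trans with (2 := Hdk). apply Rmult_le_compat_l; [apply Rabs_pos|easy]. }
assert (YP := Yw_gt0 k s).
(* The step [d <= SS / 2] is taken to the side on which it stays inside [[0, SS]]. *)
assert (exists e, Rabs e = 1 /\ 0 <= s + e * d <= SS) as [e [He Hse]].
{ destruct (Rle_lt_dec s (SS / 2)); [exists 1|exists (-1)]; split; try lra; [apply Rabs_R1|rewrite Rabs_left; lra]. }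
assert (Hed : Rabs (e * d) = d) by (rewrite Rabs_mult, He, (Rabs_right d) by lra; ring).
assert (Hin : forall t, Rabs (t - s) <= d -> (Rmin s (s + e * d) <= t <= Rmax s (s + e * d)) -> 0 <= t <= SS).
{ intros t _. unfold Rmin, Rmax. destruct (Rle_dec s (s + e * d)); lra. }
destruct (MVT_gen y s (s + e * d) dy) as [c [Hc1 E1]].
{ intros; apply D1. }
{ intros. apply derivable_continuous_pt. exists (dy x). apply is_derive_Reals, D1. }
assert (Hcd : Rabs (c - s) <= d).
{ rewrite <- Hed. revert Hc1. unfold Rmin, Rmax. destruct (Rle_dec s (s + e * d)); intros; unfold Rabs;
  destruct (Rcase_abs (c - s)); destruct (Rcase_abs (e * d)); lra. }
destruct (MVT_gen dy s c (fun t => zz k * y t + h t)) as [c2 [Hc2 E2]].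
{ intros; apply D2. }
{ intros. apply derivable_continuous_pt. exists (zz k * y x + h x). apply is_derive_Reals, D2. }
assert (Hcd2 : Rabs (c2 - s) <= d).
{ apply Rle_trans with (2 := Hcd). revert Hc2. unfold Rmin, Rmax. destruct (Rle_dec s c); intros; unfold Rabs;
  destruct (Rcase_abs (c2 - s)); destruct (Rcase_abs (c - s)); lra. }
assert (HcS : 0 <= c <= SS) by now apply Hin.
assert (Hc2S : 0 <= c2 <= SS).
{ revert Hc2. unfold Rmin, Rmax. destruct (Rle_dec s c); lra. }
assert (Cy : forall t, Rabs (t - s) <= d -> 0 <= t <= SS -> Rabs (y t) <= C * a * (exp SS * Yw k s)).
{ intros t Ht1 Ht2. apply Rle_trans with (1 := Hb t Ht2). apply Rmult_le_compat_l; [apply Rmult_le_pos; lra|].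
  apply YY. now rewrite Rabs_minus_sym. }
assert (Q1 := Cy s ltac:(rewrite Rminus_diag, Rabs_R0; lra) Hs).
assert (Q2 := Cy (s + e * d) ltac:(replace (s + e * d - s) with (e * d) by ring; lra) Hse).
assert (Q3 := Cy c2 Hcd2 Hc2S).
set (W := exp SS * Yw k s) in *.
assert (WP : 0 < W) by (now apply Rmult_lt_0_compat).
assert (Q4 : Rabs (zz k * y c2 + h c2) <= (1 + k ^ 4) * (C + 1) * a * W).
{ apply Rle_trans with (1 := Rabs_triang _ _). rewrite Rabs_mult.
  assert (A1 : Rabs (zz k) * Rabs (y c2) <= (1 + k ^ 4) * (C * a * W)).
  { apply Rmult_le_compat; try apply Rabs_pos; [apply zz_abs|easy]. }
  assert (A2 : Rabs (h c2) <= (1 + k ^ 4) * a * W).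
  { apply Rle_trans with (1 := Hh c2 Hc2S). apply Rmult_le_compat; [easy|left; apply Yw_gt0|easy|].
    apply YY. now rewrite Rabs_minus_sym. }
  lra. }
assert (E3 : dy s = (y (s + e * d) - y s) * / (e * d) - (zz k * y c2 + h c2) * (c - s)).
{ assert (e <> 0) by (intros E0; rewrite E0, Rabs_R0 in He; lra).
  assert (d <> 0) by lra. rewrite E1, <- E2. field. easy. }
rewrite E3.
assert (Q5 : Rabs ((y (s + e * d) - y s) * / (e * d)) <= 2 * (C * a * W) * / d).
{ rewrite Rabs_mult, Rabs_inv, Hed. apply Rmult_le_compat_r; [left; now apply Rinv_0_lt_compat|].
  unfold Rminus. apply Rle_trans with (1 := Rabs_triang _ _). rewrite Rabs_Ropp. lra. }
assert (Q6 : Rabs ((zz k * y c2 + h c2) * (c - s)) <= (1 + k ^ 4) * (C + 1) * a * W * d).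
{ rewrite Rabs_mult. apply Rmult_le_compat; try apply Rabs_pos; easy. }
unfold Rminus at 1. apply Rle_trans with (1 := Rabs_triang _ _). rewrite Rabs_Ropp.
assert (Q7 : / d <= 2 * (1 + k ^ 2)).
{ unfold d, Rdiv. rewrite Rinv_mult, Rinv_inv. rewrite <- (Rmult_1_l (2 * (1 + k ^ 2))) at 2. apply Rmult_le_compat_r; [lra|].
  apply Rle_trans with (/ 1); [apply Rinv_le_contravar; lra|lra]. }
assert (Q8 : (1 + k ^ 4) * d <= SS * (1 + k ^ 2)).
{ unfold d. apply Rmult_le_reg_r with (2 * (1 + k ^ 2)); [lra|].
  replace ((1 + k ^ 4) * (SS / (2 * (1 + k ^ 2))) * (2 * (1 + k ^ 2))) with ((1 + k ^ 4) * SS) by (field; lra).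
  replace (SS * (1 + k ^ 2) * (2 * (1 + k ^ 2))) with (SS * (2 * (1 + 2 * k ^ 2 + k ^ 4))) by ring.
  rewrite Rmult_comm. apply Rmult_le_compat_l; lra. }
assert (aW : 0 <= a * W) by (apply Rmult_le_pos; lra).
apply Rle_trans with (2 * (C * a * W) * (2 * (1 + k ^ 2)) + SS * (1 + k ^ 2) * ((C + 1) * (a * W))).
- apply Rplus_le_compat.
  + apply Rle_trans with (1 := Q5). apply Rmult_le_compat_l; [|exact Q7]. rewrite Rmult_assoc. assert (0 <= C * (a * W)) by (apply Rmult_le_pos; lra). lra.
  + apply Rle_trans with (1 := Q6).
    replace ((1 + k ^ 4) * (C + 1) * a * W * d) with ((1 + k ^ 4) * d * ((C + 1) * (a * W))) by ring.
    apply Rmult_le_compat_r; [apply Rmult_le_pos; lra|exact Q8].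
- unfold W. right. ring.
Qed.

End Bounds.

(** * Dependence of the solution on the frequency *)

Section Regularity.
Context {P : params}.

(** Clamping to [[0, SS]] extends functions of [s] to the whole line, so that continuity and bounds
    can be stated without a domain; the values outside carry no information. *)
Definition cl (s : R) : R := Rmax 0 (Rmin s SS).

Lemma cl_in s : 0 <= cl s <= SS.
Proof.
assert (HS := SS_ge1). unfold cl. split; [apply Rmax_l|]. apply Rmax_lub; [lra|apply Rmin_r].
Qed.

Lemma cl_id s : 0 <= s <= SS -> cl s = s.
Proof. intros H. unfold cl. rewrite Rmin_left, Rmax_right; lra. Qed.

Lemma cl_cl s : cl (cl s) = cl s.
Proof. apply cl_id, cl_in. Qed.

Lemma cl_lip s t : Rabs (cl s - cl t) <= Rabs (s - t).
Proof.
assert (HS := SS_ge1). unfold cl, Rmax, Rmin, Rabs.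
destruct (Rle_dec s SS); destruct (Rle_dec t SS);
repeat match goal with
| |- context [Rle_dec 0 ?b] => destruct (Rle_dec 0 b)
end;
repeat match goal with
| |- context [Rcase_abs ?a] => destruct (Rcase_abs a)
end; lra.
Qed.

Lemma cl_cont s : continuous cl s.
Proof.
apply filterlim_locally. intros eps. exists eps. intros t Ht.
change (Rabs (cl t - cl s) < eps). apply Rle_lt_trans with (1 := cl_lip t s). exact Ht.
Qed.

Lemma is_sol_ext z phi psi h g y dy : phi = psi -> (forall s, h s = g s) ->
  is_sol z phi h y dy -> is_sol z psi g y dy.
Proof.
intros -> E [H1 [H2 [H3 H4]]]. split; [easy|split; [|now split]]. intros s. rewrite <- E. apply H2.
Qed.

(** The change of the symbol is moved into the source, so that solutions at two frequencies become
    solutions of problems with one and the same [z0] and can be subtracted. *)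
Lemma is_sol_change z0 z phi h y dy : is_sol z phi h y dy ->
  is_sol z0 phi (fun s => h s + (z - z0) * y s) y dy.
Proof.
intros [H1 [H2 [H3 H4]]]. split; [easy|split; [|now split]]. intros s.
replace (z0 * y s + (h s + (z - z0) * y s)) with (z * y s + h s) by ring. apply H2.
Qed.

Lemma sol_eq k phi h y dy s : (forall t, continuous h t) -> is_sol (zz k) phi h y dy ->
  y s = sol (zz k) phi h s /\ dy s = dsol (zz k) phi h s.
Proof.
intros Hc H. apply (is_sol_unique (zz k) phi h); [apply zz_ge|easy|apply sol_is_sol; [apply zz_ge|easy]].
Qed.

Lemma is_sol_cont z phi h y dy t : is_sol z phi h y dy -> continuous y t.
Proof. intros [H _]. apply (ex_derive_continuous y). eexists; apply H. Qed.

(** For bounded [k] the weight [Yw] lies between positive constants, so the weighted bounds turn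
    into plain ones. *)
Lemma sol_local_bound r : exists C, 0 <= C /\ forall k phi h H y dy, Rabs k <= r -> (forall t, continuous h t) ->
  (forall s, 0 <= s <= SS -> Rabs (h s) <= H) -> is_sol (zz k) phi h y dy ->
  forall s, 0 <= s <= SS -> Rabs (y s) <= C * (Rabs phi + H) /\ Rabs (dy s) <= C * (Rabs phi + H).
Proof.
destruct sol_bound as [C1 [HC1 B1]]. destruct dsol_bound as [C2 [HC2 B2]]. assert (HS := SS_ge1).
set (E := exp (r * SS)).
assert (EP : 0 < E) by apply exp_pos.
exists (2 * (C1 + C2 * (1 + r ^ 2)) * (1 + E)).
assert (r2 : 0 <= r ^ 2) by apply pow2_ge_0.
assert (C20 : 0 <= C2 * (1 + r ^ 2)) by (apply Rmult_le_pos; lra).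
split; [apply Rmult_le_pos; lra|].
intros k phi h H y dy Hk Hc Hh Hy s Hs.
destruct (sol_eq _ _ _ _ _ s Hc Hy) as [-> ->].
assert (HH : 0 <= H) by (apply Rle_trans with (2 := Hh s Hs), Rabs_pos).
assert (HEP : 0 <= H * E) by (apply Rmult_le_pos; lra).
assert (Hh' : forall s, 0 <= s <= SS -> Rabs (h s) <= H * E * Yw k s).
{ intros t Ht. apply Rle_trans with (1 := Hh t Ht). rewrite Rmult_assoc. rewrite <- (Rmult_1_r H) at 1.
  apply Rmult_le_compat_l; [easy|]. apply Rle_trans with (E * exp (- (Rabs k * SS))).
  - unfold E. rewrite <- exp_plus, <- exp_0. apply exp_le_mono. nra.
  - apply Rmult_le_compat_l; [lra|now apply Yw_ge]. }
specialize (B1 k phi h (H * E) Hc HEP Hh' s Hs). specialize (B2 k phi h (H * E) Hc HEP Hh' s Hs).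
assert (k4 := pow4_ge0 k). assert (k2 : 0 <= k ^ 2) by apply pow2_ge_0.
assert (k2r : k ^ 2 <= r ^ 2) by (rewrite <- (pow2_abs k); apply pow_incr; split; [apply Rabs_pos|easy]).
assert (Y2 : Yw k s <= 2) by now apply Yw_le2. assert (YP := Yw_gt0 k s).
assert (Hp := Rabs_pos phi).
assert (T : 0 <= Rabs phi + H * E / (1 + k ^ 4) <= (1 + E) * (Rabs phi + H)).
{ assert (H * E / (1 + k ^ 4) <= H * E / 1) by (apply Rmult_le_compat_l; [easy|apply Rinv_le_contravar; lra]).
  assert (0 <= H * E / (1 + k ^ 4)) by (apply Rmult_le_pos; [easy|left; apply Rinv_0_lt_compat; lra]).
  assert (0 <= E * Rabs phi) by (apply Rmult_le_pos; lra). lra. }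
assert (T2 : 0 <= (1 + E) * (Rabs phi + H)) by lra.
set (a := Rabs phi + H * E / (1 + k ^ 4)) in *.
split.
- apply Rle_trans with (1 := B1). apply Rle_trans with (C1 * ((1 + E) * (Rabs phi + H)) * 2).
  + apply Rmult_le_compat; try lra; [apply Rmult_le_pos; lra|apply Rmult_le_compat_l; lra].
  + assert (0 <= C2 * (1 + r ^ 2) * ((1 + E) * (Rabs phi + H))) by now apply Rmult_le_pos. lra.
- apply Rle_trans with (1 := B2). apply Rle_trans with (C2 * (1 + r ^ 2) * ((1 + E) * (Rabs phi + H)) * 2).
  + apply Rmult_le_compat; try lra; [repeat apply Rmult_le_pos; lra|].
    apply Rmult_le_compat; try lra; [apply Rmult_le_pos; lra|apply Rmult_le_compat_l; lra].
  + assert (0 <= C1 * ((1 + E) * (Rabs phi + H))) by (apply Rmult_le_pos; lra). lra.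
Qed.

Lemma cont_bounded (f : R -> R) : (forall t, continuous f t) ->
  exists B, 0 <= B /\ forall s, 0 <= s <= SS -> Rabs (f s) <= B.
Proof.
intros Hc. assert (HS := SS_ge1).
destruct (continuity_ab_maj (fun s => Rabs (f s)) 0 SS) as [m [Hm _]]; [lra| |].
- intros c _. apply continuity_pt_filterlim.
  apply (continuous_comp f Rabs); [apply Hc|apply continuous_Rabs].
- exists (Rabs (f m)). split; [apply Rabs_pos|exact Hm].
Qed.

Lemma zz_derive k : is_derive zz k (4 * k ^ 3 - 2 * k).
Proof. unfold zz. auto_derive; [easy|ring]. Qed.

Lemma zz_cont k : continuous zz k.
Proof. apply (ex_derive_continuous zz). eexists; apply zz_derive. Qed.

Lemma local_le (f : R -> R) k0 eps : 0 < eps -> continuous f k0 -> locally k0 (fun k => Rabs (f k - f k0) <= eps).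
Proof.
intros He H. apply filterlim_locally with (eps := mkposreal eps He) in H.
revert H. apply filter_imp. intros k Hk. left. exact Hk.
Qed.

Lemma local_abs_le k0 : locally k0 (fun k => Rabs k <= Rabs k0 + 1).
Proof.
generalize (local_le (fun k => k) k0 1 Rlt_0_1 (continuous_id k0)). apply filter_imp. intros k Hk.
replace k with (k0 + (k - k0)) by ring. apply Rle_trans with (1 := Rabs_triang _ _). lra.
Qed.

Definition solk (phi : R -> R) (h : R -> R -> R) (k s : R) : R := sol (zz k) (phi k) (h k) s.
Definition dsolk (phi : R -> R) (h : R -> R -> R) (k s : R) : R := dsol (zz k) (phi k) (h k) s.

Lemma solk_is_sol phi h k : cont2 h -> is_sol (zz k) (phi k) (h k) (solk phi h k) (dsolk phi h k).
Proof. intros Hh. apply sol_is_sol; [apply zz_ge|]. intros t. now apply (cont2_2 h). Qed.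

(** After [is_sol_change] the difference solves the problem at [k0]. Its datum is the variation of
    [phi], and its source is the variation of [h] plus [zz k - zz k0] times the solution at [k],
    which [B] bounds beforehand. *)
Lemma solk_unif phi h k0 eps : continuous phi k0 -> cont2 h -> 0 < eps ->
  locally k0 (fun k => forall s, 0 <= s <= SS ->
    Rabs (solk phi h k s - solk phi h k0 s) <= eps /\ Rabs (dsolk phi h k s - dsolk phi h k0 s) <= eps).
Proof.
intros Hphi Hh He. assert (HS := SS_ge1).
assert (Hc : forall k t, continuous (h k) t) by (intros; now apply (cont2_2 h)).
destruct (sol_local_bound (Rabs k0 + 1)) as [C [HC HB]].
destruct (cont_bounded (h k0) (Hc k0)) as [Hm [Hm0 Hmb]].
(* The two added units leave room for the variation of [phi] and of [h] near [k0]; both are at most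
   [eta <= 1]. *)
set (B := C * (Rabs (phi k0) + 1 + (Hm + 1))).
assert (B0 : 0 <= B) by (apply Rmult_le_pos; [easy|generalize (Rabs_pos (phi k0)); lra]).
assert (Cd : 0 < C * (2 + B) + 1) by (assert (0 <= C * (2 + B)) by (apply Rmult_le_pos; lra); lra).
set (eta := Rmin 1 (eps / (C * (2 + B) + 1))).
assert (He0 : 0 < eta) by (apply Rmin_glb_lt; [lra|now apply Rdiv_lt_0_compat]).
assert (He1 : eta <= 1) by apply Rmin_l.
assert (He2 : C * (eta + (eta + eta * B)) <= eps).
{ assert (K : eta <= eps / (C * (2 + B) + 1)) by apply Rmin_r.
  apply (Rmult_le_compat_r (C * (2 + B) + 1)) in K; [|lra].
  unfold Rdiv in K. rewrite Rmult_assoc, Rinv_l in K by lra. lra. }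
assert (T : forall l, 0 <= l <= SS -> continuous (fun q : R * R => h (snd q) (fst q)) (l, k0)).
{ intros l _. apply (cont2_comp h); [easy|apply continuous_snd|apply continuous_fst]. }
generalize (filter_and _ _ (local_abs_le k0) (filter_and _ _ (local_le phi k0 eta He0 Hphi)
  (filter_and _ _ (local_le zz k0 eta He0 (zz_cont k0)) (tube (fun s k => h k s) 0 SS k0 eta He0 T)))).
apply filter_imp. intros k [K1 [K2 [K3 K4]]].
assert (S1 := solk_is_sol phi h k Hh). assert (S0 := solk_is_sol phi h k0 Hh).
assert (Y1 : forall s, 0 <= s <= SS -> Rabs (solk phi h k s) <= B).
{ intros s Hs. unshelve epose proof (HB k (phi k) (h k) (Hm + 1) _ _ K1 (Hc k) _ S1 s Hs) as [A _].
  - intros t Ht. replace (h k t) with (h k0 t + (h k t - h k0 t)) by ring.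
    apply Rle_trans with (1 := Rabs_triang _ _). specialize (Hmb t Ht). specialize (K4 t Ht). lra.
  - apply Rle_trans with (1 := A). apply Rmult_le_compat_l; [easy|].
    replace (phi k) with (phi k0 + (phi k - phi k0)) by ring.
    generalize (Rabs_triang (phi k0) (phi k - phi k0)); lra. }
assert (S2 := is_sol_lin _ 1 (-1) _ _ _ _ _ _ _ _ (is_sol_change (zz k0) _ _ _ _ _ S1) S0).
intros s Hs.
replace (solk phi h k s - solk phi h k0 s) with (1 * solk phi h k s + -1 * solk phi h k0 s) by ring.
replace (dsolk phi h k s - dsolk phi h k0 s) with (1 * dsolk phi h k s + -1 * dsolk phi h k0 s) by ring.
assert (K0 : Rabs k0 <= Rabs k0 + 1) by lra.
unshelve epose proof (HB k0 _ _ (eta + eta * B) _ _ K0 _ _ S2 s Hs) as [A1 A2].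
- intros t. apply (continuous_plus (fun s => 1 * (h k s + (zz k - zz k0) * solk phi h k s)) (fun s => -1 * h k0 s)).
  + apply (continuous_mult (fun _ => 1)); [apply continuous_const|].
    apply (continuous_plus (h k)); [apply Hc|].
    apply (continuous_mult (fun _ => zz k - zz k0)); [apply continuous_const|apply (is_sol_cont _ _ _ _ _ _ S1)].
  + apply (continuous_mult (fun _ => -1)); [apply continuous_const|apply Hc].
- intros t Ht. cbv beta. replace (_ + _) with ((h k t - h k0 t) + (zz k - zz k0) * solk phi h k t) by ring.
  apply Rle_trans with (1 := Rabs_triang _ _). rewrite Rabs_mult. specialize (K4 t Ht). specialize (Y1 t Ht).
  apply Rplus_le_compat; [easy|]. apply Rmult_le_compat; try apply Rabs_pos; easy.
- assert (X : C * (Rabs (1 * phi k + -1 * phi k0) + (eta + eta * B)) <= eps).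
  { apply Rle_trans with (2 := He2). apply Rmult_le_compat_l; [easy|].
    replace (1 * phi k + -1 * phi k0) with (phi k - phi k0) by ring. lra. }
  split; lra.
Qed.

(** Continuity in [k] uniform in [s], together with continuity in [s] at fixed [k], gives joint
    continuity. *)
Lemma cont2_of_unif (f : R -> R -> R) :
  (forall k eps, 0 < eps -> locally k (fun k' => forall s, 0 <= s <= SS -> Rabs (f k' s - f k s) <= eps)) ->
  (forall k s, continuous (f k) s) -> cont2 (fun k s => f k (cl s)).
Proof.
intros H1 H2 k s. apply filterlim_locally. intros eps.
assert (He : 0 < eps / 3) by (generalize (cond_pos eps); lra).
destruct (H1 k _ He) as [d1 Hd1].
assert (Hc : continuous (fun s => f k (cl s)) s).
{ apply (continuous_comp cl (f k)); [apply cl_cont|apply H2]. }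
apply filterlim_locally with (eps := mkposreal _ He) in Hc. destruct Hc as [d2 Hd2].
exists (mkposreal _ (Rmin_stable_in_posreal d1 d2)). intros [k' s'] [Hk Hs]. simpl in *.
assert (A1 := Hd1 k' (ball_le _ _ _ (Rmin_l _ _) _ Hk) (cl s') (cl_in s')).
assert (A2 := Hd2 s' (ball_le _ _ _ (Rmin_r _ _) _ Hs)).
change (Rabs (f k (cl s') - f k (cl s)) < eps / 3) in A2.
change (Rabs (f k' (cl s') - f k (cl s)) < eps).
replace (f k' (cl s') - f k (cl s)) with ((f k' (cl s') - f k (cl s')) + (f k (cl s') - f k (cl s))) by ring.
apply Rle_lt_trans with (1 := Rabs_triang _ _). lra.
Qed.

Lemma solk_cont2 phi h : (forall k, continuous phi k) -> cont2 h -> cont2 (fun k s => solk phi h k (cl s)).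
Proof.
intros Hphi Hh. apply cont2_of_unif.
- intros k eps He. generalize (solk_unif phi h k eps (Hphi k) Hh He). apply filter_imp.
  intros k' H s Hs. now apply H.
- intros k s. apply (is_sol_cont _ _ _ _ _ _ (solk_is_sol phi h k Hh)).
Qed.

Lemma dsolk_cont2 phi h : (forall k, continuous phi k) -> cont2 h -> cont2 (fun k s => dsolk phi h k (cl s)).
Proof.
intros Hphi Hh. apply cont2_of_unif.
- intros k eps He. generalize (solk_unif phi h k eps (Hphi k) Hh He). apply filter_imp.
  intros k' H s Hs. now apply H.
- intros k s. apply (ex_derive_continuous (dsolk phi h k)).
  destruct (solk_is_sol phi h k Hh) as [_ [H _]]. eexists; apply H.
Qed.

Lemma locally_shift k0 (Q : R -> Prop) : locally k0 Q -> locally' 0 (fun e => Q (k0 + e)).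
Proof.
intros [d Hd]. exists d. intros e He _. apply Hd.
change (Rabs (k0 + e - k0) < d). change (Rabs (e - 0) < d) in He.
apply Rle_lt_trans with (2 := He). right; f_equal. unfold minus, plus, opp; simpl; ring.
Qed.

Lemma quot_le (f : R -> R) x l eps : 0 < eps -> is_derive f x l ->
  locally' 0 (fun e => Rabs ((f (x + e) - f x) / e - l) <= eps).
Proof.
intros He H. apply is_derive_quot in H. apply filterlim_locally with (eps := mkposreal eps He) in H.
revert H. apply filter_imp. intros e H1. left; exact H1.
Qed.

(** The candidate derivative solves the formally differentiated problem, whose source contains the
    derivative of the symbol times the solution. The difference quotient minus this candidate again
    solves a problem at [k0], with small datum and small source, so [sol_local_bound] finishes. *)
Lemma solk_derive phi dphi h dh k0 : (forall k, continuous phi k) -> is_derive phi k0 dphi ->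
  cont2 h -> cont2 dh -> (forall k s, is_derive (fun k => h k s) k (dh k s)) ->
  forall s, 0 <= s <= SS ->
  is_derive (fun k => solk phi h k s) k0
    (sol (zz k0) dphi (fun s => dh k0 s + (4 * k0 ^ 3 - 2 * k0) * solk phi h k0 s) s) /\
  is_derive (fun k => dsolk phi h k s) k0
    (dsol (zz k0) dphi (fun s => dh k0 s + (4 * k0 ^ 3 - 2 * k0) * solk phi h k0 s) s).
Proof.
intros Hphi Hdphi Hh Hdh Dh s Hs. assert (HS := SS_ge1).
set (dz := 4 * k0 ^ 3 - 2 * k0). set (g := fun s => dh k0 s + dz * solk phi h k0 s).
assert (Hc : forall k t, continuous (h k) t) by (intros; now apply (cont2_2 h)).
assert (S0 := solk_is_sol phi h k0 Hh).
assert (Hg : forall t, continuous g t).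
{ intros t. apply (continuous_plus (dh k0)); [now apply (cont2_2 dh)|].
  apply (continuous_mult (fun _ => dz)); [apply continuous_const|apply (is_sol_cont _ _ _ _ _ _ S0)]. }
assert (Sg := sol_is_sol (zz k0) dphi g (zz_ge k0) Hg).
destruct (sol_local_bound (Rabs k0)) as [C [HC HB]].
destruct (cont_bounded (solk phi h k0)) as [B [B0 HBy]].
{ intros t. apply (is_sol_cont _ _ _ _ _ _ S0). }
assert (K : forall eps, 0 < eps -> locally' 0 (fun e =>
  Rabs ((solk phi h (k0 + e) s - solk phi h k0 s) / e - sol (zz k0) dphi g s) <= eps /\
  Rabs ((dsolk phi h (k0 + e) s - dsolk phi h k0 s) / e - dsol (zz k0) dphi g s) <= eps)).
{ intros eps He.
  assert (Hdz := Rabs_pos dz).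
  assert (Cd : 0 < C * (4 + B + Rabs dz) + 1) by (assert (0 <= C * (4 + B + Rabs dz)) by (apply Rmult_le_pos; lra); lra).
  set (eta := Rmin 1 (eps / (C * (4 + B + Rabs dz) + 1))).
  assert (He0 : 0 < eta) by (apply Rmin_glb_lt; [lra|now apply Rdiv_lt_0_compat]).
  assert (He1 : eta <= 1) by apply Rmin_l.
  assert (He2 : C * (eta + (eta + (eta * (B + 1) + Rabs dz * eta))) <= eps).
  { assert (K : eta <= eps / (C * (4 + B + Rabs dz) + 1)) by apply Rmin_r.
    apply (Rmult_le_compat_r (C * (4 + B + Rabs dz) + 1)) in K; [|lra].
    unfold Rdiv in K. rewrite Rmult_assoc, Rinv_l in K by lra.
    assert (0 <= C * eta) by (apply Rmult_le_pos; lra). lra. }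
  assert (T : forall l, 0 <= l <= SS -> continuous (fun q : R * R => dh (snd q) (fst q)) (l, k0)).
  { intros l _. apply (cont2_comp dh); [easy|apply continuous_snd|apply continuous_fst]. }
  destruct (tube (fun s k => dh k s) 0 SS k0 eta He0 T) as [d Hd].
  assert (N0 : locally' 0 (fun e => e <> 0 /\ Rabs e < d)).
  { exists d. intros e H1 H2. split; [easy|]. change (Rabs (e - 0) < d) in H1. now rewrite Rminus_0_r in H1. }
  generalize (filter_and _ _ N0 (filter_and _ _ (quot_le _ _ _ _ He0 Hdphi) (filter_and _ _ (quot_le _ _ _ _ He0 (zz_derive k0))
   (locally_shift k0 _ (solk_unif phi h k0 eta (Hphi k0) Hh He0))))).
  apply filter_imp. intros e [[N1 N2] [K2 [K3 K4]]]. fold dz in K3.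
  assert (S1 := solk_is_sol phi h (k0 + e) Hh).
  assert (S2 := is_sol_lin _ 1 (-1) _ _ _ _ _ _ _ _ (is_sol_change (zz k0) _ _ _ _ _ S1) S0).
  assert (S3 := is_sol_lin _ (/ e) (-1) _ _ _ _ _ _ _ _ S2 Sg).
  assert (Hq : forall t, 0 <= t <= SS -> Rabs ((h (k0 + e) t - h k0 t) / e - dh k0 t) <= eta).
  { intros t Ht. destruct (MVT_le (fun k => h k t) (fun k => dh k t) k0 e) as [c [Hc1 Hc2]].
    - intros; apply Dh.
    - rewrite Hc2. replace (dh c t * e / e) with (dh c t) by (field; easy). apply Hd; [|easy].
      change (Rabs (c - k0) < d). lra. }
  unshelve epose proof (HB k0 _ _ (eta + (eta * (B + 1) + Rabs dz * eta)) _ _ (Rle_refl _) _ _ S3 s Hs) as [A1 A2].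
  - intros t. apply (continuous_plus (fun s => / e * (1 * (h (k0 + e) s + (zz (k0 + e) - zz k0) * solk phi h (k0 + e) s) + -1 * h k0 s)) (fun s => -1 * g s)).
    + apply (continuous_mult (fun _ => / e)); [apply continuous_const|].
      apply (continuous_plus (fun s => 1 * (h (k0 + e) s + (zz (k0 + e) - zz k0) * solk phi h (k0 + e) s)) (fun s => -1 * h k0 s)).
      * apply (continuous_mult (fun _ => 1)); [apply continuous_const|].
        apply (continuous_plus (h (k0 + e))); [apply Hc|].
        apply (continuous_mult (fun _ => zz (k0 + e) - zz k0)); [apply continuous_const|apply (is_sol_cont _ _ _ _ _ _ S1)].
      * apply (continuous_mult (fun _ => -1)); [apply continuous_const|apply Hc].
    + apply (continuous_mult (fun _ => -1)); [apply continuous_const|apply Hg].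
  - intros t Ht. specialize (Hq t Ht). specialize (HBy t Ht). destruct (K4 t Ht) as [K5 _]. cbv beta.
    replace (_ + _) with (((h (k0 + e) t - h k0 t) / e - dh k0 t) +
      (((zz (k0 + e) - zz k0) / e - dz) * (solk phi h k0 t + (solk phi h (k0 + e) t - solk phi h k0 t))
      + dz * (solk phi h (k0 + e) t - solk phi h k0 t))).
    2:{ unfold g. field. easy. }
    apply Rle_trans with (1 := Rabs_triang _ _). apply Rplus_le_compat; [easy|].
    apply Rle_trans with (1 := Rabs_triang _ _). rewrite !Rabs_mult. apply Rplus_le_compat.
    + apply Rmult_le_compat; try apply Rabs_pos; [easy|]. apply Rle_trans with (1 := Rabs_triang _ _). lra.
    + apply Rmult_le_compat_l; easy.
  - assert (X : C * (Rabs (/ e * (1 * phi (k0 + e) + -1 * phi k0) + -1 * dphi) + (eta + (eta * (B + 1) + Rabs dz * eta))) <= eps).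
    { apply Rle_trans with (2 := He2). apply Rmult_le_compat_l; [easy|].
      replace (/ e * (1 * phi (k0 + e) + -1 * phi k0) + -1 * dphi) with ((phi (k0 + e) - phi k0) / e - dphi) by (field; easy). lra. }
    replace ((solk phi h (k0 + e) s - solk phi h k0 s) / e - sol (zz k0) dphi g s) with
      (/ e * (1 * solk phi h (k0 + e) s + -1 * solk phi h k0 s) + -1 * sol (zz k0) dphi g s) by (field; easy).
    replace ((dsolk phi h (k0 + e) s - dsolk phi h k0 s) / e - dsol (zz k0) dphi g s) with
      (/ e * (1 * dsolk phi h (k0 + e) s + -1 * dsolk phi h k0 s) + -1 * dsol (zz k0) dphi g s) by (field; easy).
    split; lra. }
split; apply is_derive_quot; apply filterlim_locally; intros eps;
  generalize (K (eps / 2) (is_pos_div_2 eps)); apply filter_imp; intros e [E1 E2].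
- change (Rabs ((solk phi h (k0 + e) s - solk phi h k0 s) / e - sol (zz k0) dphi g s) < eps). generalize (cond_pos eps); lra.
- change (Rabs ((dsolk phi h (k0 + e) s - dsolk phi h k0 s) / e - dsol (zz k0) dphi g s) < eps). generalize (cond_pos eps); lra.
Qed.

End Regularity.

(** * Convolution estimates and Picard iteration *)

Section Star.
Context {P : params}.

(** With [a = qn] this is the decay for which [k ^ qn * f] is still integrable at [s = 0]. *)
Definition wt (a : nat) (k : R) : R := om k / (1 + Rabs k) ^ a.

Lemma pow_abs1 k a : 1 <= (1 + Rabs k) ^ a.
Proof. apply pow_R1_Rle, abs1_ge1. Qed.

Lemma wt_gt0 a k : 0 < wt a k.
Proof. apply Rdiv_lt_0_compat; [apply om_gt0|]. generalize (pow_abs1 k a); lra. Qed.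

Lemma wt_le_om a k : wt a k <= om k.
Proof.
unfold wt, Rdiv. rewrite <- (Rmult_1_r (om k)) at 2. apply Rmult_le_compat_l; [left; apply om_gt0|].
apply Rle_trans with (/ 1); [apply Rinv_le_contravar; [lra|apply pow_abs1]|lra].
Qed.

Lemma wt_opp a k : wt a (- k) = wt a k.
Proof. unfold wt. now rewrite om_opp, Rabs_Ropp. Qed.

Lemma wt_comp a c k l : 1 <= c -> 1 + Rabs k <= c * (1 + Rabs l) -> wt a l <= c ^ (2 + a) * wt a k.
Proof.
intros Hc H. unfold wt, Rdiv. rewrite pow_add.
assert (H1 := om_comp c k l Hc H).
assert (P1 := pow_abs1 k a). assert (P2 := pow_abs1 l a).
assert (H2 : / (1 + Rabs l) ^ a <= c ^ a * / (1 + Rabs k) ^ a).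
{ assert (K : (1 + Rabs k) ^ a <= c ^ a * (1 + Rabs l) ^ a).
  { rewrite <- Rpow_mult_distr. apply pow_incr. generalize (abs1_ge1 k); lra. }
  apply Rmult_le_reg_r with ((1 + Rabs k) ^ a * (1 + Rabs l) ^ a); [apply Rmult_lt_0_compat; lra|].
  replace (/ (1 + Rabs l) ^ a * ((1 + Rabs k) ^ a * (1 + Rabs l) ^ a)) with ((1 + Rabs k) ^ a) by (field; lra).
  replace (c ^ a * / (1 + Rabs k) ^ a * ((1 + Rabs k) ^ a * (1 + Rabs l) ^ a)) with (c ^ a * (1 + Rabs l) ^ a) by (field; lra).
  easy. }
replace (c ^ 2 * c ^ a * (om k * / (1 + Rabs k) ^ a)) with ((c ^ 2 * om k) * (c ^ a * / (1 + Rabs k) ^ a)) by ring.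
apply Rmult_le_compat; [left; apply om_gt0|left; apply Rinv_0_lt_compat; lra|easy|easy].
Qed.

(** The alternative of [om_mult]: the larger frequency transfers its full weight to [k], and of the
    smaller one only the integrable part [om] is kept. *)
Lemma wt_mult a k l : wt a l * wt a (k - l) <= 2 ^ (2 + a) * wt a k * (om l + om (k - l)).
Proof.
assert (P1 := wt_gt0 a l). assert (P2 := wt_gt0 a (k - l)). assert (P3 := wt_gt0 a k).
assert (Q1 := wt_le_om a l). assert (Q2 := wt_le_om a (k - l)).
assert (O1 := om_gt0 l). assert (O2 := om_gt0 (k - l)).
assert (T : Rabs k <= Rabs l + Rabs (k - l)).
{ replace k with (l + (k - l)) at 1 by ring. apply Rabs_triang. }
assert (E : 0 < 2 ^ (2 + a)) by (apply pow_lt; lra).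
assert (EW : 0 < 2 ^ (2 + a) * wt a k) by now apply Rmult_lt_0_compat.
destruct (Rle_lt_dec (1 + Rabs k) (2 * (1 + Rabs l))) as [H|H].
- assert (K := wt_comp a 2 k l ltac:(lra) H).
  apply Rle_trans with (2 ^ (2 + a) * wt a k * om (k - l)).
  + apply Rmult_le_compat; lra.
  + apply Rmult_le_compat_l; lra.
- assert (K := wt_comp a 2 k (k - l) ltac:(lra) ltac:(lra)).
  apply Rle_trans with (om l * (2 ^ (2 + a) * wt a k)).
  + apply Rmult_le_compat; lra.
  + rewrite Rmult_comm. apply Rmult_le_compat_l; lra.
Qed.

Definition ndom (A : R) (f : R -> R -> R) : Prop :=
  cont2 f /\ forall k s, Rabs (f k s) <= A * (wt qn k * Yw k (cl s)).

Lemma wY_gt0 k s : 0 < wt qn k * Yw k s.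
Proof. apply Rmult_lt_0_compat; [apply wt_gt0|apply Yw_gt0]. Qed.

Lemma ndom_ge0 A f : ndom A f -> 0 <= A.
Proof.
intros [_ H]. specialize (H 0 0). assert (W := wY_gt0 0 (cl 0)). generalize (Rabs_pos (f 0 0)); intros.
destruct (Rle_lt_dec 0 A); [easy|]. nra.
Qed.

Lemma ndom_weaken A B f : A <= B -> ndom A f -> ndom B f.
Proof.
intros H [Hc Hb]; split; [easy|]. intros k s. apply Rle_trans with (1 := Hb k s).
apply Rmult_le_compat_r; [left; apply wY_gt0|easy].
Qed.

Lemma ndom_dom2 A f : ndom A f -> dom2 (2 * A) f.
Proof.
intros Hf. assert (HA := ndom_ge0 _ _ Hf). destruct Hf as [Hc Hb]. split; [easy|].
intros k s. apply Rle_trans with (1 := Hb k s).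
assert (W := wt_le_om qn k). assert (W0 := wt_gt0 qn k). assert (Y := Yw_le2 k (cl s) (cl_in s)). assert (Y0 := Yw_gt0 k (cl s)).
replace (2 * A * om k) with (A * (om k * 2)) by ring. apply Rmult_le_compat_l; [easy|].
apply Rmult_le_compat; lra.
Qed.

Definition rf (f : R -> R -> R) (k s : R) : R := f (- k) s.

Lemma cont2_rf f : cont2 f -> cont2 (rf f).
Proof.
intros H k s. apply (cont2_comp f (fun p : R * R => - fst p) (fun p => snd p)); [easy| |apply continuous_snd].
apply (continuous_opp (fun p : R * R => fst p)), continuous_fst.
Qed.

Lemma ndom_rf A f : ndom A f -> ndom A (rf f).
Proof.
intros [Hc Hb]; split; [now apply cont2_rf|]. intros k s. unfold rf.
replace (wt qn k * Yw k (cl s)) with (wt qn (- k) * Yw (- k) (cl s)); [apply Hb|].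
rewrite wt_opp. unfold Yw. now rewrite Rabs_Ropp.
Qed.

Lemma dom2_rf C f : dom2 C f -> dom2 C (rf f).
Proof.
intros [Hc Hb]; split; [now apply cont2_rf|]. intros k s. unfold rf. rewrite <- (om_opp k). apply Hb.
Qed.

Lemma cont2_lin a b f g : cont2 f -> cont2 g -> cont2 (fun k s => a * f k s + b * g k s).
Proof.
intros Hf Hg k s.
apply (continuous_plus (fun p : R * R => a * f (fst p) (snd p)) (fun p => b * g (fst p) (snd p))).
- apply (continuous_mult (fun _ => a) (fun p : R * R => f (fst p) (snd p))); [apply continuous_const|apply Hf].
- apply (continuous_mult (fun _ => b) (fun p : R * R => g (fst p) (snd p))); [apply continuous_const|apply Hg].
Qed.

Lemma cont2_mult f g : cont2 f -> cont2 g -> cont2 (fun k s => f k s * g k s).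
Proof. intros Hf Hg k s. apply (continuous_mult (fun p : R * R => f (fst p) (snd p)) (fun p => g (fst p) (snd p))); [apply Hf|apply Hg]. Qed.

Lemma cont2_fst (f : R -> R) : (forall k, continuous f k) -> cont2 (fun k _ => f k).
Proof. intros Hf k s. apply (continuous_comp (fun p : R * R => fst p) f); [apply continuous_fst|apply Hf]. Qed.

Lemma ndom_lin a b A B f g : ndom A f -> ndom B g -> ndom (Rabs a * A + Rabs b * B) (fun k s => a * f k s + b * g k s).
Proof.
intros [Hf Bf] [Hg Bg]; split; [now apply cont2_lin|]. intros k s.
apply Rle_trans with (1 := Rabs_triang _ _). rewrite !Rabs_mult, Rmult_plus_distr_r, !Rmult_assoc.
apply Rplus_le_compat; apply Rmult_le_compat_l; try apply Rabs_pos; [apply Bf|apply Bg].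
Qed.

(** The factors come from [conv_bound], [Yw_mult] and [wt_mult] in this order. *)
Definition conv_const : R := 2 * intR om * (4 * 2 ^ (2 + qn)).

Lemma conv_const_ge0 : 0 <= conv_const.
Proof.
unfold conv_const. assert (H := intR_om_ge0). assert (0 < 2 ^ (2 + qn)) by (apply pow_lt; lra).
apply Rmult_le_pos; [lra|]. lra.
Qed.

Lemma conv2_ndom A B f g : ndom A f -> ndom B g -> ndom (conv_const * A * B) (conv2 f g).
Proof.
intros Hf Hg. assert (HA := ndom_ge0 _ _ Hf). assert (HB := ndom_ge0 _ _ Hg).
assert (Df := ndom_dom2 _ _ Hf). assert (Dg := ndom_dom2 _ _ Hg).
split; [now apply (conv2_cont (2 * A) (2 * B))|].
intros k s. unfold conv2.
apply Rle_trans with (2 * intR om * (4 * 2 ^ (2 + qn) * A * B * (wt qn k * Yw k (cl s)))); [|unfold conv_const; right; ring].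
apply (conv_bound _ (2 * A) (2 * B) _ _ k (fun l => A * (wt qn l * Yw l (cl s))) (fun l => B * (wt qn l * Yw l (cl s)))).
- now apply dom2_1.
- now apply dom2_1.
- intros l; apply Hf.
- intros l; apply Hg.
- intros l. assert (H1 := wt_mult qn k l). assert (H2 := Yw_mult k l (cl s) (cl_in s)).
  replace (A * (wt qn l * Yw l (cl s)) * (B * (wt qn (k - l) * Yw (k - l) (cl s)))) with
    (A * B * ((wt qn l * wt qn (k - l)) * (Yw l (cl s) * Yw (k - l) (cl s)))) by ring.
  replace (4 * 2 ^ (2 + qn) * A * B * (wt qn k * Yw k (cl s)) * (om l + om (k - l))) with
    (A * B * ((2 ^ (2 + qn) * wt qn k * (om l + om (k - l))) * (4 * Yw k (cl s)))) by ring.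
  apply Rmult_le_compat_l; [now apply Rmult_le_pos|].
  assert (X1 := wt_gt0 qn l). assert (X2 := wt_gt0 qn (k - l)). assert (X3 := Yw_gt0 l (cl s)). assert (X4 := Yw_gt0 (k - l) (cl s)).
  apply Rmult_le_compat; [apply Rmult_le_pos; lra|apply Rmult_le_pos; lra|easy|easy].
Qed.

(* [comb e1 e2 e3 e4] covers the Hartley form of the product and of its derivatives in k. *)
Definition comb (e1 e2 e3 e4 : R) (f g : R -> R -> R) (k s : R) : R :=
  / 2 * (e1 * conv2 f g k s + e2 * conv2 (rf f) g k s + e3 * conv2 f (rf g) k s + e4 * conv2 (rf f) (rf g) k s).

(** The signs are those of [2 cas a cas b = cas (a + b) + cas (b - a) + cas (a - b) - cas (- a -
    b)], a reflection of a factor negating its frequency. In [dstar2] the second factor is the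
    derivative; reflecting it changes the sign of the differentiated terms, whence the opposite
    third and fourth signs. *)
Definition star2 := comb 1 1 1 (-1).
Definition dstar2 := comb 1 1 (-1) 1.

Lemma comb_ndom e1 e2 e3 e4 A B f g : Rabs e1 = 1 -> Rabs e2 = 1 -> Rabs e3 = 1 -> Rabs e4 = 1 ->
  ndom A f -> ndom B g -> ndom (2 * conv_const * A * B) (comb e1 e2 e3 e4 f g).
Proof.
intros E1 E2 E3 E4 Hf Hg.
assert (Rff := ndom_rf _ _ Hf). assert (Rg := ndom_rf _ _ Hg).
assert (N1 := conv2_ndom _ _ _ _ Hf Hg). assert (N2 := conv2_ndom _ _ _ _ Rff Hg).
assert (N3 := conv2_ndom _ _ _ _ Hf Rg). assert (N4 := conv2_ndom _ _ _ _ Rff Rg).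
assert (M1 := ndom_lin e1 e2 _ _ _ _ N1 N2). assert (M2 := ndom_lin e3 e4 _ _ _ _ N3 N4).
assert (M3 := ndom_lin (/ 2) (/ 2) _ _ _ _ M1 M2).
rewrite E1, E2, E3, E4, Rabs_inv, (Rabs_right 2) in M3 by lra.
destruct M3 as [Q1 Q2]. split.
- intros k s. apply continuous_ext with (2 := Q1 k s). intros p. unfold comb. apply eq_sym. rewrite <- Rmult_plus_distr_l. f_equal. rewrite Rplus_assoc, <- !Rplus_assoc. reflexivity.
- intros k s. specialize (Q2 k s). cbv beta in Q2.
  assert (X : comb e1 e2 e3 e4 f g k s = / 2 * (e1 * conv2 f g k s + e2 * conv2 (rf f) g k s) + / 2 * (e3 * conv2 f (rf g) k s + e4 * conv2 (rf f) (rf g) k s)) by (unfold comb; ring).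
  rewrite X. apply Rle_trans with (1 := Q2). right. field.
Qed.

Lemma conv2_lin_l C D E a b f f' g k s : dom2 C f -> dom2 D f' -> dom2 E g ->
  conv2 (fun k s => a * f k s + b * f' k s) g k s = a * conv2 f g k s + b * conv2 f' g k s.
Proof.
intros Hf Hf' Hg. unfold conv2, conv.
assert (I1 := conv_dom_integrand C E (fun l => f l s) (fun l => g l s) k (dom2_1 _ _ s Hf) (dom2_1 _ _ s Hg)).
assert (I2 := conv_dom_integrand D E (fun l => f' l s) (fun l => g l s) k (dom2_1 _ _ s Hf') (dom2_1 _ _ s Hg)).
rewrite <- (intR_scal _ a _ I1), <- (intR_scal _ b _ I2).
rewrite <- (intR_plus _ _ _ _ (dom_scal _ a _ I1) (dom_scal _ b _ I2)).
apply intR_ext; intros l; ring.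
Qed.

Lemma conv2_lin_r C D E a b f g g' k s : dom2 C f -> dom2 D g -> dom2 E g' ->
  conv2 f (fun k s => a * g k s + b * g' k s) k s = a * conv2 f g k s + b * conv2 f g' k s.
Proof.
intros Hf Hg Hg'. unfold conv2, conv.
assert (I1 := conv_dom_integrand C D (fun l => f l s) (fun l => g l s) k (dom2_1 _ _ s Hf) (dom2_1 _ _ s Hg)).
assert (I2 := conv_dom_integrand C E (fun l => f l s) (fun l => g' l s) k (dom2_1 _ _ s Hf) (dom2_1 _ _ s Hg')).
rewrite <- (intR_scal _ a _ I1), <- (intR_scal _ b _ I2).
rewrite <- (intR_plus _ _ _ _ (dom_scal _ a _ I1) (dom_scal _ b _ I2)).
apply intR_ext; intros l; ring.
Qed.

Lemma comb_diff e1 e2 e3 e4 C D E F f f' g g' k s : dom2 C f -> dom2 D f' -> dom2 E g -> dom2 F g' ->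
  comb e1 e2 e3 e4 f' g' k s - comb e1 e2 e3 e4 f g k s =
  comb e1 e2 e3 e4 (fun k s => 1 * f' k s + -1 * f k s) g' k s + comb e1 e2 e3 e4 f (fun k s => 1 * g' k s + -1 * g k s) k s.
Proof.
intros Hf Hf' Hg Hg'. assert (Rff := dom2_rf _ _ Hf). assert (Rf' := dom2_rf _ _ Hf'). assert (Rg := dom2_rf _ _ Hg). assert (Rg' := dom2_rf _ _ Hg').
unfold comb.
change (rf (fun k s => 1 * f' k s + -1 * f k s)) with (fun k s => 1 * rf f' k s + -1 * rf f k s).
change (rf (fun k s => 1 * g' k s + -1 * g k s)) with (fun k s => 1 * rf g' k s + -1 * rf g k s).
rewrite !(conv2_lin_l D C F), !(conv2_lin_r C F E) by assumption. ring.
Qed.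

Lemma comb_diff_ndom e1 e2 e3 e4 A B D E f f' g g' : Rabs e1 = 1 -> Rabs e2 = 1 -> Rabs e3 = 1 -> Rabs e4 = 1 ->
  ndom A f -> ndom A f' -> ndom B g -> ndom B g' ->
  ndom D (fun k s => 1 * f' k s + -1 * f k s) -> ndom E (fun k s => 1 * g' k s + -1 * g k s) ->
  forall k s, Rabs (comb e1 e2 e3 e4 f' g' k s - comb e1 e2 e3 e4 f g k s) <= 2 * conv_const * (D * B + A * E) * (wt qn k * Yw k (cl s)).
Proof.
intros E1 E2 E3 E4 Hf Hf' Hg Hg' Hd He k s.
rewrite (comb_diff e1 e2 e3 e4 (2 * A) (2 * A) (2 * B) (2 * B)) by now apply ndom_dom2.
apply Rle_trans with (1 := Rabs_triang _ _).
destruct (comb_ndom e1 e2 e3 e4 D B _ g' E1 E2 E3 E4 Hd Hg') as [_ K1].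
destruct (comb_ndom e1 e2 e3 e4 A E f _ E1 E2 E3 E4 Hf He) as [_ K2].
specialize (K1 k s). specialize (K2 k s). lra.
Qed.

(** The elliptic gain: the source may exceed the weight by the factor [1 + k^4], which inverting the
    operator removes. The nonlinearity needs only [k^2] of it, the differentiated symbol [|k|^3]. *)
Lemma solk_diff_bound : exists C, 0 < C /\ forall e H phi psi h g,
  0 <= e -> 0 <= H -> (forall k, continuous phi k) -> (forall k, continuous psi k) ->
  (forall k, Rabs (phi k - psi k) <= e * wt qn k) -> cont2 h -> cont2 g ->
  (forall k s, 0 <= s <= SS -> Rabs (h k s - g k s) <= H * (1 + k ^ 4) * (wt qn k * Yw k (cl s))) ->
  ndom (C * (e + H)) (fun k s => 1 * solk phi h k (cl s) + -1 * solk psi g k (cl s)).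
Proof.
destruct sol_bound as [C [HC Hb]]. exists C; split; [easy|].
intros e H phi psi h g He HH Cphi Cpsi Hd Ch Cg Hh.
split; [apply cont2_lin; now apply solk_cont2|].
intros k s. assert (W := wt_gt0 qn k). assert (k4 := pow4_ge0 k). assert (Y := Yw_gt0 k (cl s)).
assert (S := is_sol_lin _ 1 (-1) _ _ _ _ _ _ _ _ (solk_is_sol phi h k Ch) (solk_is_sol psi g k Cg)).
assert (Hc : forall t, continuous (fun s => 1 * h k s + -1 * g k s) t).
{ intros t. apply (cont2_2 (fun k s => 1 * h k s + -1 * g k s)). now apply cont2_lin. }
destruct (sol_eq _ _ _ _ _ (cl s) Hc S) as [-> _].
apply Rle_trans with (C * (Rabs (1 * phi k + -1 * psi k) + H * (1 + k ^ 4) * wt qn k / (1 + k ^ 4)) * Yw k (cl s)).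
- apply Hb; [easy| | |apply cl_in].
  + apply Rmult_le_pos; [apply Rmult_le_pos|]; lra.
  + intros t Ht. replace (1 * h k t + -1 * g k t) with (h k t - g k t) by ring.
    rewrite Rmult_assoc. rewrite <- (cl_id t) at 3 by easy. now apply Hh.
- replace (C * (e + H) * (wt qn k * Yw k (cl s))) with (C * (e * wt qn k + H * wt qn k) * Yw k (cl s)) by ring.
  apply Rmult_le_compat_r; [lra|]. apply Rmult_le_compat_l; [lra|]. apply Rplus_le_compat.
  + replace (1 * phi k + -1 * psi k) with (phi k - psi k) by ring. apply Hd.
  + right. field. lra.
Qed.

End Star.

Lemma geom_limit (u : nat -> R) C : (forall n, Rabs (u (S n) - u n) <= C * (1/2) ^ n) ->
  forall n, Rabs (real (Lim_seq u) - u n) <= 2 * C * (1/2) ^ n.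
Proof.
intros H.
assert (HC : 0 <= C) by (specialize (H 0%nat); simpl in H; generalize (Rabs_pos (u 1%nat - u 0%nat)); lra).
assert (T : forall n p, Rabs (u (n + p)%nat - u n) <= 2 * C * (1/2) ^ n * (1 - (1/2) ^ p)).
{ intros n p. induction p as [|p IH].
  - rewrite Nat.add_0_r, Rminus_diag, Rabs_R0. simpl; lra.
  - rewrite Nat.add_succ_r. specialize (H (n + p)%nat). rewrite pow_add in H.
    replace (u (S (n + p)) - u n) with ((u (S (n + p)) - u (n + p)%nat) + (u (n + p)%nat - u n)) by ring.
    apply Rle_trans with (1 := Rabs_triang _ _). simpl pow. nra. }
assert (T' : forall n p, Rabs (u (n + p)%nat - u n) <= 2 * C * (1/2) ^ n).
{ intros n p. apply Rle_trans with (1 := T n p). rewrite <- (Rmult_1_r (2 * C * (1/2) ^ n)) at 2.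
  assert (0 < (1/2) ^ p) by (apply pow_lt; lra). assert (0 < (1/2) ^ n) by (apply pow_lt; lra).
  apply Rmult_le_compat_l; [apply Rmult_le_pos; lra|lra]. }
assert (L0 : is_lim_seq (fun n => 2 * C * (1/2) ^ n) 0).
{ replace (Finite 0) with (Rbar_mult (2 * C) 0) by (simpl; f_equal; ring).
  apply is_lim_seq_scal_l, is_lim_seq_geom. rewrite Rabs_right; lra. }
assert (E : ex_finite_lim_seq u).
{ apply ex_lim_seq_cauchy_corr. intros eps.
  apply is_lim_seq_spec in L0. destruct (L0 (pos_div_2 eps)) as [N HN].
  exists N. intros n m Hn Hm. specialize (HN N (Nat.le_refl _)). rewrite Rminus_0_r in HN. simpl in HN.
  assert (A1 := T' N (n - N)%nat). assert (A2 := T' N (m - N)%nat).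
  replace (N + (n - N))%nat with n in A1 by lia. replace (N + (m - N))%nat with m in A2 by lia.
  replace (u n - u m) with ((u n - u N) - (u m - u N)) by ring.
  unfold Rminus at 1. apply Rle_lt_trans with (1 := Rabs_triang _ _). rewrite Rabs_Ropp.
  apply Rabs_lt_between in HN. lra. }
destruct E as [l Hl]. rewrite (is_lim_seq_unique _ _ Hl). simpl.
intros n.
assert (Hl2 : is_lim_seq (fun p => Rabs (u (n + p)%nat - u n)) (Rabs (l - u n))).
{ apply (is_lim_seq_abs (fun p => u (n + p)%nat - u n) (l - u n)). apply is_lim_seq_minus'; [|apply is_lim_seq_const].
  apply is_lim_seq_ext with (fun p => u (p + n)%nat); [intros; f_equal; lia|]. now apply is_lim_seq_incr_n. }
apply (is_lim_seq_le (fun p => Rabs (u (n + p)%nat - u n)) (fun _ => 2 * C * (1/2) ^ n) (Rabs (l - u n)) (2 * C * (1/2) ^ n)); [apply T'|easy|apply is_lim_seq_const].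
Qed.

Lemma half_pow_small C eps : 0 <= C -> 0 < eps -> exists N, forall n, (N <= n)%nat -> C * (1/2) ^ n < eps.
Proof.
intros HC He.
assert (L0 : is_lim_seq (fun n => C * (1/2) ^ n) 0).
{ replace (Finite 0) with (Rbar_mult C 0) by (simpl; f_equal; ring).
  apply is_lim_seq_scal_l, is_lim_seq_geom. rewrite Rabs_right; lra. }
apply is_lim_seq_spec in L0. destruct (L0 (mkposreal eps He)) as [N HN]. exists N. intros n Hn.
specialize (HN n Hn). rewrite Rminus_0_r in HN. simpl in HN. apply Rabs_lt_between in HN. lra.
Qed.

Section Picard.
Context {P : params}.

Definition nonlin (f : R -> R -> R) (k s : R) : R := - (k ^ 2 * star2 f f k s).
Definition dz (k : R) : R := 4 * k ^ 3 - 2 * k.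
(** The source of the problem solved by the derivative in [k]. The last argument is separate because
    in the iteration the symbol multiplies the new iterate, while the products are formed from the
    old one. *)
Definition dnonlin (f g f1 : R -> R -> R) (k s : R) : R :=
  - (2 * k * star2 f f k s + k ^ 2 * dstar2 f g k s) + dz k * f1 k s.

Lemma cont_pow n k : continuous (fun k => k ^ n) k.
Proof.
apply (ex_derive_continuous (fun k => k ^ n)). auto_derive; easy.
Qed.

Lemma dz_cont k : continuous dz k.
Proof. apply (ex_derive_continuous dz). unfold dz. auto_derive; easy. Qed.

Lemma k_bounds k : Rabs k <= 1 + k ^ 4 /\ k ^ 2 <= 1 + k ^ 4 /\ Rabs (dz k) <= 6 * (1 + k ^ 4).
Proof.
assert (H0 := Rabs_pos k). set (m := Rabs k) in *.
assert (E2 : k ^ 2 = m ^ 2) by (unfold m; symmetry; apply pow2_abs).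
assert (E4 : k ^ 4 = m ^ 4) by (replace (k ^ 4) with ((k ^ 2) ^ 2) by ring; rewrite E2; ring).
assert (E3 : Rabs (dz k) <= 4 * m ^ 3 + 2 * m).
{ unfold dz, m. unfold Rminus. apply Rle_trans with (1 := Rabs_triang _ _). rewrite Rabs_Ropp, !Rabs_mult, RPow_abs.
  rewrite (Rabs_right 4), (Rabs_right 2) by lra. lra. }
rewrite E2, E4.
assert (Q1 : m ^ 2 <= 1 + m ^ 4) by (assert (0 <= (m ^ 2 - 1/2) ^ 2) by apply pow2_ge_0; nra).
assert (Q2 : m <= 1 + m ^ 4).
{ destruct (Rle_lt_dec m 1); [assert (0 <= m ^ 4) by (apply pow_le; lra); lra|].
  assert (m * 1 <= m * m ^ 3) by (apply Rmult_le_compat_l; [lra|apply pow_R1_Rle; lra]). simpl in *. lra. }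
assert (Q3 : m ^ 3 <= 1 + m ^ 4).
{ destruct (Rle_lt_dec m 1).
  - assert (m ^ 3 <= 1) by (replace 1 with (1 ^ 3) by ring; apply pow_incr; lra). assert (0 <= m ^ 4) by (apply pow_le; lra). lra.
  - assert (1 * m ^ 3 <= m * m ^ 3) by (apply Rmult_le_compat_r; [apply pow_le; lra|lra]). simpl in *. lra. }
repeat split; lra.
Qed.

Lemma star2_ndom A B f g : ndom A f -> ndom B g -> ndom (2 * conv_const * A * B) (star2 f g).
Proof. apply comb_ndom; rewrite ?Rabs_R1; try lra. rewrite Rabs_left; lra. Qed.

Lemma dstar2_ndom A B f g : ndom A f -> ndom B g -> ndom (2 * conv_const * A * B) (dstar2 f g).
Proof. apply comb_ndom; rewrite ?Rabs_R1; try lra. rewrite Rabs_left; lra. Qed.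

Lemma cont2_opp f : cont2 f -> cont2 (fun k s => - f k s).
Proof. intros H k s. apply (continuous_opp (fun p : R * R => f (fst p) (snd p))), H. Qed.

Lemma cont2_plus f g : cont2 f -> cont2 g -> cont2 (fun k s => f k s + g k s).
Proof. intros Hf Hg k s. apply (continuous_plus (fun p : R * R => f (fst p) (snd p)) (fun p => g (fst p) (snd p))); [apply Hf|apply Hg]. Qed.

Lemma nonlin_cont A f : ndom A f -> cont2 (nonlin f).
Proof.
intros Hf. apply cont2_opp. apply (cont2_mult (fun k _ => k ^ 2)); [apply (cont2_fst (fun k => k ^ 2)), cont_pow|].
apply (star2_ndom _ _ _ _ Hf Hf).
Qed.

Lemma dnonlin_cont A B f g f1 : ndom A f -> ndom B g -> cont2 f1 -> cont2 (dnonlin f g f1).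
Proof.
intros Hf Hg Hf1. apply cont2_plus.
- apply cont2_opp. apply cont2_plus.
  + apply (cont2_mult (fun k _ => 2 * k)); [|apply (star2_ndom _ _ _ _ Hf Hf)].
    apply (cont2_fst (fun k => 2 * k)). intros k. apply (continuous_mult (fun _ => 2) (fun k : R => k)); [apply continuous_const|apply continuous_id].
  + apply (cont2_mult (fun k _ => k ^ 2)); [apply (cont2_fst (fun k => k ^ 2)), cont_pow|].
    apply (dstar2_ndom _ _ _ _ Hf Hg).
- apply (cont2_mult (fun k _ => dz k)); [apply (cont2_fst dz), dz_cont|easy].
Qed.

Lemma abs_mult_le a b x y : Rabs a <= x -> Rabs b <= y -> Rabs (a * b) <= x * y.
Proof. intros Ha Hb. rewrite Rabs_mult. apply Rmult_le_compat; try apply Rabs_pos; easy. Qed.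

Lemma nonlin_diff A D f f' : ndom A f -> ndom A f' -> ndom D (fun k s => 1 * f' k s + -1 * f k s) ->
  forall k s, Rabs (nonlin f' k s - nonlin f k s) <= 4 * conv_const * A * D * (1 + k ^ 4) * (wt qn k * Yw k (cl s)).
Proof.
intros Hf Hf' Hd k s. unfold nonlin. replace (_ - _) with (- (k ^ 2 * (star2 f' f' k s - star2 f f k s))) by ring.
rewrite Rabs_Ropp. destruct (k_bounds k) as [_ [K2 _]].
assert (K := comb_diff_ndom 1 1 1 (-1) A A D D f f' f f' Rabs_R1 Rabs_R1 Rabs_R1 ltac:(rewrite Rabs_left; lra) Hf Hf' Hf Hf' Hd Hd k s).
apply Rle_trans with ((1 + k ^ 4) * (2 * conv_const * (D * A + A * D) * (wt qn k * Yw k (cl s)))); [|right; ring].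
apply abs_mult_le; [|exact K]. rewrite Rabs_right; [easy|apply Rle_ge, pow2_ge_0].
Qed.

Lemma dnonlin_diff A B D E D1 f f' g g' f1 f1' : ndom A f -> ndom A f' -> ndom B g -> ndom B g' ->
  ndom D (fun k s => 1 * f' k s + -1 * f k s) -> ndom E (fun k s => 1 * g' k s + -1 * g k s) ->
  ndom D1 (fun k s => 1 * f1' k s + -1 * f1 k s) ->
  forall k s, Rabs (dnonlin f' g' f1' k s - dnonlin f g f1 k s) <=
    (8 * conv_const * A * D + 2 * conv_const * (D * B + A * E) + 6 * D1) * (1 + k ^ 4) * (wt qn k * Yw k (cl s)).
Proof.
intros Hf Hf' Hg Hg' Hd He Hd1 k s. unfold dnonlin.
replace (_ - _) with (- (2 * k * (star2 f' f' k s - star2 f f k s) + k ^ 2 * (dstar2 f' g' k s - dstar2 f g k s)) + dz k * (1 * f1' k s + -1 * f1 k s)) by ring.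
destruct (k_bounds k) as [K1 [K2 K3]].
assert (L1 := comb_diff_ndom 1 1 1 (-1) A A D D f f' f f' Rabs_R1 Rabs_R1 Rabs_R1 ltac:(rewrite Rabs_left; lra) Hf Hf' Hf Hf' Hd Hd k s).
assert (L2 := comb_diff_ndom 1 1 (-1) 1 A B D E f f' g g' Rabs_R1 Rabs_R1 ltac:(rewrite Rabs_left; lra) Rabs_R1 Hf Hf' Hg Hg' Hd He k s).
assert (L3 := proj2 Hd1 k s). cbv beta in L3.
set (W := wt qn k * Yw k (cl s)) in *.
assert (M1 : Rabs (2 * k * (star2 f' f' k s - star2 f f k s)) <= 2 * (1 + k ^ 4) * (2 * conv_const * (D * A + A * D) * W)).
{ apply abs_mult_le; [|exact L1]. rewrite Rabs_mult, (Rabs_right 2) by lra. lra. }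
assert (M2 : Rabs (k ^ 2 * (dstar2 f' g' k s - dstar2 f g k s)) <= (1 + k ^ 4) * (2 * conv_const * (D * B + A * E) * W)).
{ apply abs_mult_le; [|exact L2]. rewrite Rabs_right; [easy|apply Rle_ge, pow2_ge_0]. }
assert (M3 : Rabs (dz k * (1 * f1' k s + -1 * f1 k s)) <= 6 * (1 + k ^ 4) * (D1 * W)) by (apply abs_mult_le; easy).
apply Rle_trans with (1 := Rabs_triang _ _). rewrite Rabs_Ropp.
assert (M4 := Rabs_triang (2 * k * (star2 f' f' k s - star2 f f k s)) (k ^ 2 * (dstar2 f' g' k s - dstar2 f g k s))).
lra.
Qed.

Lemma ndom_0 A : 0 <= A -> ndom A (fun _ _ => 0).
Proof.
intros HA; split; [intros k s; apply continuous_const|]. intros k s. rewrite Rabs_R0.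
apply Rmult_le_pos; [easy|left; apply wY_gt0].
Qed.

Lemma sol_zero phi k s : (forall k : R, phi k = 0) -> 0 <= s <= SS -> solk phi (fun _ _ => 0) k s = 0.
Proof.
intros Hp Hs. destruct sol_bound as [C [HC Hb]].
assert (K := Hb k (phi k) (fun _ => 0) 0 (fun t => continuous_const _ _) (Rle_refl _)).
specialize (K ltac:(intros t _; cbv beta; rewrite Rabs_R0; lra) s Hs). rewrite Hp, Rabs_R0 in K.
unfold solk. rewrite Hp. apply Rabs_eq_0. apply Rle_antisym; [|apply Rabs_pos].
apply Rle_trans with (1 := K). right. field. generalize (pow4_ge0 k); lra.
Qed.

Lemma ndom_lim A C (u : nat -> R -> R -> R) : 0 <= C ->
  (forall n, ndom A (u n)) ->
  (forall n, ndom (C * (1/2) ^ n) (fun k s => 1 * u (S n) k s + -1 * u n k s)) ->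
  let f := fun k s => real (Lim_seq (fun n => u n k s)) in
  ndom A f /\ (forall n, ndom (2 * C * (1/2) ^ n) (fun k s => 1 * f k s + -1 * u n k s)) /\
  (forall k s n, Rabs (f k s - u n k s) <= 4 * C * (1/2) ^ n).
Proof.
intros HC Hu Hd f.
assert (K : forall k s n, Rabs (f k s - u n k s) <= 2 * C * (1/2) ^ n * (wt qn k * Yw k (cl s))).
{ intros k s n.
  apply Rle_trans with (2 * (C * (wt qn k * Yw k (cl s))) * (1/2) ^ n); [|right; ring].
  apply (geom_limit (fun n => u n k s)). clear n. intros n. destruct (Hd n) as [_ Hb]. specialize (Hb k s). cbv beta in Hb.
  replace (u (S n) k s - u n k s) with (1 * u (S n) k s + -1 * u n k s) by ring.
  apply Rle_trans with (1 := Hb). right; ring. }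
assert (hp : forall n, 0 < (1/2) ^ n) by (intros; apply pow_lt; lra).
assert (K2 : forall k s n, Rabs (f k s - u n k s) <= 4 * C * (1/2) ^ n).
{ intros k s n. apply Rle_trans with (1 := K k s n).
  assert (W := wt_le_om qn k). assert (W1 := om_le1 k). assert (Y := Yw_le2 k (cl s) (cl_in s)).
  assert (W0 := wt_gt0 qn k). assert (Y0 := Yw_gt0 k (cl s)).
  replace (4 * C * (1/2) ^ n) with (2 * C * (1/2) ^ n * (1 * 2)) by ring. specialize (hp n).
  apply Rmult_le_compat_l; [apply Rmult_le_pos; lra|]. apply Rmult_le_compat; lra. }
assert (Cf : cont2 f).
{ intros k s. apply filterlim_locally. intros eps.
  assert (He : 0 < eps / 3) by (generalize (cond_pos eps); lra).
  destruct (half_pow_small (4 * C) (eps / 3) ltac:(lra) He) as [N HN]. specialize (HN N (Nat.le_refl _)).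
  destruct (Hu N) as [Hc _]. specialize (Hc k s). apply filterlim_locally with (eps := mkposreal _ He) in Hc.
  revert Hc. apply filter_imp. intros [k' s'] Hk. simpl in *.
  change (Rabs (u N k' s' - u N k s) < eps / 3) in Hk.
  change (Rabs (f k' s' - f k s) < eps).
  assert (A1 := K2 k' s' N). assert (A2 := K2 k s N).
  apply Rabs_lt_between in Hk. apply Rabs_le_between in A1, A2. apply Rabs_lt_between. lra. }
assert (Bf : forall k s, Rabs (f k s) <= A * (wt qn k * Yw k (cl s))).
{ intros k s. apply Rnot_lt_le. intros Hlt.
  destruct (half_pow_small (4 * C) (Rabs (f k s) - A * (wt qn k * Yw k (cl s))) ltac:(lra) ltac:(lra)) as [N HN].
  specialize (HN N (Nat.le_refl _)). assert (A1 := K2 k s N). assert (A2 := proj2 (Hu N) k s).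
  assert (A3 := Rabs_triang (f k s - u N k s) (u N k s)). replace (f k s - u N k s + u N k s) with (f k s) in A3 by ring. lra. }
split; [now split|split; [|easy]].
intros n. split; [apply cont2_lin; [easy|apply Hu]|]. intros k s.
replace (1 * f k s + -1 * u n k s) with (f k s - u n k s) by ring. apply K.
Qed.

Lemma star_derive A G f g k s : ndom A f -> ndom G g -> (forall k s, is_derive (fun k => f k s) k (g k s)) ->
  is_derive (fun k => star2 f f k s) k (dstar2 f g k s).
Proof.
intros Hf Hg H.
assert (Df := dom2_1 _ _ s (ndom_dom2 _ _ Hf)). assert (Dg := dom2_1 _ _ s (ndom_dom2 _ _ Hg)).
assert (Drf := dom2_1 _ _ s (ndom_dom2 _ _ (ndom_rf _ _ Hf))).
assert (Drg := dom2_1 _ _ s (ndom_dom2 _ _ (ndom_rf _ _ Hg))).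
assert (Drg' := dom_scal _ (-1) _ Drg).
assert (H' : forall k, is_derive (fun k => rf f k s) k (-1 * rf g k s)).
{ intros l. unfold rf. apply (is_derive_comp (fun k => f k s) (fun k => - k)); [apply H|auto_derive; [easy|ring]]. }
assert (D1 := conv_derive _ _ _ _ _ _ k Df Df Dg (fun k => H k s)).
assert (D2 := conv_derive _ _ _ _ _ _ k Drf Df Dg (fun k => H k s)).
assert (D3 := conv_derive _ _ _ _ _ _ k Df Drf Drg' H').
assert (D4 := conv_derive _ _ _ _ _ _ k Drf Drf Drg' H').
assert (E : forall u, dom (2 * A) u -> conv u (fun k => -1 * rf g k s) k = - conv u (fun k => rf g k s) k).
{ intros u Hu. transitivity (-1 * conv u (fun k => rf g k s) k); [|ring]. unfold conv.
  rewrite <- (intR_scal _ (-1) _ (conv_dom_integrand _ _ _ _ k Hu Drg)). apply intR_ext; intros; ring. }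
cbv beta in D3, D4. rewrite (E _ Df) in D3. rewrite (E _ Drf) in D4.
unfold star2, dstar2, comb, conv2.
apply (is_derive_scal (fun k => 1 * conv (fun l => f l s) (fun l => f l s) k + 1 * conv (fun l => rf f l s) (fun l => f l s) k +
   1 * conv (fun l => f l s) (fun l => rf f l s) k + -1 * conv (fun l => rf f l s) (fun l => rf f l s) k) k (/ 2)).
assert (L : forall (u v : R -> R) du dv, is_derive u k du -> is_derive v k dv -> is_derive (fun k => u k + v k) k (du + dv)).
{ intros u v du dv Hu Hv. apply (is_derive_plus u v); easy. }
replace (-1 * conv (fun l => f l s) (fun l => rf g l s) k) with (1 * - conv (fun l => f l s) (fun l => rf g l s) k) by ring.
replace (1 * conv (fun l => rf f l s) (fun l => rf g l s) k) with (-1 * - conv (fun l => rf f l s) (fun l => rf g l s) k) by ring.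
apply L; [apply L; [apply L|]|]; apply is_derive_scal; assumption.
Qed.

(** Sources that agree on [[0, SS]] give the same solution there; this identifies clamped and
    unclamped sources, which differ outside. The proof is the local bound with zero datum and zero
    source. *)
Lemma sol_ext_in k phi h g s : (forall t, continuous h t) -> (forall t, continuous g t) ->
  (forall t, 0 <= t <= SS -> h t = g t) -> 0 <= s <= SS ->
  sol (zz k) phi h s = sol (zz k) phi g s /\ dsol (zz k) phi h s = dsol (zz k) phi g s.
Proof.
intros Hh Hg E Hs.
assert (S := is_sol_lin _ 1 (-1) _ _ _ _ _ _ _ _ (sol_is_sol (zz k) phi h (zz_ge k) Hh) (sol_is_sol (zz k) phi g (zz_ge k) Hg)).
destruct (sol_local_bound (Rabs k)) as [C [HC HB]].
unshelve epose proof (HB k _ _ 0 _ _ (Rle_refl _) _ _ S s Hs) as [A1 A2].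
- intros t. apply (continuous_plus (fun s => 1 * h s) (fun s => -1 * g s)).
  + apply (continuous_mult (fun _ => 1) h); [apply continuous_const|apply Hh].
  + apply (continuous_mult (fun _ => -1) g); [apply continuous_const|apply Hg].
- intros t Ht. cbv beta. rewrite E by easy. replace (1 * g t + -1 * g t) with 0 by ring. rewrite Rabs_R0; lra.
- replace (1 * phi + -1 * phi) with 0 in A1, A2 by ring. rewrite Rabs_R0 in A1, A2.
  assert (Z : C * (0 + 0) = 0) by ring. rewrite Z in A1, A2.
  assert (B1 := Rabs_pos (1 * sol (zz k) phi h s + -1 * sol (zz k) phi g s)).
  assert (B2 := Rabs_pos (1 * dsol (zz k) phi h s + -1 * dsol (zz k) phi g s)).
  assert (C1 := Rabs_eq_0 _ (Rle_antisym _ _ A1 B1)). assert (C2 := Rabs_eq_0 _ (Rle_antisym _ _ A2 B2)). lra.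
Qed.

Lemma nonlin_derive A G f g f1 k s : ndom A f -> ndom G g -> (forall k s, is_derive (fun k => f k s) k (g k s)) ->
  is_derive (fun k => nonlin f k s) k (dnonlin f g f1 k s - dz k * f1 k s).
Proof.
intros Hf Hg H. assert (D := star_derive A G f g k s Hf Hg H). unfold nonlin, dnonlin. auto_derive.
- eexists; eassumption.
- use_der D. ring.
Qed.

(** The iterates of [f] and of its derivative in [k] run in parallel. Given [f], the derivative
    enters its own equation linearly and with a small coefficient, so the bound [E] on [dphi] is
    arbitrary and only [phi] has to be small. *)
Theorem picard : exists e0, 0 < e0 /\ forall phi dphi E,
  (forall k, continuous phi k) -> (forall k, continuous dphi k) -> (forall k, is_derive phi k (dphi k)) ->
  (forall k, Rabs (phi k) <= e0 * wt qn k) -> (forall k, Rabs (dphi k) <= E * wt qn k) ->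
  exists f g A G, ndom A f /\ ndom G g /\
    (forall k s, f k s = solk phi (nonlin f) k (cl s)) /\
    (forall k s, is_derive (fun k => f k s) k (g k s)).
Proof.
destruct solk_diff_bound as [C [HC HS]]. assert (HK := conv_const_ge0).
(* With radius [A = 2 * C * e0] this gives [conv_const * A * C <= 1/32]. The iterates then stay in
   their ball, and their differences contract by a factor below [1/4]. *)
set (e0 := / (64 * (conv_const + 1) * (C * C + 1))).
assert (CC : 0 <= C * C) by (apply Rmult_le_pos; lra).
assert (De : 0 < 64 * (conv_const + 1) * (C * C + 1)) by (apply Rmult_lt_0_compat; lra).
assert (He0 : 0 < e0) by now apply Rinv_0_lt_compat.
exists e0; split; [easy|].
intros phi dphi E Cphi Cdphi Dphi Bphi Bdphi.
set (A := 2 * C * e0).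
assert (HA : 0 < A) by (apply Rmult_lt_0_compat; lra).
assert (KA : conv_const * A * C <= 1 / 32).
{ assert (e0 * (64 * (conv_const + 1) * (C * C + 1)) = 1) by (unfold e0; field; lra).
  assert (conv_const * (C * C) * e0 <= (conv_const + 1) * (C * C + 1) * e0).
  { apply Rmult_le_compat_r; [lra|]. apply Rmult_le_compat; lra. }
  unfold A. lra. }
assert (HE : 0 <= E).
{ assert (W := wt_gt0 qn 0). specialize (Bdphi 0). generalize (Rabs_pos (dphi 0)); intros.
  destruct (Rle_lt_dec 0 E); [easy|nra]. }
assert (KA0 : 0 <= conv_const * A) by (apply Rmult_le_pos; lra).
assert (KAA0 : 0 <= conv_const * A * A) by (apply Rmult_le_pos; lra).
(* Twice the contribution that does not involve [g]; the part linear in [g] adds at most [G / 8], so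
   the ball of radius [G] is preserved. *)
set (G := 2 * C * (E + 8 * conv_const * A * A + 6 * A)).
assert (HG : 0 <= G) by (apply Rmult_le_pos; lra).
set (fi := fix fi n := match n with O => fun _ _ => 0 | S n => fun k s => solk phi (nonlin (fi n)) k (cl s) end : R -> R -> R).
set (gi := fix gi n := match n with O => fun _ _ => 0 | S n => fun k s => solk dphi (dnonlin (fi n) (gi n) (fi (S n))) k (cl s) end : R -> R -> R).
assert (fi0 : fi 0%nat = fun _ _ => 0) by reflexivity.
assert (fiS : forall n, fi (S n) = fun k s => solk phi (nonlin (fi n)) k (cl s)) by reflexivity.
assert (gi0 : gi 0%nat = fun _ _ => 0) by reflexivity.
assert (giS : forall n, gi (S n) = fun k s => solk dphi (dnonlin (fi n) (gi n) (fi (S n))) k (cl s)) by reflexivity.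
clearbody gi. clearbody fi.
assert (N0 : forall B, 0 <= B -> ndom B (fun _ _ => 0)) by apply ndom_0.
assert (Cz : cont2 (fun _ _ => 0)) by (intros k s; apply continuous_const).
assert (ZN : forall k s, nonlin (fun _ _ => 0) k s = 0).
{ intros k s. assert (K := proj2 (star2_ndom 0 0 _ _ (N0 0 (Rle_refl _)) (N0 0 (Rle_refl _))) k s).
  rewrite Rmult_0_r, Rmult_0_l in K. unfold nonlin.
  rewrite (Rabs_eq_0 _ (Rle_antisym _ _ K (Rabs_pos _))). ring. }
assert (ZG : forall k s, dnonlin (fun _ _ => 0) (fun _ _ => 0) (fun _ _ => 0) k s = 0).
{ intros k s. assert (K := proj2 (star2_ndom 0 0 _ _ (N0 0 (Rle_refl _)) (N0 0 (Rle_refl _))) k s).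
  assert (K' := proj2 (dstar2_ndom 0 0 _ _ (N0 0 (Rle_refl _)) (N0 0 (Rle_refl _))) k s).
  rewrite Rmult_0_r, Rmult_0_l in K, K'. unfold dnonlin.
  rewrite (Rabs_eq_0 _ (Rle_antisym _ _ K (Rabs_pos _))), (Rabs_eq_0 _ (Rle_antisym _ _ K' (Rabs_pos _))). ring. }
assert (Cc0 : forall k : R, continuous (fun _ : R => 0) k) by (intros; apply continuous_const).
assert (S0 : forall k s, solk (fun _ => 0) (fun _ _ => 0) k (cl s) = 0) by (intros; apply sol_zero; [easy|apply cl_in]).
assert (ndom_eq : forall B f g, (forall k s, f k s = g k s) -> ndom B f -> ndom B g).
{ intros B f g Efg [Q1 Q2]; split.
  - intros k s. apply continuous_ext with (2 := Q1 k s). intros; apply Efg.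
  - intros k s. rewrite <- Efg. apply Q2. }
assert (F : forall n, ndom A (fi n)).
{ induction n as [|n IH]; [rewrite fi0; apply N0; lra|]. rewrite fiS.
  assert (K := HS e0 (4 * conv_const * A * A) phi (fun _ => 0) (nonlin (fi n)) (fun _ _ => 0) ltac:(lra) ltac:(lra) Cphi Cc0).
  apply ndom_weaken with (C * (e0 + 4 * conv_const * A * A)).
  { assert (EA : C * e0 = A / 2) by (unfold A; field).
    replace (C * (e0 + 4 * conv_const * A * A)) with (C * e0 + 4 * ((conv_const * A * C) * A)) by ring.
    assert ((conv_const * A * C) * A <= 1 / 32 * A) by (apply Rmult_le_compat_r; lra). lra. }
  eapply ndom_eq; [|apply K].
  - intros k s. cbv beta. rewrite S0. ring.
  - intros k. rewrite Rminus_0_r. apply Bphi.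
  - apply (nonlin_cont A), IH.
  - easy.
  - intros k s _. rewrite <- (ZN k s). apply (nonlin_diff A A (fun _ _ => 0) (fi n)); [apply N0; lra|easy|].
    eapply ndom_eq; [|apply IH]. intros; cbv beta; ring. }
assert (Dn : forall n, ndom (A * (1/4) ^ n) (fun k s => 1 * fi (S n) k s + -1 * fi n k s)).
{ induction n as [|n IH].
  - eapply ndom_eq; [|apply ndom_weaken with (2 := F 1%nat)]; [intros; rewrite fi0; ring|simpl; lra].
  - assert (p4 : 0 < (1/4) ^ n) by (apply pow_lt; lra).
    assert (K := HS 0 (4 * conv_const * A * (A * (1/4) ^ n)) phi phi (nonlin (fi (S n))) (nonlin (fi n)) (Rle_refl _)).
    apply ndom_weaken with (C * (0 + 4 * conv_const * A * (A * (1/4) ^ n))).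
    { replace (C * (0 + 4 * conv_const * A * (A * (1/4) ^ n))) with (4 * (conv_const * A * C) * (A * (1/4) ^ n)) by ring.
      replace (A * (1/4) ^ S n) with (1/4 * (A * (1/4) ^ n)) by (simpl; ring).
      apply Rmult_le_compat_r; [apply Rmult_le_pos; lra|lra]. }
    eapply ndom_eq; [|apply K].
    + intros k s. now rewrite !fiS.
    + apply Rmult_le_pos; [lra|apply Rmult_le_pos; lra].
    + easy.
    + easy.
    + intros k. rewrite Rminus_diag, Rabs_R0. lra.
    + apply (nonlin_cont A), F.
    + apply (nonlin_cont A), F.
    + intros k s _. apply nonlin_diff; [apply F|apply F|apply IH]. }
assert (GG : forall n, ndom G (gi n)).
{ induction n as [|n IH]; [rewrite gi0; now apply N0|].
  set (H := 8 * conv_const * A * A + 2 * conv_const * (A * G + A * G) + 6 * A).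
  assert (KAG : 0 <= conv_const * A * G) by (apply Rmult_le_pos; lra).
  assert (HH : 0 <= H) by (unfold H; lra).
  assert (K := HS E H dphi (fun _ => 0) (dnonlin (fi n) (gi n) (fi (S n))) (fun _ _ => 0) HE HH Cdphi Cc0).
  apply ndom_weaken with (C * (E + H)).
  { unfold H. replace (C * _) with (G / 2 + 4 * (conv_const * A * C) * G) by (unfold G; field). nra. }
  eapply ndom_eq; [|apply K].
  - intros k s. cbv beta. rewrite S0, giS. ring.
  - intros k. rewrite Rminus_0_r. apply Bdphi.
  - apply (dnonlin_cont A G); [apply F|apply IH|apply F].
  - easy.
  - intros k s _. rewrite <- (ZG k s).
    apply (dnonlin_diff A G A G A (fun _ _ => 0) (fi n) (fun _ _ => 0) (gi n) (fun _ _ => 0) (fi (S n))).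
    + apply N0; lra.
    + apply F.
    + now apply N0.
    + exact IH.
    + eapply ndom_eq; [|apply (F n)]. intros; cbv beta; ring.
    + eapply ndom_eq; [|apply IH]. intros; cbv beta; ring.
    + eapply ndom_eq; [|apply (F (S n))]. intros; cbv beta; ring. }
set (K0 := C * (8 * conv_const * A * A + 2 * conv_const * A * G + 6 * A)).
assert (KAG : 0 <= conv_const * A * G) by (apply Rmult_le_pos; lra).
assert (HK0 : 0 <= K0) by (apply Rmult_le_pos; lra).
(* The error of [fi], of order [(1/4)^n], enters the error of [gi] as a forcing term. The slower
   rate [(1/2)^n] absorbs it: [4 * K0] in the constant makes the forcing at most a quarter of the
   error, and the linear part adds a sixteenth, together less than the half needed. *)
assert (gauss_der : forall n, ndom ((G + 4 * K0) * (1/2) ^ n) (fun k s => 1 * gi (S n) k s + -1 * gi n k s)).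
{ induction n as [|n IH].
  - eapply ndom_eq; [|apply ndom_weaken with (2 := GG 1%nat)]; [intros; rewrite gi0; ring|simpl; lra].
  - assert (p4 : 0 < (1/4) ^ n) by (apply pow_lt; lra). assert (p2 : 0 < (1/2) ^ n) by (apply pow_lt; lra).
    assert (p42 : (1/4) ^ n <= (1/2) ^ n) by (apply pow_incr; lra).
    assert (D1 := Dn (S n)).
    assert (D1' : ndom (A * (1/4) ^ n) (fun k s => 1 * fi (S (S n)) k s + -1 * fi (S n) k s)).
    { apply ndom_weaken with (2 := D1). simpl. assert (0 <= A * (1/4) ^ n) by (apply Rmult_le_pos; lra). lra. }
    set (X := (G + 4 * K0) * (1/2) ^ n) in *.
    assert (HX : 0 <= X) by (apply Rmult_le_pos; lra).
    set (H := 8 * conv_const * A * (A * (1/4) ^ n) + 2 * conv_const * ((A * (1/4) ^ n) * G + A * X) + 6 * (A * (1/4) ^ n)).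
    assert (HXA : 0 <= conv_const * A * X) by (apply Rmult_le_pos; lra).
    assert (HE2 : C * (0 + H) = K0 * (1/4) ^ n + 2 * (conv_const * A * C) * X) by (unfold H, K0; ring).
    assert (HH : 0 <= H).
    { unfold H. assert (0 <= conv_const * A * A * (1/4) ^ n) by (apply Rmult_le_pos; lra).
      assert (0 <= conv_const * A * G * (1/4) ^ n) by (apply Rmult_le_pos; lra). assert (0 <= A * (1/4) ^ n) by (apply Rmult_le_pos; lra). lra. }
    assert (K := HS 0 H dphi dphi (dnonlin (fi (S n)) (gi (S n)) (fi (S (S n)))) (dnonlin (fi n) (gi n) (fi (S n))) (Rle_refl _) HH Cdphi Cdphi).
    apply ndom_weaken with (C * (0 + H)).
    { rewrite HE2. replace ((G + 4 * K0) * (1/2) ^ S n) with (X / 2) by (unfold X; simpl; field).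
      assert (K0 * (1/4) ^ n <= K0 * (1/2) ^ n) by (apply Rmult_le_compat_l; lra).
      assert (4 * K0 * (1/2) ^ n <= X) by (unfold X; apply Rmult_le_compat_r; lra).
      assert (2 * (conv_const * A * C) * X <= 1/16 * X) by (apply Rmult_le_compat_r; lra). lra. }
    eapply ndom_eq; [|apply K].
    + intros k s. now rewrite !giS.
    + intros k. rewrite Rminus_diag, Rabs_R0. lra.
    + apply (dnonlin_cont A G); [apply F|apply GG|apply F].
    + apply (dnonlin_cont A G); [apply F|apply GG|apply F].
    + intros k s _. apply dnonlin_diff; [apply F|apply F|apply GG|apply GG|apply Dn|apply IH|apply D1']. }
assert (Dn2 : forall n, ndom (A * (1/2) ^ n) (fun k s => 1 * fi (S n) k s + -1 * fi n k s)).
{ intros n. apply ndom_weaken with (2 := Dn n). apply Rmult_le_compat_l; [lra|]. apply pow_incr; lra. }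
destruct (ndom_lim A A fi ltac:(lra) F Dn2) as [Lf [Lfd Lfu]].
destruct (ndom_lim G (G + 4 * K0) gi ltac:(lra) GG gauss_der) as [Lg [_ Lgu]].
set (f := fun k s => real (Lim_seq (fun n => fi n k s))) in *.
set (g := fun k s => real (Lim_seq (fun n => gi n k s))) in *.
change (forall k s n, Rabs (f k s - fi n k s) <= 4 * A * (1/2) ^ n) in Lfu.
change (forall k s n, Rabs (g k s - gi n k s) <= 4 * (G + 4 * K0) * (1/2) ^ n) in Lgu.
assert (Dfi : forall n k s, is_derive (fun k => fi n k s) k (gi n k s)).
{ induction n as [|n IH]; intros k s.
  - rewrite fi0, gi0. apply (is_derive_const (K := R_AbsRing) (V := R_NormedModule) 0).
  - assert (Ch : cont2 (nonlin (fi n))) by (apply (nonlin_cont A), F).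
    assert (Cg : cont2 (dnonlin (fi n) (gi n) (fi (S n)))) by (apply (dnonlin_cont A G); [apply F|apply GG|apply F]).
    assert (Cd : cont2 (fun k s => dnonlin (fi n) (gi n) (fi (S n)) k s - dz k * fi (S n) k s)).
    { apply (cont2_plus _ (fun k s => - (dz k * fi (S n) k s))); [easy|]. apply cont2_opp.
      apply (cont2_mult (fun k _ => dz k)); [apply (cont2_fst dz), dz_cont|apply F]. }
    destruct (solk_derive phi (dphi k) (nonlin (fi n)) (fun k s => dnonlin (fi n) (gi n) (fi (S n)) k s - dz k * fi (S n) k s) k Cphi (Dphi k) Ch Cd) with (s := cl s) as [K _].
    + intros k' s'. apply (nonlin_derive A G); [apply F|apply GG|apply IH].
    + apply cl_in.
    + rewrite giS. unfold solk at 1.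
      destruct (sol_ext_in k (dphi k) (fun s0 => dnonlin (fi n) (gi n) (fi (S n)) k s0 - dz k * fi (S n) k s0 + (4 * k ^ 3 - 2 * k) * solk phi (nonlin (fi n)) k s0)
        (dnonlin (fi n) (gi n) (fi (S n)) k) (cl s)) as [E1 _].
      * intros t. apply (continuous_plus (fun s0 => dnonlin (fi n) (gi n) (fi (S n)) k s0 - dz k * fi (S n) k s0)); [now apply (cont2_2 (fun k s => dnonlin (fi n) (gi n) (fi (S n)) k s - dz k * fi (S n) k s))|].
        apply (continuous_mult (fun _ => 4 * k ^ 3 - 2 * k)); [apply continuous_const|].
        apply (is_sol_cont _ _ _ _ _ _ (solk_is_sol phi (nonlin (fi n)) k Ch)).
      * intros t. now apply (cont2_2 (dnonlin (fi n) (gi n) (fi (S n)))).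
      * intros t Ht. rewrite fiS, (cl_id t) by easy. unfold dz. Rring.
      * apply cl_in.
      * rewrite <- E1. apply is_derive_ext with (2 := K). intros; now rewrite fiS. }
exists f, g, A, G. split; [easy|split; [easy|split]].
- intros k s.
  assert (K : forall n, Rabs (f k s - solk phi (nonlin f) k (cl s)) <= (2 + C * (16 * conv_const * A + 0)) * A * 2 * (1/2) ^ n).
  { intros n.
    assert (Q := HS 0 (4 * conv_const * A * (2 * A * (1/2) ^ n)) phi phi (nonlin f) (nonlin (fi n)) (Rle_refl _)).
    assert (p2 : 0 < (1/2) ^ n) by (apply pow_lt; lra).
    destruct Q as [_ Q]; try easy.
    - apply Rmult_le_pos; [lra|]. apply Rmult_le_pos; lra.
    - intros k'. rewrite Rminus_diag, Rabs_R0. lra.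
    - apply (nonlin_cont A), Lf.
    - apply (nonlin_cont A), F.
    - intros k' s' _. apply nonlin_diff; [apply F|apply Lf|apply Lfd].
    - specialize (Q k s). cbv beta in Q.
      assert (EfS : solk phi (nonlin (fi n)) k (cl s) = fi (S n) k s) by now rewrite fiS.
      rewrite EfS in Q.
      assert (R1 := Lfu k s (S n)). simpl pow in R1.
      assert (W := wt_le_om qn k). assert (W1 := om_le1 k). assert (Y := Yw_le2 k (cl s) (cl_in s)).
      assert (W0 := wt_gt0 qn k). assert (Y0 := Yw_gt0 k (cl s)).
      assert (synth : wt qn k * Yw k (cl s) <= 1 * 2) by (apply Rmult_le_compat; lra).
      set (Z := C * (0 + 4 * conv_const * A * (2 * A * (1/2) ^ n))) in *.
      assert (HZ : 0 <= Z).
      { unfold Z. apply Rmult_le_pos; [lra|]. assert (0 <= conv_const * A * A * (1/2) ^ n) by (apply Rmult_le_pos; lra). lra. }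
      assert (Q2 : Rabs (1 * solk phi (nonlin f) k (cl s) + -1 * fi (S n) k s) <= Z * 2).
      { apply Rle_trans with (1 := Q). apply Rmult_le_compat_l; lra. }
      replace (f k s - solk phi (nonlin f) k (cl s)) with ((f k s - fi (S n) k s) - (1 * solk phi (nonlin f) k (cl s) + -1 * fi (S n) k s)) by ring.
      unfold Rminus at 1. apply Rle_trans with (1 := Rabs_triang _ _). rewrite Rabs_Ropp.
      assert (A * (1/2) ^ n >= 0) by (apply Rle_ge, Rmult_le_pos; lra).
      unfold Z in Q2. assert (0 <= C * conv_const * A * (A * (1/2) ^ n)).
      { apply Rmult_le_pos; [|lra]. rewrite Rmult_assoc. apply Rmult_le_pos; lra. }
      nra. }
  apply Rabs_small_eq. intros eps He.
  destruct (half_pow_small ((2 + C * (16 * conv_const * A + 0)) * A * 2) eps) as [N HN]; [|easy|].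
  + apply Rmult_le_pos; [|lra]. apply Rmult_le_pos; [|lra]. assert (0 <= C * (16 * conv_const * A + 0)) by (apply Rmult_le_pos; lra). lra.
  + specialize (HN N (Nat.le_refl _)). specialize (K N). lra.
- intros k s. apply is_derive_Reals.
  apply (derivable_pt_lim_CVU (fun n k => fi n k s) (fun n k => gi n k s) (fun k => f k s) (fun k => g k s) k k (mkposreal 1 Rlt_0_1)).
  + unfold Boule. rewrite Rminus_diag, Rabs_R0. simpl; lra.
  + intros y n _. apply is_derive_Reals, Dfi.
  + intros y _ eps He. destruct (half_pow_small (4 * A) eps) as [N HN]; [lra|easy|]. exists N. intros n Hn.
    unfold Rdist. rewrite Rabs_minus_sym. apply Rle_lt_trans with (1 := Lfu y s n). now apply HN.
  + intros eps He. destruct (half_pow_small (4 * (G + 4 * K0)) eps) as [N HN]; [lra|easy|]. exists N. intros n y Hn _.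
    apply Rle_lt_trans with (1 := Lgu y s n). now apply HN.
  + intros y _. apply continuity_pt_filterlim. apply (cont2_1 g). apply Lg.
Qed.

End Picard.

(** * Smoothness in k *)

Section Smooth.
Context {P : params}.

Definition boundW (p : nat) (f : R -> R -> R) : Prop :=
  cont2 f /\ exists A, 0 <= A /\ forall k s, Rabs (f k s) <= A * ((1 + Rabs k) ^ p * (wt qn k * Yw k (cl s))).

(** Every derivative in [k] gets the same polynomial loss [p]. No gain under differentiation is
    asked for, since at interior [s] the exponential weight beats any power. *)
Fixpoint smoothW (p n : nat) (f : R -> R -> R) : Prop :=
  boundW p f /\ match n with
  | O => True
  | S n => exists g, (forall k s, is_derive (fun k => f k s) k (g k s)) /\ smoothW p n g
  end.

Lemma smoothW_bd p n f : smoothW p n f -> boundW p f.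
Proof. destruct n; simpl; tauto. Qed.

Lemma smoothW_pred p n f : smoothW p (S n) f -> smoothW p n f.
Proof.
revert f. induction n as [|n IH]; intros f [H1 [g [H2 H3]]].
- now split.
- split; [easy|]. exists g; split; [easy|]. now apply IH.
Qed.

Lemma smoothW_le p n m f : (m <= n)%nat -> smoothW p n f -> smoothW p m f.
Proof. intros H. induction H; [easy|]. intros H1. apply IHle, smoothW_pred, H1. Qed.

Lemma boundW_weaken p p' f : (p <= p')%nat -> boundW p f -> boundW p' f.
Proof.
intros Hp [Hc [A [HA Hb]]]. split; [easy|]. exists A; split; [easy|]. intros k s.
apply Rle_trans with (1 := Hb k s). apply Rmult_le_compat_l; [easy|].
apply Rmult_le_compat_r; [left; apply wY_gt0|]. apply Rle_pow; [apply abs1_ge1|easy].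
Qed.

Lemma smoothW_weaken p p' n f : (p <= p')%nat -> smoothW p n f -> smoothW p' n f.
Proof.
intros Hp. revert f. induction n as [|n IH]; intros f [H1 H2]; (split; [now apply (boundW_weaken p)|]).
- easy.
- destruct H2 as [g [H2 H3]]. exists g; split; [easy|]. now apply IH.
Qed.

Lemma boundW_ext p f g : (forall k s, f k s = g k s) -> boundW p f -> boundW p g.
Proof.
intros E [Hc [A [HA Hb]]]. split.
- intros k s. apply continuous_ext with (2 := Hc k s). intros; apply E.
- exists A; split; [easy|]. intros k s. rewrite <- E. apply Hb.
Qed.

Lemma smoothW_ext p n f g : (forall k s, f k s = g k s) -> smoothW p n f -> smoothW p n g.
Proof.
intros E. destruct n as [|n]; intros [H1 H2]; (split; [now apply (boundW_ext p f)|]).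
- easy.
- destruct H2 as [h [H2 H3]]. exists h; split; [|easy]. intros k s.
  apply is_derive_ext with (2 := H2 k s). intros; apply E.
Qed.

Lemma boundW_lin p a b f g : boundW p f -> boundW p g -> boundW p (fun k s => a * f k s + b * g k s).
Proof.
intros [Hf [A [HA Bf]]] [Hg [B [HB Bg]]]. split; [now apply cont2_lin|].
exists (Rabs a * A + Rabs b * B). assert (H1 := Rabs_pos a). assert (H2 := Rabs_pos b).
split; [apply Rplus_le_le_0_compat; now apply Rmult_le_pos|].
intros k s. apply Rle_trans with (1 := Rabs_triang _ _). rewrite !Rabs_mult, Rmult_plus_distr_r, !Rmult_assoc.
apply Rplus_le_compat; apply Rmult_le_compat_l; easy || apply Bf || apply Bg.
Qed.

Lemma smoothW_lin p n a b f g : smoothW p n f -> smoothW p n g -> smoothW p n (fun k s => a * f k s + b * g k s).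
Proof.
revert f g. induction n as [|n IH]; intros f g [H1 H2] [H3 H4]; (split; [now apply boundW_lin|]).
- easy.
- destruct H2 as [df [H2 H5]]. destruct H4 as [dg [H4 H6]].
  exists (fun k s => a * df k s + b * dg k s). split; [|now apply IH]. intros k s.
  apply (is_derive_plus (fun k => a * f k s) (fun k => b * g k s)); apply is_derive_scal; [apply H2|apply H4].
Qed.

Lemma boundW_mulk p f : boundW p f -> boundW (S p) (fun k s => k * f k s).
Proof.
intros [Hf [A [HA Bf]]]. split.
- apply (cont2_mult (fun k _ => k)); [apply (cont2_fst (fun k => k)); intros; apply continuous_id|easy].
- exists A; split; [easy|]. intros k s. rewrite Rabs_mult.
  replace (A * ((1 + Rabs k) ^ S p * (wt qn k * Yw k (cl s)))) with ((1 + Rabs k) * (A * ((1 + Rabs k) ^ p * (wt qn k * Yw k (cl s))))) by (simpl; ring).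
  apply Rmult_le_compat; try apply Rabs_pos; [lra|apply Bf].
Qed.

Lemma smoothW_mulk p n f : smoothW p n f -> smoothW (S p) n (fun k s => k * f k s).
Proof.
revert f. induction n as [|n IH]; intros f [H1 H2]; (split; [now apply boundW_mulk|]).
- easy.
- destruct H2 as [g [H2 H3]]. exists (fun k s => 1 * f k s + 1 * (k * g k s)). split.
  + intros k s. assert (D := H2 k s). auto_derive; [eexists; eassumption|]. use_der D. ring.
  + apply smoothW_lin; [|now apply IH]. apply (smoothW_weaken p); [lia|]. apply smoothW_pred. split; [easy|]. now exists g.
Qed.

Lemma smoothW_mulpow p n m f : smoothW p n f -> smoothW (m + p) n (fun k s => k ^ m * f k s).
Proof.
intros H. induction m as [|m IH].
- apply smoothW_ext with (2 := H). intros; simpl; ring.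
- apply smoothW_ext with (2 := smoothW_mulk _ _ _ IH). intros; simpl; ring.
Qed.

Lemma boundW_0 f : boundW 0 f <-> exists A, ndom A f.
Proof.
split.
- intros [Hc [A [HA Hb]]]. exists A; split; [easy|]. intros k s. apply Rle_trans with (1 := Hb k s). right; simpl; ring.
- intros [A HA]. assert (H0 := ndom_ge0 _ _ HA). destruct HA as [Hc Hb]. split; [easy|]. exists A; split; [easy|].
  intros k s. apply Rle_trans with (1 := Hb k s). right; simpl; ring.
Qed.

Lemma smoothW_rf n f : smoothW 0 n f -> smoothW 0 n (rf f).
Proof.
revert f. induction n as [|n IH]; intros f [H1 H2].
- split; [|easy]. apply boundW_0. apply boundW_0 in H1. destruct H1 as [A HA]. exists A. now apply ndom_rf.
- split; [apply boundW_0; apply boundW_0 in H1; destruct H1 as [A HA]; exists A; now apply ndom_rf|].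
  destruct H2 as [g [H2 H3]]. exists (fun k s => -1 * rf g k s + 0 * rf g k s). split.
  + intros k s. unfold rf. replace (-1 * g (- k) s + 0 * g (- k) s) with (-1 * g (- k) s) by ring.
    apply (is_derive_comp (fun k => f k s) (fun k => - k)); [apply H2|auto_derive; [easy|ring]].
  + apply smoothW_lin; now apply IH.
Qed.

Lemma conv_comm C D f g k : dom C f -> dom D g -> conv f g k = conv g f k.
Proof.
intros Hf Hg. unfold conv.
assert (I := conv_dom_integrand _ _ _ _ k Hf Hg).
rewrite <- (intR_flip _ _ I).
rewrite <- (intR_shift _ _ (- k) (dom_flip _ _ I)).
apply intR_ext. intros l.
replace (k - - (l + - k)) with l by ring. replace (- (l + - k)) with (k - l) by ring. ring.
Qed.

(** Each derivative is spent on a factor that still has one to give: on the second factor by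
    [conv_derive], and once that is exhausted on the first by commutativity. Hence the orders
    add. *)
Lemma conv2_SmW a b f g : smoothW 0 a f -> smoothW 0 b g -> smoothW 0 (a + b) (conv2 f g).
Proof.
remember (a + b)%nat as n eqn:gauss_der. revert a b f g gauss_der.
induction n as [|n IH]; intros a b f g gauss_der Hf Hg.
- split; [|easy]. apply boundW_0.
  destruct (proj1 (boundW_0 _) (smoothW_bd _ _ _ Hf)) as [A HA]. destruct (proj1 (boundW_0 _) (smoothW_bd _ _ _ Hg)) as [B HB].
  exists (conv_const * A * B). now apply conv2_ndom.
- destruct (proj1 (boundW_0 _) (smoothW_bd _ _ _ Hf)) as [A HA]. destruct (proj1 (boundW_0 _) (smoothW_bd _ _ _ Hg)) as [B HB].
  split; [apply boundW_0; exists (conv_const * A * B); now apply conv2_ndom|].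
  destruct b as [|b].
  + destruct a as [|a]; [lia|]. destruct Hf as [_ [df [D1 D2]]].
    destruct (proj1 (boundW_0 _) (smoothW_bd _ _ _ D2)) as [A' HA'].
    exists (conv2 df g). split; [|apply (IH a O); [lia|easy|easy]].
    intros k s. unfold conv2.
    assert (Df := dom2_1 _ _ s (ndom_dom2 _ _ HA)). assert (Dg := dom2_1 _ _ s (ndom_dom2 _ _ HB)).
    assert (Ddf := dom2_1 _ _ s (ndom_dom2 _ _ HA')).
    rewrite (conv_comm _ _ _ _ k Ddf Dg).
    apply is_derive_ext with (fun k => conv (fun l => g l s) (fun l => f l s) k).
    * intros t. apply (conv_comm _ _ _ _ t Dg Df).
    * apply (conv_derive _ _ _ _ _ _ k Dg Df Ddf). intros; apply D1.
  + destruct Hg as [_ [dg [D1 D2]]].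
    destruct (proj1 (boundW_0 _) (smoothW_bd _ _ _ D2)) as [B' HB'].
    exists (conv2 f dg). split; [|apply (IH a b); [lia|easy|easy]].
    intros k s. unfold conv2.
    apply (conv_derive _ _ _ _ _ _ k (dom2_1 _ _ s (ndom_dom2 _ _ HA)) (dom2_1 _ _ s (ndom_dom2 _ _ HB)) (dom2_1 _ _ s (ndom_dom2 _ _ HB'))).
    intros; apply D1.
Qed.

Lemma star2_SmW a b f g : smoothW 0 a f -> smoothW 0 b g -> smoothW 0 (a + b) (star2 f g).
Proof.
intros Hf Hg. assert (Rff := smoothW_rf _ _ Hf). assert (Rg := smoothW_rf _ _ Hg).
assert (N1 := conv2_SmW _ _ _ _ Hf Hg). assert (N2 := conv2_SmW _ _ _ _ Rff Hg).
assert (N3 := conv2_SmW _ _ _ _ Hf Rg). assert (N4 := conv2_SmW _ _ _ _ Rff Rg).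
assert (M1 := smoothW_lin _ _ 1 1 _ _ N1 N2). assert (M2 := smoothW_lin _ _ 1 (-1) _ _ N3 N4).
apply smoothW_ext with (2 := smoothW_lin _ _ (/ 2) (/ 2) _ _ M1 M2). intros k s. unfold star2, comb. ring.
Qed.

Fixpoint smooth_datum (n : nat) (phi : R -> R) : Prop :=
  ((forall k, continuous phi k) /\ exists E, 0 <= E /\ forall k, Rabs (phi k) <= E * wt qn k) /\
  match n with
  | O => True
  | S n => exists psi, (forall k, is_derive phi k (psi k)) /\ smooth_datum n psi
  end.

Lemma smooth_datum_pred n phi : smooth_datum (S n) phi -> smooth_datum n phi.
Proof.
revert phi. induction n as [|n IH]; intros f [H1 [g [H2 H3]]].
- now split.
- split; [easy|]. exists g; split; [easy|]. now apply IH.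
Qed.

Lemma abs1_pow4 k : (1 + Rabs k) ^ 4 <= 8 * (1 + k ^ 4).
Proof.
replace (k ^ 4) with ((Rabs k) ^ 4) by (replace (Rabs k ^ 4) with ((Rabs k ^ 2) ^ 2) by ring; rewrite pow2_abs; ring).
set (m := Rabs k).
assert (Q1 : (1 + m) ^ 2 <= 2 * (1 + m ^ 2)) by (assert (0 <= (1 - m) ^ 2) by apply pow2_ge_0; nra).
assert (Q2 : (1 + m ^ 2) ^ 2 <= 2 * (1 + m ^ 4)).
{ assert (0 <= (1 - m ^ 2) ^ 2) by apply pow2_ge_0. nra. }
assert (Q3 : ((1 + m) ^ 2) ^ 2 <= (2 * (1 + m ^ 2)) ^ 2) by (apply pow_incr; split; [apply pow2_ge_0|easy]).
replace ((1 + m) ^ 4) with (((1 + m) ^ 2) ^ 2) by ring. lra.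
Qed.

Lemma solk_bdW phi h : smooth_datum 0 phi -> boundW 4 h -> boundW 0 (fun k s => solk phi h k (cl s)).
Proof.
intros [[Cp [E [HE Bp]]] _] [Ch [H [HH Bh]]]. apply boundW_0.
destruct solk_diff_bound as [C [HC HS]].
assert (Cc0 : forall k : R, continuous (fun _ : R => 0) k) by (intros; apply continuous_const).
assert (Cz : cont2 (fun _ _ => 0)) by (intros k s; apply continuous_const).
exists (C * (E + 8 * H)).
destruct (HS E (8 * H) phi (fun _ => 0) h (fun _ _ => 0) HE ltac:(lra) Cp Cc0) as [Q1 Q2].
- intros k. rewrite Rminus_0_r. apply Bp.
- easy.
- easy.
- intros k s _. rewrite Rminus_0_r. apply Rle_trans with (1 := Bh k s).
  replace (8 * H * (1 + k ^ 4) * (wt qn k * Yw k (cl s))) with (H * ((8 * (1 + k ^ 4)) * (wt qn k * Yw k (cl s)))) by ring.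
  apply Rmult_le_compat_l; [easy|]. apply Rmult_le_compat_r; [left; apply wY_gt0|apply abs1_pow4].
- assert (Ez : forall k s, 1 * solk phi h k (cl s) + -1 * solk (fun _ => 0) (fun _ _ => 0) k (cl s) = solk phi h k (cl s)).
  { intros k s. rewrite sol_zero; [ring|easy|apply cl_in]. }
  split.
  + intros k s. apply continuous_ext with (2 := Q1 k s). intros; apply Ez.
  + intros k s. rewrite <- Ez. apply Q2.
Qed.

(** The derivative in [k] solves the same problem with datum [psi] and with the extra source
    [(4 k^3 - 2 k) y]. As [y] itself has no polynomial loss, this stays within loss 4, which the
    inversion removes, and the induction repeats. *)
Lemma solk_SmW n phi h : smooth_datum n phi -> smoothW 4 n h -> smoothW 0 n (fun k s => solk phi h k (cl s)).
Proof.
revert phi h. induction n as [|n IH]; intros phi h Hp Hh.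
- split; [|easy]. apply solk_bdW; [easy|apply Hh].
- assert (Hb : boundW 0 (fun k s => solk phi h k (cl s))).
  { apply solk_bdW; [split; [apply Hp|easy]|apply Hh]. }
  split; [easy|].
  assert (Y := IH phi h (smooth_datum_pred _ _ Hp) (smoothW_pred _ _ _ Hh)).
  destruct Hp as [[Cp _] [psi [Dp Hpsi]]]. destruct Hh as [[Ch _] [dh [Dh Hdh]]].
  set (y := fun k s => solk phi h k (cl s)) in *.
  assert (Hz : smoothW 4 n (fun k s => 1 * dh k s + 1 * (4 * (k ^ 3 * y k s) + -2 * (k ^ 1 * y k s)))).
  { apply smoothW_lin; [easy|]. apply smoothW_lin.
    - apply (smoothW_weaken (3 + 0)); [lia|]. now apply smoothW_mulpow.
    - apply (smoothW_weaken (1 + 0)); [lia|]. now apply smoothW_mulpow. }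
  set (H := fun k s => 1 * dh k s + 1 * (4 * (k ^ 3 * y k s) + -2 * (k ^ 1 * y k s))) in *.
  exists (fun k s => solk psi H k (cl s)). split; [|now apply IH].
  intros k s.
  assert (Cdh : cont2 dh) by apply (smoothW_bd _ _ _ Hdh).
  destruct (solk_derive phi (psi k) h dh k Cp (Dp k) Ch Cdh Dh (cl s) (cl_in s)) as [K _].
  replace (solk psi H k (cl s)) with (sol (zz k) (psi k) (fun s => dh k s + (4 * k ^ 3 - 2 * k) * solk phi h k s) (cl s)); [exact K|].
  apply sol_ext_in; [| | |apply cl_in].
  + intros t. apply (continuous_plus (dh k)); [now apply (cont2_2 dh)|].
    apply (continuous_mult (fun _ => 4 * k ^ 3 - 2 * k)); [apply continuous_const|].
    apply (is_sol_cont _ _ _ _ _ _ (solk_is_sol phi h k Ch)).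
  + intros t. apply (cont2_2 H). apply (smoothW_bd _ _ _ Hz).
  + intros t Ht. unfold H, y. rewrite (cl_id t) by easy. Rring.
Qed.

Lemma nonlin_SmW n f : smoothW 0 n f -> smoothW 4 (n + n) (nonlin f).
Proof.
intros Hf. assert (Hs := star2_SmW _ _ _ _ Hf Hf).
apply (smoothW_weaken (2 + 0)); [lia|].
apply smoothW_ext with (2 := smoothW_lin _ _ (-1) 0 _ _ (smoothW_mulpow _ _ 2 _ Hs) (smoothW_mulpow _ _ 2 _ Hs)).
intros k s. unfold nonlin. ring.
Qed.

(* Bootstrapping: one k-derivative is doubled by the convolution, since derivatives may be put on either factor. *)
Lemma fixed_point_SmW phi f : (forall n, smooth_datum n phi) -> smoothW 0 1 f ->
  (forall k s, f k s = solk phi (nonlin f) k (cl s)) -> forall n, smoothW 0 n f.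
Proof.
intros Hp H1 E.
assert (K : forall n, smoothW 0 (S n) f).
{ induction n as [|n IH]; [easy|].
  apply smoothW_ext with (fun k s => solk phi (nonlin f) k (cl s)); [intros; now rewrite E|].
  apply solk_SmW; [apply Hp|]. apply (smoothW_le 4 (S n + S n)); [lia|]. now apply nonlin_SmW. }
intros n. apply smoothW_pred, K.
Qed.

(** * The kernel [cas] and decay in [x] *)

Definition cas (y : R) : R := cos y + sin y.

Lemma cas_bound y : Rabs (cas y) <= 2.
Proof.
unfold cas. apply Rle_trans with (1 := Rabs_triang _ _).
assert (H1 := COS_bound y). assert (H2 := SIN_bound y).
assert (Rabs (cos y) <= 1) by (apply Rabs_le_between; lra).
assert (Rabs (sin y) <= 1) by (apply Rabs_le_between; lra). lra.
Qed.

(** Differentiation is a phase shift by [PI / 2], so all derivatives in [x] have one formula: a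
    power of [k] and a shifted phase. *)
Lemma cas_derive y : is_derive cas y (cas (y + PI / 2)).
Proof.
unfold cas. auto_derive; [easy|]. replace (PI * / 2) with (PI / 2) by (unfold Rdiv; ring).
rewrite sin_plus, cos_plus, sin_PI2, cos_PI2. ring.
Qed.

Lemma cas_cont y : continuous cas y.
Proof. apply (ex_derive_continuous cas). eexists; apply cas_derive. Qed.

Lemma cas_derive_lin a b y : is_derive (fun y => cas (a * y + b)) y (a * cas (a * y + b + PI / 2)).
Proof.
apply (is_derive_comp cas (fun y => a * y + b)); [apply cas_derive|auto_derive; [easy|ring]].
Qed.

Lemma cas_cont_lin a b k : continuous (fun k => cas (k * a + b)) k.
Proof.
apply (continuous_comp (fun k => k * a + b) cas); [|apply cas_cont].
apply (continuous_plus (fun k => k * a) (fun _ => b)); [|apply continuous_const].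
apply (continuous_mult (fun k : R => k) (fun _ => a)); [apply continuous_id|apply continuous_const].
Qed.

Lemma exp_rapid s0 a : 0 < s0 -> exists C, 0 < C /\ forall m, 0 <= m -> exp (- (m * s0)) * (1 + m) ^ a <= C.
Proof.
intros Hs. set (d := s0 / INR (S a)).
assert (Ha : 0 < INR (S a)) by (apply lt_0_INR; lia).
assert (Hd : 0 < d) by now apply Rdiv_lt_0_compat.
set (c := Rmin 1 d). assert (Hc : 0 < c) by (apply Rmin_glb_lt; lra).
assert (Hc1 : c <= 1) by apply Rmin_l. assert (Hc2 : c <= d) by apply Rmin_r.
exists ((/ c) ^ a). split; [apply pow_lt; now apply Rinv_0_lt_compat|]. intros m Hm.
assert (E : 1 + m <= / c * exp (m * d)).
{ apply Rmult_le_reg_l with c; [easy|]. rewrite <- Rmult_assoc, Rinv_r, Rmult_1_l by lra.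
  apply Rle_trans with (2 := exp_ineq1_le (m * d)). nra. }
assert (E2 : (1 + m) ^ a <= (/ c) ^ a * exp (m * s0)).
{ apply Rle_trans with ((/ c * exp (m * d)) ^ a); [apply pow_incr; lra|].
  rewrite Rpow_mult_distr. apply Rmult_le_compat_l; [left; apply pow_lt; now apply Rinv_0_lt_compat|].
  assert (X : forall n, exp (m * d) ^ n = exp (INR n * (m * d))).
  { induction n as [|n IHn]; [simpl; rewrite Rmult_0_l, exp_0; easy|].
    rewrite S_INR. simpl pow. rewrite IHn, <- exp_plus. f_equal; ring. }
  rewrite X. apply exp_le_mono. replace (INR a * (m * d)) with (m * (INR a * d)) by ring.
  apply Rmult_le_compat_l; [easy|]. unfold d. rewrite S_INR.
  apply Rmult_le_reg_r with (INR a + 1); [rewrite <- S_INR; lra|].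
  replace (INR a * (s0 / (INR a + 1)) * (INR a + 1)) with (INR a * s0) by (field; rewrite <- S_INR; lra). lra. }
apply Rle_trans with (exp (- (m * s0)) * ((/ c) ^ a * exp (m * s0))).
- apply Rmult_le_compat_l; [left; apply exp_pos|easy].
- replace (exp (- (m * s0)) * ((/ c) ^ a * exp (m * s0))) with ((/ c) ^ a * (exp (- (m * s0)) * exp (m * s0))) by ring.
  rewrite <- exp_plus. replace (- (m * s0) + m * s0) with 0 by ring. rewrite exp_0; lra.
Qed.

Lemma Yw_rapid s0 a : 0 < s0 -> exists C, 0 < C /\ forall k s, s0 <= s <= SS - s0 ->
  (1 + Rabs k) ^ a * Yw k s <= C.
Proof.
intros Hs. destruct (exp_rapid s0 a Hs) as [C [HC H]]. exists (2 * C); split; [lra|].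
intros k s Hks. specialize (H (Rabs k) (Rabs_pos k)). assert (Hk := Rabs_pos k).
assert (E : Yw k s <= 2 * exp (- (Rabs k * s0))).
{ unfold Yw. assert (exp (- (Rabs k * s)) <= exp (- (Rabs k * s0))) by (apply exp_le_mono; nra).
  assert (exp (- (Rabs k * (SS - s))) <= exp (- (Rabs k * s0))) by (apply exp_le_mono; nra). lra. }
assert (Pw := pow_abs1 k a).
assert ((1 + Rabs k) ^ a * Yw k s <= (1 + Rabs k) ^ a * (2 * exp (- (Rabs k * s0)))) by (apply Rmult_le_compat_l; lra).
lra.
Qed.

Lemma cl_in_mid s0 s : 0 < s0 -> s0 <= s <= SS - s0 -> cl s = s.
Proof. intros; apply cl_id; lra. Qed.

Lemma boundW_dom p F s0 : 0 < s0 -> boundW p F -> exists C, 0 <= C /\ forall s, s0 <= s <= SS - s0 -> dom C (fun k => F k s).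
Proof.
intros Hs [Hc [A [HA Hb]]]. destruct (Yw_rapid s0 p Hs) as [C [HC HY]].
exists (A * C). split; [apply Rmult_le_pos; lra|]. intros s Hss. split; intros k; [now apply cont2_1|].
apply Rle_trans with (1 := Hb k s). rewrite (cl_in_mid s0) by easy. rewrite !Rmult_assoc.
apply Rmult_le_compat_l; [easy|]. specialize (HY k s Hss).
assert (W := wt_le_om qn k). assert (W0 := wt_gt0 qn k). assert (Y0 := Yw_gt0 k s). assert (Pw := pow_abs1 k p).
replace ((1 + Rabs k) ^ p * (wt qn k * Yw k s)) with (((1 + Rabs k) ^ p * Yw k s) * wt qn k) by ring.
apply Rmult_le_compat; try lra. apply Rmult_le_pos; lra.
Qed.

Lemma dom_cas C f x c : dom C f -> dom (C * 2) (fun k => f k * cas (k * x + c)).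
Proof. intros Hf. apply dom_mult_gen; [easy|apply cas_cont_lin|intros; apply cas_bound]. Qed.

Lemma intR_cas_by_parts C D f g x c : dom C f -> dom D g -> (forall k, is_derive f k (g k)) ->
  x * intR (fun k => f k * cas (k * x + c)) = - intR (fun k => g k * cas (k * x + (c - PI / 2))).
Proof.
intros Hf Hg H.
assert (D1 := dom_cas _ _ x c Hf). assert (D2 := dom_cas _ _ x (c - PI / 2) Hg).
assert (D3 := dom_cas _ _ x (c - PI / 2) Hf). assert (D4 := dom_scal _ x _ D1).
assert (Z : intR (fun k => g k * cas (k * x + (c - PI / 2)) + x * (f k * cas (k * x + c))) = 0).
{ apply (intR_derive _ _ _ _ D3 (dom_plus _ _ _ _ D2 D4)). intros k.
  replace (x * (f k * cas (k * x + c))) with (f k * (x * cas (k * x + c))) by ring.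
  apply (is_derive_mult f (fun k => cas (k * x + (c - PI / 2)))); [apply H| |intros; apply Rmult_comm].
  apply is_derive_ext with (fun k => cas (x * k + (c - PI / 2))); [intros; f_equal; ring|].
  replace (k * x + c) with (x * k + (c - PI / 2) + PI / 2) by field. apply cas_derive_lin. }
rewrite (intR_plus _ _ _ _ D2 D4), (intR_scal _ _ _ D1) in Z. lra.
Qed.

(** Each integration by parts trades a factor [x] for a derivative in [k] and shifts the phase;
    quantifying over all phases [c] lets the induction go through. *)
Lemma smoothW_decay p N F s0 : 0 < s0 -> smoothW p N F -> exists C, forall x c s, s0 <= s <= SS - s0 ->
  Rabs x ^ N * Rabs (intR (fun k => F k s * cas (k * x + c))) <= C.
Proof.
intros Hs. revert F. induction N as [|N IH]; intros F HF.
- destruct (boundW_dom p F s0 Hs (smoothW_bd _ _ _ HF)) as [C [HC HD]]. exists (C * 2 * intR om). intros x c s Hss.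
  simpl. rewrite Rmult_1_l. apply intR_bound, dom_cas, HD, Hss.
- destruct HF as [HF [G [DG HG]]]. destruct (IH G HG) as [C HC]. exists C. intros x c s Hss.
  destruct (boundW_dom p F s0 Hs HF) as [C1 [_ D1]]. destruct (boundW_dom p G s0 Hs (smoothW_bd _ _ _ HG)) as [C2 [_ D2]].
  simpl. rewrite (Rmult_comm (Rabs x)), Rmult_assoc, <- Rabs_mult.
  rewrite (intR_cas_by_parts C1 C2 _ _ x c (D1 s Hss) (D2 s Hss)) by (intros; apply DG).
  rewrite Rabs_Ropp. now apply HC.
Qed.

End Smooth.

(** * Derivatives in s *)

Section TimeDerivatives.
Context {P : params}.

Definition clm (a b s : R) : R := Rmax a (Rmin s b).

Lemma clm_in a b s : a <= b -> a <= clm a b s <= b.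
Proof. intros H. unfold clm. split; [apply Rmax_l|apply Rmax_lub; [easy|apply Rmin_r]]. Qed.

Lemma clm_id a b s : a <= s <= b -> clm a b s = s.
Proof. intros H. unfold clm. rewrite Rmin_left, Rmax_right; lra. Qed.

Lemma clm_cont a b s : continuous (clm a b) s.
Proof.
apply filterlim_locally. intros eps. exists eps. intros t Ht.
change (Rabs (t - s) < eps) in Ht. change (Rabs (clm a b t - clm a b s) < eps).
apply Rle_lt_trans with (2 := Ht).
unfold clm, Rmax, Rmin, Rabs. destruct (Rle_dec t b); destruct (Rle_dec s b);
repeat match goal with |- context [Rle_dec a ?b] => destruct (Rle_dec a b) end;
repeat match goal with |- context [Rcase_abs ?a] => destruct (Rcase_abs a) end; lra.
Qed.

(** [p] counts the powers of [k] that remain integrable against [f] on the strip. On [[s0, SS - s0]]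
    every [p] is available; on [[0, SS]] the decay of the datum limits it. *)
Definition good (a b : R) (p : nat) (f : R -> R -> R) : Prop :=
  cont2 (fun k s => f k (clm a b s)) /\
  exists C, 0 <= C /\ forall k s, Rabs (f k (clm a b s)) <= C * wt p k.

Lemma wt_le p p' k : (p <= p')%nat -> wt p' k <= wt p k.
Proof.
intros H. unfold wt, Rdiv. apply Rmult_le_compat_l; [left; apply om_gt0|].
apply Rinv_le_contravar; [generalize (pow_abs1 k p); lra|]. apply Rle_pow; [apply abs1_ge1|easy].
Qed.

Lemma good_weaken a b p p' f : (p <= p')%nat -> good a b p' f -> good a b p f.
Proof.
intros H [Hc [C [HC Hb]]]. split; [easy|]. exists C; split; [easy|]. intros k s.
apply Rle_trans with (1 := Hb k s). apply Rmult_le_compat_l; [easy|now apply wt_le].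
Qed.

Lemma good_lin a b p x y f g : good a b p f -> good a b p g -> good a b p (fun k s => x * f k s + y * g k s).
Proof.
intros [Hf [A [HA Bf]]] [Hg [B [HB Bg]]]. split.
- apply (cont2_lin x y _ _ Hf Hg).
- exists (Rabs x * A + Rabs y * B). assert (H1 := Rabs_pos x). assert (H2 := Rabs_pos y).
  split; [apply Rplus_le_le_0_compat; now apply Rmult_le_pos|].
  intros k s. apply Rle_trans with (1 := Rabs_triang _ _). rewrite !Rabs_mult, Rmult_plus_distr_r, !Rmult_assoc.
  apply Rplus_le_compat; apply Rmult_le_compat_l; easy || apply Bf || apply Bg.
Qed.

Lemma good_ext a b p f g : (forall k s, f k s = g k s) -> good a b p f -> good a b p g.
Proof.
intros E [Hc [C [HC Hb]]]. split.
- intros k s. apply continuous_ext with (2 := Hc k s). intros; apply E.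
- exists C; split; [easy|]. intros k s. rewrite <- E. apply Hb.
Qed.

Lemma wt_pow p m k : (1 + Rabs k) ^ m * wt (m + p) k = wt p k.
Proof.
unfold wt. rewrite pow_add. field. split; generalize (pow_abs1 k p) (pow_abs1 k m); lra.
Qed.

Lemma abs_pow_le k m : Rabs (k ^ m) <= (1 + Rabs k) ^ m.
Proof. rewrite <- RPow_abs. apply pow_incr. generalize (Rabs_pos k); lra. Qed.

Lemma good_mulpow a b m p f : good a b (m + p) f -> good a b p (fun k s => k ^ m * f k s).
Proof.
intros [Hf [A [HA Bf]]]. split.
- apply (cont2_mult (fun k _ => k ^ m)); [apply (cont2_fst (fun k => k ^ m)), cont_pow|easy].
- exists A; split; [easy|]. intros k s. rewrite <- (wt_pow p m k), <- Rmult_assoc, (Rmult_comm A), Rmult_assoc.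
  apply abs_mult_le; [apply abs_pow_le|apply Bf].
Qed.

Lemma good_zz a b p f : good a b (4 + p) f -> good a b p (fun k s => zz k * f k s).
Proof.
intros H. apply good_ext with (fun k s => 1 * (k ^ 4 * f k s) + -1 * (k ^ 2 * f k s)).
- intros k s. unfold zz. ring.
- apply good_lin; [now apply good_mulpow|]. apply good_mulpow. apply (good_weaken _ _ _ (4 + p)); [lia|easy].
Qed.

Lemma good_dom2 a b p f : good a b p f -> exists C, dom2 C (fun k s => f k (clm a b s)).
Proof.
intros [Hc [C [HC Hb]]]. exists C. split; [easy|]. intros k s. apply Rle_trans with (1 := Hb k s).
apply Rmult_le_compat_l; [easy|apply wt_le_om].
Qed.

Lemma good_rf a b p f : good a b p f -> good a b p (rf f).
Proof.
intros [Hc [C [HC Hb]]]. split; [apply (cont2_rf _ Hc)|]. exists C; split; [easy|].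
intros k s. unfold rf. rewrite <- (wt_opp p k). apply Hb.
Qed.

Lemma good_cv2 a b p f g : good a b p f -> good a b p g -> good a b p (conv2 f g).
Proof.
intros Hf Hg. destruct (good_dom2 _ _ _ _ Hf) as [C Df]. destruct (good_dom2 _ _ _ _ Hg) as [D Dg].
split; [apply (conv2_cont C D _ _ Df Dg)|].
destruct Hf as [_ [A [HA Bf]]]. destruct Hg as [_ [B [HB Bg]]].
assert (P2 : 0 < 2 ^ (2 + p)) by (apply pow_lt; lra).
exists (2 * intR om * (A * B * 2 ^ (2 + p))). split.
{ assert (H := intR_om_ge0). apply Rmult_le_pos; [lra|]. apply Rmult_le_pos; [now apply Rmult_le_pos|lra]. }
intros k s. unfold conv2.
apply Rle_trans with (2 * intR om * (A * B * 2 ^ (2 + p) * wt p k)); [|right; ring].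
apply (conv_bound _ C D _ _ k (fun l => A * wt p l) (fun l => B * wt p l)).
- apply (dom2_1 _ _ s Df).
- apply (dom2_1 _ _ s Dg).
- intros l; apply Bf.
- intros l; apply Bg.
- intros l. replace (A * wt p l * (B * wt p (k - l))) with (A * B * (wt p l * wt p (k - l))) by ring.
  replace (A * B * 2 ^ (2 + p) * wt p k * (om l + om (k - l))) with (A * B * (2 ^ (2 + p) * wt p k * (om l + om (k - l)))) by ring.
  apply Rmult_le_compat_l; [now apply Rmult_le_pos|apply wt_mult].
Qed.

Lemma good_star a b p f g : good a b p f -> good a b p g -> good a b p (star2 f g).
Proof.
intros Hf Hg. assert (Rff := good_rf _ _ _ _ Hf). assert (Rg := good_rf _ _ _ _ Hg).
assert (N1 := good_cv2 _ _ _ _ _ Hf Hg). assert (N2 := good_cv2 _ _ _ _ _ Rff Hg).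
assert (N3 := good_cv2 _ _ _ _ _ Hf Rg). assert (N4 := good_cv2 _ _ _ _ _ Rff Rg).
assert (M1 := good_lin _ _ _ 1 1 _ _ N1 N2). assert (M2 := good_lin _ _ _ 1 (-1) _ _ N3 N4).
apply good_ext with (2 := good_lin _ _ _ (/ 2) (/ 2) _ _ M1 M2). intros k s. unfold star2, comb. ring.
Qed.

Lemma locally_mid a b s : a < s < b -> locally s (fun t => a < t < b).
Proof.
intros H. apply (locally_interval _ s a b); simpl; try lra; tauto.
Qed.

Lemma good_dom a b p f s : good a b p f -> a <= s <= b -> exists C, dom C (fun k => f k s).
Proof.
intros H Hs. destruct (good_dom2 _ _ _ _ H) as [C D]. exists C.
assert (D1 := dom2_1 _ _ s D). cbv beta in D1. now rewrite (clm_id a b s) in D1.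
Qed.

(** Derivatives in [s] are known only inside the strip, whereas domination has to hold near every
    parameter; clamping reconciles the two. *)
Lemma conv2_ds a b f g df dg k s : good a b 0 f -> good a b 0 g -> good a b 0 df -> good a b 0 dg ->
  (forall k s, a < s < b -> is_derive (f k) s (df k s)) -> (forall k s, a < s < b -> is_derive (g k) s (dg k s)) ->
  a < s < b -> is_derive (conv2 f g k) s (conv2 df g k s + conv2 f dg k s).
Proof.
intros Gf Gg Gdf Gdg Df Dg Hs.
destruct (good_dom2 _ _ _ _ Gf) as [C1 D1]. destruct (good_dom2 _ _ _ _ Gg) as [C2 D2].
destruct (good_dom2 _ _ _ _ Gdf) as [C3 D3]. destruct (good_dom2 _ _ _ _ Gdg) as [C4 D4].
set (c := clm a b) in *.
assert (Ec : forall t, a < t < b -> c t = t) by (intros; apply clm_id; lra).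
assert (Lc : forall (h : R -> R) t l, a < t < b -> is_derive h t l -> is_derive (fun t => h (c t)) t l).
{ intros h t l Ht. apply is_derive_ext_loc. generalize (locally_mid a b t Ht). apply filter_imp.
  intros u Hu. now rewrite Ec. }
apply is_derive_ext_loc with (fun t => intR (fun l => f l (c t) * g (k - l) (c t))).
{ generalize (locally_mid a b s Hs). apply filter_imp. intros t Ht. now rewrite !Ec. }
assert (I : forall t, dom (C3 * C2 + C1 * C4) (fun l => df l (c t) * g (k - l) (c t) + f l (c t) * dg (k - l) (c t))).
{ intros t. apply dom_plus.
  - apply (conv_dom_integrand C3 C2 (fun l => df l (c t)) (fun l => g l (c t))); [apply (dom2_1 _ _ t D3)|apply (dom2_1 _ _ t D2)].
  - apply (conv_dom_integrand C1 C4 (fun l => f l (c t)) (fun l => dg l (c t))); [apply (dom2_1 _ _ t D1)|apply (dom2_1 _ _ t D4)]. }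
replace (conv2 df g k s + conv2 f dg k s) with (intR (fun l => df l (c s) * g (k - l) (c s) + f l (c s) * dg (k - l) (c s))).
2:{ unfold conv2, conv. rewrite (intR_plus (C3 * C2) (C1 * C4)).
    - now rewrite !Ec.
    - apply (conv_dom_integrand C3 C2 (fun l => df l (c s)) (fun l => g l (c s))); [apply (dom2_1 _ _ s D3)|apply (dom2_1 _ _ s D2)].
    - apply (conv_dom_integrand C1 C4 (fun l => f l (c s)) (fun l => dg l (c s))); [apply (dom2_1 _ _ s D1)|apply (dom2_1 _ _ s D4)]. }
apply (intR_is_derive (C1 * C2) (C3 * C2 + C1 * C4) (fun l t => f l (c t) * g (k - l) (c t))
  (fun l t => df l (c t) * g (k - l) (c t) + f l (c t) * dg (k - l) (c t)) s).
- intros l.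
  assert (K1 : forall h : R -> R -> R, cont2 (fun k s => h k (c s)) -> continuous (fun q : R * R => h (fst q) (c (snd q))) (l, s)).
  { intros h Hh. apply Hh. }
  assert (K2 : forall h : R -> R -> R, cont2 (fun k s => h k (c s)) -> continuous (fun q : R * R => h (k - fst q) (c (snd q))) (l, s)).
  { intros h Hh. apply (cont2_comp _ (fun q : R * R => k - fst q) (fun q => snd q) (l, s) Hh).
    - apply (continuous_minus (fun _ : R * R => k) (fun q => fst q)); [apply continuous_const|apply continuous_fst].
    - apply continuous_snd. }
  apply (continuous_plus (fun q : R * R => df (fst q) (c (snd q)) * g (k - fst q) (c (snd q)))
    (fun q => f (fst q) (c (snd q)) * dg (k - fst q) (c (snd q)))).
  + apply (continuous_mult (fun q : R * R => df (fst q) (c (snd q))) (fun q => g (k - fst q) (c (snd q)))); [apply K1, D3|apply K2, D2].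
  + apply (continuous_mult (fun q : R * R => f (fst q) (c (snd q))) (fun q => dg (k - fst q) (c (snd q)))); [apply K1, D1|apply K2, D4].
- apply filter_forall. intros t. apply (conv_dom_integrand C1 C2 (fun l => f l (c t)) (fun l => g l (c t))); [apply (dom2_1 _ _ t D1)|apply (dom2_1 _ _ t D2)].
- apply filter_forall. exact I.
- generalize (locally_mid a b s Hs). apply filter_imp. intros t Ht l.
  apply (is_derive_mult (fun t => f l (c t)) (fun t => g (k - l) (c t))); [| |intros; apply Rmult_comm].
  + rewrite Ec by easy. now apply Lc, Df.
  + rewrite Ec by easy. now apply Lc, Dg.
Qed.

Lemma star_ds a b f g df dg k s : good a b 0 f -> good a b 0 g -> good a b 0 df -> good a b 0 dg ->
  (forall k s, a < s < b -> is_derive (f k) s (df k s)) -> (forall k s, a < s < b -> is_derive (g k) s (dg k s)) ->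
  a < s < b -> is_derive (star2 f g k) s (star2 df g k s + star2 f dg k s).
Proof.
intros Gf Gg Gdf Gdg Df Dg Hs.
assert (Rff := good_rf _ _ _ _ Gf). assert (Rg := good_rf _ _ _ _ Gg).
assert (Rdf := good_rf _ _ _ _ Gdf). assert (Rdg := good_rf _ _ _ _ Gdg).
assert (Drf : forall k s, a < s < b -> is_derive (rf f k) s (rf df k s)) by (intros; now apply Df).
assert (Drg : forall k s, a < s < b -> is_derive (rf g k) s (rf dg k s)) by (intros; now apply Dg).
assert (E1 := conv2_ds a b _ _ _ _ k s Gf Gg Gdf Gdg Df Dg Hs).
assert (E2 := conv2_ds a b _ _ _ _ k s Rff Gg Rdf Gdg Drf Dg Hs).
assert (E3 := conv2_ds a b _ _ _ _ k s Gf Rg Gdf Rdg Df Drg Hs).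
assert (E4 := conv2_ds a b _ _ _ _ k s Rff Rg Rdf Rdg Drf Drg Hs).
unfold star2, comb.
match goal with |- is_derive _ _ ?l => replace l with (/ 2 * (1 * (conv2 df g k s + conv2 f dg k s) + 1 * (conv2 (rf df) g k s + conv2 (rf f) dg k s)
   + 1 * (conv2 df (rf g) k s + conv2 f (rf dg) k s) + -1 * (conv2 (rf df) (rf g) k s + conv2 (rf f) (rf dg) k s))) by Rring end.
assert (L : forall (u v : R -> R) du dv, is_derive u s du -> is_derive v s dv -> is_derive (fun k => u k + v k) s (du + dv)).
{ intros u v du dv Hu Hv. apply (is_derive_plus u v); easy. }
apply is_derive_scal. apply L; [apply L; [apply L|]|]; apply is_derive_scal; assumption.
Qed.

Lemma clm_cl s : clm 0 SS s = cl s.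
Proof. reflexivity. Qed.

Section Fixed.
Variables (phi : R -> R) (f : R -> R -> R).

(* The n-th s-derivative of the convolution of G a and G b when G (S i) is the derivative of G i; doubling the
   terms instead of using binomial coefficients keeps the recursion structural. *)
Fixpoint leibniz (G : nat -> R -> R -> R) (n a b : nat) (k s : R) : R :=
  match n with
  | O => star2 (G a) (G b) k s
  | S n => leibniz G n (S a) b k s + leibniz G n a (S b) k s
  end.

(* The s-derivatives of f of order <= n, with those of order >= 2 read off from the equation. *)
Fixpoint tder_upto (n : nat) : nat -> R -> R -> R :=
  match n with
  | O => fun _ => f
  | S m => fun i => if Nat.leb i m then tder_upto m i else
      match m with
      | O => fun k s => dsolk phi (nonlin f) k (cl s)
      | S j => fun k s => zz k * tder_upto m j k s - k ^ 2 * leibniz (tder_upto m) j 0 0 k s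
      end
  end.

Lemma tder_upto_S m i : tder_upto (S m) i = if Nat.leb i m then tder_upto m i else
  match m with
  | O => fun k s => dsolk phi (nonlin f) k (cl s)
  | S j => fun k s => zz k * tder_upto m j k s - k ^ 2 * leibniz (tder_upto m) j 0 0 k s
  end.
Proof. reflexivity. Qed.

Definition tder (j : nat) : R -> R -> R := tder_upto j j.

Lemma tder_upto_stable n i : (i <= n)%nat -> tder_upto n i = tder i.
Proof.
intros H. induction H as [|n H IH]; [easy|]. simpl.
destruct (Nat.leb_spec i n); [easy|lia].
Qed.

Lemma leibniz_ext G G' n a b k s : (forall i, (i <= n + a + b)%nat -> G i = G' i) -> leibniz G n a b k s = leibniz G' n a b k s.
Proof.
revert a b. induction n as [|n IH]; intros a b H; simpl.
- rewrite (H a), (H b) by lia. easy.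
- rewrite (IH (S a) b), (IH a (S b)); [easy| |]; intros i Hi; apply H; lia.
Qed.

Lemma tder_0 : tder 0 = f.
Proof. reflexivity. Qed.

Lemma tder_1 : tder 1 = fun k s => dsolk phi (nonlin f) k (cl s).
Proof. reflexivity. Qed.

(** [tder_upto] carries a whole table since [leibniz] uses all lower derivatives at once. Its
    entries do not change as the table grows, and on the diagonal this leaves the equation
    differentiated [j] times in [s]. *)
Lemma tder_SS j k s : tder (S (S j)) k s = zz k * tder j k s - k ^ 2 * leibniz tder j 0 0 k s.
Proof.
unfold tder at 1. rewrite tder_upto_S. destruct (Nat.leb_spec (S (S j)) (S j)); [lia|].
rewrite (leibniz_ext _ tder).
- now rewrite tder_upto_stable by lia.
- intros i Hi. apply tder_upto_stable. lia.
Qed.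

Lemma good_st a b p m : (forall i, (i <= m)%nat -> good a b p (tder i)) ->
  forall n u v, (n + u + v <= m)%nat -> good a b p (leibniz tder n u v).
Proof.
intros H. induction n as [|n IH]; intros u v Huv.
- apply good_star; apply H; lia.
- apply good_ext with (fun k s => 1 * leibniz tder n (S u) v k s + 1 * leibniz tder n u (S v) k s); [intros; simpl; ring|].
  apply good_lin; apply IH; lia.
Qed.

Lemma leibniz_ds a b m : (forall i, (i <= S m)%nat -> good a b 0 (tder i)) ->
  (forall i, (i <= m)%nat -> forall k s, a < s < b -> is_derive (tder i k) s (tder (S i) k s)) ->
  forall n u v k s, (n + u + v <= m)%nat -> a < s < b ->
  is_derive (leibniz tder n u v k) s (leibniz tder (S n) u v k s).
Proof.
intros HG HD. induction n as [|n IH]; intros u v k s Huv Hs.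
- simpl. apply (star_ds a b); try apply HG; try apply HD; try easy; lia.
- change (is_derive (fun s => leibniz tder n (S u) v k s + leibniz tder n u (S v) k s) s (leibniz tder (S n) (S u) v k s + leibniz tder (S n) u (S v) k s)).
  apply (is_derive_plus (leibniz tder n (S u) v k) (leibniz tder n u (S v) k)); apply IH; easy || lia.
Qed.

Hypothesis Hphi : (forall k, continuous phi k) /\ exists E, 0 <= E /\ forall k, Rabs (phi k) <= E * wt qn k.
Hypothesis Hf : exists A, ndom A f.
Hypothesis Ef : forall k s, f k s = solk phi (nonlin f) k (cl s).

Lemma nonlin_cont2 : cont2 (nonlin f).
Proof. destruct Hf as [A HA]. now apply (nonlin_cont A). Qed.

Lemma nonlin_bound : exists K, 0 <= K /\ forall k s, 0 <= s <= SS -> Rabs (nonlin f k s) <= K * k ^ 2 * wt qn k * Yw k s.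
Proof.
destruct Hf as [A HA]. assert (H0 := ndom_ge0 _ _ HA). assert (K0 := conv_const_ge0).
exists (2 * conv_const * A * A). split; [apply Rmult_le_pos; [apply Rmult_le_pos; lra|lra]|]. intros k s Hs.
unfold nonlin. rewrite Rabs_Ropp, Rabs_mult, (Rabs_right (k ^ 2)) by apply Rle_ge, pow2_ge_0.
assert (K := proj2 (star2_ndom _ _ _ _ HA HA) k s). rewrite (cl_id s Hs) in K.
apply Rle_trans with (k ^ 2 * (2 * conv_const * A * A * (wt qn k * Yw k s))); [|right; ring].
apply Rmult_le_compat_l; [apply pow2_ge_0|easy].
Qed.

(** The nonlinearity costs [k^2] and the inversion gains [1 + k^4]; this is the net gain of two
    powers. *)
Lemma sq_ratio k : k ^ 2 / (1 + k ^ 4) <= 8 / (1 + Rabs k) ^ 2.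
Proof.
assert (k4 := pow4_ge0 k). assert (Pw := pow_abs1 k 2).
apply Rmult_le_reg_r with ((1 + k ^ 4) * (1 + Rabs k) ^ 2); [apply Rmult_lt_0_compat; lra|].
replace (k ^ 2 / (1 + k ^ 4) * ((1 + k ^ 4) * (1 + Rabs k) ^ 2)) with (k ^ 2 * (1 + Rabs k) ^ 2) by (field; lra).
replace (8 / (1 + Rabs k) ^ 2 * ((1 + k ^ 4) * (1 + Rabs k) ^ 2)) with (8 * (1 + k ^ 4)) by (field; generalize (Rabs_pos k); lra).
apply Rle_trans with (2 := abs1_pow4 k). replace ((1 + Rabs k) ^ 4) with ((1 + Rabs k) ^ 2 * (1 + Rabs k) ^ 2) by ring.
apply Rmult_le_compat_r; [lra|]. rewrite <- (pow2_abs k). apply pow_incr. generalize (Rabs_pos k); lra.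
Qed.

Lemma one_k2_le k : 1 + k ^ 2 <= (1 + Rabs k) ^ 2.
Proof. rewrite <- (pow2_abs k). generalize (Rabs_pos k); intros; nra. Qed.

(** The share [E] of the datum and the share [K0] of the source are kept apart because only the
    latter improves by two powers of [k]. *)
Lemma dsol_good_bound h K0 E psi : cont2 h -> 0 <= K0 -> 0 <= E -> (forall k, Rabs (psi k) <= E * wt qn k) ->
  (forall k s, 0 <= s <= SS -> Rabs (h k s) <= K0 * k ^ 2 * wt qn k * Yw k s) ->
  exists C, 0 <= C /\ forall k s, 0 <= s <= SS ->
    Rabs (solk psi h k s) <= C * (E + K0 / (1 + Rabs k) ^ 2) * (wt qn k * Yw k s) /\
    Rabs (dsolk psi h k s) <= C * (1 + Rabs k) ^ 2 * (E + K0 / (1 + Rabs k) ^ 2) * (wt qn k * Yw k s).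
Proof.
intros Ch HK HE Hpsi Hh. destruct sol_bound as [C1 [HC1 B1]]. destruct dsol_bound as [C2 [HC2 B2]].
exists (8 * (C1 + C2)). split; [lra|]. intros k s Hs.
assert (W := wt_gt0 qn k). assert (Y := Yw_gt0 k s). assert (k4 := pow4_ge0 k). assert (k2 : 0 <= k ^ 2) by apply pow2_ge_0.
assert (Pw := pow_abs1 k 2).
assert (Hc : forall t, continuous (h k) t) by (intros; now apply cont2_2).
assert (HH : 0 <= K0 * k ^ 2 * wt qn k) by (apply Rmult_le_pos; [now apply Rmult_le_pos|lra]).
specialize (B1 k (psi k) (h k) _ Hc HH (Hh k) s Hs). specialize (B2 k (psi k) (h k) _ Hc HH (Hh k) s Hs).
assert (Q : 0 <= Rabs (psi k) + K0 * k ^ 2 * wt qn k / (1 + k ^ 4) <= 8 * (E + K0 / (1 + Rabs k) ^ 2) * wt qn k).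
{ assert (K0 * wt qn k * (k ^ 2 / (1 + k ^ 4)) <= K0 * wt qn k * (8 / (1 + Rabs k) ^ 2)).
  { apply Rmult_le_compat_l; [apply Rmult_le_pos; lra|apply sq_ratio]. }
  assert (0 <= K0 * k ^ 2 * wt qn k / (1 + k ^ 4)) by (apply Rmult_le_pos; [easy|left; apply Rinv_0_lt_compat; lra]).
  specialize (Hpsi k). assert (0 <= E * wt qn k) by (apply Rmult_le_pos; lra).
  split; [generalize (Rabs_pos (psi k)); lra|].
  replace (K0 * k ^ 2 * wt qn k / (1 + k ^ 4)) with (K0 * wt qn k * (k ^ 2 / (1 + k ^ 4))) by (field; lra).
  replace (8 * (E + K0 / (1 + Rabs k) ^ 2) * wt qn k) with (8 * (E * wt qn k) + K0 * wt qn k * (8 / (1 + Rabs k) ^ 2)) by (field; generalize (Rabs_pos k); lra).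
  lra. }
set (a := Rabs (psi k) + K0 * k ^ 2 * wt qn k / (1 + k ^ 4)) in *.
set (b := E + K0 / (1 + Rabs k) ^ 2) in *.
assert (bW : 0 <= b * wt qn k) by lra.
split.
- apply Rle_trans with (1 := B1). apply Rle_trans with (C1 * (8 * b * wt qn k) * Yw k s).
  + apply Rmult_le_compat_r; [lra|]. apply Rmult_le_compat_l; lra.
  + assert (0 <= C2 * (b * wt qn k) * Yw k s) by (apply Rmult_le_pos; [apply Rmult_le_pos; lra|lra]). lra.
- apply Rle_trans with (1 := B2). assert (O := one_k2_le k).
  apply Rle_trans with (C2 * (1 + Rabs k) ^ 2 * (8 * b * wt qn k) * Yw k s).
  + apply Rmult_le_compat_r; [lra|]. apply Rmult_le_compat; try lra; [apply Rmult_le_pos; lra|apply Rmult_le_compat_l; lra].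
  + assert (0 <= C1 * (1 + Rabs k) ^ 2 * (b * wt qn k) * Yw k s) by (apply Rmult_le_pos; [apply Rmult_le_pos; [apply Rmult_le_pos; lra|lra]|lra]). lra.
Qed.

Lemma f_good_mid s0 p : 0 < s0 -> s0 <= SS - s0 -> good s0 (SS - s0) p (tder 0) /\ good s0 (SS - s0) p (tder 1).
Proof.
intros Hs0 Hs1. destruct Hphi as [Cp [E [HE Bp]]]. destruct nonlin_bound as [K0 [HK0 BK]].
destruct (dsol_good_bound (nonlin f) K0 E phi nonlin_cont2 HK0 HE Bp BK) as [C [HC HB]].
destruct (Yw_rapid s0 (2 + p) Hs0) as [Rc [HR YR]].
assert (Cs : forall h, cont2 (fun k s => h k (cl s)) -> cont2 (fun k s => h k (cl (clm s0 (SS - s0) s)))).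
{ intros h Hh k s. apply (cont2_comp _ (fun q : R * R => fst q) (fun q => clm s0 (SS - s0) (snd q)) (k, s) Hh); [apply continuous_fst|].
  apply (continuous_comp (fun q : R * R => snd q) (clm s0 (SS - s0))); [apply continuous_snd|apply clm_cont]. }
assert (X : forall k s, s0 <= s <= SS - s0 -> (E + K0 / (1 + Rabs k) ^ 2) * (wt qn k * Yw k s) <= (E + K0) * Rc * wt (2 + p) k).
{ intros k s Hs. specialize (YR k s Hs). assert (Pw := pow_abs1 k 2). assert (Pp := pow_abs1 k (2 + p)).
  assert (K0 / (1 + Rabs k) ^ 2 <= K0).
  { unfold Rdiv. rewrite <- (Rmult_1_r K0) at 2. apply Rmult_le_compat_l; [easy|]. apply Rle_trans with (/ 1); [apply Rinv_le_contravar; lra|lra]. }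
  assert (W := wt_le_om qn k). assert (W0 := wt_gt0 qn k). assert (Y := Yw_gt0 k s).
  rewrite Rmult_assoc. apply Rmult_le_compat; [|apply Rmult_le_pos; lra|lra|].
  - assert (0 <= K0 / (1 + Rabs k) ^ 2) by (apply Rmult_le_pos; [easy|left; apply Rinv_0_lt_compat; lra]). lra.
  - unfold wt at 2. apply Rmult_le_reg_r with ((1 + Rabs k) ^ (2 + p)); [lra|].
    replace (Rc * (om k / (1 + Rabs k) ^ (2 + p)) * (1 + Rabs k) ^ (2 + p)) with (om k * Rc) by (field; lra).
    replace (wt qn k * Yw k s * (1 + Rabs k) ^ (2 + p)) with (wt qn k * ((1 + Rabs k) ^ (2 + p) * Yw k s)) by ring.
    apply Rmult_le_compat; try lra. apply Rmult_le_pos; lra. }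
split; split.
- intros k s. apply continuous_ext with (2 := Cs _ (solk_cont2 phi (nonlin f) Cp nonlin_cont2) k s). intros q. now rewrite tder_0, Ef.
- exists (C * ((E + K0) * Rc)). split; [apply Rmult_le_pos; [easy|apply Rmult_le_pos; lra]|]. intros k s.
  assert (Hc := clm_in s0 (SS - s0) s Hs1). rewrite tder_0, Ef, (cl_id (clm _ _ _)) by lra.
  assert (Hc' : 0 <= clm s0 (SS - s0) s <= SS) by lra. destruct (HB k _ Hc') as [H1 _]. apply Rle_trans with (1 := H1).
  rewrite !Rmult_assoc. apply Rmult_le_compat_l; [easy|].
  apply Rle_trans with (1 := X k _ Hc). rewrite Rmult_assoc. apply Rmult_le_compat_l; [lra|]. apply Rmult_le_compat_l; [lra|]. apply wt_le; lia.
- intros k s. apply continuous_ext with (2 := Cs _ (dsolk_cont2 phi (nonlin f) Cp nonlin_cont2) k s). intros q. now rewrite tder_1.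
- exists (C * ((E + K0) * Rc)). split; [apply Rmult_le_pos; [easy|apply Rmult_le_pos; lra]|]. intros k s.
  assert (Hc := clm_in s0 (SS - s0) s Hs1). rewrite tder_1, (cl_id (clm _ _ _)) by lra.
  assert (Hc' : 0 <= clm s0 (SS - s0) s <= SS) by lra. destruct (HB k _ Hc') as [_ H1]. apply Rle_trans with (1 := H1).
  rewrite !Rmult_assoc. apply Rmult_le_compat_l; [easy|]. rewrite <- (wt_pow p 2 k).
  apply Rle_trans with ((1 + Rabs k) ^ 2 * ((E + K0) * Rc * wt (2 + p) k)); [|right; ring].
  apply Rmult_le_compat_l; [generalize (pow_abs1 k 2); lra|]. apply X, Hc.
Qed.

Lemma tder_good_mid s0 : 0 < s0 -> s0 <= SS - s0 -> forall n j p, (j <= n)%nat -> good s0 (SS - s0) p (tder j).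
Proof.
intros Hs0 Hs1. induction n as [|n IH]; intros j p Hj.
- replace j with O by lia. now apply f_good_mid.
- destruct (Nat.eq_dec j (S n)) as [->|]; [|apply IH; lia].
  destruct n as [|n]; [now apply f_good_mid|].
  apply good_ext with (fun k s => 1 * (zz k * tder n k s) + -1 * (k ^ 2 * leibniz tder n 0 0 k s)).
  { intros. rewrite tder_SS. ring. }
  apply good_lin.
  + apply good_zz, IH; lia.
  + apply good_mulpow. apply (good_st _ _ _ n); [|lia]. intros i Hi. apply IH; lia.
Qed.

Lemma tder_good s0 j p : 0 < s0 -> s0 <= SS - s0 -> good s0 (SS - s0) p (tder j).
Proof. intros H0 H1. now apply (tder_good_mid s0 H0 H1 j). Qed.

Lemma tder_derive01 k s : 0 < s < SS -> is_derive (tder 0 k) s (tder 1 k s) /\ is_derive (tder 1 k) s (tder 2 k s).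
Proof.
intros Hs. destruct (solk_is_sol phi (nonlin f) k nonlin_cont2) as [D1 [D2 _]].
assert (Ec : forall t, 0 < t < SS -> cl t = t) by (intros; apply cl_id; lra).
rewrite tder_1. split.
- rewrite Ec by easy. apply is_derive_ext_loc with (2 := D1 s).
  generalize (locally_mid 0 SS s Hs). apply filter_imp. intros t Ht. rewrite tder_0, Ef. now rewrite Ec.
- rewrite tder_SS. simpl leibniz. rewrite tder_0.
  replace (zz k * f k s - k ^ 2 * star2 f f k s) with (zz k * solk phi (nonlin f) k s + nonlin f k s).
  2:{ rewrite Ef, Ec by easy. unfold nonlin at 2. ring. }
  apply is_derive_ext_loc with (2 := D2 s).
  generalize (locally_mid 0 SS s Hs). apply filter_imp. intros t Ht. now rewrite Ec.
Qed.

Lemma mid_exists s : 0 < s < SS -> exists s0, 0 < s0 /\ s0 < s < SS - s0.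
Proof. intros H. exists (Rmin (s / 2) ((SS - s) / 2)). unfold Rmin. destruct (Rle_dec _ _); lra. Qed.

Lemma tder_derive_n n j : (j <= n)%nat -> forall k s, 0 < s < SS -> is_derive (tder j k) s (tder (S j) k s).
Proof.
revert j. induction n as [|n IH]; intros j Hj k s Hs.
- replace j with O by lia. now apply tder_derive01.
- destruct (Nat.eq_dec j (S n)) as [->|]; [|apply IH; lia || easy].
  destruct n as [|n]; [now apply tder_derive01|].
  destruct (mid_exists s Hs) as [s0 [H0 H1]].
  rewrite tder_SS.
  apply is_derive_ext with (fun s => zz k * tder n k s - k ^ 2 * leibniz tder n 0 0 k s).
  { intros t. now rewrite tder_SS. }
  apply (is_derive_minus (fun s => zz k * tder n k s) (fun s => k ^ 2 * leibniz tder n 0 0 k s)); apply is_derive_scal.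
  + apply IH; [lia|easy].
  + apply (leibniz_ds s0 (SS - s0) n); [| |lia|easy].
    * intros i Hi. apply tder_good; lra.
    * intros i Hi k' s' Hs'. apply IH; [lia|lra].
Qed.

Lemma tder_derive j k s : 0 < s < SS -> is_derive (tder j k) s (tder (S j) k s).
Proof. now apply (tder_derive_n j j). Qed.

Lemma f_good_full : good 0 SS qn (tder 0) /\ ((2 <= qn)%nat -> good 0 SS (qn - 2) (tder 1)).
Proof.
assert (HS := SS_ge1).
destruct Hphi as [Cp [E [HE Bp]]]. destruct nonlin_bound as [K0 [HK0 BK]].
destruct (dsol_good_bound (nonlin f) K0 E phi nonlin_cont2 HK0 HE Bp BK) as [C [HC HB]].
assert (X : forall k s, 0 <= s <= SS -> (E + K0 / (1 + Rabs k) ^ 2) * (wt qn k * Yw k s) <= (E + K0) * 2 * wt qn k).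
{ intros k s Hs. assert (Pw := pow_abs1 k 2).
  assert (K0 / (1 + Rabs k) ^ 2 <= K0).
  { unfold Rdiv. rewrite <- (Rmult_1_r K0) at 2. apply Rmult_le_compat_l; [easy|]. apply Rle_trans with (/ 1); [apply Rinv_le_contravar; lra|lra]. }
  assert (W0 := wt_gt0 qn k). assert (Y := Yw_gt0 k s). assert (Y2 := Yw_le2 k s Hs).
  rewrite Rmult_assoc. apply Rmult_le_compat; [|apply Rmult_le_pos; lra|lra|].
  - assert (0 <= K0 / (1 + Rabs k) ^ 2) by (apply Rmult_le_pos; [easy|left; apply Rinv_0_lt_compat; lra]). lra.
  - rewrite Rmult_comm. apply Rmult_le_compat_r; lra. }
split.
- split.
  + intros k s. apply continuous_ext with (2 := solk_cont2 phi (nonlin f) Cp nonlin_cont2 k s). intros q. rewrite tder_0, Ef, clm_cl. now rewrite cl_cl.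
  + exists (C * ((E + K0) * 2)). split; [apply Rmult_le_pos; [easy|lra]|]. intros k s.
    rewrite tder_0, Ef, clm_cl, cl_cl. destruct (HB k (cl s) (cl_in s)) as [H1 _]. apply Rle_trans with (1 := H1).
    rewrite !Rmult_assoc. apply Rmult_le_compat_l; [easy|]. apply Rle_trans with (1 := X k _ (cl_in s)). right; ring.
- intros Hq. split.
  + intros k s. apply continuous_ext with (2 := dsolk_cont2 phi (nonlin f) Cp nonlin_cont2 k s). intros q. rewrite tder_1, clm_cl. now rewrite cl_cl.
  + exists (C * ((E + K0) * 2)). split; [apply Rmult_le_pos; [easy|lra]|]. intros k s.
    rewrite tder_1, clm_cl, cl_cl. destruct (HB k (cl s) (cl_in s)) as [_ H1]. apply Rle_trans with (1 := H1).
    rewrite !Rmult_assoc. apply Rmult_le_compat_l; [easy|]. rewrite <- (wt_pow (qn - 2) 2 k). replace (2 + (qn - 2))%nat with qn by lia.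
    apply Rle_trans with ((1 + Rabs k) ^ 2 * ((E + K0) * 2 * wt qn k)); [|right; ring].
    apply Rmult_le_compat_l; [generalize (pow_abs1 k 2); lra|]. apply X, cl_in.
Qed.

(** On the closed strip two derivatives in [s] cost the four powers in [zz], that is two powers
    each. This is the parabolic counting [q1 + 2 q2] of the statement. *)
Lemma tder_good_full_n n j : (j <= n)%nat -> (2 * j <= qn)%nat -> good 0 SS (qn - 2 * j) (tder j).
Proof.
revert j. induction n as [|n IH]; intros j Hj Hq.
- replace j with O by lia. replace (qn - 2 * 0)%nat with qn by lia. apply f_good_full.
- destruct (Nat.eq_dec j (S n)) as [->|]; [|apply IH; lia].
  destruct n as [|n]; [apply f_good_full; lia|].
  apply good_ext with (fun k s => 1 * (zz k * tder n k s) + -1 * (k ^ 2 * leibniz tder n 0 0 k s)).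
  { intros. rewrite tder_SS. ring. }
  apply good_lin.
  + apply good_zz. apply (good_weaken _ _ _ (qn - 2 * n)); [lia|]. apply IH; lia.
  + apply good_mulpow. apply (good_weaken _ _ _ (qn - 2 * n)); [lia|].
    apply (good_st _ _ _ n); [|lia]. intros i Hi. apply (good_weaken _ _ _ (qn - 2 * i)); [lia|]. apply IH; lia.
Qed.

Lemma tder_good_full j : (2 * j <= qn)%nat -> good 0 SS (qn - 2 * j) (tder j).
Proof. now apply (tder_good_full_n j). Qed.

Definition lin0 (k s : R) : R := solk phi (fun _ _ => 0) k s.
Definition lin1 (k s : R) : R := dsolk phi (fun _ _ => 0) k s.

Fixpoint tder_lin (j : nat) : R -> R -> R :=
  match j with
  | O => fun k s => lin0 k (cl s)
  | S O => fun k s => lin1 k (cl s)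
  | S (S j) => fun k s => zz k * tder_lin j k s
  end.

Definition tder_nl (j : nat) (k s : R) : R := tder j k s - tder_lin j k s.

Lemma tder_nl_SS j k s : tder_nl (S (S j)) k s = zz k * tder_nl j k s - k ^ 2 * leibniz tder j 0 0 k s.
Proof. unfold tder_nl. rewrite tder_SS. simpl. ring. Qed.

Lemma zero_cont2 : cont2 (fun _ _ => 0).
Proof. intros k s; apply continuous_const. Qed.

Lemma tder_nl_01 k s : tder_nl 0 k s = solk (fun _ => 0) (nonlin f) k (cl s) /\ tder_nl 1 k s = dsolk (fun _ => 0) (nonlin f) k (cl s).
Proof.
assert (K1 := is_sol_lin _ 1 (-1) _ _ _ _ _ _ _ _ (solk_is_sol phi (nonlin f) k nonlin_cont2) (solk_is_sol phi (fun _ _ => 0) k zero_cont2)).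
assert (Z1 : 1 * phi k + -1 * phi k = 0) by ring.
assert (Z2 : forall t, 1 * nonlin f k t + -1 * 0 = nonlin f k t) by (intros; ring).
assert (K2 := is_sol_ext _ _ _ _ _ _ _ Z1 Z2 K1).
destruct (sol_eq _ _ _ _ _ (cl s) (fun t => cont2_2 _ k t nonlin_cont2) K2) as [E1 E2].
unfold tder_nl. rewrite tder_0, tder_1, Ef. simpl tder_lin. unfold lin0, lin1.
split; (etransitivity; [|exact E1 || exact E2]); ring.
Qed.

(** By linearity the remainder solves the problem with zero datum, so only the improved share of the
    source is left in [dsol_good_bound]. *)
Lemma tder_nl_good01 : good 0 SS (qn + 2) (tder_nl 0) /\ good 0 SS qn (tder_nl 1).
Proof.
assert (HS := SS_ge1). destruct nonlin_bound as [K0 [HK0 BK]].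
assert (Cc0 : forall k : R, continuous (fun _ : R => 0) k) by (intros; apply continuous_const).
destruct (dsol_good_bound (nonlin f) K0 0 (fun _ => 0) nonlin_cont2 HK0 (Rle_refl _)) as [C [HC HB]].
{ intros k. rewrite Rabs_R0. generalize (wt_gt0 qn k); lra. }
{ exact BK. }
assert (X : forall k s, 0 <= s <= SS -> (0 + K0 / (1 + Rabs k) ^ 2) * (wt qn k * Yw k s) <= K0 * 2 * wt (qn + 2) k).
{ intros k s Hs. assert (Pw := pow_abs1 k 2). assert (Pq := pow_abs1 k qn).
  assert (Y2 := Yw_le2 k s Hs). assert (Y := Yw_gt0 k s).
  assert (E : wt qn k / (1 + Rabs k) ^ 2 = wt (qn + 2) k) by (unfold wt; rewrite pow_add; field; assert (Rk := Rabs_pos k); repeat split; lra).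
  replace ((0 + K0 / (1 + Rabs k) ^ 2) * (wt qn k * Yw k s)) with (K0 * (wt qn k / (1 + Rabs k) ^ 2) * Yw k s) by (field; generalize (Rabs_pos k); lra).
  rewrite E. assert (W := wt_gt0 (qn + 2) k). assert (0 <= K0 * wt (qn + 2) k) by (apply Rmult_le_pos; lra).
  rewrite (Rmult_assoc K0 2), (Rmult_comm 2), <- Rmult_assoc. apply Rmult_le_compat_l; lra. }
split; split.
- intros k s. apply continuous_ext with (2 := solk_cont2 (fun _ => 0) (nonlin f) Cc0 nonlin_cont2 k s). intros q.
  rewrite (proj1 (tder_nl_01 _ _)), clm_cl. now rewrite cl_cl.
- exists (C * (K0 * 2)). split; [apply Rmult_le_pos; lra|]. intros k s. rewrite (proj1 (tder_nl_01 _ _)), clm_cl, cl_cl.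
  destruct (HB k (cl s) (cl_in s)) as [H1 _]. apply Rle_trans with (1 := H1). rewrite !(Rmult_assoc C).
  apply Rmult_le_compat_l; [easy|]. apply X, cl_in.
- intros k s. apply continuous_ext with (2 := dsolk_cont2 (fun _ => 0) (nonlin f) Cc0 nonlin_cont2 k s). intros q.
  rewrite (proj2 (tder_nl_01 _ _)), clm_cl. now rewrite cl_cl.
- exists (C * (K0 * 2)). split; [apply Rmult_le_pos; lra|]. intros k s. rewrite (proj2 (tder_nl_01 _ _)), clm_cl, cl_cl.
  destruct (HB k (cl s) (cl_in s)) as [_ H1]. apply Rle_trans with (1 := H1).
  apply Rle_trans with (C * ((1 + Rabs k) ^ 2 * (K0 * 2 * wt (qn + 2) k))).
  2:{ rewrite <- (wt_pow qn 2 k), (Nat.add_comm 2 qn). right; ring. }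
  rewrite !(Rmult_assoc C). apply Rmult_le_compat_l; [easy|]. rewrite Rmult_assoc.
  apply Rmult_le_compat_l; [generalize (pow_abs1 k 2); lra|]. apply X, cl_in.
Qed.

(** The head start of two powers persists: [k^2] times a product of weight [qn - 2 n] has weight
    [qn + 2 - 2 (n + 2)]. Since derivatives of order [qn + 1] need one extra power, the remainder
    stays bounded there and the singularity is purely linear. *)
Lemma tder_nl_good_n n j : (j <= n)%nat -> (2 * j <= qn + 2)%nat -> good 0 SS (qn + 2 - 2 * j) (tder_nl j).
Proof.
revert j. induction n as [|n IH]; intros j Hj Hq.
- replace j with O by lia. replace (qn + 2 - 2 * 0)%nat with (qn + 2)%nat by lia. apply tder_nl_good01.
- destruct (Nat.eq_dec j (S n)) as [->|]; [|apply IH; lia].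
  destruct n as [|n]; [replace (qn + 2 - 2 * 1)%nat with qn by lia; apply tder_nl_good01|].
  apply good_ext with (fun k s => 1 * (zz k * tder_nl n k s) + -1 * (k ^ 2 * leibniz tder n 0 0 k s)).
  { intros. rewrite tder_nl_SS. ring. }
  apply good_lin.
  + apply good_zz. apply (good_weaken _ _ _ (qn + 2 - 2 * n)); [lia|]. apply IH; lia.
  + apply good_mulpow. apply (good_weaken _ _ _ (qn - 2 * n)); [lia|].
    apply (good_st _ _ _ n); [|lia]. intros i Hi. apply (good_weaken _ _ _ (qn - 2 * i)); [lia|]. apply tder_good_full; lia.
Qed.

Lemma tder_nl_good j : (2 * j <= qn + 2)%nat -> good 0 SS (qn + 2 - 2 * j) (tder_nl j).
Proof. now apply (tder_nl_good_n j). Qed.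

End Fixed.
End TimeDerivatives.

(** * Hartley synthesis *)

Section Synthesis.
Context {P : params}.

Definition synth (G : R -> R -> R) (i : nat) (x s : R) : R :=
  intR (fun k => k ^ i * G k s * cas (k * x + INR i * (PI / 2))).

Lemma cas_cont2 c : cont2 (fun k x => cas (k * x + c)).
Proof.
intros k x. apply (continuous_comp (fun q : R * R => fst q * snd q + c) cas); [|apply cas_cont].
apply (continuous_plus (fun q : R * R => fst q * snd q) (fun _ => c)); [|apply continuous_const].
apply (continuous_mult (fun q : R * R => fst q) (fun q => snd q)); [apply continuous_fst|apply continuous_snd].
Qed.

Lemma synth_cont a b G i : good a b i G -> cont2 (fun x s => synth G i x (clm a b s)).
Proof.
intros HG. replace i with (i + 0)%nat in HG by lia. destruct (good_dom2 _ _ _ _ (good_mulpow _ _ _ _ _ HG)) as [C D].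
intros x s. unfold synth. simpl.
apply (intR_continuous (C * 2) (fun k p => k ^ i * G k (clm a b (snd p)) * cas (k * fst p + INR i * (PI / 2))) (x, s)).
- intros l. apply (continuous_mult (fun q : R * (R * R) => fst q ^ i * G (fst q) (clm a b (snd (snd q)))) (fun q => cas (fst q * fst (snd q) + INR i * (PI / 2)))).
  + apply (cont2_comp _ (fun q : R * (R * R) => fst q) (fun q => snd (snd q)) (l, (x, s)) (proj1 D)); [apply continuous_fst|].
    apply (continuous_comp (fun q : R * (R * R) => snd q) (fun p : R * R => snd p)); apply continuous_snd.
  + apply (cont2_comp _ (fun q : R * (R * R) => fst q) (fun q => fst (snd q)) (l, (x, s)) (cas_cont2 (INR i * (PI / 2)))); [apply continuous_fst|].
    apply (continuous_comp (fun q : R * (R * R) => snd q) (fun p : R * R => fst p)); [apply continuous_snd|apply continuous_fst].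
- apply filter_forall. intros p. apply dom_cas. apply (dom2_1 _ _ (snd p) D).
Qed.

Lemma synth_bound a b G i : good a b i G -> exists C, 0 <= C /\ forall x s, a <= s <= b -> Rabs (synth G i x s) <= C.
Proof.
intros HG. replace i with (i + 0)%nat in HG by lia. destruct (good_dom2 _ _ _ _ (good_mulpow _ _ _ _ _ HG)) as [C D].
assert (C0 := dom_ge0 _ _ (dom2_1 _ _ 0 D)).
exists (C * 2 * intR om). split; [apply Rmult_le_pos; [lra|apply intR_om_ge0]|].
intros x t Ht. apply intR_bound, dom_cas. assert (D1 := dom2_1 _ _ t D). cbv beta in D1. now rewrite clm_id in D1.
Qed.

Lemma synth_dx a b G i x s : good a b (S i) G -> a <= s <= b -> is_derive (fun x => synth G i x s) x (synth G (S i) x s).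
Proof.
intros HG Hs.
assert (HG0 : good a b (i + 0) G) by (apply (good_weaken _ _ _ (S i)); [lia|easy]).
replace (S i) with (S i + 0)%nat in HG by lia.
destruct (good_dom _ _ _ _ s (good_mulpow _ _ _ _ _ HG0) Hs) as [C D].
destruct (good_dom _ _ _ _ s (good_mulpow _ _ _ _ _ HG) Hs) as [C' D'].
unfold synth. apply (intR_is_derive (C * 2) (C' * 2) (fun k x => k ^ i * G k s * cas (k * x + INR i * (PI / 2)))
  (fun k x => k ^ S i * G k s * cas (k * x + INR (S i) * (PI / 2)))).
- intros l. apply (continuous_mult (fun q : R * R => fst q ^ S i * G (fst q) s) (fun q => cas (fst q * snd q + INR (S i) * (PI / 2)))).
  + apply (continuous_comp (fun q : R * R => fst q) (fun k => k ^ S i * G k s)); [apply continuous_fst|apply D'].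
  + apply cas_cont2.
- apply filter_forall. intros t. now apply dom_cas.
- apply filter_forall. intros t. now apply dom_cas.
- apply filter_forall. intros t k.
  replace (k ^ S i * G k s * cas (k * t + INR (S i) * (PI / 2))) with (k ^ i * G k s * (k * cas (k * t + INR i * (PI / 2) + PI / 2))).
  2:{ rewrite S_INR. replace (k * t + (INR i + 1) * (PI / 2)) with (k * t + INR i * (PI / 2) + PI / 2) by ring. simpl; ring. }
  apply is_derive_scal, cas_derive_lin.
Qed.

Lemma synth_ds a b G dG i x s : good a b i G -> good a b i dG -> a < s < b ->
  (forall k s, a < s < b -> is_derive (G k) s (dG k s)) -> is_derive (fun s => synth G i x s) s (synth dG i x s).
Proof.
intros HG HdG Hs H. replace i with (i + 0)%nat in HG by lia. replace i with (i + 0)%nat in HdG by lia.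
destruct (good_dom2 _ _ _ _ (good_mulpow _ _ _ _ _ HG)) as [C D].
destruct (good_dom2 _ _ _ _ (good_mulpow _ _ _ _ _ HdG)) as [C' D'].
set (c := clm a b) in *.
assert (Ec : forall t, a < t < b -> c t = t) by (intros; apply clm_id; lra).
unfold synth.
apply is_derive_ext_loc with (fun t => intR (fun k => k ^ i * G k (c t) * cas (k * x + INR i * (PI / 2)))).
{ generalize (locally_mid a b s Hs). apply filter_imp. intros t Ht. now rewrite Ec. }
assert (E2 : intR (fun k => k ^ i * dG k s * cas (k * x + INR i * (PI / 2))) = intR (fun k => k ^ i * dG k (c s) * cas (k * x + INR i * (PI / 2)))) by now rewrite Ec.
rewrite E2.
apply (intR_is_derive (C * 2) (C' * 2) (fun k s => k ^ i * G k (c s) * cas (k * x + INR i * (PI / 2)))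
  (fun k s => k ^ i * dG k (c s) * cas (k * x + INR i * (PI / 2)))).
- intros l. apply (continuous_mult (fun q : R * R => fst q ^ i * dG (fst q) (c (snd q))) (fun q => cas (fst q * x + INR i * (PI / 2)))).
  + apply D'.
  + apply (continuous_comp (fun q : R * R => fst q) (fun k => cas (k * x + INR i * (PI / 2)))); [apply continuous_fst|apply cas_cont_lin].
- apply filter_forall. intros t. apply dom_cas, (dom2_1 _ _ t D).
- apply filter_forall. intros t. apply dom_cas, (dom2_1 _ _ t D').
- generalize (locally_mid a b s Hs). apply filter_imp. intros t Ht k.
  assert (D0 : is_derive (fun s => G k (c s)) t (dG k t)).
  { apply is_derive_ext_loc with (2 := H k t Ht). generalize (locally_mid a b t Ht). apply filter_imp. intros u Hu. now rewrite Ec. }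
  rewrite Ec by easy.
  apply is_derive_ext with (fun s => k ^ i * cas (k * x + INR i * (PI / 2)) * G k (c s)); [intros; Rring|].
  replace (k ^ i * dG k t * cas (k * x + INR i * (PI / 2))) with (k ^ i * cas (k * x + INR i * (PI / 2)) * dG k t) by ring.
  now apply is_derive_scal.
Qed.

(** The convolution theorem in real form: the addition formulas inserted into [intR_cv]. *)
Lemma intR_cv_trig C D f g x : dom C f -> dom D g ->
  intR (fun k => conv f g k * cos (k * x)) = intR (fun k => f k * cos (k * x)) * intR (fun k => g k * cos (k * x))
    - intR (fun k => f k * sin (k * x)) * intR (fun k => g k * sin (k * x)) /\
  intR (fun k => conv f g k * sin (k * x)) = intR (fun k => f k * sin (k * x)) * intR (fun k => g k * cos (k * x))
    + intR (fun k => f k * cos (k * x)) * intR (fun k => g k * sin (k * x)).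
Proof.
intros Hf Hg.
assert (Lx : forall k : R, continuous (fun k => k * x) k).
{ intros k. apply (continuous_mult (fun k : R => k) (fun _ => x)); [apply continuous_id|apply continuous_const]. }
assert (Cc : forall k, continuous (fun k => cos (k * x)) k).
{ intros k. apply (continuous_comp (fun k => k * x) cos); [apply Lx|apply continuous_cos]. }
assert (Cs : forall k, continuous (fun k => sin (k * x)) k).
{ intros k. apply (continuous_comp (fun k => k * x) sin); [apply Lx|apply continuous_sin]. }
assert (Bc : forall k, Rabs (cos (k * x)) <= 1) by (intros; apply Rabs_le_between, COS_bound).
assert (Bs : forall k, Rabs (sin (k * x)) <= 1) by (intros; apply Rabs_le_between, SIN_bound).
assert (Fc := dom_mult _ _ _ Hf Cc Bc). assert (Fs := dom_mult _ _ _ Hf Cs Bs).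
assert (Gc := dom_mult _ _ _ Hg Cc Bc). assert (Gs := dom_mult _ _ _ Hg Cs Bs).
set (cf := intR (fun k => f k * cos (k * x))). set (sf := intR (fun k => f k * sin (k * x))).
set (cg := intR (fun k => g k * cos (k * x))). set (sg := intR (fun k => g k * sin (k * x))).
split.
- rewrite (intR_cv C D f g (fun k => cos (k * x)) Hf Hg Cc Bc).
  transitivity (intR (fun l => cg * (f l * cos (l * x)) + (- sg) * (f l * sin (l * x)))).
  + apply intR_ext. intros l.
    transitivity (f l * intR (fun k => cos (l * x) * (g k * cos (k * x)) + (- sin (l * x)) * (g k * sin (k * x)))).
    * f_equal. apply intR_ext. intros k. rewrite Rmult_plus_distr_r, cos_plus. ring.
    * rewrite (intR_plus _ _ _ _ (dom_scal _ _ _ Gc) (dom_scal _ _ _ Gs)), (intR_scal _ _ _ Gc), (intR_scal _ _ _ Gs). fold cg sg. ring.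
  + rewrite (intR_plus _ _ _ _ (dom_scal _ _ _ Fc) (dom_scal _ _ _ Fs)), (intR_scal _ _ _ Fc), (intR_scal _ _ _ Fs). fold cf sf. ring.
- rewrite (intR_cv C D f g (fun k => sin (k * x)) Hf Hg Cs Bs).
  transitivity (intR (fun l => sg * (f l * cos (l * x)) + cg * (f l * sin (l * x)))).
  + apply intR_ext. intros l.
    transitivity (f l * intR (fun k => sin (l * x) * (g k * cos (k * x)) + cos (l * x) * (g k * sin (k * x)))).
    * f_equal. apply intR_ext. intros k. rewrite Rmult_plus_distr_r, sin_plus. ring.
    * rewrite (intR_plus _ _ _ _ (dom_scal _ _ _ Gc) (dom_scal _ _ _ Gs)), (intR_scal _ _ _ Gc), (intR_scal _ _ _ Gs). fold cg sg. ring.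
  + rewrite (intR_plus _ _ _ _ (dom_scal _ _ _ Fc) (dom_scal _ _ _ Fs)), (intR_scal _ _ _ Fc), (intR_scal _ _ _ Fs). fold cf sf. ring.
Qed.

(** Let [c] and [d] be the cosine and sine integrals of [f]; reflection keeps [c] and negates [d].
    The four convolutions give [c^2 - d^2 + 2 c d], twice [c^2 + d^2], and [c^2 - d^2 - 2 c d], and
    half of their signed sum is [(c + d)^2]. *)
Lemma intR_star_cas C f x s : dom2 C f ->
  intR (fun k => star2 f f k s * cas (k * x)) = intR (fun k => f k s * cas (k * x)) ^ 2.
Proof.
intros Df. assert (Drf := dom2_rf _ _ Df).
assert (F := dom2_1 _ _ s Df). assert (Rf := dom2_1 _ _ s Drf).
assert (Lx : forall k : R, continuous (fun k => k * x) k).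
{ intros k. apply (continuous_mult (fun k : R => k) (fun _ => x)); [apply continuous_id|apply continuous_const]. }
assert (Cc : forall k, continuous (fun k => cos (k * x)) k).
{ intros k. apply (continuous_comp (fun k => k * x) cos); [apply Lx|apply continuous_cos]. }
assert (Cs : forall k, continuous (fun k => sin (k * x)) k).
{ intros k. apply (continuous_comp (fun k => k * x) sin); [apply Lx|apply continuous_sin]. }
assert (Bc : forall k, Rabs (cos (k * x)) <= 1) by (intros; apply Rabs_le_between, COS_bound).
assert (Bs : forall k, Rabs (sin (k * x)) <= 1) by (intros; apply Rabs_le_between, SIN_bound).
assert (Fc := dom_mult _ _ _ F Cc Bc). assert (Fs := dom_mult _ _ _ F Cs Bs).
set (c := intR (fun k => f k s * cos (k * x))). set (d := intR (fun k => f k s * sin (k * x))).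
assert (Ec : intR (fun k => rf f k s * cos (k * x)) = c).
{ unfold c. rewrite <- (intR_flip _ _ Fc). apply intR_ext. intros k. unfold rf. rewrite <- (cos_neg (k * x)). do 2 f_equal. ring. }
assert (Ed : intR (fun k => rf f k s * sin (k * x)) = - d).
{ unfold d. rewrite <- (intR_flip _ _ Fs). transitivity (-1 * intR (fun k => f (- k) s * sin (- k * x))); [|ring].
  rewrite <- (intR_scal _ (-1) _ (dom_flip _ _ Fs)). apply intR_ext. intros k. unfold rf.
  replace (- k * x) with (- (k * x)) by ring. rewrite sin_neg. ring. }
destruct (intR_cv_trig _ _ _ _ x F F) as [A1 B1]. destruct (intR_cv_trig _ _ _ _ x Rf F) as [A2 B2].
destruct (intR_cv_trig _ _ _ _ x F Rf) as [A3 B3]. destruct (intR_cv_trig _ _ _ _ x Rf Rf) as [A4 B4].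
fold c d in A1, B1, A2, B2, A3, B3, A4, B4. rewrite Ec, Ed in A2, B2, A3, B3, A4, B4.
assert (Eu : intR (fun k => f k s * cas (k * x)) = c + d).
{ unfold c, d. rewrite <- (intR_plus _ _ _ _ Fc Fs). apply intR_ext; intros k; unfold cas; ring. }
rewrite Eu.
assert (N1 := dom2_1 _ _ s (conv2_dom2 _ _ _ _ Df Df)). assert (N2 := dom2_1 _ _ s (conv2_dom2 _ _ _ _ Drf Df)).
assert (N3 := dom2_1 _ _ s (conv2_dom2 _ _ _ _ Df Drf)). assert (N4 := dom2_1 _ _ s (conv2_dom2 _ _ _ _ Drf Drf)).
assert (X : forall g A B D, dom D g -> intR (fun k => g k * cos (k * x)) = A -> intR (fun k => g k * sin (k * x)) = B ->
   intR (fun k => g k * cas (k * x + 0)) = A + B).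
{ intros g A0 B0 D0 Hg <- <-. rewrite <- (intR_plus _ _ _ _ (dom_mult _ _ _ Hg Cc Bc) (dom_mult _ _ _ Hg Cs Bs)).
  apply intR_ext; intros k; rewrite Rplus_0_r; unfold cas; ring. }
assert (X1 := X _ _ _ _ N1 A1 B1). assert (X2 := X _ _ _ _ N2 A2 B2). assert (X3 := X _ _ _ _ N3 A3 B3). assert (X4 := X _ _ _ _ N4 A4 B4).
assert (M1 := dom_cas _ _ x 0 N1). assert (M2 := dom_cas _ _ x 0 N2). assert (M3 := dom_cas _ _ x 0 N3). assert (M4 := dom_cas _ _ x 0 N4).
transitivity (intR (fun k => / 2 * (conv2 f f k s * cas (k * x + 0)) + (/ 2 * (conv2 (rf f) f k s * cas (k * x + 0)) +
  (/ 2 * (conv2 f (rf f) k s * cas (k * x + 0)) + - / 2 * (conv2 (rf f) (rf f) k s * cas (k * x + 0)))))).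
{ apply intR_ext; intros k. rewrite Rplus_0_r. unfold star2, comb. ring. }
assert (L4 := dom_scal _ (- / 2) _ M4). assert (L3 := dom_scal _ (/ 2) _ M3). assert (L2 := dom_scal _ (/ 2) _ M2). assert (L1 := dom_scal _ (/ 2) _ M1).
assert (L34 := dom_plus _ _ _ _ L3 L4). assert (L234 := dom_plus _ _ _ _ L2 L34).
rewrite (intR_plus _ _ _ _ L1 L234), (intR_plus _ _ _ _ L2 L34), (intR_plus _ _ _ _ L3 L4).
rewrite (intR_scal _ _ _ M1), (intR_scal _ _ _ M2), (intR_scal _ _ _ M3), (intR_scal _ _ _ M4), X1, X2, X3, X4. field.
Qed.

Lemma cas_2PI y : cas (y + INR 4 * (PI / 2)) = cas y.
Proof.
unfold cas. replace (y + INR 4 * (PI / 2)) with (y + 2 * INR 1 * PI) by (simpl; field). now rewrite cos_period, sin_period.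
Qed.

Lemma cas_PI y : cas (y + INR 2 * (PI / 2)) = - cas y.
Proof.
unfold cas. replace (y + INR 2 * (PI / 2)) with (y + PI) by (simpl; field). rewrite neg_cos, neg_sin. ring.
Qed.

Section Equation.
Variables (phi : R -> R) (f : R -> R -> R).
Hypothesis Hphi : (forall k, continuous phi k) /\ exists E, 0 <= E /\ forall k, Rabs (phi k) <= E * wt qn k.
Hypothesis Hf : exists A, ndom A f.
Hypothesis Ef : forall k s, f k s = solk phi (nonlin f) k (cl s).

(** Two derivatives in [x] multiply the integrand by [- k^2] and four by [k^4], so the equation is
    [tder_SS] at [j = 0] under the integral. *)
Lemma boussinesq_s x s : 0 < s < SS ->
  synth (tder phi f 2) 0 x s = synth (tder phi f 0) 2 x s + Derive_n (fun y => synth (tder phi f 0) 0 y s ^ 2) 2 x + synth (tder phi f 0) 4 x s.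
Proof.
intros Hs. destruct (mid_exists s Hs) as [s0 [H0 H1]].
assert (Hs' : s0 <= s <= SS - s0) by lra.
assert (G : forall j p, good s0 (SS - s0) p (tder phi f j)) by (intros; apply tder_good; easy || lra).
assert (GS : forall p, good s0 (SS - s0) p (star2 f f)) by (intros; apply good_star; apply (G 0%nat)).
destruct Hf as [A HA]. assert (D2 := ndom_dom2 _ _ HA).
assert (E0 : forall y, synth (tder phi f 0) 0 y s ^ 2 = synth (star2 f f) 0 y s).
{ intros y. unfold synth. rewrite tder_0.
  assert (X := intR_star_cas _ f y s D2).
  transitivity (intR (fun k => f k s * cas (k * y)) ^ 2).
  - f_equal. apply intR_ext; intros k. simpl. rewrite Rmult_0_l, Rplus_0_r. ring.
  - rewrite <- X. apply intR_ext; intros k. simpl. rewrite Rmult_0_l, Rplus_0_r. ring. }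
assert (E1 : Derive_n (fun y => synth (tder phi f 0) 0 y s ^ 2) 2 x = synth (star2 f f) 2 x s).
{ rewrite (Derive_n_ext _ _ 2 x E0). simpl. apply is_derive_unique.
  apply is_derive_ext with (fun y => synth (star2 f f) 1 y s).
  - intros y. symmetry. apply is_derive_unique. apply (synth_dx s0 (SS - s0)); [apply GS|easy].
  - apply (synth_dx s0 (SS - s0)); [apply GS|easy]. }
rewrite E1. unfold synth.
destruct (good_dom _ _ _ _ s (good_mulpow _ _ 4 0 _ (G 0%nat (4 + 0)%nat)) Hs') as [C4 D4].
destruct (good_dom _ _ _ _ s (good_mulpow _ _ 2 0 _ (G 0%nat (2 + 0)%nat)) Hs') as [C2 D2'].
destruct (good_dom _ _ _ _ s (good_mulpow _ _ 2 0 _ (GS (2 + 0)%nat)) Hs') as [Cs Ds].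
assert (M4 := dom_cas _ _ x (INR 4 * (PI / 2)) D4). assert (M2 := dom_cas _ _ x (INR 2 * (PI / 2)) D2').
assert (Ms := dom_cas _ _ x (INR 2 * (PI / 2)) Ds). cbv beta in M4, M2, Ms.
rewrite <- (intR_plus _ _ _ _ M2 Ms). rewrite <- (intR_plus _ _ _ _ (dom_plus _ _ _ _ M2 Ms) M4).
apply intR_ext. intros k. rewrite tder_SS, cas_2PI, !cas_PI. simpl leibniz. rewrite tder_0. unfold zz.
simpl (INR 0). rewrite Rmult_0_l, Rplus_0_r. ring.
Qed.

Hypothesis Hsm : forall n, smoothW 0 n f.

Lemma f_schwartz s0 i N : 0 < s0 -> exists M, 0 <= M /\ forall x s, s0 <= s <= SS - s0 ->
  (1 + Rabs x) ^ N * Rabs (synth (tder phi f 0) i x s) <= M.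
Proof.
intros Hs.
destruct (smoothW_decay (i + 0) N (fun k s => k ^ i * f k s) s0 Hs (smoothW_mulpow _ _ _ _ (Hsm N))) as [C1 H1].
destruct (smoothW_decay (i + 0) 0 (fun k s => k ^ i * f k s) s0 Hs (smoothW_mulpow _ _ _ _ (Hsm 0))) as [C0 H0].
exists (2 ^ N * (Rabs C1 + Rabs C0)).
assert (P2 : 0 < 2 ^ N) by (apply pow_lt; lra).
split; [apply Rmult_le_pos; [lra|generalize (Rabs_pos C1) (Rabs_pos C0); lra]|].
intros x s Hss. specialize (H1 x (INR i * (PI / 2)) s Hss). specialize (H0 x (INR i * (PI / 2)) s Hss).
change (intR (fun k => k ^ i * f k s * cas (k * x + INR i * (PI / 2)))) with (synth (tder phi f 0) i x s) in H1, H0.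
simpl in H0. rewrite Rmult_1_l in H0. set (v := Rabs (synth (tder phi f 0) i x s)) in *.
assert (V0 : 0 <= v) by apply Rabs_pos.
assert (Rx := Rabs_pos x).
assert (K : (1 + Rabs x) ^ N <= 2 ^ N * (1 + Rabs x ^ N)).
{ destruct (Rle_lt_dec (Rabs x) 1).
  - apply Rle_trans with (2 ^ N); [apply pow_incr; lra|]. rewrite <- (Rmult_1_r (2 ^ N)) at 1.
    apply Rmult_le_compat_l; [lra|]. assert (0 <= Rabs x ^ N) by now apply pow_le. lra.
  - apply Rle_trans with ((2 * Rabs x) ^ N); [apply pow_incr; lra|]. rewrite Rpow_mult_distr.
    apply Rmult_le_compat_l; lra. }
apply Rle_trans with (2 ^ N * (1 + Rabs x ^ N) * v); [now apply Rmult_le_compat_r|].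
rewrite Rmult_assoc. apply Rmult_le_compat_l; [lra|].
generalize (Rle_abs C1) (Rle_abs C0); lra.
Qed.

End Equation.
End Synthesis.

(** * The datum *)

(** The derivatives of the Gaussian, through the three-term recurrence of the Hermite polynomials,
    from which bounds follow by induction. *)
Fixpoint gauss_der (n : nat) (x : R) : R :=
  match n with
  | O => exp (- x ^ 2)
  | S O => -2 * x * exp (- x ^ 2)
  | S (S m as m1) => -2 * x * gauss_der m1 x - 2 * INR (S m) * gauss_der m x
  end.

Lemma gauss_der_SS n x : gauss_der (S (S n)) x = -2 * x * gauss_der (S n) x - 2 * INR (S n) * gauss_der n x.
Proof. reflexivity. Qed.

Lemma gauss_der_derive n x : is_derive (gauss_der n) x (gauss_der (S n) x).
Proof.
enough (H : forall n x, is_derive (gauss_der n) x (gauss_der (S n) x) /\ is_derive (gauss_der (S n)) x (gauss_der (S (S n)) x)) by apply H.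
clear n x. induction n as [|n IH]; intros x.
- split.
  + unfold gauss_der. auto_derive; [easy|]. simpl; ring.
  + rewrite gauss_der_SS. unfold gauss_der. auto_derive; [easy|]. simpl; ring.
- destruct (IH x) as [H1 H2]. split; [easy|].
  apply is_derive_ext with (fun x => -2 * x * gauss_der (S n) x - 2 * INR (S n) * gauss_der n x); [intros; now rewrite gauss_der_SS|].
  replace (gauss_der (S (S (S n))) x) with ((-2 * gauss_der (S n) x + -2 * x * gauss_der (S (S n)) x) - 2 * INR (S n) * gauss_der (S n) x).
  2:{ rewrite (gauss_der_SS (S n)), (S_INR (S n)). ring. }
  apply (is_derive_minus (fun x => -2 * x * gauss_der (S n) x) (fun x => 2 * INR (S n) * gauss_der n x)); [|now apply is_derive_scal].
  apply (is_derive_mult (fun x => -2 * x) (gauss_der (S n))); [auto_derive; [easy|ring]|easy|intros; apply Rmult_comm].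
Qed.

Lemma exp_sq_abs x : exp (- x ^ 2) <= exp 1 * exp (- (Rabs x * 1)).
Proof.
rewrite <- exp_plus. apply exp_le_mono. rewrite <- (pow2_abs x).
assert (0 <= (Rabs x - 1/2) ^ 2) by apply pow2_ge_0. nra.
Qed.

Lemma gauss_der_bound n N : exists C, 0 <= C /\ forall x, Rabs (gauss_der n x) * (1 + Rabs x) ^ N <= C.
Proof.
enough (H : forall n, exists C, 0 <= C /\ forall x, Rabs (gauss_der n x) <= C * (1 + Rabs x) ^ n * exp (- x ^ 2) /\
  Rabs (gauss_der (S n) x) <= C * (1 + Rabs x) ^ S n * exp (- x ^ 2)).
{ destruct (H n) as [C [HC Hb]]. destruct (exp_rapid 1 (n + N) Rlt_0_1) as [D [HD HDb]].
  exists (C * (exp 1 * D)). assert (E1 := exp_pos 1). split; [apply Rmult_le_pos; [easy|apply Rmult_le_pos; lra]|].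
  intros x. destruct (Hb x) as [K _]. assert (Rx := Rabs_pos x).
  assert (PN : 0 <= (1 + Rabs x) ^ N) by (apply pow_le; lra).
  apply Rle_trans with (C * (1 + Rabs x) ^ n * exp (- x ^ 2) * (1 + Rabs x) ^ N); [now apply Rmult_le_compat_r|].
  replace (C * (1 + Rabs x) ^ n * exp (- x ^ 2) * (1 + Rabs x) ^ N) with (C * (exp (- x ^ 2) * (1 + Rabs x) ^ (n + N))) by (rewrite pow_add; ring).
  apply Rmult_le_compat_l; [easy|].
  apply Rle_trans with (exp 1 * exp (- (Rabs x * 1)) * (1 + Rabs x) ^ (n + N)).
  - apply Rmult_le_compat_r; [apply pow_le; lra|apply exp_sq_abs].
  - rewrite Rmult_assoc. apply Rmult_le_compat_l; [lra|]. now apply HDb. }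
clear n. induction n as [|n [C [HC IH]]].
- exists 2. split; [lra|]. intros x. assert (E := exp_pos (- x ^ 2)). assert (Rx := Rabs_pos x). split.
  + unfold gauss_der. rewrite Rabs_right by lra. simpl ((1 + Rabs x) ^ 0). lra.
  + unfold gauss_der. rewrite !Rabs_mult, (Rabs_left (-2)), (Rabs_right (exp _)) by lra. rewrite pow_1.
    apply Rmult_le_compat_r; lra.
- exists (C + (2 * C + 2 * INR (S n) * C)). assert (In : 0 <= INR (S n)) by apply pos_INR.
  assert (I2 : 0 <= INR (S n) * C) by now apply Rmult_le_pos.
  split; [lra|]. intros x. destruct (IH x) as [H1 H2]. assert (Rx := Rabs_pos x). assert (E := exp_pos (- x ^ 2)).
  assert (P1 : 0 <= (1 + Rabs x) ^ S n) by (apply pow_le; lra).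
  assert (P2 : (1 + Rabs x) ^ n <= (1 + Rabs x) ^ S (S n)) by (apply Rle_pow; [lra|lia]).
  assert (PE : 0 <= (1 + Rabs x) ^ S n * exp (- x ^ 2)) by (apply Rmult_le_pos; lra).
  split.
  + apply Rle_trans with (1 := H2). rewrite !Rmult_assoc. apply Rmult_le_compat_r; lra.
  + rewrite gauss_der_SS. unfold Rminus. apply Rle_trans with (1 := Rabs_triang _ _). rewrite Rabs_Ropp, !Rabs_mult.
    rewrite (Rabs_left (-2)), (Rabs_right 2), (Rabs_right (INR (S n))) by lra.
    set (X := (1 + Rabs x) ^ S (S n) * exp (- x ^ 2)).
    assert (A1 : Rabs x * Rabs (gauss_der (S n) x) <= C * X).
    { apply Rle_trans with ((1 + Rabs x) * (C * (1 + Rabs x) ^ S n * exp (- x ^ 2))).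
      - apply Rmult_le_compat; try apply Rabs_pos; [lra|easy].
      - unfold X. right. simpl. ring. }
    assert (A2 : Rabs (gauss_der n x) <= C * X).
    { apply Rle_trans with (1 := H1). unfold X. rewrite Rmult_assoc. apply Rmult_le_compat_l; [easy|]. apply Rmult_le_compat_r; lra. }
    assert (A3 : INR (S n) * Rabs (gauss_der n x) <= INR (S n) * (C * X)) by now apply Rmult_le_compat_l.
    assert (X0 : 0 <= X).
    { unfold X. apply Rmult_le_pos; [apply pow_le|]; lra. }
    assert (CX : 0 <= C * X) by now apply Rmult_le_pos.
    replace ((C + (2 * C + 2 * INR (S n) * C)) * (1 + Rabs x) ^ S (S n) * exp (- x ^ 2)) with ((C + (2 * C + 2 * INR (S n) * C)) * X) by (unfold X; ring).
    lra.
Qed.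

Lemma series_geom_bound (a : nat -> R) C r : 0 <= r < 1 -> (forall j, Rabs (a j) <= C * r ^ j) ->
  ex_series a /\ (forall N, Rabs (Series a - sum_f_R0 a N) <= C / (1 - r) * r ^ S N) /\ Rabs (Series a) <= C / (1 - r).
Proof.
intros Hr H.
assert (Hr' : Rabs r < 1) by (rewrite Rabs_right; lra).
assert (Eg : ex_series (fun j => C * r ^ j)) by (apply (ex_series_scal (V := R_NormedModule)), ex_series_geom, Hr').
assert (Ea : ex_series (fun j => Rabs (a j))) by (apply (ex_series_le (K := R_AbsRing) (V := R_CompleteNormedModule) (fun j => Rabs (a j)) (fun j => C * r ^ j)); [|easy]; intros n; unfold norm; simpl; unfold abs; simpl; rewrite Rabs_Rabsolu; apply H).
assert (X : ex_series a) by now apply ex_series_Rabs.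
assert (B : forall b : nat -> R, forall D, ex_series b -> (forall j, Rabs (b j) <= D * r ^ j) -> Rabs (Series b) <= D / (1 - r)).
{ intros b D Hb HD.
  assert (Egd : ex_series (fun j => D * r ^ j)) by (apply (ex_series_scal (V := R_NormedModule)), ex_series_geom, Hr').
  assert (Eb : ex_series (fun j => Rabs (b j))) by (apply (ex_series_le (K := R_AbsRing) (V := R_CompleteNormedModule) (fun j => Rabs (b j)) (fun j => D * r ^ j)); [|easy]; intros n; unfold norm; simpl; unfold abs; simpl; rewrite Rabs_Rabsolu; apply HD).
  apply Rle_trans with (1 := Series_Rabs _ Eb).
  apply Rle_trans with (Series (fun j => D * r ^ j)).
  - apply Series_le; [|easy]. intros n; split; [apply Rabs_pos|apply HD].
  - rewrite Series_scal_l, Series_geom by easy. unfold Rdiv; lra. }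
split; [easy|split; [|now apply B]].
intros N. rewrite (Series_incr_n a (S N)) by (easy || lia). simpl pred.
replace (sum_f_R0 a N + Series (fun k => a (S N + k)%nat) - sum_f_R0 a N) with (Series (fun k => a (S N + k)%nat)) by ring.
replace (C / (1 - r) * r ^ S N) with (C * r ^ S N / (1 - r)) by (field; lra).
apply B.
- now apply ex_series_incr_n.
- intros j. rewrite Rmult_assoc, <- pow_add. apply H.
Qed.

Lemma pow_small C r eps : 0 <= C -> 0 <= r < 1 -> 0 < eps -> exists N, forall n, (N <= n)%nat -> C * r ^ S n < eps.
Proof.
intros HC Hr He.
assert (L0 : is_lim_seq (fun n => C * r ^ n) 0).
{ replace (Finite 0) with (Rbar_mult C 0) by (simpl; f_equal; ring).
  apply is_lim_seq_scal_l, is_lim_seq_geom. rewrite Rabs_right; lra. }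
apply is_lim_seq_spec in L0. destruct (L0 (mkposreal eps He)) as [N HN]. exists N. intros n Hn.
specialize (HN (S n) ltac:(lia)). rewrite Rminus_0_r in HN. simpl Rabs in HN. apply Rabs_lt_between in HN. simpl in *. lra.
Qed.

Section GaussianSum.
Context {P : params}.
Variables (tau G : nat -> R) (C0 r : R).
Hypothesis Htau : forall j, 0 < tau j <= 1.
Hypothesis HG : forall j, 0 <= G j.
Hypothesis Hr : 0 <= r < 1.
Hypothesis HC0 : 0 <= C0.
Hypothesis HGr : forall j, G j * Rpower (tau j) (1 - th) <= C0 * r ^ j.

(** The moment of order [2 * qn + 2] of [exp (- t^2 k^2)] scales like [t] to the power
    [- (2 * qn + 3)]. The coefficient undoes this, so that each Gaussian contributes about [G j]. *)
Definition coef (j : nat) : R := G j * tau j ^ (2 * qn + 3).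
Definition term (n : nat) (k : R) (j : nat) : R := coef j * tau j ^ n * gauss_der n (tau j * k).
Definition psi (n : nat) (k : R) : R := Series (term n k).

(** With [N = 2 * qn + 1 + n] the power of [t = tau j] splits into [t^N], [t^(1 + th)] and
    [t^(1 - th)]. The first two become decay in [k], since [t (1 + |k|) <= 1 + |t k|] and the
    Gaussian absorbs powers of the right side; the last one tames the growth of [G] through
    [HGr]. *)
Lemma term_bound n : exists C, 0 <= C /\ forall k j, Rabs (term n k j) <= C * r ^ j * wt (2 * qn + 1 + n) k.
Proof.
set (N := (2 * qn + 1 + n)%nat).
destruct (gauss_der_bound n (N + 2)) as [C [HC Hb]].
exists (C * C0). split; [now apply Rmult_le_pos|]. intros k j.
destruct (Htau j) as [Ht0 Ht1]. set (t := tau j) in *.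
assert (Rk := Rabs_pos k).
set (m := 1 + Rabs (t * k)).
assert (Hm : 1 <= m) by (unfold m; generalize (Rabs_pos (t * k)); lra).
assert (K1 : t * (1 + Rabs k) <= m).
{ unfold m. rewrite Rabs_mult, (Rabs_right t) by lra. lra. }
assert (KN : t ^ N * (1 + Rabs k) ^ N <= m ^ N).
{ rewrite <- Rpow_mult_distr. apply pow_incr. split; [apply Rmult_le_pos; lra|easy]. }
assert (T2 := th_gt0). assert (T3 := th_le1).
assert (KO : Rpower t (1 + th) <= m ^ 2 * om k).
{ rewrite om_inv. set (w := Rpower (1 + Rabs k) (1 + th)). assert (Hw : 0 < w) by apply exp_pos.
  apply Rmult_le_reg_r with w; [easy|]. rewrite Rmult_assoc, Rinv_l, Rmult_1_r by lra.
  unfold w. rewrite Rpower_mult_distr by lra.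
  apply Rle_trans with (Rpower m (1 + th)); [apply Rle_Rpower_l; [lra|split; [apply Rmult_lt_0_compat; lra|easy]]|].
  rewrite <- (Rpower_pow 2) by lra. apply Rle_Rpower; [easy|simpl; lra]. }
assert (KW : t ^ N * Rpower t (1 + th) <= m ^ (N + 2) * wt N k).
{ assert (W := pow_abs1 k N). unfold wt. rewrite pow_add.
  apply Rmult_le_reg_r with ((1 + Rabs k) ^ N); [lra|].
  replace (m ^ N * m ^ 2 * (om k / (1 + Rabs k) ^ N) * (1 + Rabs k) ^ N) with (m ^ N * (m ^ 2 * om k)) by (field; lra).
  replace (t ^ N * Rpower t (1 + th) * (1 + Rabs k) ^ N) with ((t ^ N * (1 + Rabs k) ^ N) * Rpower t (1 + th)) by ring.
  apply Rmult_le_compat; [apply Rmult_le_pos; apply pow_le; lra|left; apply exp_pos|easy|easy]. }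
assert (Et : t ^ (2 * qn + 3) * t ^ n = t ^ N * Rpower t (1 + th) * Rpower t (1 - th)).
{ rewrite Rmult_assoc, <- Rpower_plus. replace (1 + th + (1 - th)) with (INR 2) by (simpl; ring). rewrite Rpower_pow by lra.
  rewrite <- !pow_add. f_equal. unfold N. lia. }
unfold term, coef. fold t. rewrite !Rabs_mult.
rewrite (Rabs_right (G j)) by (apply Rle_ge, HG). rewrite (Rabs_right (t ^ (2 * qn + 3))) by (apply Rle_ge, pow_le; lra).
rewrite (Rabs_right (t ^ n)) by (apply Rle_ge, pow_le; lra).
replace (G j * t ^ (2 * qn + 3) * t ^ n * Rabs (gauss_der n (t * k))) with ((G j * Rpower t (1 - th)) * (t ^ N * Rpower t (1 + th)) * Rabs (gauss_der n (t * k))).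
2:{ rewrite (Rmult_assoc (G j) (t ^ _)), Et. ring. }
assert (WN := wt_gt0 N k).
apply Rle_trans with ((C0 * r ^ j) * (m ^ (N + 2) * wt N k) * Rabs (gauss_der n (t * k))).
- apply Rmult_le_compat_r; [apply Rabs_pos|]. apply Rmult_le_compat.
  + apply Rmult_le_pos; [apply HG|left; apply exp_pos].
  + apply Rmult_le_pos; [apply pow_le; lra|left; apply exp_pos].
  + apply HGr.
  + exact KW.
- replace (C0 * r ^ j * (m ^ (N + 2) * wt N k) * Rabs (gauss_der n (t * k))) with ((C0 * r ^ j * wt N k) * (Rabs (gauss_der n (t * k)) * m ^ (N + 2))) by ring.
  replace (C * C0 * r ^ j * wt N k) with ((C0 * r ^ j * wt N k) * C) by ring.
  apply Rmult_le_compat_l; [|apply Hb]. apply Rmult_le_pos; [|lra]. apply Rmult_le_pos; [easy|apply pow_le; lra].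
Qed.

Lemma wt_le1 a k : wt a k <= 1.
Proof. apply Rle_trans with (1 := wt_le_om a k). apply om_le1. Qed.

Lemma term_bound1 n : exists C, 0 <= C /\ forall k j, Rabs (term n k j) <= C * r ^ j.
Proof.
destruct (term_bound n) as [C [HC Hb]]. exists C; split; [easy|]. intros k j. apply Rle_trans with (1 := Hb k j).
rewrite <- (Rmult_1_r (C * r ^ j)) at 2. apply Rmult_le_compat_l; [apply Rmult_le_pos; [easy|apply pow_le; lra]|apply wt_le1].
Qed.

Lemma psi_bound n : exists C, 0 <= C /\ forall k, Rabs (psi n k) <= C * wt (2 * qn + 1 + n) k.
Proof.
destruct (term_bound n) as [C [HC Hb]]. exists (C / (1 - r)). split; [apply Rdiv_le_0_compat; lra|].
intros k. destruct (series_geom_bound (term n k) (C * wt (2 * qn + 1 + n) k) r Hr) as [_ [_ K]].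
- intros j. apply Rle_trans with (1 := Hb k j). right; ring.
- apply Rle_trans with (1 := K). right. field. lra.
Qed.

Lemma term_derive n k j : is_derive (fun k => term n k j) k (term (S n) k j).
Proof.
unfold term. replace (coef j * tau j ^ S n * gauss_der (S n) (tau j * k)) with (coef j * tau j ^ n * (tau j * gauss_der (S n) (tau j * k))) by (simpl; ring).
apply is_derive_scal. apply (is_derive_comp (gauss_der n) (fun k => tau j * k)); [apply gauss_der_derive|auto_derive; [easy|ring]].
Qed.

Lemma psum_derive n N k : is_derive (fun k => sum_f_R0 (term n k) N) k (sum_f_R0 (term (S n) k) N).
Proof.
induction N as [|N IH]; [apply term_derive|].
apply (is_derive_plus (fun k => sum_f_R0 (term n k) N) (fun k => term n k (S N))); [easy|apply term_derive].
Qed.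

Lemma psum_unif n : exists C, 0 <= C /\ forall k N, Rabs (psi n k - sum_f_R0 (term n k) N) <= C * r ^ S N.
Proof.
destruct (term_bound1 n) as [C [HC Hb]]. exists (C / (1 - r)). split; [apply Rdiv_le_0_compat; lra|].
intros k N. apply (series_geom_bound (term n k) C r Hr). apply Hb.
Qed.

Lemma cvu_term n : forall eps, 0 < eps -> exists N, forall m k, (N <= m)%nat -> Rabs (psi n k - sum_f_R0 (term n k) m) < eps.
Proof.
intros eps He. destruct (psum_unif n) as [C [HC Hb]]. destruct (pow_small C r eps HC Hr He) as [N HN].
exists N. intros m k Hm. apply Rle_lt_trans with (1 := Hb k m). now apply HN.
Qed.

Lemma psi_cont n k : continuous (psi n) k.
Proof.
apply continuity_pt_filterlim.
apply (CVU_continuity (fun N k => sum_f_R0 (term n k) N) (psi n) k (mkposreal 1 Rlt_0_1)).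
- intros eps He. destruct (cvu_term n eps He) as [N HN]. exists N. intros m y Hm _. now apply HN.
- intros m y _. apply derivable_continuous_pt. exists (sum_f_R0 (term (S n) y) m). apply is_derive_Reals, psum_derive.
- unfold Boule. rewrite Rminus_diag, Rabs_R0. simpl; lra.
Qed.

Lemma psi_derive n k : is_derive (psi n) k (psi (S n) k).
Proof.
apply is_derive_Reals.
apply (derivable_pt_lim_CVU (fun N k => sum_f_R0 (term n k) N) (fun N k => sum_f_R0 (term (S n) k) N) (psi n) (psi (S n)) k k (mkposreal 1 Rlt_0_1)).
- unfold Boule. rewrite Rminus_diag, Rabs_R0. simpl; lra.
- intros y m _. apply is_derive_Reals, psum_derive.
- intros y _ eps He. destruct (cvu_term n eps He) as [N HN]. exists N. intros m Hm. unfold Rdist. rewrite Rabs_minus_sym. now apply HN.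
- intros eps He. destruct (cvu_term (S n) eps He) as [N HN]. exists N. intros m y Hm _. now apply HN.
- intros y _. apply continuity_pt_filterlim, psi_cont.
Qed.

(* Each derivative gains a power of 1 + |k|. *)
Fixpoint symb (a n : nat) (f : R -> R) : Prop :=
  ((forall k, continuous f k) /\ exists E, 0 <= E /\ forall k, Rabs (f k) <= E * wt a k) /\
  match n with
  | O => True
  | S n => exists g, (forall k, is_derive f k (g k)) /\ symb (S a) n g
  end.

Lemma symb_pred a n f : symb a (S n) f -> symb a n f.
Proof.
revert a f. induction n as [|n IH]; intros a f [H1 [g [H2 H3]]].
- now split.
- split; [easy|]. exists g; split; [easy|]. now apply IH.
Qed.

Lemma symb_psi n m : symb (2 * qn + 1 + m) n (psi m).
Proof.
revert m. induction n as [|n IH]; intros m.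
- split; [|easy]. split; [apply psi_cont|apply psi_bound].
- split; [split; [apply psi_cont|apply psi_bound]|]. exists (psi (S m)). split; [apply psi_derive|].
  replace (S (2 * qn + 1 + m)) with (2 * qn + 1 + S m)%nat by lia. apply IH.
Qed.

Lemma symb_lin a n x y f g : symb a n f -> symb a n g -> symb a n (fun k => x * f k + y * g k).
Proof.
revert a f g. induction n as [|n IH]; intros a f g [[Cf [E [HE Bf]]] Hf] [[Cg [F [HF Bg]]] Hg].
all: assert (X : (forall k, continuous (fun k => x * f k + y * g k) k) /\ exists E, 0 <= E /\ forall k, Rabs (x * f k + y * g k) <= E * wt a k).
1,3: split; [intros k; apply (continuous_plus (fun k => x * f k) (fun k => y * g k));
   [apply (continuous_mult (fun _ => x) f); [apply continuous_const|apply Cf]|apply (continuous_mult (fun _ => y) g); [apply continuous_const|apply Cg]]|];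
   exists (Rabs x * E + Rabs y * F); split; [apply Rplus_le_le_0_compat; apply Rmult_le_pos; try apply Rabs_pos; easy|];
   intros k; apply Rle_trans with (1 := Rabs_triang _ _); rewrite !Rabs_mult, Rmult_plus_distr_r, !Rmult_assoc;
   apply Rplus_le_compat; apply Rmult_le_compat_l; try apply Rabs_pos; [apply Bf|apply Bg].
- now split.
- split; [easy|]. destruct Hf as [df [D1 D2]]. destruct Hg as [dg [D3 D4]].
  exists (fun k => x * df k + y * dg k). split; [|now apply IH]. intros k.
  apply (is_derive_plus (fun k => x * f k) (fun k => y * g k)); apply is_derive_scal; [apply D1|apply D3].
Qed.

Lemma wt_S a k : (1 + Rabs k) * wt (S a) k = wt a k.
Proof. unfold wt. assert (W := pow_abs1 k a). simpl. field. generalize (Rabs_pos k); intros; split; lra. Qed.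

Lemma symb_mulk a n f : symb (S a) n f -> symb a n (fun k => k * f k).
Proof.
revert a f. induction n as [|n IH]; intros a f H; assert (H' := H); destruct H as [[Cf [E [HE Bf]]] Hf].
all: assert (X : (forall k, continuous (fun k => k * f k) k) /\ exists E, 0 <= E /\ forall k, Rabs (k * f k) <= E * wt a k).
1,3: split; [intros k; apply (continuous_mult (fun k : R => k) f); [apply continuous_id|apply Cf]|];
  exists E; split; [easy|]; intros k; rewrite <- wt_S, <- Rmult_assoc, (Rmult_comm E), Rmult_assoc;
  apply abs_mult_le; [lra|apply Bf].
- now split.
- split; [easy|]. destruct Hf as [df [D1 D2]].
  exists (fun k => 1 * f k + 1 * (k * df k)). split.
  + intros k. assert (D := D1 k). auto_derive; [eexists; eassumption|]. use_der D. ring.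
  + apply symb_lin; [|now apply IH]. now apply symb_pred.
Qed.

Lemma symb_ext a n f g : (forall k, f k = g k) -> symb a n f -> symb a n g.
Proof.
intros E. destruct n as [|n]; intros [[X1 [B [HB X2]]] X3]; (split; [split|]).
1,4: intros k; apply continuous_ext with (2 := X1 k); intros; apply E.
1,3: exists B; split; [easy|]; intros k; rewrite <- E; apply X2.
- easy.
- destruct X3 as [h [X3 X4]]. exists h. split; [|easy]. intros k.
  apply is_derive_ext with (2 := X3 k). intros; apply E.
Qed.

Lemma symb_mulpow a n m f : symb (m + a) n f -> symb a n (fun k => k ^ m * f k).
Proof.
revert a. induction m as [|m IH]; intros a H.
- apply symb_ext with (2 := H). intros; simpl; ring.
- apply symb_ext with (fun k => k * (k ^ m * f k)); [intros; simpl; ring|].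
  apply symb_mulk, IH. now replace (m + S a)%nat with (S m + a)%nat by lia.
Qed.

Lemma symb_pSm n a f : (qn <= a)%nat -> symb a n f -> smooth_datum n f.
Proof.
revert a f. induction n as [|n IH]; intros a f Ha [[Cf [E [HE Bf]]] Hf].
all: assert (X : (forall k, continuous f k) /\ exists E, 0 <= E /\ forall k, Rabs (f k) <= E * wt qn k).
1,3: split; [easy|]; exists E; split; [easy|]; intros k; apply Rle_trans with (1 := Bf k); apply Rmult_le_compat_l; [easy|];
  unfold wt, Rdiv; apply Rmult_le_compat_l; [left; apply om_gt0|]; apply Rinv_le_contravar; [generalize (pow_abs1 k qn); lra|]; apply Rle_pow; [apply abs1_ge1|easy].
- now split.
- split; [easy|]. destruct Hf as [g [D1 D2]]. exists g; split; [easy|]. apply (IH (S a)); [lia|easy].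
Qed.

(** The factor [k ^ S qn] lowers the decay of [psi 0] exactly to [wt qn]. If [i + 2 j = qn + 1],
    then [k ^ i * k ^ S qn] is an even power, hence nonnegative, so that nothing cancels in the
    high-frequency linear part at [x = x0]. *)
Definition phi0 (c k : R) : R := c * (k ^ S qn * psi 0 k).

Lemma phi0_PS c n : symb qn n (phi0 c).
Proof.
assert (X : symb qn n (fun k => k ^ S qn * psi 0 k)).
{ apply symb_mulpow. replace (S qn + qn)%nat with (2 * qn + 1 + 0)%nat by lia. apply symb_psi. }
apply symb_ext with (2 := symb_lin _ _ c 0 _ _ X X). intros k; unfold phi0; ring.
Qed.

End GaussianSum.

(** * Growth of iterated logarithms and of the profile *)

Lemma ln_le_mono x y : 0 < x -> x <= y -> ln x <= ln y.
Proof. intros Hx [H|H]; [left; now apply ln_increasing|subst; right; easy]. Qed.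

Lemma iter_log_S r x : iter_log (S r) x = ln (iter_log r x).
Proof. reflexivity. Qed.

Lemma iter_log_large r M : exists X, forall x, X <= x -> M <= iter_log r x.
Proof.
revert M. induction r as [|r IH]; intros M.
- exists M. easy.
- destruct (IH (exp M)) as [X HX]. exists X. intros x Hx. specialize (HX x Hx). rewrite iter_log_S.
  rewrite <- (ln_exp M). apply ln_le_mono; [apply exp_pos|easy].
Qed.

Lemma iter_log_mono r : exists X, forall x y, X <= x -> x <= y -> iter_log r x <= iter_log r y.
Proof.
induction r as [|r [X HX]].
- exists 0. easy.
- destruct (iter_log_large r 1) as [X' HX']. exists (Rmax X X'). intros x y Hx Hxy.
  assert (A1 := Rmax_l X X'). assert (A2 := Rmax_r X X'). rewrite !iter_log_S.
  specialize (HX' x ltac:(lra)). apply ln_le_mono; [lra|]. apply HX; lra.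
Qed.

Lemma ln_1p_le e : 0 <= e -> ln (1 + e) <= e.
Proof. intros He. rewrite <- (ln_exp e) at 2. apply ln_le_mono; [lra|]. apply exp_ineq1_le. Qed.

(** For one logarithm, [ln 4] is eventually below [e * ln x]. A further logarithm turns the factor
    [1 + e] into a summand of at most [e], which is at most [e] times the iterate once that exceeds
    1. *)
Lemma iter_log_4 r e : (0 < r)%nat -> 0 < e -> exists X, forall x, X <= x -> iter_log r (4 * x) <= (1 + e) * iter_log r x.
Proof.
intros Hr He. destruct r as [|r]; [lia|]. clear Hr. induction r as [|r [X HX]].
- destruct (iter_log_large 1 (ln 4 / e)) as [X HX]. exists (Rmax 1 X). intros x Hx.
  assert (A1 := Rmax_l 1 X). assert (A2 := Rmax_r 1 X). specialize (HX x ltac:(lra)).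
  rewrite !iter_log_S in *. simpl in *. rewrite ln_mult by lra.
  apply (Rmult_le_compat_r e) in HX; [|lra]. unfold Rdiv in HX. rewrite Rmult_assoc, Rinv_l in HX by lra. lra.
- destruct (iter_log_large (S r) 1) as [X1 HX1]. destruct (iter_log_large (S (S r)) 1) as [X2 HX2].
  exists (Rmax 1 (Rmax X (Rmax X1 X2))). intros x Hx.
  assert (A1 := Rmax_l 1 (Rmax X (Rmax X1 X2))). assert (A2 := Rmax_r 1 (Rmax X (Rmax X1 X2))).
  assert (A3 := Rmax_l X (Rmax X1 X2)). assert (A4 := Rmax_r X (Rmax X1 X2)).
  assert (A5 := Rmax_l X1 X2). assert (A6 := Rmax_r X1 X2).
  specialize (HX x ltac:(lra)). assert (B1 := HX1 x ltac:(lra)). assert (B2 := HX2 x ltac:(lra)).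
  assert (B3 := HX1 (4 * x) ltac:(lra)).
  rewrite (iter_log_S (S r) (4 * x)).
  apply Rle_trans with (ln ((1 + e) * iter_log (S r) x)); [apply ln_le_mono; lra|].
  rewrite ln_mult by lra. rewrite <- iter_log_S. assert (K := ln_1p_le e ltac:(lra)). nra.
Qed.

(** Slow variation, tested only along the ratio 4. The lower bound 1 and the monotonicity make the
    class closed under products. *)
Definition slow (L : R -> R) : Prop :=
  (exists X, forall x, X <= x -> 1 <= L x) /\
  (exists X, forall x y, X <= x -> x <= y -> L x <= L y) /\
  (forall c, 1 < c -> exists X, forall x, X <= x -> L (4 * x) <= c * L x).

Lemma Rpower_ge1 x a : 1 <= x -> 0 <= a -> 1 <= Rpower x a.
Proof. intros Hx Ha. apply Rle_trans with (Rpower x 0); [rewrite Rpower_O; lra|]. now apply Rle_Rpower. Qed.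

Lemma slow_iter_log r a : (0 < r)%nat -> 0 <= a -> slow (fun x => Rpower (iter_log r x) a).
Proof.
intros Hr Ha. destruct (iter_log_large r 1) as [X1 H1]. destruct (iter_log_mono r) as [X2 H2].
split; [|split].
- exists X1. intros x Hx. apply Rpower_ge1; [now apply H1|easy].
- exists (Rmax X1 X2). intros x y Hx Hxy. assert (A1 := Rmax_l X1 X2). assert (A2 := Rmax_r X1 X2).
  specialize (H1 x ltac:(lra)). apply Rle_Rpower_l; [easy|]. split; [lra|]. apply H2; lra.
- intros c Hc.
  destruct (iter_log_4 r (Rpower c (/ (a + 1)) - 1) Hr) as [X3 H3].
  { assert (1 < Rpower c (/ (a + 1))); [|lra]. apply Rle_lt_trans with (Rpower c 0); [rewrite Rpower_O; lra|].
    apply Rpower_lt; [easy|]. apply Rinv_0_lt_compat; lra. }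
  exists (Rmax 1 (Rmax X1 X3)). intros x Hx.
  assert (A0 := Rmax_l 1 (Rmax X1 X3)). assert (A01 := Rmax_r 1 (Rmax X1 X3)).
  assert (A1 := Rmax_l X1 X3). assert (A2 := Rmax_r X1 X3).
  specialize (H3 x ltac:(lra)). assert (B := H1 x ltac:(lra)). assert (B' := H1 (4 * x) ltac:(lra)).
  replace (1 + (Rpower c (/ (a + 1)) - 1)) with (Rpower c (/ (a + 1))) in H3 by ring.
  apply Rle_trans with (Rpower (Rpower c (/ (a + 1)) * iter_log r x) a).
  + apply Rle_Rpower_l; [easy|lra].
  + rewrite <- Rpower_mult_distr by (apply exp_pos || lra). rewrite Rpower_mult.
    apply Rmult_le_compat_r; [left; apply exp_pos|].
    apply Rle_trans with (Rpower c 1); [|rewrite Rpower_1; lra]. apply Rle_Rpower; [lra|].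
    apply Rmult_le_reg_l with (a + 1); [lra|]. rewrite <- Rmult_assoc, Rinv_r; lra.
Qed.

Lemma slow_mult L K : slow L -> slow K -> slow (fun x => L x * K x).
Proof.
intros [[X1 H1] [[X2 H2] H3]] [[Y1 K1] [[Y2 K2] K3]]. split; [|split].
- exists (Rmax X1 Y1). intros x Hx. assert (A1 := Rmax_l X1 Y1). assert (A2 := Rmax_r X1 Y1).
  specialize (H1 x ltac:(lra)). specialize (K1 x ltac:(lra)). nra.
- exists (Rmax (Rmax X1 Y1) (Rmax X2 Y2)). intros x y Hx Hxy.
  assert (A1 := Rmax_l X1 Y1). assert (A2 := Rmax_r X1 Y1). assert (A3 := Rmax_l X2 Y2). assert (A4 := Rmax_r X2 Y2).
  assert (A5 := Rmax_l (Rmax X1 Y1) (Rmax X2 Y2)). assert (A6 := Rmax_r (Rmax X1 Y1) (Rmax X2 Y2)).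
  specialize (H1 x ltac:(lra)). specialize (K1 x ltac:(lra)).
  specialize (H2 x y ltac:(lra) Hxy). specialize (K2 x y ltac:(lra) Hxy). apply Rmult_le_compat; lra.
- intros c Hc. assert (Hs : 1 < sqrt c) by (rewrite <- sqrt_1; apply sqrt_lt_1; lra).
  destruct (H3 (sqrt c) Hs) as [X3 H3']. destruct (K3 (sqrt c) Hs) as [Y3 K3'].
  exists (Rmax 1 (Rmax (Rmax X1 Y1) (Rmax X3 Y3))). intros x Hx.
  assert (A0 := Rmax_l 1 (Rmax (Rmax X1 Y1) (Rmax X3 Y3))). assert (A00 := Rmax_r 1 (Rmax (Rmax X1 Y1) (Rmax X3 Y3))).
  assert (A1 := Rmax_l X1 Y1). assert (A2 := Rmax_r X1 Y1). assert (A3 := Rmax_l X3 Y3). assert (A4 := Rmax_r X3 Y3).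
  assert (A5 := Rmax_l (Rmax X1 Y1) (Rmax X3 Y3)). assert (A6 := Rmax_r (Rmax X1 Y1) (Rmax X3 Y3)).
  specialize (H3' x ltac:(lra)). specialize (K3' x ltac:(lra)).
  assert (B1 := H1 (4 * x) ltac:(lra)). assert (B2 := K1 (4 * x) ltac:(lra)).
  rewrite <- (sqrt_sqrt c) at 1 by lra.
  replace (sqrt c * sqrt c * (L x * K x)) with ((sqrt c * L x) * (sqrt c * K x)) by ring.
  apply Rmult_le_compat; lra.
Qed.

Lemma slow_prod p (r : nat -> nat) (a : nat -> R) :
  (forall j, (j < p)%nat -> (0 < r j)%nat) -> (forall j, (j < p)%nat -> 0 <= a j) ->
  slow (fun x => prod_upto p (fun j => Rpower (iter_log (r j) x) (a j))).
Proof.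
intros Hr Ha. induction p as [|p IH].
- simpl. split; [|split].
  + exists 0. intros; lra.
  + exists 0. intros; lra.
  + intros c Hc. exists 0. intros; lra.
- simpl. apply (slow_mult (fun x => prod_upto p (fun j => Rpower (iter_log (r j) x) (a j)))).
  + apply IH; intros j Hj; [apply Hr|apply Ha]; lia.
  + apply slow_iter_log; [apply Hr|apply Ha]; lia.
Qed.

(* Growth with ratios strictly between 1 and 2 along powers of 4; this is all that is used of the profile. *)
Definition regular (g : R -> R) (r1 r2 X0 : R) : Prop :=
  1 <= X0 /\ (forall x, X0 <= x -> 0 < g x) /\ (forall x y, X0 <= x -> x <= y -> g x <= g y) /\
  (forall x, X0 <= x -> r1 * g x <= g (4 * x)) /\ (forall x, X0 <= x -> g (4 * x) <= r2 * g x).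

(** Monotonicity of [L] gives the lower ratio; the slack [d' - d] in the exponent pays for its
    growth in the upper one. *)
Lemma slow_regular L d d' : slow L -> 0 < d -> d < d' -> exists X0,
  regular (fun x => Rpower x d * L x) (Rpower 4 d) (Rpower 4 d') X0.
Proof.
intros [[X1 H1] [[X2 H2] H3]] Hd Hd'.
assert (Hc : 1 < Rpower 4 (d' - d)) by (rewrite <- (Rpower_O 4) by lra; apply Rpower_lt; lra).
destruct (H3 _ Hc) as [X3 H3'].
exists (Rmax 1 (Rmax X1 (Rmax X2 X3))).
set (X0 := Rmax 1 (Rmax X1 (Rmax X2 X3))).
assert (A1 : 1 <= X0) by apply Rmax_l. assert (A2 : Rmax X1 (Rmax X2 X3) <= X0) by apply Rmax_r.
assert (A3 := Rmax_l X1 (Rmax X2 X3)). assert (A4 := Rmax_r X1 (Rmax X2 X3)).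
assert (A5 := Rmax_l X2 X3). assert (A6 := Rmax_r X2 X3).
assert (E4 : forall x, X0 <= x -> Rpower (4 * x) d = Rpower 4 d * Rpower x d) by (intros; symmetry; apply Rpower_mult_distr; lra).
split; [easy|split; [|split; [|split]]].
- intros x Hx. specialize (H1 x ltac:(lra)). apply Rmult_lt_0_compat; [apply exp_pos|lra].
- intros x y Hx Hxy. assert (B := H1 x ltac:(lra)). apply Rmult_le_compat; [left; apply exp_pos|lra| |apply H2; lra].
  apply Rle_Rpower_l; lra.
- intros x Hx. rewrite E4 by easy. rewrite Rmult_assoc. assert (P1 : 0 < Rpower 4 d) by apply exp_pos. assert (P2 : 0 < Rpower x d) by apply exp_pos.
  apply Rmult_le_compat_l; [lra|]. apply Rmult_le_compat_l; [lra|]. apply H2; lra.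
- intros x Hx. rewrite E4 by easy. specialize (H3' x ltac:(lra)).
  assert (P1 : 0 < Rpower 4 d) by apply exp_pos. assert (P2 : 0 < Rpower x d) by apply exp_pos.
  replace (Rpower 4 d') with (Rpower 4 d * Rpower 4 (d' - d)) by (rewrite <- Rpower_plus; f_equal; ring).
  replace (Rpower 4 d * Rpower 4 (d' - d) * (Rpower x d * L x)) with ((Rpower 4 d * Rpower x d) * (Rpower 4 (d' - d) * L x)) by ring.
  apply Rmult_le_compat_l; [|easy]. left; now apply Rmult_lt_0_compat.
Qed.

(** * Asymptotics of the linear part *)

(** With [y = sqrt lam * k], the function [y^(2 Q) exp (- y^2)] is at most a constant times
    [/ (1 + y^2)], whose integral is an arctangent. An upper bound of the correct scaling in [lam]
    is enough. *)
Lemma gauss_moment Q : exists C, 0 < C /\ forall lam r, 0 < lam -> 0 < r ->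
  RInt (fun k => k ^ (2 * Q) * exp (- (lam * k ^ 2))) (- r) r <= C / (lam ^ Q * sqrt lam).
Proof.
destruct (gauss_der_bound 0 (2 * Q + 2)) as [C [HC Hb]]. assert (HP := PI_RGT_0).
exists ((C + 1) * PI). split; [apply Rmult_lt_0_compat; lra|]. intros lam r Hl Hr.
assert (Hs := sqrt_lt_R0 lam Hl). set (m := sqrt lam) in *.
assert (Em : m * m = lam) by (apply sqrt_sqrt; lra).
assert (Hd : forall k, 0 < 1 + (m * k) ^ 2) by (intros; generalize (pow2_ge_0 (m * k)); lra).
assert (LQ : 0 < lam ^ Q) by now apply pow_lt.
set (D := fun k => (C + 1) / lam ^ Q * / (1 + (m * k) ^ 2)).
assert (CD : forall k, continuous D k).
{ intros k. apply (ex_derive_continuous D). unfold D. auto_derive. specialize (Hd k). simpl in Hd. lra. }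
assert (CF : forall k, continuous (fun k => k ^ (2 * Q) * exp (- (lam * k ^ 2))) k).
{ intros k. apply (continuous_mult (fun k => k ^ (2 * Q)) (fun k => exp (- (lam * k ^ 2)))); [apply cont_pow|].
  apply (ex_derive_continuous (fun k => exp (- (lam * k ^ 2)))). auto_derive; easy. }
apply Rle_trans with (RInt D (- r) r).
- apply RInt_le; [lra|now apply ex_RInt_cont|now apply ex_RInt_cont|]. intros k _.
  specialize (Hb (m * k)). specialize (Hd k).
  set (y := m * k) in *. set (m0 := Rabs y) in *.
  assert (HR : 0 <= m0) by apply Rabs_pos. assert (ER : m0 ^ 2 = y ^ 2) by apply pow2_abs.
  assert (Ey : lam * k ^ 2 = y ^ 2) by (unfold y; rewrite <- Em; ring).
  assert (Ek : k ^ (2 * Q) * lam ^ Q = m0 ^ (2 * Q)).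
  { rewrite !pow_mult, ER, <- Ey, Rpow_mult_distr. ring. }
  simpl gauss_der in Hb. rewrite Rabs_right in Hb by (left; apply exp_pos). rewrite Ey.
  assert (E := exp_pos (- y ^ 2)). replace (- (y * (y * 1))) with (- y ^ 2) in Hb by ring.
  assert (K : exp (- y ^ 2) * (m0 ^ (2 * Q) * (1 + y ^ 2)) <= C).
  { apply Rle_trans with (2 := Hb). apply Rmult_le_compat_l; [lra|]. rewrite pow_add. rewrite <- ER.
    apply Rmult_le_compat; [now apply pow_le|generalize (pow2_ge_0 m0); lra|apply pow_incr; lra|nra]. }
  unfold D. fold y. apply Rmult_le_reg_r with (lam ^ Q * (1 + y ^ 2)); [now apply Rmult_lt_0_compat|].
  replace ((C + 1) / lam ^ Q * / (1 + y ^ 2) * (lam ^ Q * (1 + y ^ 2))) with (C + 1) by (field; lra).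
  replace (k ^ (2 * Q) * exp (- y ^ 2) * (lam ^ Q * (1 + y ^ 2))) with (exp (- y ^ 2) * ((k ^ (2 * Q) * lam ^ Q) * (1 + y ^ 2))) by ring.
  rewrite Ek. apply Rle_trans with (1 := K). lra.
- assert (E : is_RInt D (- r) r (minus ((C + 1) / lam ^ Q / m * atan (m * r)) ((C + 1) / lam ^ Q / m * atan (m * - r)))).
  { apply (is_RInt_derive (fun k => (C + 1) / lam ^ Q / m * atan (m * k)) D).
    - intros k _. specialize (Hd k). unfold D.
      replace ((C + 1) / lam ^ Q * / (1 + (m * k) ^ 2)) with ((C + 1) / lam ^ Q / m * (m * / (1 + (m * k) ^ 2))) by (field; lra).
      apply is_derive_scal. apply (is_derive_comp atan (fun k => m * k)).
      + apply is_derive_Reals. apply derivable_pt_lim_atan.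
      + auto_derive; [easy|ring].
    - intros; apply CD. }
  rewrite (is_RInt_unique _ _ _ _ E). unfold minus, plus, opp; simpl.
  destruct (atan_bound (m * r)) as [_ A1]. destruct (atan_bound (m * - r)) as [A2 _].
  assert (Z : 0 < (C + 1) / lam ^ Q / m) by (apply Rdiv_lt_0_compat; [apply Rdiv_lt_0_compat; lra|easy]).
  replace ((C + 1) * PI / (lam ^ Q * m)) with ((C + 1) / lam ^ Q / m * PI) by (field; lra).
  set (Zc := (C + 1) / lam ^ Q / m) in *.
  replace (Zc * atan (m * r) + - (Zc * atan (m * - r))) with (Zc * (atan (m * r) - atan (m * - r))) by ring.
  apply Rmult_le_compat_l; lra.
Qed.

Section Asymptotics.
Context {P : params}.

Lemma intR_le_of_RInt C f B : dom C f -> (forall r, 0 < r -> RInt f (- r) r <= B) -> intR f <= B.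
Proof.
intros Hf H. apply Rnot_lt_le. intros Hlt. assert (HC := dom_ge0 _ _ Hf).
destruct (tail_small_mul (2 * C) (intR f - B)) as [r [Hr Ht]]; [lra|lra|].
assert (K := intR_key C f r (- r) r Hf ltac:(lra) ltac:(lra) ltac:(lra)). specialize (H r Hr).
apply Rabs_le_between in K. lra.
Qed.

Lemma intR_ge_RInt C f a b : dom C f -> (forall k, 0 <= f k) -> 0 < a <= b -> RInt f a b <= intR f.
Proof.
intros Hf H0 Hab. apply Rnot_lt_le. intros Hlt. assert (HC := dom_ge0 _ _ Hf).
destruct (tail_small_mul (2 * C) (RInt f a b - intR f)) as [r [Hr Ht]]; [lra|lra|].
set (r' := r + b).
assert (K := intR_key C f r (- r') r' Hf ltac:(lra) ltac:(unfold r'; lra) ltac:(unfold r'; lra)).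
assert (E : RInt f (- r') r' = RInt f (- r') a + (RInt f a b + RInt f b r')).
{ rewrite !RInt_ChaslesR by apply Hf. reflexivity. }
assert (N1 : 0 <= RInt f (- r') a) by (apply RInt_ge_0; [unfold r'; lra|apply ex_RInt_cont, Hf|intros; apply H0]).
assert (N2 : 0 <= RInt f b r') by (apply RInt_ge_0; [unfold r'; lra|apply ex_RInt_cont, Hf|intros; apply H0]).
apply Rabs_le_between in K. lra.
Qed.

Variables (g : R -> R) (r1 r2 X0 : R).
Hypothesis Hreg : regular g r1 r2 X0.
Hypothesis Hr1 : 1 < r1.
Hypothesis Hr2 : 0 < r2 <= 2.
Hypothesis Hrr : r2 * Rpower (/ 2) (1 - th) < 1.

Definition Xj (j : nat) : R := X0 * 4 ^ j.
Definition Gj (j : nat) : R := g (Xj j).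
Definition tj (j : nat) : R := / sqrt (Xj j).

Lemma pow4_ge1 j : 1 <= 4 ^ j.
Proof. apply pow_R1_Rle; lra. Qed.

Lemma Xj_ge j : X0 <= Xj j.
Proof. destruct Hreg as [H _]. unfold Xj. assert (K := pow4_ge1 j). nra. Qed.

Lemma Xj_ge1 j : 1 <= Xj j.
Proof. destruct Hreg as [H _]. assert (K := Xj_ge j). lra. Qed.

Lemma Xj_S j : Xj (S j) = 4 * Xj j.
Proof. unfold Xj. simpl. ring. Qed.

Lemma Gj_gt0 j : 0 < Gj j.
Proof. destruct Hreg as [_ [H _]]. apply H, Xj_ge. Qed.

Lemma Gj_lo j : r1 * Gj j <= Gj (S j).
Proof. destruct Hreg as [_ [_ [_ [H _]]]]. unfold Gj. rewrite Xj_S. apply H, Xj_ge. Qed.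

Lemma Gj_hi j : Gj (S j) <= r2 * Gj j.
Proof. destruct Hreg as [_ [_ [_ [_ H]]]]. unfold Gj. rewrite Xj_S. apply H, Xj_ge. Qed.

Lemma tj_bd j : 0 < tj j <= 1.
Proof.
assert (H := Xj_ge1 j). assert (Hs : 1 <= sqrt (Xj j)) by (rewrite <- sqrt_1; now apply sqrt_le_1_alt).
unfold tj. split; [apply Rinv_0_lt_compat; lra|]. apply Rle_trans with (/ 1); [apply Rinv_le_contravar; lra|lra].
Qed.

Lemma tj_sq j : tj j ^ 2 = / Xj j.
Proof.
assert (H := Xj_ge1 j). unfold tj. rewrite pow_inv. f_equal. simpl. rewrite Rmult_1_r. apply sqrt_sqrt. lra.
Qed.

Lemma tj_S j : tj (S j) = / 2 * tj j.
Proof.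
assert (H := Xj_ge1 j). unfold tj. rewrite Xj_S, sqrt_mult by lra.
replace 4 with (2 * 2) by ring. rewrite sqrt_square by lra. rewrite Rinv_mult. reflexivity.
Qed.

Lemma Gj_pow j : Gj j <= Gj 0 * r2 ^ j.
Proof.
induction j as [|j IH]; [simpl; lra|]. apply Rle_trans with (1 := Gj_hi j). simpl.
apply Rle_trans with (r2 * (Gj 0 * r2 ^ j)); [apply Rmult_le_compat_l; lra|right; ring].
Qed.

Definition ratio : R := r2 * Rpower (/ 2) (1 - th).

Lemma ratio_bd : 0 <= ratio < 1.
Proof. split; [|exact Hrr]. unfold ratio. apply Rmult_le_pos; [lra|left; apply exp_pos]. Qed.

(** From one scale to the next [Gj] grows by at most [r2], while [tj] is halved; [Hrr] says that the
    product of the two effects is below 1. *)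
Lemma Gj_tj_le j : Gj j * Rpower (tj j) (1 - th) <= Gj 0 * ratio ^ j.
Proof.
assert (T : Rpower (tj j) (1 - th) <= Rpower (/ 2) (1 - th) ^ j).
{ induction j as [|j IH].
  - simpl. destruct (tj_bd 0). assert (H1 := th_le1).
    apply Rle_trans with (Rpower 1 (1 - th)); [apply Rle_Rpower_l; lra|]. unfold Rpower. rewrite ln_1, Rmult_0_r, exp_0. lra.
  - rewrite tj_S. destruct (tj_bd j). rewrite <- Rpower_mult_distr by lra. simpl.
    apply Rmult_le_compat_l; [left; apply exp_pos|easy]. }
unfold ratio. rewrite Rpow_mult_distr, <- Rmult_assoc.
apply Rmult_le_compat; [left; apply Gj_gt0|left; apply exp_pos|apply Gj_pow|easy].
Qed.

Definition psi0 (k : R) : R := psi tj Gj 0 k.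

Lemma term0 k j : term tj Gj 0 k j = coef tj Gj j * exp (- (tj j ^ 2 * k ^ 2)).
Proof. unfold term. simpl gauss_der. simpl pow. rewrite Rmult_1_r. f_equal. f_equal. ring. Qed.

Lemma coef_ge0 j : 0 <= coef tj Gj j.
Proof. unfold coef. apply Rmult_le_pos; [left; apply Gj_gt0|apply pow_le; destruct (tj_bd j); lra]. Qed.

Lemma psi0_unif : exists C, 0 <= C /\ forall k N, Rabs (psi0 k - sum_f_R0 (term tj Gj 0 k) N) <= C * ratio ^ S N.
Proof. apply (psum_unif tj Gj (Gj 0) ratio tj_bd (fun j => Rlt_le _ _ (Gj_gt0 j)) ratio_bd (Rlt_le _ _ (Gj_gt0 0)) Gj_tj_le). Qed.

Lemma psi0_ge j k : coef tj Gj j * exp (- (tj j ^ 2 * k ^ 2)) <= psi0 k.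
Proof.
rewrite <- term0. destruct psi0_unif as [C [HC Hb]].
assert (T0 : forall i, 0 <= term tj Gj 0 k i) by (intros; rewrite term0; apply Rmult_le_pos; [apply coef_ge0|left; apply exp_pos]).
assert (S0 : forall N, (j <= N)%nat -> term tj Gj 0 k j <= sum_f_R0 (term tj Gj 0 k) N).
{ intros N HN. induction HN as [|N HN IH].
  - destruct j; [simpl; lra|]. simpl. assert (0 <= sum_f_R0 (term tj Gj 0 k) j) by (apply cond_pos_sum; apply T0). lra.
  - simpl. specialize (T0 (S N)). lra. }
apply Rnot_lt_le. intros Hlt.
assert (Hd : 0 < term tj Gj 0 k j - psi0 k) by lra.
destruct (pow_small C ratio (term tj Gj 0 k j - psi0 k) HC ratio_bd Hd) as [N HN].
specialize (HN (N + j)%nat ltac:(lia)). specialize (Hb k (N + j)%nat). specialize (S0 (N + j)%nat ltac:(lia)).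
apply Rabs_le_between in Hb. lra.
Qed.

Lemma psi0_ge0 k : 0 <= psi0 k.
Proof. apply Rle_trans with (2 := psi0_ge 0 k). apply Rmult_le_pos; [apply coef_ge0|left; apply exp_pos]. Qed.

Lemma psi0_cont k : continuous psi0 k.
Proof. apply (psi_cont tj Gj (Gj 0) ratio tj_bd (fun j => Rlt_le _ _ (Gj_gt0 j)) ratio_bd (Rlt_le _ _ (Gj_gt0 0)) Gj_tj_le). Qed.

Lemma find_scale y : X0 <= y -> exists j, Xj j <= y < Xj (S j).
Proof.
intros Hy. destruct Hreg as [HX _].
assert (U : exists n, y < Xj n).
{ destruct (Pow_x_infinity 4 ltac:(rewrite Rabs_right; lra) (y + 1)) as [N HN]. exists N. specialize (HN N (Nat.le_refl _)).
  rewrite Rabs_right in HN by (apply Rle_ge, pow_le; lra). unfold Xj. assert (K := pow4_ge1 N). nra. }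
destruct U as [n Hn]. induction n as [|n IH].
- unfold Xj in Hn. simpl in Hn. lra.
- destruct (Rle_lt_dec (Xj n) y) as [H|H]; [now exists n|now apply IH].
Qed.

Lemma g_scale y j : Xj j <= y < Xj (S j) -> Gj j <= g y /\ g y <= r2 * Gj j.
Proof.
intros [H1 H2]. destruct Hreg as [HX [_ [Hm _]]]. split.
- apply Hm; [apply Xj_ge|easy].
- apply Rle_trans with (Gj (S j)); [apply Hm; [apply Rle_trans with (1 := Xj_ge j); easy|lra]|apply Gj_hi].
Qed.

(** The ratio [r1 > 1] along powers of 4 forces [g] to infinity, so that bounded errors can be
    absorbed. *)
Lemma g_large M : exists y0, X0 <= y0 /\ forall y, y0 <= y -> M <= g y.
Proof.
assert (K : forall j, r1 ^ j * Gj 0 <= Gj j).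
{ induction j as [|j IH]; [simpl; lra|]. apply Rle_trans with (2 := Gj_lo j). simpl. rewrite Rmult_assoc. apply Rmult_le_compat_l; lra. }
destruct (Pow_x_infinity r1 ltac:(rewrite Rabs_right; lra) (M / Gj 0)) as [N HN].
exists (Xj N). split; [apply Xj_ge|]. intros y Hy. destruct Hreg as [_ [_ [Hm _]]].
apply Rle_trans with (Gj N); [|apply Hm; [apply Xj_ge|easy]]. apply Rle_trans with (2 := K N).
specialize (HN N (Nat.le_refl _)). rewrite Rabs_right in HN by (apply Rle_ge, pow_le; lra).
assert (G0 := Gj_gt0 0). apply Rge_le in HN. apply (Rmult_le_compat_r (Gj 0)) in HN; [|lra].
unfold Rdiv in HN. rewrite Rmult_assoc, Rinv_l in HN; lra.
Qed.

Lemma tau_coef j : coef tj Gj j * sqrt (Xj j) ^ (2 * qn + 3) = Gj j.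
Proof.
unfold coef, tj. assert (H := Xj_ge1 j). assert (Hs := sqrt_lt_R0 (Xj j) ltac:(lra)).
rewrite pow_inv. field. apply pow_nonzero; lra.
Qed.

Lemma RInt_ge_const (f : R -> R) a b c : a <= b -> (forall k, continuous f k) -> (forall k, a <= k <= b -> c <= f k) ->
  (b - a) * c <= RInt f a b.
Proof.
intros Hab Hc H. rewrite <- (RInt_const (V := R_CompleteNormedModule) a b c : RInt (fun _ => c) a b = (b - a) * c).
apply RInt_le; [easy|apply ex_RInt_const|now apply ex_RInt_cont|]. intros; apply H; lra.
Qed.

(** A single Gaussian suffices, the one whose scale [Xj j] is comparable to [/ s], integrated over
    [[a, 2 a]] with [a = sqrt (Xj j)] only. The length of that interval times [a ^ (2 * S qn)]
    cancels the power of [tj] in [coef] and leaves [Gj j]. *)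
Lemma asym_lower K0 a1 C2 : 0 < K0 -> 0 < a1 -> 0 <= C2 -> exists c C, 0 < c /\ 0 <= C /\
  forall s E F, 0 < s <= / X0 -> dom E F ->
  (forall k, Rabs k <= K0 -> Rabs (F k) <= C2) ->
  (forall k, K0 <= Rabs k -> a1 * (k ^ (2 * S qn) * psi0 k * exp (- (k ^ 2 * s))) <= F k) ->
  c * g (/ s) - C <= intR F.
Proof.
intros HK Ha HC2.
(* As [om k] is at least [/ (1 + |k|)^2], the function [C3 * om] exceeds [C2] for [|k| <= K0].
   Adding it makes the integrand nonnegative, so that the integral may be restricted to a
   subinterval. *)
set (C3 := C2 * (1 + K0) ^ 2). assert (H3 : 0 <= C3) by (apply Rmult_le_pos; [easy|apply pow_le; lra]).
(* On [[a, 2 a]] each of the exponents [tj^2 k^2] and [k^2 s] is at most 4, hence the 8; [r2] passes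
   from [Gj j] to [g (/ s)]. *)
set (c := a1 * exp (-8) / r2). assert (E8 := exp_pos (-8)).
assert (Hc : 0 < c) by (apply Rdiv_lt_0_compat; [now apply Rmult_lt_0_compat|lra]).
(* below the frequency cutoff K0 the scale 1/s is bounded *)
destruct Hreg as [HX _].
exists c, (C3 * intR om + c * (r2 * g (Xj 0 + K0 ^ 2))).
assert (G1 : 0 < g (Xj 0 + K0 ^ 2)).
{ destruct Hreg as [_ [Hp _]]. apply Hp. assert (X := Xj_ge 0). generalize (pow2_ge_0 K0); lra. }
assert (R0 := intR_om_ge0).
assert (N0 : 0 <= C3 * intR om) by now apply Rmult_le_pos.
assert (N1 : 0 <= c * (r2 * g (Xj 0 + K0 ^ 2))) by (apply Rmult_le_pos; [lra|apply Rmult_le_pos; lra]).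
split; [easy|split; [lra|]]. intros s E F Hs HF Hlow Hhigh.
assert (Hs1 : X0 <= / s).
{ rewrite <- (Rinv_inv X0). apply Rinv_le_contravar; lra. }
destruct (find_scale (/ s) Hs1) as [j Hj]. destruct (g_scale _ _ Hj) as [_ Hg].
assert (DF : dom (E + Rabs C3 * 1) (fun k => F k + C3 * om k)) by (apply dom_plus; [easy|apply dom_scal, dom_om]).
assert (EF : intR (fun k => F k + C3 * om k) = intR F + C3 * intR om).
{ rewrite (intR_plus _ _ _ _ HF (dom_scal _ C3 _ dom_om)), (intR_scal _ _ _ dom_om). easy. }
assert (PF : forall k, 0 <= F k + C3 * om k).
{ intros k. assert (O := om_gt0 k). destruct (Rle_lt_dec (Rabs k) K0) as [Hk|Hk].
  - specialize (Hlow k Hk). apply Rabs_le_between in Hlow.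
    assert (C2 <= C3 * om k).
    { unfold C3. rewrite Rmult_assoc. rewrite <- (Rmult_1_r C2) at 1. apply Rmult_le_compat_l; [easy|].
      apply Rle_trans with ((1 + K0) ^ 2 * / (1 + Rabs k) ^ 2).
      - assert (Pk := pow_abs1 k 2). apply Rmult_le_reg_r with ((1 + Rabs k) ^ 2); [lra|].
        rewrite Rmult_assoc, Rinv_l by lra. rewrite Rmult_1_l, Rmult_1_r. apply pow_incr. generalize (Rabs_pos k); lra.
      - apply Rmult_le_compat_l; [apply pow_le; lra|apply om_ge]. }
    lra.
  - specialize (Hhigh k ltac:(lra)).
    assert (0 <= a1 * (k ^ (2 * S qn) * psi0 k * exp (- (k ^ 2 * s)))).
    { apply Rmult_le_pos; [lra|]. apply Rmult_le_pos; [|left; apply exp_pos]. apply Rmult_le_pos; [|apply psi0_ge0].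
      rewrite pow_mult. apply pow_le, pow2_ge_0. }
    assert (0 <= C3 * om k) by (apply Rmult_le_pos; lra). lra. }
assert (HX1 := Xj_ge1 j).
set (a := sqrt (Xj j)).
assert (Ha0 : 1 <= a) by (unfold a; rewrite <- sqrt_1; now apply sqrt_le_1_alt).
assert (Ea : a * a = Xj j) by (apply sqrt_sqrt; lra).
destruct (Rle_lt_dec K0 a) as [HKa|HKa].
- assert (L : (2 * a - a) * (a1 * (a ^ (2 * S qn) * coef tj Gj j * exp (-8))) <= RInt (fun k => F k + C3 * om k) a (2 * a)).
  { apply RInt_ge_const; [lra|apply DF|]. intros k Hk. specialize (Hhigh k ltac:(rewrite Rabs_right; lra)).
    assert (O := om_gt0 k). assert (0 <= C3 * om k) by (apply Rmult_le_pos; lra).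
    apply Rle_trans with (F k); [|lra]. apply Rle_trans with (2 := Hhigh). apply Rmult_le_compat_l; [lra|].
    assert (Hp := psi0_ge j k). assert (Hcf := coef_ge0 j).
    apply Rle_trans with (k ^ (2 * S qn) * (coef tj Gj j * exp (- (tj j ^ 2 * k ^ 2))) * exp (- (k ^ 2 * s))).
    - replace (k ^ (2 * S qn) * (coef tj Gj j * exp (- (tj j ^ 2 * k ^ 2))) * exp (- (k ^ 2 * s))) with
        (k ^ (2 * S qn) * coef tj Gj j * (exp (- (tj j ^ 2 * k ^ 2)) * exp (- (k ^ 2 * s)))) by ring.
      rewrite <- exp_plus. apply Rmult_le_compat; [apply Rmult_le_pos; [apply pow_le; lra|easy]|lra| |].
      + apply Rmult_le_compat_r; [easy|]. apply pow_incr; lra.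
      + apply exp_le_mono. rewrite tj_sq.
        assert (S1 : s <= / Xj j) by (rewrite <- (Rinv_inv s); apply Rinv_le_contravar; lra).
        assert (K2 : k ^ 2 <= 4 * Xj j) by (rewrite <- Ea; nra).
        assert (I0 : 0 < / Xj j) by (apply Rinv_0_lt_compat; lra).
        assert (I1 : / Xj j * k ^ 2 <= 4).
        { apply Rle_trans with (/ Xj j * (4 * Xj j)); [apply Rmult_le_compat_l; lra|right; field; lra]. }
        assert (I2 : k ^ 2 * s <= / Xj j * k ^ 2) by (rewrite Rmult_comm; apply Rmult_le_compat_r; [apply pow2_ge_0|easy]). lra.
    - apply Rmult_le_compat_r; [left; apply exp_pos|]. apply Rmult_le_compat_l; [apply pow_le; lra|easy]. }
  assert (M := intR_ge_RInt _ _ a (2 * a) DF PF ltac:(lra)).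
  assert (E2 : (2 * a - a) * (a1 * (a ^ (2 * S qn) * coef tj Gj j * exp (-8))) = a1 * exp (-8) * Gj j).
  { rewrite <- (tau_coef j). fold a. replace (2 * qn + 3)%nat with (S (2 * S qn)) by lia. simpl pow. ring. }
  assert (E3 : c * g (/ s) <= a1 * exp (-8) * Gj j).
  { unfold c. apply Rle_trans with (a1 * exp (-8) / r2 * (r2 * Gj j)).
    - apply Rmult_le_compat_l; [fold c; lra|easy].
    - right. field. lra. }
  lra.
- assert (E4 : g (/ s) <= r2 * g (Xj 0 + K0 ^ 2)).
  { apply Rle_trans with (1 := Hg). apply Rmult_le_compat_l; [lra|]. unfold Gj.
    destruct Hreg as [_ [_ [Hm _]]]. apply Hm; [apply Xj_ge|]. rewrite <- Ea. assert (X := Xj_ge1 0). nra. }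
  assert (E5 : c * g (/ s) <= c * (r2 * g (Xj 0 + K0 ^ 2))) by (apply Rmult_le_compat_l; lra).
  assert (E6 : 0 <= intR (fun k => F k + C3 * om k)).
  { apply Rle_trans with (RInt (fun k => F k + C3 * om k) 1 1); [rewrite RInt_point; right; reflexivity|]. apply (intR_ge_RInt _ _ 1 1 DF PF); lra. }
  lra.
Qed.

(** Read backwards, the terms decrease at least geometrically with ratio [/ r1], so the last one
    dominates. *)
Lemma sum_G_bound J : sum_f_R0 Gj J <= r1 / (r1 - 1) * Gj J.
Proof.
assert (Hq : 1 <= r1 / (r1 - 1)).
{ apply Rmult_le_reg_r with (r1 - 1); [lra|]. unfold Rdiv. rewrite Rmult_assoc, Rinv_l; lra. }
induction J as [|J IH].
- simpl. assert (G0 := Gj_gt0 0). nra.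
- simpl. assert (L := Gj_lo J). assert (G0 := Gj_gt0 J). assert (G1 := Gj_gt0 (S J)).
  assert (E : r1 / (r1 - 1) * Gj J <= / (r1 - 1) * Gj (S J)).
  { unfold Rdiv. rewrite (Rmult_comm r1), Rmult_assoc. apply Rmult_le_compat_l; [left; apply Rinv_0_lt_compat; lra|easy]. }
  replace (r1 / (r1 - 1) * Gj (S J)) with (/ (r1 - 1) * Gj (S J) + Gj (S J)) by (field; lra). lra.
Qed.

(** The contributions are summed in two ranges around the scale [J] of [/ s]. Up to [J] the minimum
    is bounded by 1 and [sum_G_bound] applies; beyond [J] the terms [Gj / (Xj s)] decay
    geometrically because [r2 <= 2 < 4]. Both ranges give a multiple of [Gj J]. *)
Lemma asym_upper K0 a2 C2 : 0 < K0 -> 0 < a2 -> 0 <= C2 -> exists c C, 0 < c /\ 0 <= C /\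
  forall s E F, 0 < s <= / X0 -> dom E F ->
  (forall k, Rabs k <= K0 -> Rabs (F k) <= C2) ->
  (forall k, K0 <= Rabs k -> F k <= a2 * (k ^ (2 * S qn) * psi0 k * exp (- (k ^ 2 * s)))) ->
  intR F <= c * g (/ s) + C.
Proof.
intros HK Ha HC2. destruct (gauss_moment (S qn)) as [CQ [HCQ Hgm]]. destruct Hreg as [HX _].
set (C3 := C2 * (1 + K0) ^ 2). assert (H3 : 0 <= C3) by (apply Rmult_le_pos; [easy|apply pow_le; lra]).
assert (Hq : 0 < r1 / (r1 - 1)) by (apply Rdiv_lt_0_compat; lra).
exists (a2 * (CQ * (r1 / (r1 - 1) + 4))), (C3 * intR om).
assert (R0 := intR_om_ge0).
split; [apply Rmult_lt_0_compat; [easy|apply Rmult_lt_0_compat; lra]|split; [now apply Rmult_le_pos|]].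
intros s E F Hs HF Hlow Hhigh.
assert (Hs1 : X0 <= / s) by (rewrite <- (Rinv_inv X0); apply Rinv_le_contravar; lra).
destruct (find_scale (/ s) Hs1) as [J HJ]. destruct (g_scale _ _ HJ) as [HgJ _].
set (H := fun k => k ^ (2 * S qn) * psi0 k * exp (- (k ^ 2 * s))).
assert (He : forall k, 0 < exp (- (k ^ 2 * s))) by (intros; apply exp_pos).
assert (Hk2 : forall k, 0 <= k ^ (2 * S qn)) by (intros; rewrite pow_mult; apply pow_le, pow2_ge_0).
assert (Ce : forall k, continuous (fun k => exp (- (k ^ 2 * s))) k).
{ intros k. apply (ex_derive_continuous (fun k => exp (- (k ^ 2 * s)))). auto_derive; easy. }
assert (CH : forall k, continuous H k).
{ intros k. apply (continuous_mult (fun k => k ^ (2 * S qn) * psi0 k) (fun k => exp (- (k ^ 2 * s)))); [|apply Ce].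
  apply (continuous_mult (fun k => k ^ (2 * S qn)) psi0); [apply cont_pow|apply psi0_cont]. }
assert (PF : forall k, F k + (- C3) * om k <= a2 * H k).
{ intros k. assert (O := om_gt0 k). destruct (Rle_lt_dec (Rabs k) K0) as [Hk|Hk].
  - specialize (Hlow k Hk). apply Rabs_le_between in Hlow.
    assert (C2 <= C3 * om k).
    { unfold C3. rewrite Rmult_assoc. rewrite <- (Rmult_1_r C2) at 1. apply Rmult_le_compat_l; [easy|].
      apply Rle_trans with ((1 + K0) ^ 2 * / (1 + Rabs k) ^ 2).
      - assert (Pk := pow_abs1 k 2). apply Rmult_le_reg_r with ((1 + Rabs k) ^ 2); [lra|].
        rewrite Rmult_assoc, Rinv_l by lra. rewrite Rmult_1_l, Rmult_1_r. apply pow_incr. generalize (Rabs_pos k); lra.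
      - apply Rmult_le_compat_l; [apply pow_le; lra|apply om_ge]. }
    assert (0 <= a2 * H k).
    { apply Rmult_le_pos; [lra|]. unfold H. apply Rmult_le_pos; [|left; apply exp_pos]. apply Rmult_le_pos; [apply Hk2|apply psi0_ge0]. }
    lra.
  - specialize (Hhigh k ltac:(lra)). fold (H k) in Hhigh.
    assert (0 <= C3 * om k) by (apply Rmult_le_pos; lra). lra. }
assert (DF := dom_plus _ _ _ _ HF (dom_scal _ (- C3) _ dom_om)).
assert (EF : intR (fun k => F k + (- C3) * om k) = intR F - C3 * intR om).
{ rewrite (intR_plus _ _ _ _ HF (dom_scal _ (- C3) _ dom_om)), (intR_scal _ _ _ dom_om). ring. }
assert (G0 : forall j, 0 < Gj j) by apply Gj_gt0.
(* the j-th Gaussian contributes at most CQ G_j min (1, 1 / (X_j s)) *)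
set (mj := fun j => Gj j * Rmin 1 (/ (Xj j * s))).
assert (T : forall j r, 0 < r -> RInt (fun k => k ^ (2 * S qn) * term tj Gj 0 k j * exp (- (k ^ 2 * s))) (- r) r <= CQ * mj j).
{ intros j r Hr. assert (HXj := Xj_ge1 j). destruct (tj_bd j) as [Ht0 Ht1]. assert (Et := tj_sq j).
  set (t := tj j) in *. set (lam := t ^ 2 + s).
  assert (Ht2 : 0 < t ^ 2) by (apply pow_lt; easy).
  assert (Hl : 0 < lam) by (unfold lam; lra).
  assert (Cm : forall k, continuous (fun k => k ^ (2 * S qn) * exp (- (lam * k ^ 2))) k).
  { intros k. apply (continuous_mult (fun k => k ^ (2 * S qn)) (fun k => exp (- (lam * k ^ 2)))); [apply cont_pow|].
    apply (ex_derive_continuous (fun k => exp (- (lam * k ^ 2)))). auto_derive; easy. }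
  assert (E1 : RInt (fun k => k ^ (2 * S qn) * term tj Gj 0 k j * exp (- (k ^ 2 * s))) (- r) r =
     coef tj Gj j * RInt (fun k => k ^ (2 * S qn) * exp (- (lam * k ^ 2))) (- r) r).
  { rewrite <- RInt_scalR by exact Cm. apply RInt_ext. intros k _. rewrite term0. fold t.
    replace (- (lam * k ^ 2)) with (- (t ^ 2 * k ^ 2) + - (k ^ 2 * s)) by (unfold lam; ring). rewrite exp_plus. Rring. }
  rewrite E1. specialize (Hgm lam r Hl Hr).
  apply Rle_trans with (coef tj Gj j * (CQ / (lam ^ S qn * sqrt lam))); [apply Rmult_le_compat_l; [apply coef_ge0|easy]|].
  assert (Hsl := sqrt_lt_R0 lam Hl). assert (LQ : 0 < lam ^ S qn) by now apply pow_lt.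
  assert (Q1 : t <= sqrt lam).
  { rewrite <- (sqrt_square t) by lra. apply sqrt_le_1_alt. unfold lam. simpl. lra. }
  (* The flow widens [t^2] to [t^2 + s], and [rho] is the ratio of the two. The moment times [coef]
     is [Gj j * rho ^ S qn * (t / sqrt lam)] up to the constant [CQ]; one power of [rho] is kept,
     the other factors are at most 1. *)
  set (rho := t ^ 2 / lam).
  assert (Hrho0 : 0 <= rho) by (apply Rdiv_le_0_compat; lra).
  assert (Hrho1 : rho <= 1).
  { unfold rho. apply Rmult_le_reg_r with lam; [easy|]. unfold Rdiv. rewrite Rmult_assoc, Rinv_l by lra. unfold lam. lra. }
  assert (Hrho2 : rho <= Rmin 1 (/ (Xj j * s))).
  { apply Rmin_glb; [easy|]. unfold rho. rewrite Rinv_mult, <- Et. apply Rmult_le_compat_l; [lra|]. apply Rinv_le_contravar; [lra|unfold lam; lra]. }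
  assert (Hrp : rho ^ S qn <= rho).
  { simpl. rewrite <- (Rmult_1_r rho) at 3. apply Rmult_le_compat_l; [easy|].
    clear - Hrho0 Hrho1. induction qn as [|m IH]; [simpl; lra|]. simpl. assert (0 <= rho ^ m) by now apply pow_le. nra. }
  assert (Hts : 0 <= t / sqrt lam <= 1).
  { split; [apply Rdiv_le_0_compat; lra|]. apply Rmult_le_reg_r with (sqrt lam); [easy|]. unfold Rdiv. rewrite Rmult_assoc, Rinv_l by lra. lra. }
  assert (E2 : coef tj Gj j * (CQ / (lam ^ S qn * sqrt lam)) = CQ * (Gj j * (rho ^ S qn * (t / sqrt lam)))).
  { unfold coef, rho, Rdiv. fold t. replace (2 * qn + 3)%nat with (S (2 * S qn)) by lia. rewrite (Rpow_mult_distr (t ^ 2)), pow_inv.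
    rewrite <- tech_pow_Rmult, pow_mult, Rinv_mult. ring. }
  rewrite E2. apply Rmult_le_compat_l; [lra|]. unfold mj. apply Rmult_le_compat_l; [left; apply G0|].
  assert (0 <= rho ^ S qn) by now apply pow_le. nra. }
assert (Smj : forall N, (J <= N)%nat -> sum_f_R0 mj N <= (r1 / (r1 - 1) + 4) * Gj J).
{ assert (B1 : sum_f_R0 mj J <= r1 / (r1 - 1) * Gj J).
  { apply Rle_trans with (2 := sum_G_bound J). apply sum_Rle. intros n _. unfold mj. specialize (G0 n).
    assert (Rmin 1 (/ (Xj n * s)) <= 1) by apply Rmin_l. nra. }
  assert (bd : forall n, Gj (S n) / Xj (S n) <= / 2 * (Gj n / Xj n)).
  { intros n. assert (X1 := Xj_ge1 n). assert (L := Gj_hi n). rewrite Xj_S. specialize (G0 n).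
    apply Rmult_le_reg_r with (4 * Xj n); [lra|].
    replace (Gj (S n) / (4 * Xj n) * (4 * Xj n)) with (Gj (S n)) by (field; lra).
    replace (/ 2 * (Gj n / Xj n) * (4 * Xj n)) with (2 * Gj n) by (field; lra). nra. }
  (* Since [Gj / Xj] at least halves at each step, every term is at most the decrement of this
     sequence, and the sum telescopes. *)
  assert (B2 : forall N, (J <= N)%nat -> sum_f_R0 mj N <= r1 / (r1 - 1) * Gj J + (Gj J / Xj J - Gj N / Xj N) * / s).
  { intros N HN. induction HN as [|N HN IH]; [lra|]. simpl.
    assert (mj (S N) <= Gj (S N) / Xj (S N) * / s).
    { unfold mj. assert (X1 := Xj_ge1 (S N)). assert (Rmin 1 (/ (Xj (S N) * s)) <= / (Xj (S N) * s)) by apply Rmin_r.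
      replace (Gj (S N) / Xj (S N) * / s) with (Gj (S N) * / (Xj (S N) * s)) by (field; lra).
      apply Rmult_le_compat_l; [left; apply G0|easy]. }
    assert (Is : 0 < / s) by (apply Rinv_0_lt_compat; lra). specialize (bd N).
    assert (Gj (S N) / Xj (S N) * / s <= (Gj N / Xj N - Gj (S N) / Xj (S N)) * / s) by (apply Rmult_le_compat_r; lra). lra. }
  intros N HN. apply Rle_trans with (1 := B2 N HN).
  assert (X1 := Xj_ge1 J). assert (X2 := Xj_ge1 N). assert (Is : 0 < / s) by (apply Rinv_0_lt_compat; lra).
  assert (0 <= Gj N / Xj N) by (apply Rdiv_le_0_compat; [left; apply G0|lra]).
  assert (0 <= Gj N / Xj N * / s) by (apply Rmult_le_pos; lra).
  assert (Gj J / Xj J * / s <= 4 * Gj J).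
  { destruct HJ as [_ HJ]. rewrite Xj_S in HJ. specialize (G0 J).
    apply Rle_trans with (Gj J / Xj J * (4 * Xj J)); [apply Rmult_le_compat_l; [apply Rdiv_le_0_compat; lra|lra]|right; field; lra]. }
  lra. }
destruct psi0_unif as [C [HC Hb]].
(* On [[- r, r]] the partial sums converge uniformly, so a bound uniform in their length passes to
   [psi0]. *)
assert (B : forall r, 0 < r -> RInt H (- r) r <= CQ * ((r1 / (r1 - 1) + 4) * Gj J)).
{ intros r Hr. apply Rnot_lt_le. intros Hlt.
  set (d := RInt H (- r) r - CQ * ((r1 / (r1 - 1) + 4) * Gj J)).
  assert (Hd : 0 < d) by (unfold d; lra).
  assert (rp : 0 <= r ^ (2 * S qn)) by (apply pow_le; lra).
  destruct (pow_small (2 * r * r ^ (2 * S qn) * C) ratio d) as [N HN]; [apply Rmult_le_pos; [apply Rmult_le_pos; lra|easy]|apply ratio_bd|easy|].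
  specialize (HN (N + J)%nat ltac:(lia)). set (n := (N + J)%nat) in *.
  assert (Cp : forall m k, continuous (fun k => sum_f_R0 (fun j => k ^ (2 * S qn) * term tj Gj 0 k j * exp (- (k ^ 2 * s))) m) k).
  { assert (Ct : forall j k, continuous (fun k => k ^ (2 * S qn) * term tj Gj 0 k j * exp (- (k ^ 2 * s))) k).
    { intros j k. apply (continuous_mult (fun k => k ^ (2 * S qn) * term tj Gj 0 k j) (fun k => exp (- (k ^ 2 * s)))); [|apply Ce].
      apply (continuous_mult (fun k => k ^ (2 * S qn)) (fun k => term tj Gj 0 k j)); [apply cont_pow|].
      apply (ex_derive_continuous (fun k => term tj Gj 0 k j)). eexists; apply term_derive. }
    induction m as [|m IH]; intros k; [apply (Ct 0%nat)|].
    apply (continuous_plus (fun k => sum_f_R0 (fun j => k ^ (2 * S qn) * term tj Gj 0 k j * exp (- (k ^ 2 * s))) m)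
       (fun k => k ^ (2 * S qn) * term tj Gj 0 k (S m) * exp (- (k ^ 2 * s)))); [apply IH|apply Ct]. }
  assert (Sm : forall m, RInt (fun k => sum_f_R0 (fun j => k ^ (2 * S qn) * term tj Gj 0 k j * exp (- (k ^ 2 * s))) m) (- r) r <= CQ * sum_f_R0 mj m).
  { induction m as [|m IH]; [now apply T|]. simpl sum_f_R0. rewrite RInt_plusR.
    - assert (X := T (S m) r Hr). rewrite Rmult_plus_distr_l. now apply Rplus_le_compat.
    - apply Cp.
    - intros k. apply (continuous_mult (fun k => k ^ (2 * S qn) * term tj Gj 0 k (S m)) (fun k => exp (- (k ^ 2 * s)))); [|apply Ce].
      apply (continuous_mult (fun k => k ^ (2 * S qn)) (fun k => term tj Gj 0 k (S m))); [apply cont_pow|].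
      apply (ex_derive_continuous (fun k => term tj Gj 0 k (S m))). eexists; apply term_derive. }
  assert (Df : RInt H (- r) r - RInt (fun k => sum_f_R0 (fun j => k ^ (2 * S qn) * term tj Gj 0 k j * exp (- (k ^ 2 * s))) n) (- r) r <= 2 * r * r ^ (2 * S qn) * C * ratio ^ S n).
  { rewrite <- RInt_minusR by (apply CH || apply Cp).
    apply Rle_trans with (1 := Rle_abs _).
    replace (2 * r * r ^ (2 * S qn) * C * ratio ^ S n) with ((r - - r) * (r ^ (2 * S qn) * (C * ratio ^ S n))) by ring.
    apply abs_RInt_le_const; [lra| |].
    - apply ex_RInt_cont. intros k. apply (continuous_minus H (fun k => sum_f_R0 (fun j => k ^ (2 * S qn) * term tj Gj 0 k j * exp (- (k ^ 2 * s))) n)); [apply CH|apply Cp].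
    - intros k Hk.
      assert (Es : sum_f_R0 (fun j => k ^ (2 * S qn) * term tj Gj 0 k j * exp (- (k ^ 2 * s))) n = k ^ (2 * S qn) * sum_f_R0 (term tj Gj 0 k) n * exp (- (k ^ 2 * s))).
      { clear. induction n as [|n IH]; [simpl; ring|]. rewrite !tech5, IH. ring. }
      rewrite Es. unfold H.
      replace (k ^ (2 * S qn) * psi0 k * exp (- (k ^ 2 * s)) - k ^ (2 * S qn) * sum_f_R0 (term tj Gj 0 k) n * exp (- (k ^ 2 * s))) with
        (k ^ (2 * S qn) * ((psi0 k - sum_f_R0 (term tj Gj 0 k) n) * exp (- (k ^ 2 * s)))) by ring.
      apply abs_mult_le.
      + rewrite <- RPow_abs. apply pow_incr. split; [apply Rabs_pos|]. apply Rabs_le_between; lra.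
      + rewrite <- (Rmult_1_r (C * ratio ^ S n)). apply abs_mult_le; [apply Hb|]. rewrite Rabs_right by (left; apply He).
        rewrite <- exp_0. apply exp_le_mono. assert (0 <= k ^ 2 * s) by (apply Rmult_le_pos; [apply pow2_ge_0|lra]). lra. }
  specialize (Sm n). specialize (Smj n ltac:(unfold n; lia)).
  assert (CQ * sum_f_R0 mj n <= CQ * ((r1 / (r1 - 1) + 4) * Gj J)) by (apply Rmult_le_compat_l; lra).
  unfold d in HN. lra. }
assert (U : intR (fun k => F k + (- C3) * om k) <= a2 * (CQ * ((r1 / (r1 - 1) + 4) * Gj J))).
{ apply (intR_le_of_RInt _ _ _ DF). intros r Hr.
  apply Rle_trans with (RInt (fun k => a2 * H k) (- r) r).
  - apply RInt_le; [lra|apply ex_RInt_cont, DF| |intros; apply PF].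
    apply ex_RInt_cont. intros k. apply (continuous_mult (fun _ => a2) H); [apply continuous_const|apply CH].
  - rewrite RInt_scalR by exact CH. apply Rmult_le_compat_l; [lra|now apply B]. }
assert (Fin : a2 * (CQ * ((r1 / (r1 - 1) + 4) * Gj J)) <= a2 * (CQ * (r1 / (r1 - 1) + 4)) * g (/ s)).
{ replace (a2 * (CQ * ((r1 / (r1 - 1) + 4) * Gj J))) with (a2 * (CQ * (r1 / (r1 - 1) + 4)) * Gj J) by ring.
  apply Rmult_le_compat_l; [|easy]. apply Rmult_le_pos; [lra|apply Rmult_le_pos; lra]. }
lra.
Qed.

End Asymptotics.

(** * The linear flow: explicit form, two-sided bounds, symbol estimates *)

Section LinearPart.
Context {P : params}.

(** A reflection coefficient: the share of the growing exponential that the condition at [SS] forces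
    upon the decaying one. *)
Definition rho (mu : R) : R := (exp (- (mu * SS)) + bc_coef * exp (- (mu * (1 / 2)))) / (exp (mu * SS) + bc_coef * exp (mu * (1 / 2))).

Lemma bc_coef_gt0 : 0 < bc_coef.
Proof. unfold bc_coef. assert (H := SS_ge1). lra. Qed.

Lemma rho_bd mu : 2 <= mu -> 0 <= rho mu <= exp (- mu) /\ exp (- mu) <= / 4.
Proof.
intros Hm. assert (HS := SS_ge1). assert (HM := bc_coef_gt0).
assert (E1 := exp_pos (- (mu * SS))). assert (E2 := exp_pos (- (mu * (1 / 2)))).
assert (E3 := exp_pos (mu * SS)). assert (E4 := exp_pos (mu * (1 / 2))).
assert (E5 : 0 < bc_coef * exp (- (mu * (1 / 2)))) by now apply Rmult_lt_0_compat.
assert (E6 : 0 < bc_coef * exp (mu * (1 / 2))) by now apply Rmult_lt_0_compat.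
split; [split|].
- apply Rlt_le, Rdiv_lt_0_compat; lra.
- unfold rho. apply Rle_div_l; [lra|].
  rewrite Rmult_plus_distr_l, <- exp_plus. apply Rplus_le_compat.
  + apply exp_le_mono. nra.
  + apply Rle_trans with (bc_coef * (exp (- mu) * exp (mu * (1 / 2)))); [|right; ring]. apply Rmult_le_compat_l; [lra|].
    rewrite <- exp_plus. apply exp_le_mono. lra.
- rewrite exp_Ropp. apply Rinv_le_contravar; [lra|].
  apply Rle_trans with (exp (1 + 1)); [|apply exp_le_mono; lra]. rewrite exp_plus. assert (K := exp_ineq1_le 1). nra.
Qed.

Lemma sol_explicit z s : 4 <= z ->
  sol z 1 (fun _ => 0) s = (exp (- (sqrt z * s)) - rho (sqrt z) * exp (sqrt z * s)) / (1 - rho (sqrt z)) /\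
  dsol z 1 (fun _ => 0) s = - sqrt z * (exp (- (sqrt z * s)) + rho (sqrt z) * exp (sqrt z * s)) / (1 - rho (sqrt z)).
Proof.
intros Hz. set (mu := sqrt z).
assert (Hm : 2 <= mu) by (unfold mu; rewrite <- (sqrt_square 2) by lra; apply sqrt_le_1_alt; lra).
assert (Em : mu * mu = z) by (apply sqrt_sqrt; lra).
destruct (rho_bd mu Hm) as [[R0 R1] R2]. set (r := rho mu) in *.
assert (Hc : forall t : R, continuous (fun _ : R => 0) t) by (intros; apply continuous_const).
assert (Hz' : - (1 / 4) <= z) by lra.
apply (is_sol_unique z 1 (fun _ => 0) _ _ (fun s => (exp (- (mu * s)) - r * exp (mu * s)) / (1 - r))
  (fun s => - mu * (exp (- (mu * s)) + r * exp (mu * s)) / (1 - r)) Hz' (sol_is_sol z 1 _ Hz' Hc)).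
split; [|split; [|split]].
- intros t. auto_derive; [lra|field; lra].
- intros t. auto_derive; [lra|]. rewrite <- Em. field; lra.
- rewrite !Rmult_0_r, Ropp_0, exp_0. field; lra.
- assert (HS := SS_ge1). assert (HM := bc_coef_gt0).
  assert (E3 := exp_pos (mu * SS)). assert (E4 := exp_pos (mu * (1 / 2))).
  assert (E6 : 0 < bc_coef * exp (mu * (1 / 2))) by now apply Rmult_lt_0_compat.
  assert (Er : r * (exp (mu * SS) + bc_coef * exp (mu * (1 / 2))) = exp (- (mu * SS)) + bc_coef * exp (- (mu * (1 / 2)))).
  { unfold r, rho. field. lra. }
  apply Rmult_eq_reg_r with (1 - r); [|lra].
  replace (((exp (- (mu * SS)) - r * exp (mu * SS)) / (1 - r) + bc_coef * ((exp (- (mu * (1 / 2))) - r * exp (mu * (1 / 2))) / (1 - r))) * (1 - r))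
    with ((exp (- (mu * SS)) + bc_coef * exp (- (mu * (1 / 2)))) - r * (exp (mu * SS) + bc_coef * exp (mu * (1 / 2)))) by (field; lra).
  rewrite Er. ring.
Qed.

(** For [s <= 1/4] and [sqrt z >= 2] the reflected exponential is at most half of the decaying one,
    because [sqrt z * (1 - 2 s) >= 1]; so it alters only constants. *)
Lemma sol_two_sided z s : 4 <= z -> 0 <= s <= 1 / 4 ->
  / 2 * exp (- (sqrt z * s)) <= sol z 1 (fun _ => 0) s <= exp (- (sqrt z * s)) /\
  sqrt z * exp (- (sqrt z * s)) <= - dsol z 1 (fun _ => 0) s <= 4 * (sqrt z * exp (- (sqrt z * s))).
Proof.
intros Hz Hs. destruct (sol_explicit z s Hz) as [E1 E2]. rewrite E1, E2. clear E1 E2. set (mu := sqrt z).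
assert (Hm : 2 <= mu) by (unfold mu; rewrite <- (sqrt_square 2) by lra; apply sqrt_le_1_alt; lra).
destruct (rho_bd mu Hm) as [[R0 R1] R2]. set (r := rho mu) in *.
assert (Ee := exp_pos (- (mu * s))). set (e := exp (- (mu * s))) in *.
assert (K1 : r * e <= r * exp (mu * s)) by (apply Rmult_le_compat_l; [easy|]; unfold e; apply exp_le_mono; nra).
assert (K2 : r * exp (mu * s) <= / 2 * e).
{ apply Rle_trans with (exp (- mu) * exp (mu * s)); [apply Rmult_le_compat_r; [left; apply exp_pos|easy]|].
  apply Rle_trans with (exp (- 1) * e).
  - unfold e. rewrite <- !exp_plus. apply exp_le_mono. nra.
  - apply Rmult_le_compat_r; [lra|]. change (exp (- 1)) with (exp (Ropp 1)). rewrite exp_Ropp. apply Rinv_le_contravar; [lra|]. generalize (exp_ineq1_le 1); lra. }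
set (w := r * exp (mu * s)) in *. assert (Hr : 0 < 1 - r) by lra.
assert (Dv : forall a b, a * (1 - r) <= b -> a <= b / (1 - r)).
{ intros a b H. apply Rmult_le_reg_r with (1 - r); [easy|]. unfold Rdiv. rewrite Rmult_assoc, Rinv_l; lra. }
assert (Dv2 : forall a b, b <= a * (1 - r) -> b / (1 - r) <= a).
{ intros a b H. apply Rmult_le_reg_r with (1 - r); [easy|]. unfold Rdiv. rewrite Rmult_assoc, Rinv_l; lra. }
replace (- (- mu * (e + w) / (1 - r))) with (mu * (e + w) / (1 - r)) by (field; lra).
assert (re : 0 <= r * e) by (apply Rmult_le_pos; lra).
split; split; [apply Dv; lra|apply Dv2; lra|apply Dv|apply Dv2].
- rewrite Rmult_assoc. apply Rmult_le_compat_l; nra.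
- replace (4 * (mu * e) * (1 - r)) with (mu * (4 * e * (1 - r))) by ring. apply Rmult_le_compat_l; nra.
Qed.

Definition lin_kernel (j : nat) (k s : R) : R := tder_lin (fun _ => 1) j k s.

Lemma tder_lin_factor phi j k s : tder_lin phi j k s = phi k * lin_kernel j k s.
Proof.
assert (Hc : forall t : R, continuous (fun _ : R => 0) t) by (intros; apply continuous_const).
assert (K1 := is_sol_lin _ (phi k) 0 _ _ _ _ _ _ _ _ (sol_is_sol (zz k) 1 _ (zz_ge k) Hc) (sol_is_sol (zz k) 1 _ (zz_ge k) Hc)).
assert (Z1 : phi k * 1 + 0 * 1 = phi k) by ring.
assert (Z2 : forall t : R, phi k * 0 + 0 * 0 = 0) by (intros; ring).
assert (K2 := is_sol_ext _ _ _ _ _ _ _ Z1 Z2 K1).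
destruct (sol_eq _ _ _ _ _ (cl s) Hc K2) as [E1 E2].
enough (X : forall j, tder_lin phi j k s = phi k * lin_kernel j k s /\ tder_lin phi (S j) k s = phi k * lin_kernel (S j) k s) by apply X.
clear j. induction j as [|j [I1 I2]].
- unfold lin_kernel. simpl. unfold lin0, lin1, solk, dsolk. split; (etransitivity; [exact (eq_sym E1) || exact (eq_sym E2) || exact E1 || exact E2|ring]).
- split; [easy|]. unfold lin_kernel in *. simpl tder_lin in *. rewrite I1. ring.
Qed.

Lemma lin_kernel_SS j k s : lin_kernel (S (S j)) k s = zz k * lin_kernel j k s.
Proof. reflexivity. Qed.

(** Each derivative in [s] brings about [- sqrt (zz k)], which explains the alternating sign. Orders
    0 and 1 come from [sol_two_sided], and two further orders multiply exactly by [zz k]. *)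
Lemma lin_kernel_high j k s : 2 <= Rabs k -> 0 <= s <= 1 / 4 ->
  / 2 * (sqrt (zz k) ^ j * exp (- (sqrt (zz k) * s))) <= (-1) ^ j * lin_kernel j k s <= 4 * (sqrt (zz k) ^ j * exp (- (sqrt (zz k) * s))).
Proof.
intros Hk Hs. destruct (zz_high k Hk) as [_ [_ Hz]]. assert (Hz' : 4 <= zz k) by lra.
destruct (sol_two_sided (zz k) s Hz' Hs) as [H1 H2].
assert (HS := SS_ge1). assert (Ecl : cl s = s) by (apply cl_id; lra).
assert (Em : sqrt (zz k) * sqrt (zz k) = zz k) by (apply sqrt_sqrt; lra).
set (mu := sqrt (zz k)) in *. assert (Ee := exp_pos (- (mu * s))).
assert (Hm : 0 <= mu) by (apply sqrt_pos).
assert (Hme : 0 <= mu * exp (- (mu * s))) by (apply Rmult_le_pos; lra).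
revert j.
enough (X : forall j, (/ 2 * (mu ^ j * exp (- (mu * s))) <= (-1) ^ j * lin_kernel j k s <= 4 * (mu ^ j * exp (- (mu * s)))) /\
  (/ 2 * (mu ^ S j * exp (- (mu * s))) <= (-1) ^ S j * lin_kernel (S j) k s <= 4 * (mu ^ S j * exp (- (mu * s))))) by apply X.
induction j as [|j [I1 I2]].
- unfold lin_kernel. simpl. unfold lin0, lin1, solk, dsolk. rewrite Ecl. split; lra.
- split; [easy|]. rewrite lin_kernel_SS.
  replace ((-1) ^ S (S j) * (zz k * lin_kernel j k s)) with (mu * mu * ((-1) ^ j * lin_kernel j k s)) by (rewrite Em; simpl; ring).
  simpl pow. assert (0 <= mu * mu) by (apply Rmult_le_pos; lra).
  destruct I1 as [I1 I1']. split.
  + apply (Rmult_le_compat_l (mu * mu)) in I1; [|easy]. apply Rle_trans with (mu * mu * ((-1) ^ j * lin_kernel j k s)); [|right; ring]. apply Rle_trans with (2 := I1). right; ring.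
  + apply (Rmult_le_compat_l (mu * mu)) in I1'; [|easy]. apply Rle_trans with (mu * mu * ((-1) ^ j * lin_kernel j k s)); [right; ring|]. apply Rle_trans with (1 := I1'). right; ring.
Qed.

Lemma mu_bounds k : 2 <= Rabs k -> k ^ 2 / 2 <= sqrt (zz k) <= k ^ 2 /\ k ^ 2 - 1 <= sqrt (zz k).
Proof.
intros Hk. assert (H1 := sqr_of_abs k 2 ltac:(lra) Hk). set (m := k ^ 2) in *. replace (2 ^ 2) with 4 in H1 by ring.
assert (E : zz k = m * m - m) by (unfold zz, m; ring). rewrite E.
split; [split|].
- rewrite <- (sqrt_square (m / 2)) by lra. apply sqrt_le_1_alt. nra.
- apply Rle_trans with (sqrt (m * m)); [apply sqrt_le_1_alt; nra|rewrite sqrt_square; lra].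
- rewrite <- (sqrt_square (m - 1)) by lra. apply sqrt_le_1_alt. nra.
Qed.

(** The rate [sqrt (zz k)] lies between [k^2 - 1] and [k^2]. Replacing it by [k^2] in the
    exponential therefore costs at most [exp s], and in the power at most [2 ^ j]. *)
Lemma lin_kernel_gauss j : exists a1 a2, 0 < a1 /\ 0 < a2 /\ forall k s, 2 <= Rabs k -> 0 <= s <= 1 / 4 ->
  a1 * (k ^ (2 * j) * exp (- (k ^ 2 * s))) <= (-1) ^ j * lin_kernel j k s <= a2 * (k ^ (2 * j) * exp (- (k ^ 2 * s))).
Proof.
exists (/ 2 * (/ 2) ^ j), (4 * exp 1). assert (E1 := exp_pos 1).
assert (P2 : 0 < (/ 2) ^ j) by (apply pow_lt; lra).
split; [lra|split; [lra|]]. intros k s Hk Hs. destruct (lin_kernel_high j k s Hk Hs) as [H1 H2].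
destruct (mu_bounds k Hk) as [[M1 M2] M3]. set (mu := sqrt (zz k)) in *.
assert (K0 : 0 <= k ^ 2) by apply pow2_ge_0. rewrite pow_mult.
assert (Q1 : 0 <= (k ^ 2) ^ j) by now apply pow_le.
split.
- apply Rle_trans with (2 := H1). rewrite !(Rmult_assoc (/ 2)). apply Rmult_le_compat_l; [lra|].
  rewrite <- Rmult_assoc. apply Rmult_le_compat; [apply Rmult_le_pos; lra|left; apply exp_pos| |].
  + rewrite <- Rpow_mult_distr. apply pow_incr. split; lra.
  + apply exp_le_mono. nra.
- apply Rle_trans with (1 := H2). rewrite (Rmult_assoc 4). apply Rmult_le_compat_l; [lra|].
  replace (exp 1 * ((k ^ 2) ^ j * exp (- (k ^ 2 * s)))) with ((k ^ 2) ^ j * (exp 1 * exp (- (k ^ 2 * s)))) by ring.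
  apply Rmult_le_compat; [apply pow_le; lra|left; apply exp_pos|apply pow_incr; lra|].
  rewrite <- exp_plus. apply exp_le_mono. nra.
Qed.

Lemma lin_kernel_low j : exists C, 0 <= C /\ forall k s, Rabs k <= 2 -> Rabs (lin_kernel j k s) <= C.
Proof.
destruct (sol_local_bound 2) as [C [HC HB]].
assert (Hc : forall t : R, continuous (fun _ : R => 0) t) by (intros; apply continuous_const).
enough (X : forall j, (exists C, 0 <= C /\ forall k s, Rabs k <= 2 -> Rabs (lin_kernel j k s) <= C) /\
  (exists C, 0 <= C /\ forall k s, Rabs k <= 2 -> Rabs (lin_kernel (S j) k s) <= C)) by apply X.
clear j. induction j as [|j [[C1 [HC1 I1]] I2]].
- assert (Hk : forall k s, Rabs k <= 2 -> Rabs (lin_kernel 0 k s) <= C * (Rabs 1 + 0) /\ Rabs (lin_kernel 1 k s) <= C * (Rabs 1 + 0)).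
  { intros k s Hk. refine (HB k 1 (fun _ => 0) 0 (sol (zz k) 1 (fun _ => 0)) (dsol (zz k) 1 (fun _ => 0)) Hk Hc _ _ (cl s) (cl_in s)).
    - intros; rewrite Rabs_R0; lra.
    - exact (sol_is_sol (zz k) 1 _ (zz_ge k) Hc). }
  rewrite Rabs_R1 in Hk. split; exists (C * (1 + 0)); (split; [lra|intros; now apply Hk]).
- split; [easy|]. exists (17 * C1). split; [lra|]. intros k s Hk. rewrite lin_kernel_SS. apply abs_mult_le; [|now apply I1].
  apply Rle_trans with (1 := zz_abs k). rewrite <- (Rabs_right (k ^ 4)), <- RPow_abs.
  + assert (Rabs k ^ 4 <= 2 ^ 4) by (apply pow_incr; split; [apply Rabs_pos|easy]). lra.
  + replace (k ^ 4) with ((k ^ 2) ^ 2) by ring. apply Rle_ge, pow2_ge_0.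
Qed.

(* Symbols on [0,SS] whose k-derivative gains one power of 1 + |k|. *)
Definition sym (p : nat) (G : R -> R -> R) : Prop := exists dG,
  (forall k s, 0 <= s <= SS -> is_derive (fun k => G k s) k (dG k s)) /\
  (forall k s, 0 <= s <= SS -> continuous (fun k => dG k s) k) /\
  exists C, 0 <= C /\ forall k s, 0 <= s <= SS ->
    Rabs (G k s) <= C * ((1 + Rabs k) ^ p * wt qn k) /\ Rabs (dG k s) <= C * ((1 + Rabs k) ^ p * wt (S qn) k).

Lemma sym_weaken p p' G : (p <= p')%nat -> sym p G -> sym p' G.
Proof.
intros Hp [dG [D1 [D2 [C [HC HB]]]]]. exists dG. split; [easy|split; [easy|]]. exists C; split; [easy|].
intros k s Hs. destruct (HB k s Hs) as [H1 H2].
assert (W1 := wt_gt0 qn k). assert (W2 := wt_gt0 (S qn) k).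
assert (W3 : (1 + Rabs k) ^ p <= (1 + Rabs k) ^ p') by (apply Rle_pow; [apply abs1_ge1|easy]).
split; [apply Rle_trans with (1 := H1)|apply Rle_trans with (1 := H2)]; (apply Rmult_le_compat_l; [easy|]; apply Rmult_le_compat_r; lra).
Qed.

Lemma sym_mulk p G : sym p G -> sym (S p) (fun k s => k * G k s).
Proof.
intros [dG [D1 [D2 [C [HC HB]]]]]. exists (fun k s => G k s + k * dG k s). split; [|split].
- intros k s Hs. assert (D := D1 k s Hs). auto_derive; [eexists; eassumption|]. use_der D. ring.
- intros k s Hs. apply (continuous_plus (fun k => G k s) (fun k => k * dG k s)).
  + apply (ex_derive_continuous (fun k => G k s)). eexists. now apply D1.
  + apply (continuous_mult (fun k : R => k) (fun k => dG k s)); [apply continuous_id|now apply D2].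
- exists (2 * C). split; [lra|]. intros k s Hs. destruct (HB k s Hs) as [H1 H2].
  assert (Rk := Rabs_pos k). set (m := 1 + Rabs k) in *.
  assert (W0 : 0 <= C * (m ^ p * wt qn k)) by (apply Rle_trans with (2 := H1), Rabs_pos).
  assert (E1 : m ^ S p * wt (S qn) k = m ^ p * wt qn k).
  { rewrite <- (wt_S qn k). fold m. simpl. ring. }
  assert (E2 : m ^ S p * wt qn k = m * (m ^ p * wt qn k)) by (simpl; ring).
  rewrite E1, E2. split.
  + rewrite Rabs_mult. apply Rle_trans with (m * (C * (m ^ p * wt qn k))).
    * apply Rmult_le_compat; try apply Rabs_pos; [unfold m; lra|easy].
    * assert (0 <= m * (C * (m ^ p * wt qn k))) by (apply Rmult_le_pos; [unfold m; lra|easy]). lra.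
  + apply Rle_trans with (1 := Rabs_triang _ _). rewrite Rabs_mult.
    assert (Rabs k * Rabs (dG k s) <= m * (C * (m ^ p * wt (S qn) k))).
    { apply Rmult_le_compat; try apply Rabs_pos; [unfold m; lra|easy]. }
    replace (m * (C * (m ^ p * wt (S qn) k))) with (C * (m ^ S p * wt (S qn) k)) in H by (simpl; ring).
    rewrite E1 in H. lra.
Qed.

Lemma sym_lin p x y F G : sym p F -> sym p G -> sym p (fun k s => x * F k s + y * G k s).
Proof.
intros [dF [D1 [D2 [C [HC HB]]]]] [dG [D1' [D2' [C' [HC' HB']]]]].
exists (fun k s => x * dF k s + y * dG k s). split; [|split].
- intros k s Hs. apply (is_derive_plus (fun k => x * F k s) (fun k => y * G k s)); apply is_derive_scal; [now apply D1|now apply D1'].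
- intros k s Hs. apply (continuous_plus (fun k => x * dF k s) (fun k => y * dG k s));
   [apply (continuous_mult (fun _ => x) (fun k => dF k s))|apply (continuous_mult (fun _ => y) (fun k => dG k s))];
   try apply continuous_const; [now apply D2|now apply D2'].
- exists (Rabs x * C + Rabs y * C'). split.
  { apply Rplus_le_le_0_compat; apply Rmult_le_pos; try apply Rabs_pos; easy. }
  intros k s Hs. destruct (HB k s Hs) as [H1 H2]. destruct (HB' k s Hs) as [H1' H2'].
  split; (apply Rle_trans with (1 := Rabs_triang _ _); rewrite !Rabs_mult, Rmult_plus_distr_r, !(Rmult_assoc (Rabs _));
    apply Rplus_le_compat; apply Rmult_le_compat_l; try apply Rabs_pos; easy).
Qed.

Lemma sym_ext p F G : (forall k s, 0 <= s <= SS -> F k s = G k s) -> sym p F -> sym p G.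
Proof.
intros HE [dF [D1 [D2 [C [HC HB]]]]]. exists dF. split; [|split; [easy|]].
- intros k s Hs. apply is_derive_ext with (2 := D1 k s Hs). intros; now apply HE.
- exists C; split; [easy|]. intros k s Hs. rewrite <- HE by easy. now apply HB.
Qed.

Lemma sym_mulpow m p G : sym p G -> sym (m + p) (fun k s => k ^ m * G k s).
Proof.
intros HG. induction m as [|m IH]; [apply sym_ext with (2 := HG); intros; simpl; ring|].
apply sym_ext with (fun k s => k * (k ^ m * G k s)); [intros; simpl; ring|]. now apply sym_mulk.
Qed.

(** The weight [w] is left free because the solution and its derivative in [k] are measured in
    different weights. *)
Lemma sol_weight : exists C, 0 < C /\ forall (w k phi : R) (h : R -> R) E A, (forall t, continuous h t) -> 0 <= w -> 0 <= A ->
  Rabs phi <= E * w -> (forall s, 0 <= s <= SS -> Rabs (h s) <= A * (1 + k ^ 4) * w * Yw k s) ->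
  forall s, 0 <= s <= SS -> Rabs (sol (zz k) phi h s) <= C * ((E + A) * w) * Yw k s /\
    Rabs (dsol (zz k) phi h s) <= C * (1 + k ^ 2) * ((E + A) * w) * Yw k s.
Proof.
destruct sol_bound as [C1 [HC1 B1]]. destruct dsol_bound as [C2 [HC2 B2]].
exists (C1 + C2). split; [lra|]. intros w k phi h E A Hh Hw HA Hp Hb s Hs.
assert (K4 := pow4_ge0 k). assert (Y := Yw_gt0 k s). assert (K2 := pow2_ge_0 k).
assert (H0 : 0 <= A * (1 + k ^ 4) * w) by (apply Rmult_le_pos; [apply Rmult_le_pos; lra|easy]).
assert (X1 := B1 k phi h _ Hh H0 Hb s Hs). assert (X2 := B2 k phi h _ Hh H0 Hb s Hs).
replace (A * (1 + k ^ 4) * w / (1 + k ^ 4)) with (A * w) in X1, X2 by (field; lra).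
assert (Hp0 := Rabs_pos phi). assert (HAw : 0 <= A * w) by (apply Rmult_le_pos; lra).
assert (S1 : Rabs phi + A * w <= (E + A) * w) by lra.
split.
- apply Rle_trans with (1 := X1). apply Rmult_le_compat_r; [lra|]. apply Rmult_le_compat; lra.
- apply Rle_trans with (1 := X2). apply Rmult_le_compat_r; [lra|].
  apply Rmult_le_compat; [apply Rmult_le_pos; lra|lra| |lra]. apply Rmult_le_compat_r; lra.
Qed.

(** The derivative in [k] has datum [dphi], which decays one power better, and source
    [(4 k^3 - 2 k) y]. That source loses three powers against the four gained by the inversion, so
    it too ends one power better. *)
Lemma tder_lin_sym_01 phi dphi E : (forall k, continuous phi k) -> (forall k, continuous dphi k) -> (forall k, is_derive phi k (dphi k)) ->
  0 <= E -> (forall k, Rabs (phi k) <= E * wt qn k) -> (forall k, Rabs (dphi k) <= E * wt (S qn) k) ->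
  sym 0 (tder_lin phi 0) /\ sym 2 (tder_lin phi 1).
Proof.
intros Cp Cd Dp HE Bp Bd.
assert (Cz : cont2 (fun _ _ => 0)) by (intros k s; apply continuous_const).
set (y := fun k s => solk phi (fun _ _ => 0) k (cl s)).
assert (Cy : cont2 y) by now apply solk_cont2.
set (h := fun k s => (4 * k ^ 3 - 2 * k) * y k s).
assert (Ch : cont2 h).
{ apply cont2_mult; [|exact Cy]. intros k s. apply (continuous_comp fst (fun k => 4 * k ^ 3 - 2 * k)); [apply continuous_fst|].
  apply (ex_derive_continuous (fun k => 4 * k ^ 3 - 2 * k)). auto_derive; easy. }
destruct sol_weight as [C [HC HB]].
assert (By : forall k s, 0 <= s <= SS -> Rabs (solk phi (fun _ _ => 0) k s) <= C * E * wt qn k * Yw k s /\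
   Rabs (dsolk phi (fun _ _ => 0) k s) <= C * (1 + k ^ 2) * (E * wt qn k) * Yw k s).
{ intros k s Hs. destruct (HB (wt qn k) k (phi k) (fun _ => 0) E 0) with (s := s) as [H1 H2]; try easy; try lra.
  - intros; apply continuous_const.
  - left; apply wt_gt0.
  - intros t Ht. rewrite Rabs_R0. lra.
  - rewrite Rplus_0_r in H1, H2. split; [apply Rle_trans with (1 := H1); right; ring|exact H2]. }
assert (Bh : forall k s, 0 <= s <= SS -> Rabs (h k s) <= 16 * C * E * (1 + k ^ 4) * wt (S qn) k * Yw k s).
{ intros k s Hs. unfold h, y. rewrite (cl_id s) by easy. destruct (By k s Hs) as [H1 _].
  rewrite <- (wt_S qn k) in H1. assert (Y := Yw_gt0 k s). assert (W := wt_gt0 (S qn) k).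
  rewrite Rabs_mult. apply Rle_trans with (Rabs (4 * k ^ 3 - 2 * k) * (C * E * ((1 + Rabs k) * wt (S qn) k) * Yw k s)).
  { apply Rmult_le_compat_l; [apply Rabs_pos|easy]. }
  assert (CE : 0 <= C * E) by (apply Rmult_le_pos; lra).
  assert (X : Rabs (4 * k ^ 3 - 2 * k) * (1 + Rabs k) <= 16 * (1 + k ^ 4)).
  { assert (Rk := Rabs_pos k). apply Rle_trans with ((4 * Rabs k ^ 3 + 2 * Rabs k) * (1 + Rabs k)).
    - apply Rmult_le_compat_r; [lra|]. unfold Rminus. apply Rle_trans with (1 := Rabs_triang _ _).
      rewrite Rabs_Ropp, !Rabs_mult, <- RPow_abs, (Rabs_right 4), (Rabs_right 2) by lra. lra.
    - replace (k ^ 4) with (Rabs k ^ 4) by (rewrite RPow_abs; apply Rabs_right, Rle_ge, pow4_ge0).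
      set (m := Rabs k) in *. destruct (Rle_lt_dec m 1) as [Hm|Hm].
      + assert (m ^ 3 <= 1) by (rewrite <- (pow1 3); apply pow_incr; lra). assert (0 <= m ^ 3) by (apply pow_le; lra).
        assert (0 <= m ^ 4) by (apply pow_le; lra). nra.
      + assert (m <= m ^ 3) by (simpl; nra). assert (m ^ 3 * 1 <= m ^ 3 * m) by (apply Rmult_le_compat_l; nra).
        replace (m ^ 4) with (m ^ 3 * m) by ring. nra. }
  replace (Rabs (4 * k ^ 3 - 2 * k) * (C * E * ((1 + Rabs k) * wt (S qn) k) * Yw k s)) with
    ((Rabs (4 * k ^ 3 - 2 * k) * (1 + Rabs k)) * (C * E * wt (S qn) k * Yw k s)) by ring.
  replace (16 * C * E * (1 + k ^ 4) * wt (S qn) k * Yw k s) with ((16 * (1 + k ^ 4)) * (C * E * wt (S qn) k * Yw k s)) by ring.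
  apply Rmult_le_compat_r; [|easy]. apply Rmult_le_pos; [|lra]. apply Rmult_le_pos; lra. }
assert (CE : 0 <= C * E) by (apply Rmult_le_pos; lra).
assert (Bd' : forall k s, 0 <= s <= SS -> Rabs (solk dphi h k s) <= C * (E + 16 * C * E) * wt (S qn) k * Yw k s /\
   Rabs (dsolk dphi h k s) <= C * (1 + k ^ 2) * ((E + 16 * C * E) * wt (S qn) k) * Yw k s).
{ intros k s Hs. destruct (HB (wt (S qn) k) k (dphi k) (h k) E (16 * C * E)) with (s := s) as [H1 H2]; try easy; try lra.
  - intros t. now apply (cont2_2 h).
  - left; apply wt_gt0.
  - intros t Ht. apply (Bh k t Ht).
  - split; [apply Rle_trans with (1 := H1); right; ring|exact H2]. }
assert (Der : forall k s, 0 <= s <= SS -> is_derive (fun k => solk phi (fun _ _ => 0) k s) k (solk dphi h k s) /\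
   is_derive (fun k => dsolk phi (fun _ _ => 0) k s) k (dsolk dphi h k s)).
{ intros k s Hs.
  destruct (solk_derive phi (dphi k) (fun _ _ => 0) (fun _ _ => 0) k Cp (Dp k) Cz Cz (fun k s => is_derive_const (0 : R) k) s Hs) as [K1 K2].
  destruct (sol_ext_in k (dphi k) (fun s => 0 + (4 * k ^ 3 - 2 * k) * solk phi (fun _ _ => 0) k s) (h k) s) as [E1 E2]; [| | |easy|].
  - intros t. apply (continuous_plus (fun _ : R => 0)); [apply continuous_const|].
    apply (continuous_mult (fun _ => 4 * k ^ 3 - 2 * k)); [apply continuous_const|].
    apply (is_sol_cont _ _ _ _ _ _ (solk_is_sol phi (fun _ _ => 0) k Cz)).
  - intros t. now apply (cont2_2 h).
  - intros t Ht. unfold h, y. rewrite (cl_id t) by easy. Rring.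
  - unfold solk at 2, dsolk at 2. rewrite <- E1, <- E2. now split. }
assert (P12 : forall k, 1 + k ^ 2 <= (1 + Rabs k) ^ 2) by apply one_k2_le.
split.
- exists (fun k s => solk dphi h k (cl s)). split; [|split].
  + intros k s Hs. simpl tder_lin. unfold lin0. apply Der, cl_in.
  + intros k s _. apply (cont2_1 (fun k s => solk dphi h k (cl s))). now apply solk_cont2.
  + exists (C * (E + 16 * C * E) * 2). split; [apply Rmult_le_pos; [apply Rmult_le_pos; lra|lra]|].
    intros k s Hs. simpl tder_lin. unfold lin0. rewrite (cl_id s) by easy. destruct (By k s Hs) as [H1 _]. destruct (Bd' k s Hs) as [H2 _].
    assert (Y2 := Yw_le2 k s Hs). assert (Y := Yw_gt0 k s). assert (W := wt_gt0 qn k). assert (W' := wt_gt0 (S qn) k).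
    assert (CE2 : 0 <= C * (16 * C * E)) by (apply Rmult_le_pos; lra).
    simpl pow. rewrite !Rmult_1_l. split; [apply Rle_trans with (1 := H1)|apply Rle_trans with (1 := H2)].
    * apply Rle_trans with (C * (E + 16 * C * E) * wt qn k * Yw k s).
      { apply Rmult_le_compat_r; [lra|]. apply Rmult_le_compat_r; [lra|]. lra. }
      rewrite (Rmult_assoc _ 2), (Rmult_comm 2), <- Rmult_assoc. apply Rmult_le_compat_l; [|easy].
      apply Rmult_le_pos; [apply Rmult_le_pos; lra|lra].
    * rewrite (Rmult_assoc _ 2), (Rmult_comm 2), <- Rmult_assoc. apply Rmult_le_compat_l; [|easy].
      apply Rmult_le_pos; [apply Rmult_le_pos; lra|lra].
- exists (fun k s => dsolk dphi h k (cl s)). split; [|split].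
  + intros k s Hs. simpl tder_lin. unfold lin1. apply Der, cl_in.
  + intros k s _. apply (cont2_1 (fun k s => dsolk dphi h k (cl s))). now apply dsolk_cont2.
  + exists (C * (E + 16 * C * E) * 2). split; [apply Rmult_le_pos; [apply Rmult_le_pos; lra|lra]|].
    intros k s Hs. simpl tder_lin. unfold lin1. rewrite (cl_id s) by easy. destruct (By k s Hs) as [_ H1]. destruct (Bd' k s Hs) as [_ H2].
    assert (Y2 := Yw_le2 k s Hs). assert (Y := Yw_gt0 k s). assert (W := wt_gt0 qn k). assert (W' := wt_gt0 (S qn) k).
    assert (CE2 : 0 <= 16 * C * E) by lra. specialize (P12 k). assert (K2 := pow2_ge_0 k).
    assert (G : forall w, 0 <= w -> C * (1 + k ^ 2) * ((E + 16 * C * E) * w) * Yw k s <= C * (E + 16 * C * E) * 2 * ((1 + Rabs k) ^ 2 * w)).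
    { intros w Hw. replace (C * (E + 16 * C * E) * 2 * ((1 + Rabs k) ^ 2 * w)) with ((C * (1 + Rabs k) ^ 2 * ((E + 16 * C * E) * w)) * 2) by ring.
      assert (Z : 0 <= (E + 16 * C * E) * w) by (apply Rmult_le_pos; lra).
      apply Rmult_le_compat; [|lra| |easy].
      - apply Rmult_le_pos; [apply Rmult_le_pos; lra|easy].
      - apply Rmult_le_compat_r; [easy|]. apply Rmult_le_compat_l; lra. }
    split; [apply Rle_trans with (1 := H1)|apply Rle_trans with (1 := H2); apply G; lra].
    apply Rle_trans with (2 := G _ (Rlt_le _ _ W)). apply Rmult_le_compat_r; [lra|].
    apply Rmult_le_compat_l; [apply Rmult_le_pos; lra|]. apply Rmult_le_compat_r; lra.
Qed.

Lemma tder_lin_sym phi dphi E : (forall k, continuous phi k) -> (forall k, continuous dphi k) -> (forall k, is_derive phi k (dphi k)) ->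
  0 <= E -> (forall k, Rabs (phi k) <= E * wt qn k) -> (forall k, Rabs (dphi k) <= E * wt (S qn) k) ->
  forall j, sym (2 * j) (tder_lin phi j).
Proof.
intros Cp Cd Dp HE Bp Bd.
enough (X : forall j, sym (2 * j) (tder_lin phi j) /\ sym (2 * S j) (tder_lin phi (S j))) by (intros j; exact (proj1 (X j))).
induction j as [|j [I1 I2]]; [exact (tder_lin_sym_01 phi dphi E Cp Cd Dp HE Bp Bd)|].
split; [easy|]. apply sym_ext with (fun k s => 1 * (k ^ 4 * tder_lin phi j k s) + -1 * (k ^ 2 * tder_lin phi j k s)).
{ intros k s _. simpl tder_lin. unfold zz. ring. }
apply sym_lin; [apply (sym_weaken (4 + 2 * j))|apply (sym_weaken (2 + 2 * j))]; try lia; now apply sym_mulpow.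
Qed.

(** [k ^ i * G] has order [qn + 1] relative to [wt qn] and need not be integrable uniformly down to
    [s = 0]. Its derivative is of size [om], so one integration by parts gives a bound independent
    of [s], at the price of the factor [x]. *)
Lemma synth_decay j i G : sym j G -> (i + j = S qn)%nat -> (forall s, 0 < s < SS -> exists C, dom C (fun k => k ^ i * G k s)) ->
  exists C, 0 <= C /\ forall x s, 0 < s < SS -> Rabs x * Rabs (synth G i x s) <= C.
Proof.
intros HG Hij Hd. destruct (sym_mulpow i _ _ HG) as [dG [D1 [D2 [C [HC HB]]]]]. rewrite Hij in HB.
assert (R0 := intR_om_ge0). exists (C * 2 * intR om). split; [apply Rmult_le_pos; lra|].
intros x s Hs. destruct (Hd s Hs) as [E HE]. assert (Hs' : 0 <= s <= SS) by lra.
assert (Hdg : dom C (fun k => dG k s)).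
{ split; [intros k; now apply D2|]. intros k. destruct (HB k s Hs') as [_ H]. apply Rle_trans with (1 := H). right.
  unfold wt. field. assert (W := pow_abs1 k (S qn)). lra. }
unfold synth. rewrite <- Rabs_mult, (intR_cas_by_parts _ _ _ _ _ _ HE Hdg (fun k => D1 k s Hs')), Rabs_Ropp.
apply intR_bound, dom_cas, Hdg.
Qed.

End LinearPart.

(** * Comparison of the linear part with the profile *)

Section LinearAsymptotics.
Context {P : params}.
Variables (g : R -> R) (r1 r2 X0 : R).
Hypothesis Hreg : regular g r1 r2 X0.
Hypothesis Hr1 : 1 < r1.
Hypothesis Hr2 : 0 < r2 <= 2.
Hypothesis Hrr : r2 * Rpower (/ 2) (1 - th) < 1.

(** The integrand of the linear part at [x = x0], up to constants; the factor [(-1) ^ j] compensates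
    the alternating sign of [lin_kernel]. *)
Definition linF (i j : nat) (s k : R) : R := k ^ i * (k ^ S qn * psi0 g X0 k) * ((-1) ^ j * lin_kernel j k s).

Lemma phi0_symbol c n : symb qn n (phi0 (tj X0) (Gj g X0) c).
Proof.
apply (phi0_PS (tj X0) (Gj g X0) (Gj g X0 0) (ratio r2) (tj_bd _ _ _ _ Hreg) (fun j => Rlt_le _ _ (Gj_gt0 _ _ _ _ Hreg j))
  (ratio_bd r2 Hr2 Hrr) (Rlt_le _ _ (Gj_gt0 _ _ _ _ Hreg 0)) (Gj_tj_le _ _ _ _ Hreg Hr2)).
Qed.

Lemma psi0_bd : exists C, 0 <= C /\ forall k, Rabs (psi0 g X0 k) <= C.
Proof.
destruct (psi_bound (tj X0) (Gj g X0) (Gj g X0 0) (ratio r2) (tj_bd _ _ _ _ Hreg) (fun j => Rlt_le _ _ (Gj_gt0 _ _ _ _ Hreg j))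
  (ratio_bd r2 Hr2 Hrr) (Rlt_le _ _ (Gj_gt0 _ _ _ _ Hreg 0)) (Gj_tj_le _ _ _ _ Hreg Hr2) 0) as [C [HC H]].
exists C; split; [easy|]. intros k. apply Rle_trans with (1 := H k). rewrite <- (Rmult_1_r C) at 2.
apply Rmult_le_compat_l; [easy|apply wt_le1].
Qed.

Lemma linF_asym i j : (i + 2 * j = S qn)%nat ->
  (forall s, 0 < s < SS -> exists E, dom E (linF i j s)) ->
  exists c1 c2 C s1, 0 < c1 /\ 0 < c2 /\ 0 <= C /\ 0 < s1 /\
    forall s, 0 < s <= s1 -> c1 * g (/ s) - C <= intR (linF i j s) <= c2 * g (/ s) + C.
Proof.
intros Hij Hd. destruct (lin_kernel_gauss j) as [a1 [a2 [Ha1 [Ha2 HG]]]]. destruct (lin_kernel_low j) as [CB [HCB HB]].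
destruct psi0_bd as [Cp [HCp Hp]].
set (C2 := 3 ^ i * (3 ^ S qn * Cp) * (1 * CB)).
assert (P1 : 0 < 3 ^ i) by (apply pow_lt; lra). assert (P2 : 0 < 3 ^ S qn) by (apply pow_lt; lra).
assert (HC2 : 0 <= C2).
{ unfold C2. apply Rmult_le_pos; [|lra]. apply Rmult_le_pos; [lra|apply Rmult_le_pos; lra]. }
assert (Low : forall s k, Rabs k <= 2 -> Rabs (linF i j s k) <= C2).
{ intros s k Hk. unfold linF.
  assert (Pm : forall m, Rabs (k ^ m) <= 3 ^ m).
  { intros m. apply Rle_trans with (1 := abs_pow_le k m). apply pow_incr. generalize (Rabs_pos k); lra. }
  apply abs_mult_le; [apply abs_mult_le; [apply Pm|apply abs_mult_le; [apply Pm|apply Hp]]|].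
  apply abs_mult_le; [rewrite pow_1_abs; lra|now apply HB]. }
(* The exponents add up to [2 (qn + 1)] for every admissible pair, so one pair of estimates serves
   all derivatives of order [qn + 1]. *)
assert (Ev : forall k e, k ^ i * (k ^ S qn * psi0 g X0 k) * (k ^ (2 * j) * e) = k ^ (2 * S qn) * psi0 g X0 k * e).
{ intros k e. replace (2 * S qn)%nat with (i + S qn + 2 * j)%nat by lia. rewrite !pow_add. ring. }
assert (Np : forall k, 0 <= k ^ i * (k ^ S qn * psi0 g X0 k)).
{ intros k. rewrite <- Rmult_assoc, <- pow_add. apply Rmult_le_pos; [|apply (psi0_ge0 _ _ _ _ Hreg Hr2 Hrr)].
  replace (i + S qn)%nat with (2 * (i + j))%nat by lia. rewrite pow_mult. apply pow_le, pow2_ge_0. }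
destruct (asym_lower g r1 r2 X0 Hreg Hr2 Hrr 2 a1 C2 ltac:(lra) Ha1 HC2) as [c1 [D1 [Hc1 [HD1 L1]]]].
destruct (asym_upper g r1 r2 X0 Hreg Hr1 Hr2 Hrr 2 a2 C2 ltac:(lra) Ha2 HC2) as [c2 [D2 [Hc2 [HD2 L2]]]].
destruct Hreg as [HX _]. assert (IX : 0 < / X0) by (apply Rinv_0_lt_compat; lra).
assert (M1 := Rmin_l (/ X0) (1 / 4)). assert (M2 := Rmin_r (/ X0) (1 / 4)).
exists c1, c2, (D1 + D2), (Rmin (/ X0) (1 / 4)). split; [easy|split; [easy|split; [lra|split; [apply Rmin_glb_lt; lra|]]]].
intros s Hs. assert (HS := SS_ge1). destruct (Hd s ltac:(lra)) as [E HE].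
assert (Hs' : 0 < s <= / X0) by lra. assert (Hs4 : 0 <= s <= 1 / 4) by lra.
split.
- apply Rle_trans with (c1 * g (/ s) - D1); [lra|]. apply (L1 s E _ Hs' HE); [intros; now apply Low|].
  intros k Hk. destruct (HG k s Hk Hs4) as [H1 _]. unfold linF. rewrite <- Ev.
  rewrite <- Rmult_assoc, (Rmult_comm a1), (Rmult_assoc _ a1). apply Rmult_le_compat_l; [apply Np|easy].
- apply Rle_trans with (c2 * g (/ s) + D2); [|lra]. apply (L2 s E _ Hs' HE); [intros; now apply Low|].
  intros k Hk. destruct (HG k s Hk Hs4) as [_ H1]. unfold linF. rewrite <- Ev.
  rewrite <- (Rmult_assoc a2), (Rmult_comm a2), (Rmult_assoc _ a2). apply Rmult_le_compat_l; [apply Np|easy].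
Qed.

End LinearAsymptotics.

(** * The solution *)

Lemma cont2_eps f x s : cont2 f -> forall eps, 0 < eps -> exists del, 0 < del /\
  forall y t, Rabs (y - x) < del -> Rabs (t - s) < del -> Rabs (f y t - f x s) < eps.
Proof.
intros Hf eps He.
destruct (proj1 (filterlim_locally _ _) (Hf x s) (mkposreal eps He)) as [d Hd].
exists d. split; [apply cond_pos|]. intros y t Hy Ht. apply (Hd (y, t)). now split.
Qed.

Section Solution.
Context {P : params}.
Variables (phi : R -> R) (f : R -> R -> R).
Hypothesis Hphi : (forall k : R, continuous phi k) /\ exists E, 0 <= E /\ forall k, Rabs (phi k) <= E * wt qn k.
Hypothesis Hf : exists A, ndom A f.
Hypothesis Ef : forall k s, f k s = solk phi (nonlin f) k (cl s).
Variables (T x0 : R).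
Hypothesis HT : 0 < T.
Hypothesis HST : SS = T + 1.

(** The sign comes from differentiating in [t] through [s = T - t]. *)
Definition partial_u (i j : nat) (x t : R) : R := (-1) ^ j * synth (tder phi f j) i (x - x0) (T - t).

Lemma tder_good' s0 j p : 0 < s0 -> s0 <= SS - s0 -> good s0 (SS - s0) p (tder phi f j).
Proof. apply (tder_good phi f Hphi Hf Ef). Qed.

Lemma partial_u_dx i j x t : Ico0 T t -> derivable_pt_lim (fun y => partial_u i j y t) x (partial_u (S i) j x t).
Proof.
intros Ht. destruct (mid_exists (T - t)) as [s0 [H0 H1]]; [unfold Ico0 in Ht; lra|].
assert (Hs : s0 <= T - t <= SS - s0) by lra.
apply is_derive_Reals. unfold partial_u. apply is_derive_scal.
apply is_derive_ext with (fun y => synth (tder phi f j) i (1 * y + - x0) (T - t)); [intros; f_equal; ring|].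
replace (x - x0) with (1 * x + - x0) by ring.
rewrite <- (Rmult_1_l (synth _ _ _ _)).
apply (is_derive_comp (fun y => synth (tder phi f j) i y (T - t)) (fun y => 1 * y + - x0)).
- apply (synth_dx s0 (SS - s0)); [apply tder_good'; lra|easy].
- auto_derive; [easy|ring].
Qed.

Lemma partial_u_dt i j x t : Ico0 T t -> is_derive (fun t => partial_u i j x t) t (partial_u i (S j) x t).
Proof.
intros Ht. destruct (mid_exists (T - t)) as [s0 [H0 H1]]; [unfold Ico0 in Ht; lra|].
unfold partial_u. replace ((-1) ^ S j * synth (tder phi f (S j)) i (x - x0) (T - t)) with ((-1) ^ j * (-1 * synth (tder phi f (S j)) i (x - x0) (T - t))) by (simpl; ring).
apply is_derive_scal.
apply (is_derive_comp (fun s => synth (tder phi f j) i (x - x0) s) (fun t => T - t)).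
- apply (synth_ds s0 (SS - s0)); [apply tder_good'; lra|apply tder_good'; lra|easy|].
  intros k s Hs. apply (tder_derive phi f Hphi Hf Ef). lra.
- auto_derive; [easy|ring].
Qed.

Lemma deriv_within_of_is_derive (S : R -> Prop) h t l : is_derive h t l -> deriv_within S h t l.
Proof.
intros H eps He. apply is_derive_Reals in H. destruct (H eps He) as [d Hd]. exists d. split; [apply cond_pos|].
intros s _ Hs Hst. replace s with (t + (s - t)) at 1 by ring. apply Hd; [lra|easy].
Qed.

Lemma partial_u_cont i j : cont_within (Ico0 T) (partial_u i j).
Proof.
intros x t Ht eps He. destruct (mid_exists (T - t)) as [s0 [H0 H1]]; [unfold Ico0 in Ht; lra|].
assert (Hc := synth_cont s0 (SS - s0) (tder phi f j) i ltac:(apply tder_good'; lra)).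
destruct (cont2_eps _ (x - x0) (T - t) Hc eps He) as [d [Hd H]].
exists (Rmin d (Rmin (T - t - s0) (SS - s0 - (T - t)))).
assert (M1 := Rmin_l d (Rmin (T - t - s0) (SS - s0 - (T - t)))). assert (M2 := Rmin_r d (Rmin (T - t - s0) (SS - s0 - (T - t)))).
assert (M3 := Rmin_l (T - t - s0) (SS - s0 - (T - t))). assert (M4 := Rmin_r (T - t - s0) (SS - s0 - (T - t))).
split; [apply Rmin_glb_lt; [easy|apply Rmin_glb_lt; lra]|].
intros y s _ Hy Hs. specialize (H (y - x0) (T - s)).
assert (Hs' := Hs). apply Rabs_lt_between in Hs'.
rewrite !clm_id in H by lra. unfold partial_u.
rewrite <- Rmult_minus_distr_l, Rabs_mult, pow_1_abs, Rmult_1_l. apply H.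
- replace (y - x0 - (x - x0)) with (y - x) by ring. lra.
- replace (T - s - (T - t)) with (- (s - t)) by ring. rewrite Rabs_Ropp. lra.
Qed.

Lemma partial_u_partials : IsPartials T (partial_u 0 0) partial_u.
Proof.
split; [easy|split; [|split]].
- exact partial_u_dx.
- intros i j x t Ht. apply deriv_within_of_is_derive, partial_u_dt, Ht.
- exact partial_u_cont.
Qed.

Lemma partial_u_pde x t : Ico0 T t ->
  partial_u 0 2 x t = partial_u 2 0 x t + Derive_n (fun y => (partial_u 0 0 y t) ^ 2) 2 x + partial_u 4 0 x t.
Proof.
intros Ht. assert (Hs : 0 < T - t < SS) by (unfold Ico0 in Ht; lra).
assert (K := boussinesq_s phi f Hphi Hf Ef (x - x0) (T - t) Hs).
rewrite (Derive_n_ext _ (fun y => synth (tder phi f 0) 0 (y + - x0) (T - t) ^ 2)).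
2:{ intros y. unfold partial_u. simpl pow at 2. rewrite Rmult_1_l. reflexivity. }
rewrite (Derive_n_comp_trans (fun y => synth (tder phi f 0) 0 y (T - t) ^ 2)). fold (x - x0). unfold partial_u.
replace ((-1) ^ 2) with 1 by ring. simpl ((-1) ^ 0). rewrite !Rmult_1_l. exact K.
Qed.

Lemma sum_bound_exists (h : nat -> R -> R -> R) (Q : R -> Prop) N : (forall i, exists M, forall x t, Q t -> h i x t <= M) ->
  exists M, forall x t, Q t -> sum_f_R0 (fun i => h i x t) N <= M.
Proof.
intros H. induction N as [|N [M HM]]; [apply (H 0%nat)|]. destruct (H (S N)) as [M' HM'].
exists (M + M'). intros x t Ht. simpl. apply Rplus_le_compat; [now apply HM|now apply HM'].
Qed.

Lemma partial_u_schwartz (N : nat) tau : (forall n, smoothW 0 n f) -> 0 <= tau < T ->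
  exists M, forall x t, 0 <= t <= tau -> sum_f_R0 (fun i => (1 + Rabs x) ^ N * Rabs (partial_u i 0 x t)) N <= M.
Proof.
intros Hsm Ht. apply (sum_bound_exists (fun i x t => (1 + Rabs x) ^ N * Rabs (partial_u i 0 x t)) (fun t => 0 <= t <= tau)).
intros i. set (s0 := Rmin (T - tau) 1).
assert (M1 : s0 <= T - tau) by apply Rmin_l. assert (M2 : s0 <= 1) by apply Rmin_r.
assert (H0 : 0 < s0) by (apply Rmin_glb_lt; lra).
destruct (f_schwartz phi f Hsm s0 i N H0) as [M [HM H]].
exists ((1 + Rabs x0) ^ N * M). intros x t Htt.
specialize (H (x - x0) (T - t) ltac:(lra)).
unfold partial_u. rewrite Rabs_mult, pow_1_abs, Rmult_1_l.
assert (X0 := Rabs_pos x0). assert (X1 := Rabs_pos x). assert (X2 := Rabs_pos (x - x0)).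
apply Rle_trans with ((1 + Rabs x0) ^ N * ((1 + Rabs (x - x0)) ^ N * Rabs (synth (tder phi f 0) i (x - x0) (T - t)))).
- rewrite <- Rmult_assoc, <- Rpow_mult_distr. apply Rmult_le_compat_r; [apply Rabs_pos|]. apply pow_incr. split; [lra|].
  assert (Rabs x <= Rabs (x - x0) + Rabs x0) by (replace x with (x - x0 + x0) at 1 by ring; apply Rabs_triang).
  assert (0 <= Rabs x0 * Rabs (x - x0)) by now apply Rmult_le_pos. lra.
- apply Rmult_le_compat_l; [apply pow_le; lra|easy].
Qed.

(** For these orders the integral still converges at [s = 0], and the clamped version supplies the
    continuous extension to [t = T]. *)
Lemma partial_u_bounded i j : (i + 2 * j <= qn)%nat ->
  (exists B, forall x t, Ico0 T t -> Rabs (partial_u i j x t) <= B) /\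
  (exists F, (forall x t, Ico0 T t -> F x t = partial_u i j x t) /\ cont_within (Icc0 T) F).
Proof.
intros Hij. assert (HS := SS_ge1).
assert (Hg : good 0 SS i (tder phi f j)).
{ apply (good_weaken _ _ _ (qn - 2 * j)); [lia|]. apply (tder_good_full phi f Hphi Hf Ef). lia. }
split.
- destruct (synth_bound 0 SS (tder phi f j) i Hg) as [C [HC H]]. exists C. intros x t Ht. unfold Ico0 in Ht.
  unfold partial_u. rewrite Rabs_mult, pow_1_abs, Rmult_1_l. apply H. lra.
- exists (fun x t => (-1) ^ j * synth (tder phi f j) i (x - x0) (clm 0 SS (T - t))). split.
  + intros x t Ht. unfold Ico0 in Ht. rewrite clm_id by lra. reflexivity.
  + intros x t _ eps He. destruct (cont2_eps _ (x - x0) (T - t) (synth_cont 0 SS _ _ Hg) eps He) as [d [Hd H]].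
    exists d. split; [easy|]. intros y s _ Hy Hs.
    rewrite <- Rmult_minus_distr_l, Rabs_mult, pow_1_abs, Rmult_1_l. apply H.
    * now replace (y - x0 - (x - x0)) with (y - x) by ring.
    * replace (T - s - (T - t)) with (- (s - t)) by ring. now rewrite Rabs_Ropp.
Qed.

Lemma tder_nl_bounded i j : (i + 2 * j = S qn)%nat -> good 0 SS i (tder_nl phi f j).
Proof.
intros Hij. apply (good_weaken _ _ _ (qn + 2 - 2 * j)); [lia|]. apply (tder_nl_good phi f Hphi Hf Ef). lia.
Qed.

(** Integrability of the linear part at interior times is read off as that of the full solution
    minus that of the remainder. *)
Lemma dom_parts i j s : (i + 2 * j = S qn)%nat -> 0 < s < SS ->
  (exists C, dom C (fun k => k ^ i * tder_lin phi j k s)) /\ (exists C, dom C (fun k => k ^ i * tder_nl phi f j k s)).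
Proof.
intros Hij Hs. destruct (mid_exists s Hs) as [s0 [H0 H1]].
assert (HN := tder_nl_bounded i j Hij). replace i with (i + 0)%nat in HN by lia.
destruct (good_dom _ _ _ _ s (good_mulpow _ _ _ _ _ HN) ltac:(lra)) as [C1 D1].
destruct (good_dom _ _ _ _ s (good_mulpow _ _ i 0 _ (tder_good' s0 j (i + 0) H0 ltac:(lra))) ltac:(lra)) as [C2 D2].
split; [|now exists C1].
destruct (dom_plus _ _ _ _ D2 (dom_scal _ (-1) _ D1)) as [Dc Db]. eexists. split.
- intros k. apply continuous_ext with (2 := Dc k). intros y. unfold tder_nl. Rring.
- intros k. specialize (Db k). unfold tder_nl in Db.
  replace (k ^ i * tder phi f j k s + -1 * (k ^ i * (tder phi f j k s - tder_lin phi j k s))) with (k ^ i * tder_lin phi j k s) in Db by ring. exact Db.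
Qed.

Lemma synth_split i j x s : (i + 2 * j = S qn)%nat -> 0 < s < SS ->
  synth (tder phi f j) i x s = synth (tder_lin phi j) i x s + synth (tder_nl phi f j) i x s.
Proof.
intros Hij Hs. destruct (dom_parts i j s Hij Hs) as [[C1 D1] [C2 D2]]. unfold synth.
rewrite <- (intR_plus _ _ _ _ (dom_cas _ _ x _ D1) (dom_cas _ _ x _ D2)).
apply intR_ext. intros k. unfold tder_nl. ring.
Qed.

(** The linear part decays like [/ |x - x0|], whereas the remainder is merely bounded. Since
    [|x - x0|] is at most [|x| + |x0|], a bounded term is also of size [(1 + |x|) / |x - x0|], which
    explains the numerator. *)
Lemma partial_u_decay i j : (i + 2 * j = S qn)%nat -> sym (2 * j) (tder_lin phi j) ->
  exists C, 0 < C /\ forall x t, x <> x0 -> Ico0 T t -> Rabs (partial_u i j x t) <= C * (1 + Rabs x) / Rabs (x - x0).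
Proof.
intros Hij Hsym. assert (HS := SS_ge1).
destruct (synth_decay _ i _ Hsym Hij (fun s Hs => proj1 (dom_parts i j s Hij Hs))) as [C1 [HC1 H1]].
destruct (synth_bound 0 SS _ i (tder_nl_bounded i j Hij)) as [C2 [HC2 H2]].
assert (X0 := Rabs_pos x0). assert (N0 : 0 <= C2 * (1 + Rabs x0)) by (apply Rmult_le_pos; lra).
exists (C1 + C2 * (1 + Rabs x0) + 1). split; [lra|]. intros x t Hx Ht. unfold Ico0 in Ht.
assert (Hs : 0 < T - t < SS) by lra.
assert (Hy : 0 < Rabs (x - x0)) by (apply Rabs_pos_lt; lra). assert (Xx := Rabs_pos x).
unfold partial_u. rewrite Rabs_mult, pow_1_abs, Rmult_1_l, synth_split by easy.
apply Rle_div_r; [easy|].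
specialize (H1 (x - x0) (T - t) Hs). specialize (H2 (x - x0) (T - t) ltac:(lra)).
assert (Tr := Rabs_triang (synth (tder_lin phi j) i (x - x0) (T - t)) (synth (tder_nl phi f j) i (x - x0) (T - t))).
assert (Yx : Rabs (x - x0) <= Rabs x + Rabs x0) by (unfold Rminus; rewrite <- (Rabs_Ropp x0); apply Rabs_triang).
set (y := Rabs (x - x0)) in *. set (a := Rabs (synth (tder_lin phi j) i (x - x0) (T - t))) in *.
set (b := Rabs (synth (tder_nl phi f j) i (x - x0) (T - t))) in *.
apply (Rmult_le_compat_r y) in Tr; [|lra].
assert (B1 : b * y <= C2 * ((1 + Rabs x) * (1 + Rabs x0))).
{ apply Rmult_le_compat; [apply Rabs_pos|lra|easy|]. nra. }
assert (B2 : 0 <= C1 * Rabs x) by now apply Rmult_le_pos. nra.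
Qed.

End Solution.

(** [(i + 1) / 2] is the ceiling of [i / 2], and [cas] runs through [1, 1, -1, -1] at multiples of
    [PI / 2]. The remaining sign [(-1) ^ i] is that of [q + 1], the same for all pairs in question,
    and can be put into the datum. *)
Lemma sign_cas i : (-1) ^ ((i + 1) / 2) * cas (INR i * (PI / 2)) = (-1) ^ i.
Proof.
enough (H : forall i, (-1) ^ ((i + 1) / 2) * cas (INR i * (PI / 2)) = (-1) ^ i /\
  (-1) ^ ((S i + 1) / 2) * cas (INR (S i) * (PI / 2)) = (-1) ^ S i) by apply H.
clear i. induction i as [|i [I1 I2]].
- split; unfold cas; simpl; rewrite ?Rmult_0_l, ?Rmult_1_l, ?cos_0, ?sin_0, ?cos_PI2, ?sin_PI2; ring.
- split; [easy|]. replace (S (S i) + 1)%nat with (i + 1 + 1 * 2)%nat by lia. rewrite Nat.div_add by lia.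
  replace (INR (S (S i)) * (PI / 2)) with (INR i * (PI / 2) + INR 2 * (PI / 2)).
  2:{ rewrite !S_INR. simpl. ring. }
  rewrite cas_PI, pow_add, pow_1. change ((-1) ^ S (S i)) with (-1 * (-1 * (-1) ^ i)). rewrite <- I1. ring.
Qed.

(** * Asymptotics at [x0] and choice of the parameters *)

Section Main.
Context {P : params}.
Variables (g : R -> R) (r1 r2 X0 : R).
Hypothesis Hreg : regular g r1 r2 X0.
Hypothesis Hr1 : 1 < r1.
Hypothesis Hr2 : 0 < r2 <= 2.
Hypothesis Hrr : r2 * Rpower (/ 2) (1 - th) < 1.
Variables (T x0 sg : R).
Hypothesis HT : 0 < T.
Hypothesis HST : SS = T + 1.
Hypothesis Hsg : sg = 1 \/ sg = -1.

Definition datum (c : R) : R -> R := phi0 (tj X0) (Gj g X0) c.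

Lemma synth_Lt_0 c i j s E : dom E (linF g X0 i j s) ->
  synth (tder_lin (datum c) j) i 0 s = c * cas (INR i * (PI / 2)) * (-1) ^ j * intR (linF g X0 i j s).
Proof.
intros HE. rewrite <- (intR_scal _ _ _ HE). apply intR_ext. intros k.
rewrite tder_lin_factor. unfold linF, datum, phi0, psi0. replace (k * 0 + INR i * (PI / 2)) with (INR i * (PI / 2)) by ring.
assert (S2 : (-1) ^ j * (-1) ^ j = 1) by (rewrite <- Rpow_mult_distr; replace (-1 * -1) with 1 by ring; apply pow1).
set (b := psi _ _ _ _). set (d := cas _).
replace (c * d * (-1) ^ j * (k ^ i * (k ^ S qn * b) * ((-1) ^ j * lin_kernel j k s))) with
  ((c * d * (k ^ i * (k ^ S qn * b) * lin_kernel j k s)) * ((-1) ^ j * (-1) ^ j)) by ring.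
rewrite S2. ring.
Qed.

Lemma linF_dom c i j s : c <> 0 -> (exists E, dom E (fun k => k ^ i * tder_lin (datum c) j k s)) -> exists E, dom E (linF g X0 i j s).
Proof.
intros Hc [E HE]. destruct (dom_scal _ ((-1) ^ j / c) _ HE) as [Dc Db]. eexists.
assert (X : forall k, (-1) ^ j / c * (k ^ i * tder_lin (datum c) j k s) = linF g X0 i j s k).
{ intros k. rewrite tder_lin_factor. unfold linF, datum, phi0, psi0. field. easy. }
split.
- intros k. apply continuous_ext with (2 := Dc k). exact X.
- intros k. rewrite <- X. apply Db.
Qed.

Lemma partial_u_asymp phi f c eps : phi = datum c -> 0 < eps -> c = eps * ((-1) ^ S qn * sg) ->
  ((forall k : R, continuous phi k) /\ exists E, 0 <= E /\ forall k, Rabs (phi k) <= E * wt qn k) ->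
  (exists A, ndom A f) -> (forall k s, f k s = solk phi (nonlin f) k (cl s)) ->
  forall i j, (i + 2 * j = S qn)%nat ->
  asymp_at T (fun t => (-1) ^ ((i + 1) / 2) * partial_u phi f T x0 i j x0 t) (fun t => sg * g (/ (T - t))).
Proof.
intros Ephi He Hc Hphi Hf Ef i j Hij. assert (HS := SS_ge1).
assert (Hpm : Rabs ((-1) ^ S qn * sg) = 1).
{ rewrite Rabs_mult, pow_1_abs. destruct Hsg as [-> | ->]; [rewrite Rabs_R1|rewrite Rabs_left by lra]; ring. }
assert (Hc0 : c <> 0).
{ intros Z. assert (K : Rabs c = eps) by (rewrite Hc, Rabs_mult, Hpm, Rabs_right; lra). rewrite Z, Rabs_R0 in K. lra. }
assert (Dl : forall s, 0 < s < SS -> exists E, dom E (linF g X0 i j s)).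
{ intros s Hs. apply (linF_dom c); [easy|]. rewrite <- Ephi. apply (dom_parts phi f Hphi Hf Ef i j s Hij Hs). }
destruct (linF_asym g r1 r2 X0 Hreg Hr1 Hr2 Hrr i j Hij Dl) as [c1 [c2 [C [s1 [Hc1 [Hc2 [HC [Hs1 HL]]]]]]]].
destruct (synth_bound 0 SS _ i (tder_nl_bounded phi f Hphi Hf Ef i j Hij)) as [K [HK HN]].
assert (HeC : 0 <= eps * C) by (apply Rmult_le_pos; lra). assert (Hec1 : 0 < eps * c1) by now apply Rmult_lt_0_compat.
assert (Hec2 : 0 < eps * c2) by now apply Rmult_lt_0_compat.
(* From this point on, the bounded errors, [eps * C] from the low frequencies and [K] from the
   nonlinear remainder, are at most half of the lower bound for the main term. *)
destruct (g_large g r1 r2 X0 Hreg Hr1 (2 * (eps * C + K) / (eps * c1))) as [y0 [Hy0 Hlarge]].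
destruct Hreg as [HX0 _]. assert (Iy : 0 < / y0) by (apply Rinv_0_lt_compat; lra).
set (m := Rmin s1 (Rmin (/ y0) (T / 2))).
assert (M1 : m <= s1) by apply Rmin_l. assert (M2 : m <= Rmin (/ y0) (T / 2)) by apply Rmin_r.
assert (M3 := Rmin_l (/ y0) (T / 2)). assert (M4 := Rmin_r (/ y0) (T / 2)).
assert (M0 : 0 < m) by (apply Rmin_glb_lt; [easy|apply Rmin_glb_lt; lra]).
assert (Main : forall t, T - m <= t < T -> exists y, eps * c1 / 2 * g (/ (T - t)) <= y <= (eps * c2 + eps * c1 / 2) * g (/ (T - t)) /\
   (-1) ^ ((i + 1) / 2) * partial_u phi f T x0 i j x0 t = sg * y).
{ intros t Ht. assert (Hs : 0 < T - t < SS) by lra. destruct (Dl _ Hs) as [E HE].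
  specialize (HL (T - t) ltac:(lra)). specialize (HN 0 (T - t) ltac:(lra)).
  assert (Hg : 2 * (eps * C + K) / (eps * c1) <= g (/ (T - t))).
  { apply Hlarge. rewrite <- (Rinv_inv y0). apply Rinv_le_contravar; lra. }
  set (G := g (/ (T - t))) in *.
  assert (Hg2 : eps * C + K <= eps * c1 / 2 * G).
  { apply (Rmult_le_compat_l (eps * c1 / 2)) in Hg; [|lra].
    replace (eps * c1 / 2 * (2 * (eps * C + K) / (eps * c1))) with (eps * C + K) in Hg by (field; lra). exact Hg. }
  set (v := synth (tder_nl phi f j) i 0 (T - t)) in *. set (X := intR (linF g X0 i j (T - t))) in *.
  assert (Xs : (-1) ^ ((i + 1) / 2) * partial_u phi f T x0 i j x0 t = sg * (eps * X) + (-1) ^ ((i + 1) / 2) * ((-1) ^ j * v)).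
  { unfold partial_u. replace (x0 - x0) with 0 by ring. rewrite (synth_split phi f Hphi Hf Ef i j 0 (T - t) Hij Hs). fold v.
    rewrite Ephi at 1. rewrite (synth_Lt_0 c i j (T - t) E HE). fold X.
    assert (S2 : forall n, (-1) ^ n * (-1) ^ n = 1) by (intros n; rewrite <- Rpow_mult_distr; replace (-1 * -1) with 1 by ring; apply pow1).
    assert (S3 : (-1) ^ S qn = (-1) ^ i).
    { rewrite <- Hij, pow_add, pow_mult. replace ((-1) ^ 2) with 1 by ring. rewrite pow1. ring. }
    rewrite Hc, S3.
    replace ((-1) ^ ((i + 1) / 2) * ((-1) ^ j * (eps * ((-1) ^ i * sg) * cas (INR i * (PI / 2)) * (-1) ^ j * X + v)))
      with (eps * sg * X * ((-1) ^ j * (-1) ^ j) * (-1) ^ i * ((-1) ^ ((i + 1) / 2) * cas (INR i * (PI / 2))) + (-1) ^ ((i + 1) / 2) * ((-1) ^ j * v)) by ring.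
    rewrite sign_cas, S2. rewrite (Rmult_assoc _ ((-1) ^ i)), S2. ring. }
  set (b := (-1) ^ ((i + 1) / 2) * ((-1) ^ j * v)) in *.
  assert (Bb : Rabs b <= K) by (unfold b; rewrite !Rabs_mult, !pow_1_abs, !Rmult_1_l; apply HN; lra).
  exists (eps * X + sg * b). destruct HL as [HL1 HL2].
  apply (Rmult_le_compat_l eps) in HL1; [|lra]. apply (Rmult_le_compat_l eps) in HL2; [|lra].
  apply Rabs_le_between in Bb.
  assert (Sb : - K <= sg * b <= K) by (destruct Hsg as [-> | ->]; lra).
  split; [lra|]. rewrite Xs. destruct Hsg as [-> | ->]; ring. }
destruct Hsg as [E | E].
- exists (T - m), (eps * c1 / 2), (eps * c2 + eps * c1 / 2). split; [lra|split; [lra|split; [lra|]]].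
  intros t Ht. destruct (Main t Ht) as [y [Hy ->]]. rewrite E. lra.
(* For [sg = -1] the profile is negative, so the larger constant gives the lower bound. *)
- exists (T - m), (eps * c2 + eps * c1 / 2), (eps * c1 / 2). split; [lra|split; [lra|split; [lra|]]].
  intros t Ht. destruct (Main t Ht) as [y [Hy ->]]. rewrite E. lra.
Qed.

Lemma solution_exists : exists (u : R -> R -> R) (D : nat -> nat -> R -> R -> R),
  SchwartzBoussinesq T u D /\
  (forall i j, (i + 2 * j <= qn)%nat ->
     (exists B, forall x t, Ico0 T t -> Rabs (D i j x t) <= B) /\
     (exists F : R -> R -> R, (forall x t, Ico0 T t -> F x t = D i j x t) /\ cont_within (Icc0 T) F)) /\
  (forall i j, (i + 2 * j = S qn)%nat ->
     asymp_at T (fun t => (-1) ^ ((i + 1) / 2) * D i j x0 t) (fun t => sg * g (/ (T - t))) /\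
     (exists C, 0 < C /\ forall x t, x <> x0 -> Ico0 T t -> Rabs (D i j x t) <= C * (1 + Rabs x) / Rabs (x - x0))).
Proof.
destruct picard as [e0 [He0 Pic]].
destruct (phi0_symbol g r1 r2 X0 Hreg Hr2 Hrr 1 0) as [[_ [E1 [HE1 B1]]] _].
(* Scaling the datum meets the smallness condition of [picard]; the asymptotic relation does not see
   constant factors. *)
set (eps := e0 / (E1 + 1)). assert (Heps : 0 < eps) by (apply Rdiv_lt_0_compat; lra).
assert (Hpm : Rabs ((-1) ^ S qn * sg) = 1).
{ rewrite Rabs_mult, pow_1_abs. destruct Hsg as [-> | ->]; [rewrite Rabs_R1|rewrite Rabs_left by lra]; ring. }
set (c := eps * ((-1) ^ S qn * sg)).
assert (HPS := phi0_symbol g r1 r2 X0 Hreg Hr2 Hrr c).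
destruct (HPS 1%nat) as [[Cphi [E2 [HE2 B2]]] [dphi [Dphi [[Cd [E3 [HE3 B3]]] _]]]].
fold (datum c) in HPS, Cphi, B2, Dphi. set (phi := datum c) in *.
assert (Hsmall : forall k, Rabs (phi k) <= e0 * wt qn k).
{ intros k. assert (W := wt_gt0 qn k). replace (phi k) with (c * phi0 (tj X0) (Gj g X0) 1 k) by (unfold phi, datum, phi0; ring).
  apply Rle_trans with (eps * (E1 * wt qn k)).
  - apply abs_mult_le; [|apply B1]. unfold c. rewrite Rabs_mult, Hpm, Rabs_right; lra.
  - rewrite <- Rmult_assoc. apply Rmult_le_compat_r; [lra|]. unfold eps.
    apply Rmult_le_reg_r with (E1 + 1); [lra|]. replace (e0 / (E1 + 1) * E1 * (E1 + 1)) with (e0 * E1) by (field; lra).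
    apply Rmult_le_compat_l; lra. }
destruct (Pic phi dphi E3) as [f [gk [A0 [G0 [Hf [Hg [Ef Hfg]]]]]]]; try assumption.
{ intros k. apply Rle_trans with (1 := B3 k). apply Rmult_le_compat_l; [easy|]. apply wt_le; lia. }
assert (Hphi : (forall k : R, continuous phi k) /\ exists E, 0 <= E /\ forall k, Rabs (phi k) <= E * wt qn k) by (split; [easy|now exists E2]).
assert (Hf' : exists A, ndom A f) by now exists A0.
assert (Hsm : forall n, smoothW 0 n f).
{ apply (fixed_point_SmW phi f); [| |easy].
  - intros n. apply (symb_pSm n qn); [lia|apply HPS].
  - split; [now apply boundW_0|]. exists gk. split; [easy|]. split; [|easy]. apply boundW_0. now exists G0. }
assert (Hsym : forall j, sym (2 * j) (tder_lin phi j)).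
{ apply (tder_lin_sym phi dphi (E2 + E3)); try assumption; [lra| |].
  - intros k. apply Rle_trans with (1 := B2 k). apply Rmult_le_compat_r; [left; apply wt_gt0|lra].
  - intros k. apply Rle_trans with (1 := B3 k). apply Rmult_le_compat_r; [left; apply wt_gt0|lra]. }
exists (partial_u phi f T x0 0 0), (partial_u phi f T x0).
split; [split; [|split]|split].
- now apply partial_u_partials.
- now apply partial_u_pde.
- intros N tau _ Ht. now apply partial_u_schwartz.
- intros i j Hij. now apply partial_u_bounded.
- intros i j Hij. split; [now apply (partial_u_asymp phi f c eps)|]. now apply partial_u_decay.
Qed.

End Main.

Lemma two_Rpower d : Rpower 4 d = Rpower 2 (2 * d).
Proof.
rewrite <- Rpower_mult. f_equal. change 2 with (INR 2) at 2. rewrite Rpower_pow by lra. ring.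
Qed.

Theorem theorem2p3 :
  forall (q p : nat) (r : nat -> nat) (a : nat -> R) (sigma : nat)
         (T x0 delta : R),
    (forall j, (j < p)%nat -> (0 < r j)%nat) ->
    (forall j, (S j < p)%nat -> (r j < r (S j))%nat) ->
    (forall j, (j < p)%nat -> 0 <= a j) ->
    (sigma <= 1)%nat ->
    0 < T ->
    0 < delta < 1 / 2 ->
    exists (u : R -> R -> R) (D : nat -> nat -> R -> R -> R),
      SchwartzBoussinesq T u D /\
      (* (i) *)
      (forall q1 q2 : nat, (q1 + 2 * q2 <= q)%nat ->
         (exists B, forall x t, Ico0 T t -> Rabs (D q1 q2 x t) <= B) /\
         (exists F : R -> R -> R,
            (forall x t, Ico0 T t -> F x t = D q1 q2 x t) /\
            cont_within (Icc0 T) F)) /\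
      (* (ii) *)
      (forall q1 q2 : nat, (q1 + 2 * q2 = S q)%nat ->
         asymp_at T
           (fun t => (-1) ^ ((q1 + 1) / 2) * D q1 q2 x0 t)
           (fun t => LOG (1 / (T - t)) p r a sigma / Rpower (T - t) delta) /\
         (exists C, 0 < C /\
            forall x t, x <> x0 -> Ico0 T t ->
              Rabs (D q1 q2 x t) <= C * (1 + Rabs x) / Rabs (x - x0))).
Proof.
intros q p r a sigma T x0 delta Hr _ Ha Hsigma HT Hdelta.
(* Any [d] strictly between [delta] and [1/2] serves: the gap to [delta] absorbs the logarithms, and
   [d < 1/2] gives [Rpower 4 d <= 2]. *)
set (d := (delta + 1 / 2) / 2). assert (Hd : delta < d < 1 / 2) by (unfold d; lra).
destruct (slow_regular _ delta d (slow_prod p r a Hr Ha) (proj1 Hdelta) (proj1 Hd)) as [X0 Hreg].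
set (g := fun x => Rpower x delta * prod_upto p (fun j => Rpower (iter_log (r j) x) (a j))) in *.
assert (th0 : 0 < 1 / 2 - d) by lra. assert (th1 : 1 / 2 - d <= 1) by lra. assert (S1 : 1 <= T + 1) by lra.
(* With [th = 1/2 - d] the product in [H3] is the power of 2 with exponent
   [2 d - (1 - th) = d - 1/2], which is negative. *)
set (P := Params (1 / 2 - d) th0 th1 q (T + 1) S1).
assert (H1 : 1 < Rpower 4 delta) by (apply Rle_lt_trans with (Rpower 4 0); [rewrite Rpower_O; lra|apply Rpower_lt; lra]).
assert (H2 : 0 < Rpower 4 d <= 2).
{ split; [apply exp_pos|]. rewrite two_Rpower. apply Rle_trans with (Rpower 2 1); [apply Rle_Rpower; lra|rewrite Rpower_1; lra]. }
assert (H3 : Rpower 4 d * Rpower (/ 2) (1 - @th P) < 1).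
{ change (@th P) with (1 / 2 - d). rewrite two_Rpower.
  replace (Rpower (/ 2) (1 - (1 / 2 - d))) with (Rpower 2 (- (1 - (1 / 2 - d)))) by (unfold Rpower; rewrite ln_Rinv by lra; f_equal; ring).
  rewrite <- Rpower_plus. apply Rlt_le_trans with (Rpower 2 0); [apply Rpower_lt; lra|rewrite Rpower_O; lra]. }
assert (Hsg : (-1) ^ sigma = 1 \/ (-1) ^ sigma = -1) by (destruct sigma as [|[|n]]; [left|right|lia]; simpl; ring).
destruct (@solution_exists P g _ _ X0 Hreg H1 H2 H3 T x0 _ HT eq_refl Hsg) as [u [D [HS [HB HA]]]].
exists u, D. split; [easy|split; [exact HB|]]. intros q1 q2 Hq. destruct (HA q1 q2 Hq) as [Has HC]. split; [|exact HC].
destruct Has as [T0 [c1 [c2 [HT0 [Hc1 [Hc2 H]]]]]]. exists T0, c1, c2. split; [easy|split; [easy|split; [easy|]]].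
intros t Ht. specialize (H t Ht).
replace (LOG (1 / (T - t)) p r a sigma / Rpower (T - t) delta) with ((-1) ^ sigma * g (/ (T - t))); [exact H|].
unfold LOG, g. replace (1 / (T - t)) with (/ (T - t)) by (field; lra).
replace (Rpower (/ (T - t)) delta) with (/ Rpower (T - t) delta).
2:{ rewrite <- Rpower_Ropp. unfold Rpower. rewrite ln_Rinv by lra. f_equal; ring. }
unfold Rdiv. ring.
Qed.
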